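(* Let $(\mathcal G,\mathcal Y)$ be a complex of groups, $\mathcal Y_1\subset\mathcal Y$ a connected subcomplex and $(\mathcal G,\mathcal Y_1)$ the restriction of $(\mathcal G,\mathcal Y)$ to $\mathcal Y_1$, such that: (1) $(\mathcal G,\mathcal Y)$ and $(\mathcal G,\mathcal Y_1)$ are complexes of hyperbolic groups. (2) The universal covers $B$ and $B_1$ of $(\mathcal G,\mathcal Y)$ and $(\mathcal G,\mathcal Y_1)$ respectively are both CAT(0). (3) The action of $\pi_1(\mathcal G,\mathcal Y)$ on $B$ is acylindrical. (4) The induced homomorphism $\pi_1(\mathcal G,\mathcal Y_1)\to\pi_1(\mathcal G,\mathcal Y)$ is injective. Suppose the natural map $B_1\to B$ satisfies Mitra's criterion. Then there exists a Cannon-Thurston map for the inclusion $\pi_1(\mathcal G,\mathcal Y_1)\to\pi_1(\mathcal G,\mathcal Y)$, and $\pi_1(\mathcal G,\mathcal Y_1)$ is quasiconvex in $\pi_1(\mathcal G,\mathcal Y)$ if and only if the Cannon-Thurston map for $B_1\to B$ is injective.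
   Context: Complexes of groups. Let $\mathcal Y$ be a finite connected simplicial complex. Its directed edges are pairs $e=(\sigma,\tau)$ of simplices with $\tau\subsetneq\sigma$; $o(e)=\sigma$, $t(e)=\tau$. If $o(e)=t(e')$, put $e*e'=(o(e'),t(e))$. A complex of groups $(\mathcal G,\mathcal Y)$ consists of a group $G_\sigma$ (local group) for each simplex, an injective homomorphism (local map) $\psi_e:G_{o(e)}\to G_{t(e)}$ for each $e$, and elements $g_{e,e'}\in G_{t(e)}$ for composable $e,e'$ with $\mathrm{Ad}(g_{e,e'})\psi_{e*e'}=\psi_e\psi_{e'}$ and $\psi_e(g_{e',e''})g_{e,e'*e''}=g_{e,e'}g_{e*e',e''}$. Its fundamental group $\pi_1(\mathcal G,\mathcal Y)$ is generated by the groups $G_\sigma$ and symbols $k_e$, subject to the relations of the $G_\sigma$, $k_egk_e^{-1}=\psi_e(g)$ for $g\in G_{o(e)}$, $k_ek_{e'}=g_{e,e'}k_{e*e'}$, and $k_e=1$ for $e$ in a fixed maximal tree of the graph with vertices the simplices and edges the $e$'s. It is developable if the natural maps $G_\sigma\to G=\pi_1(\mathcal G,\mathcal Y)$ are all injective. The universal cover (development) is $B=(G\times\bigsqcup_\sigma\sigma)/\sim$ with $(gg',x)\sim(g,x)$ for $g'\in G_\sigma$, $x\in\sigma$, and, for $e=(\sigma,\sigma')$ and $x\in\sigma'\subset\sigma$, the pair $(g,x)$ with $x$ viewed in $\sigma$ is identified with $(gk_e^{-1},x)$ with $x$ viewed in $\sigma'$. It carries the quotient metric obtained by gluing standard Euclidean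 simplices, and $G$ acts on it by isometries. Restricting the data to a connected subcomplex $\mathcal Y_1$ gives $(\mathcal G,\mathcal Y_1)$ (developable if $(\mathcal G,\mathcal Y)$ is), a natural homomorphism of fundamental groups and a natural equivariant map $B_1\to B$, $[h,x]\mapsto[h,x]$. A complex of hyperbolic groups is a developable complex of groups over a finite connected simplicial complex whose local groups are hyperbolic, whose local maps are quasiisometric embeddings, and whose universal cover is a hyperbolic space. Acylindrical (in the sense of Martin's combination theorem): there is a constant $A>0$ such that every subset of $B$ of diameter at least $A$ has finite pointwise stabilizer in $G$. Under (1)-(4) and Mitra's criterion both fundamental groups are hyperbolic (Martin's combination theorem). Boundaries and CT maps. $\partial X$ is the (sequential) Gromov boundary of a hyperbolic geodesic space $X$; the boundary of a hyperbolic group is that of a Cayley graph. A map $f:Y\to X$ of hyperbolic spaces admits the Cannon-Thurston (CT) map if for every $\xi\in\partial Y$ and every sequence $y_n\to\xi$ in $Y$, $\{f(y_n)\}$ converges to a point of $\partial X$ depending only on $\xi$, and the resulting map $\partial f:\partial Y\to\partial X$ is continuous. Mitra's criterion for $f:Y\to X$: given $y_0\in Y$ there is a non-negative function $M(N)\to\infty$ as $N\to\infty$ such that for every geodesic segment $\lambda$ of $Y$ outside $B(y_0,N)$, any geodesic segment in $X$ joining the endpoints of $f(\lambda)$ lies outside $B(f(y_0),M(N))$. *)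

(* Defs.v *)
From HB Require Import structures.
From Stdlib Require Import Relation_Operators.
From mathcomp Require Import all_boot all_order all_algebra.
From mathcomp Require Import all_classical all_reals.
From mathcomp Require Import ereal topology normedtype.

Set Implicit Arguments.
Unset Strict Implicit.
Unset Printing Implicit Defensive.

Import Order.TTheory GRing.Theory Num.Theory.
Local Open Scope classical_set_scope.
Local Open Scope ring_scope.
Local Open Scope quotient_scope.

(** * Metric geometry

    A space is a type [X] with a distance function [d : X -> X -> R]. *)

Section MetricGeometry.
Variables (R : realType) (X : Type) (d : X -> X -> R).

Definition is_metric : Prop :=
  [/\ forall x y, 0 <= d x y,
      forall x y, d x y = 0 <-> x = y,
      forall x y, d x y = d y x &
      forall x y z, d x z <= d x y + d y z].

(* The geodesic segment is [c t], [0 <= t <= d x y]; values of [c] outside this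
   interval are irrelevant. *)
Definition geodesic (x y : X) (c : R -> X) : Prop :=
  [/\ c 0 = x, c (d x y) = y &
      forall s t, 0 <= s <= d x y -> 0 <= t <= d x y -> d (c s) (c t) = `|s - t|].

Definition geodesic_space : Prop :=
  is_metric /\ forall x y, exists c, geodesic x y c.

Definition hyperbolic : Prop :=
  geodesic_space /\
  exists delta : R, forall x y z a b c,
    geodesic x y a -> geodesic y z b -> geodesic x z c ->
    forall t, 0 <= t <= d x y ->
      (exists2 s, 0 <= s <= d y z & d (a t) (b s) <= delta) \/
      (exists2 s, 0 <= s <= d x z & d (a t) (c s) <= delta).

Definition quasiconvex (A : set X) : Prop :=
  exists k : R, forall x y c, A x -> A y -> geodesic x y c ->
    forall t, 0 <= t <= d x y -> exists2 a, A a & d (c t) a <= k.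

Definition gromov_product (p x y : X) : R := (d p x + d p y - d x y) / 2.

(* [(x_i | y_j)] tends to infinity as [i, j] do. *)
Definition gromov_close (x y : nat -> X) : Prop :=
  forall p (r : R), exists N, forall i j,
    (N <= i)%N -> (N <= j)%N -> r <= gromov_product p (x i) (y j).

(* A boundary point is an equivalence class of sequences converging to
   infinity. *)
Record boundary : Type := Boundary {
  bseq : set (nat -> X);
  bseq_class : exists2 x, gromov_close x x &
    bseq = [set y | gromov_close y y /\ gromov_close x y] }.

Definition converges_to (y : nat -> X) (xi : boundary) : Prop := bseq xi y.

(* For [xi] fixed and [r] varying, the sets [boundary_nbhd p r xi] are the usual
   neighbourhoods [{eta | (xi | eta)_p >= r}] of [xi]. *)
Definition boundary_nbhd (p : X) (r : R) (xi : boundary) : set boundary :=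
  [set eta | exists x y, [/\ converges_to x xi, converges_to y eta &
     exists N, forall i j, (N <= i)%N -> (N <= j)%N ->
       r <= gromov_product p (x i) (y j)]].

Definition boundary_open : set_system boundary :=
  [set U | forall xi, U xi -> forall p, exists r, boundary_nbhd p r xi `<=` U].

Lemma boundary_nbhd_mono p r r' xi : r <= r' ->
  boundary_nbhd p r' xi `<=` boundary_nbhd p r xi.
Proof.
move=> rr' eta [x [y [hx hy [N hN]]]]; exists x, y; split=> //.
by exists N => i j Ni Nj; apply: le_trans rr' (hN _ _ Ni Nj).
Qed.

Lemma boundary_openT : boundary_open setT.
Proof. by move=> xi _ p; exists 0. Qed.

Lemma boundary_openI : setI_closed boundary_open.
Proof.
move=> A B hA hB xi [Axi Bxi] p.
have [r hr] := hA _ Axi p; have [r' hr'] := hB _ Bxi p.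
exists (Num.max r r') => eta heta; split.
- by apply: hr; apply: boundary_nbhd_mono heta; rewrite le_max lexx.
- by apply: hr'; apply: boundary_nbhd_mono heta; rewrite le_max lexx orbT.
Qed.

Lemma boundary_open_bigU (I : Type) (f : I -> set boundary) :
  (forall i, boundary_open (f i)) -> boundary_open (\bigcup_i f i).
Proof.
move=> hf xi [i _ fxi] p; have [r hr] := hf i _ fxi p.
by exists r => eta /hr ?; exists i.
Qed.

Definition euclid (I : finType) (x y : {ffun I -> R}) : R :=
  Num.sqrt (\sum_i (x i - y i) ^+ 2).

(* [x'], [y'], [z'] span a comparison triangle, with [p'], [q'] the comparison
   points of [c s], [c' t]. The side from [y] to [z] needs no name: the inequality
   is required for every labelling of the vertices. *)
Definition cat0 : Prop :=
  geodesic_space /\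
  forall x y z c c', geodesic x y c -> geodesic x z c' ->
  forall s t, 0 <= s <= d x y -> 0 <= t <= d x z ->
  forall x' y' z' p' q' : {ffun 'I_2 -> R},
    euclid x' y' = d x y -> euclid x' z' = d x z -> euclid y' z' = d y z ->
    euclid x' p' = s -> euclid p' y' = d x y - s ->
    euclid x' q' = t -> euclid q' z' = d x z - t ->
    d (c s) (c' t) <= euclid p' q'.

Definition diameter (A : set X) : \bar R :=
  ereal_sup [set (d p.1 p.2)%:E | p in [set p | A p.1 /\ A p.2]].

End MetricGeometry.

HB.instance Definition _ (R : realType) (X : Type) (d : X -> X -> R) :=
  gen_eqMixin (boundary d).
HB.instance Definition _ (R : realType) (X : Type) (d : X -> X -> R) :=
  gen_choiceMixin (boundary d).
HB.instance Definition _ (R : realType) (X : Type) (d : X -> X -> R) :=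
  isOpenTopological.Build (boundary d)
    (@boundary_openT R X d) (@boundary_openI R X d) (@boundary_open_bigU R X d).

Section Maps.
Variables (R : realType) (Y X : Type) (dY : Y -> Y -> R) (dX : X -> X -> R).
Variable f : Y -> X.

Definition qi_embedding : Prop :=
  exists k c : R, [/\ 1 <= k, 0 <= c & forall x y,
    dY x y / k - c <= dX (f x) (f y) <= k * dY x y + c].

Definition is_CT (F : boundary dY -> boundary dX) : Prop :=
  [/\ hyperbolic dY, hyperbolic dX,
      forall xi y, converges_to y xi -> converges_to (f \o y) (F xi) &
      continuous F].

Definition admits_CT : Prop := exists F, is_CT F.

Definition mitra_criterion : Prop :=
  forall y0, exists M : nat -> R,
  [/\ forall N, 0 <= M N,
      M @ \oo --> +oo%R &
      forall N x y c, geodesic dY x y c ->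
        (forall t, 0 <= t <= dY x y -> N%:R <= dY y0 (c t)) ->
        forall c', geodesic dX (f x) (f y) c' ->
        forall t, 0 <= t <= dX (f x) (f y) -> M N <= dX (f y0) (c' t)].

End Maps.

(** * Gluing *)

Lemma clos_map (P Q : Type) (r : P -> P -> Prop) (r' : Q -> Q -> Prop) (f : P -> Q) :
  (forall x y, r x y -> r' (f x) (f y)) -> forall x y,
  clos_refl_sym_trans P r x y -> clos_refl_sym_trans Q r' (f x) (f y).
Proof.
move=> rf x y; elim=> [z w /rf h|z|z w _ h|z w v _ h _ h'].
- exact: rst_step.
- exact: rst_refl.
- exact: rst_sym.
- exact: rst_trans h h'.
Qed.

Section Gluing.
Variables (R : realType) (P : choiceType).
Variable glue : P -> P -> Prop.
(* [piece x y l]: [x] and [y] are in a common piece and at distance [l] in it. *)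
Variable piece : P -> P -> R -> Prop.

Let glue_eqb (x y : P) : bool := `[< clos_refl_sym_trans P glue x y >].

Lemma glue_equiv_class : equiv_class_of glue_eqb.
Proof.
split=> [x|x y|y x z].
- by apply/asboolP; apply: rst_refl.
- by apply/asboolP/asboolP; apply: rst_sym.
- by move=> /asboolP xy /asboolP yz; apply/asboolP; apply: rst_trans xy yz.
Qed.

Definition glue_equiv : equiv_rel P := EquivRelPack glue_equiv_class.

Definition glued : Type := {eq_quot glue_equiv}.
HB.instance Definition _ := Choice.on glued.
HB.instance Definition _ := Quotient.on glued.

Inductive chain : glued -> glued -> R -> Prop :=
| chain_nil a : chain a a 0
| chain_cons x y l b m : piece x y l -> chain (\pi_glued y) b m ->
    chain (\pi_glued x) b (l + m).

(* As [inf] is real-valued, this is the quotient (pseudo)metric only if any two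
   points are joined by a chain. *)
Definition glue_dist (a b : glued) : R := inf [set l | chain a b l].

Lemma glued_eqP x y :
  \pi_glued x = \pi_glued y <-> clos_refl_sym_trans P glue x y.
Proof.
split; first by move=> /eqquotP /asboolP.
by move=> ?; apply/eqquotP/asboolP.
Qed.

Lemma glued_reprP x : clos_refl_sym_trans P glue (repr (\pi_glued x)) x.
Proof. by apply/glued_eqP; rewrite reprK. Qed.

End Gluing.

(** * Cayley graphs and hyperbolic groups *)

Section Cayley.
Variables (R : realType) (G : groupType) (S : seq G).
Local Open Scope group_scope.

Definition generates : Prop := forall g : G, exists w : seq G,
  {in w, forall x, x \in S \/ x^-1 \in S} /\ g = \prod_(x <- w) x.

(* [Cedge g s t] is the point at distance [t] from [g] on the edge from [g] to
   [g * s]. *)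
Inductive cayley_pre : Type :=
| Cvert of G
| Cedge (g s : G) (t : R) of s \in S & (0 <= t <= 1)%R.

HB.instance Definition _ := gen_eqMixin cayley_pre.
HB.instance Definition _ := gen_choiceMixin cayley_pre.

Inductive cayley_glue : cayley_pre -> cayley_pre -> Prop :=
| cayley_glue0 g s hs h0 : cayley_glue (@Cedge g s 0%R hs h0) (Cvert g)
| cayley_glue1 g s hs h1 : cayley_glue (@Cedge g s 1%R hs h1) (Cvert (g * s)).

Inductive cayley_piece : cayley_pre -> cayley_pre -> R -> Prop :=
| Cayley_piece g s t t' hs ht hs' ht' :
    cayley_piece (@Cedge g s t hs ht) (@Cedge g s t' hs' ht') `|t - t'|%R.

Definition cayley : Type := glued cayley_glue.
HB.instance Definition _ := Choice.on cayley.
HB.instance Definition _ := Quotient.on cayley.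

Definition cayley_dist : cayley -> cayley -> R := @glue_dist R _ _ cayley_piece.

Definition cvert (g : G) : cayley := \pi_cayley (Cvert g).

(* The Cayley graph induces the word metric on its vertices. *)
Definition word_dist (g h : G) : R := cayley_dist (cvert g) (cvert h).

End Cayley.

Definition hyperbolic_group (R : realType) (G : groupType) : Prop :=
  exists2 S : seq G, generates S & hyperbolic (@cayley_dist R G S).

Definition group_qi_embedding (R : realType) (H G : groupType)
    (f : {multiplicative H -> G}) : Prop :=
  exists (S : seq H) (S' : seq G), [/\ generates S, generates S' &
    qi_embedding (@word_dist R H S) (@word_dist R G S') f].

Section CayleyMap.
Variables (R : realType) (H G : groupType) (f : {multiplicative H -> G}).
Variables (SH : seq H) (SG : seq G).
Hypothesis fS : {in SH, forall s, f s \in SG}.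

Definition cayley_map_pre (x : cayley_pre R SH) : cayley_pre R SG :=
  match x with
  | Cvert g => Cvert R SG (f g)
  | Cedge g s t hs ht => Cedge (f g) (fS hs) ht
  end.

Definition cayley_map (x : cayley R SH) : cayley R SG :=
  \pi_(cayley R SG) (cayley_map_pre (repr x)).

Lemma cayley_mapE x :
  cayley_map (\pi_(cayley R SH) x) = \pi_(cayley R SG) (cayley_map_pre x).
Proof.
rewrite /cayley_map; apply/glued_eqP; apply: clos_map (glued_reprP _ _).
move=> _ _ [g s hs h|g s hs h] /=; first exact: cayley_glue0.
by rewrite gmulfM; apply: cayley_glue1.
Qed.

End CayleyMap.

(* A homomorphism of hyperbolic groups admits the Cannon-Thurston map if all the
   maps of Cayley graphs it induces do. *)
Definition group_admits_CT (R : realType) (H G : groupType)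
    (f : {multiplicative H -> G}) : Prop :=
  [/\ hyperbolic_group R H, hyperbolic_group R G &
    forall (SH : seq H) (SG : seq G) (fS : {in SH, forall s, f s \in SG}),
      generates SH -> generates SG ->
      admits_CT (@cayley_dist R H SH) (@cayley_dist R G SG) (@cayley_map R H G f SH SG fS)].

Definition quasiconvex_image (R : realType) (H G : groupType)
    (f : {multiplicative H -> G}) (S : seq G) : Prop :=
  quasiconvex (@cayley_dist R G S) (range (fun h => cvert R S (f h))).

(** * Complexes of groups *)

Section Complexes.
Variable V : finType.

Record simplicial_complex := SimplicialComplex {
  simplices : {set {set V}};
  simplex_neq0 : forall s, s \in simplices -> s != finset.set0;
  simplex_sub : forall s t : {set V}, s \in simplices -> t != finset.set0 ->
    t \subset s -> t \in simplices }.

Definition simplex (K : simplicial_complex) : Type :=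
  {s : {set V} | s \in simplices K}.
HB.instance Definition _ K := Finite.on (simplex K).

Definition face K (t s : simplex K) : bool := sval t \proper sval s.

(* A directed edge [(s, t)] is given by a proof of [face t s]; this is [e * e']
   for [e = (t, u)] and [e' = (s, t)]. *)
Definition edge_comp K (s t u : simplex K) (e : face u t) (e' : face t s) :
  face u s := proper_trans e e'.

Definition edge K : Type := {p : simplex K * simplex K | face p.2 p.1}.
HB.instance Definition _ K := Finite.on (edge K).

Definition mk_edge K (s t : simplex K) (h : face t s) : edge K :=
  exist _ (s, t) h.

Definition connected_complex K : Prop :=
  (exists s : simplex K, True) /\
  forall s t : simplex K, connect (fun x y => face x y || face y x) s t.

Definition edge_adj K (T : {set edge K}) : rel (simplex K) :=
  fun s t => [exists e in T, (sval e == (s, t)) || (sval e == (t, s))].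

(* In a connected graph the maximal trees are the spanning trees. The graph is
   simple, so a cycle of length 2 runs back and forth along an edge. *)
Definition maximal_tree K (T : {set edge K}) : Prop :=
  (forall s t : simplex K, connect (edge_adj T) s t) /\
  (forall c : seq (simplex K), ucycle (edge_adj T) c -> (size c <= 2)%N).

(* [twist e e'] is the element usually denoted [g_{e,e'}]. *)
Record complex_of_groups (K : simplicial_complex) := ComplexOfGroups {
  lgroup : simplex K -> groupType;
  lmap : forall s t, face t s -> {multiplicative lgroup s -> lgroup t};
  twist : forall s t u, face u t -> face t s -> lgroup u;
  lmap_inj : forall s t (e : face t s), injective (lmap e);
  twist_ad : forall s t u (e : face u t) (e' : face t s) (x : lgroup s),
    (twist e e' * lmap (edge_comp e e') x * (twist e e')^-1
     = lmap e (lmap e' x))%g;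
  twist_cocycle : forall s t u v (e : face v u) (e' : face u t) (e'' : face t s),
    (lmap e (twist e' e'') * twist e (edge_comp e' e'')
     = twist e e' * twist (edge_comp e e') e'')%g }.

End Complexes.

Section FundamentalGroup.
Variables (V : finType) (K : simplicial_complex V) (G : complex_of_groups K).
Variable T : {set edge K}.

Inductive letter : Type :=
| Lgroup (s : simplex K) of lgroup G s
| Lk (s t : simplex K) of face t s
| LkV (s t : simplex K) of face t s.

HB.instance Definition _ := gen_eqMixin letter.
HB.instance Definition _ := gen_choiceMixin letter.

(* Presentation as a monoid with generators the elements of the local groups, the
   [k_e] and their inverses. *)
Inductive relation : seq letter -> seq letter -> Prop :=
| rel_mul s (g h : lgroup G s) :
    relation [:: Lgroup g; Lgroup h] [:: Lgroup (g * h)%g]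
| rel_one s : relation [:: Lgroup (1%g : lgroup G s)] [::]
| rel_kkV s t (e : face t s) : relation [:: Lk e; LkV e] [::]
| rel_kVk s t (e : face t s) : relation [:: LkV e; Lk e] [::]
| rel_conj s t (e : face t s) (g : lgroup G s) :
    relation [:: Lk e; Lgroup g; LkV e] [:: Lgroup (lmap G e g)]
| rel_comp s t u (e : face u t) (e' : face t s) :
    relation [:: Lk e; Lk e'] [:: Lgroup (twist G e e'); Lk (edge_comp e e')]
| rel_tree s t (e : face t s) : mk_edge e \in T -> relation [:: Lk e] [::].

Inductive step : seq letter -> seq letter -> Prop :=
| Step u a b v : relation a b -> step (u ++ a ++ v) (u ++ b ++ v).

Definition pi1 : Type := glued step.
HB.instance Definition _ := Choice.on pi1.
HB.instance Definition _ := Quotient.on pi1.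

Definition pi1_class (w : seq letter) : pi1 := \pi_pi1 w.

Lemma pi1_eqP u v : pi1_class u = pi1_class v <-> clos_refl_sym_trans _ step u v.
Proof. exact: glued_eqP. Qed.

Lemma pi1_reprK x : pi1_class (repr x) = x.
Proof. exact: reprK. Qed.

Lemma pi1_rel a b : relation a b -> pi1_class a = pi1_class b.
Proof.
by move=> h; apply/pi1_eqP/rst_step; have := Step [::] [::] h; rewrite !cats0.
Qed.

Lemma pi1_catl u v w : pi1_class u = pi1_class v ->
  pi1_class (w ++ u) = pi1_class (w ++ v).
Proof.
move/pi1_eqP => h; apply/pi1_eqP; apply: (clos_map (f := cat w)) h.
by move=> _ _ [x a b y h]; rewrite !(catA w); apply: Step.
Qed.

Lemma pi1_catr u v w : pi1_class u = pi1_class v ->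
  pi1_class (u ++ w) = pi1_class (v ++ w).
Proof.
move/pi1_eqP => h; apply/pi1_eqP; apply: (clos_map (f := cat^~ w)) h.
by move=> _ _ [x a b y h]; rewrite -!catA; apply: Step.
Qed.

Definition letterV (x : letter) : letter :=
  match x with
  | Lgroup s g => Lgroup (g^-1)%g
  | Lk s t e => LkV e
  | LkV s t e => Lk e
  end.

Lemma pi1_letterV x : pi1_class [:: letterV x; x] = pi1_class [::].
Proof.
case: x => [s g|s t e|s t e] /=; last 2 first.
- exact/pi1_rel/rel_kVk.
- exact/pi1_rel/rel_kkV.
by rewrite (pi1_rel (rel_mul _ _)) mulVg; apply/pi1_rel/rel_one.
Qed.

Lemma letterVK x : pi1_class [:: letterV (letterV x)] = pi1_class [:: x].
Proof. by case: x => //= s g; rewrite invgK. Qed.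

Definition pi1_mul (x y : pi1) : pi1 := pi1_class (repr x ++ repr y).
Definition pi1_inv (x : pi1) : pi1 := pi1_class (rev (map letterV (repr x))).

Lemma pi1_cat u v : pi1_class (u ++ v) = pi1_mul (pi1_class u) (pi1_class v).
Proof.
rewrite /pi1_mul.
transitivity (pi1_class (repr (pi1_class u) ++ v)).
- by apply: pi1_catr; rewrite pi1_reprK.
- by apply: pi1_catl; rewrite pi1_reprK.
Qed.

Lemma pi1_mulA : associative pi1_mul.
Proof.
move=> x y z; rewrite -(pi1_reprK x) -(pi1_reprK y) -(pi1_reprK z).
by rewrite -!pi1_cat catA.
Qed.

Lemma pi1_mul1 : left_id (pi1_class [::]) pi1_mul.
Proof. by move=> x; rewrite -(pi1_reprK x) -pi1_cat. Qed.

Lemma pi1_1mul : right_id (pi1_class [::]) pi1_mul.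
Proof. by move=> x; rewrite -(pi1_reprK x) -pi1_cat cats0. Qed.

Lemma pi1_word_mulV w : pi1_class (rev (map letterV w) ++ w) = pi1_class [::].
Proof.
elim: w => [//|x w IH]; rewrite /= rev_cons -cats1 -catA.
rewrite -[RHS]IH (_ : [:: letterV x] ++ x :: w = [:: letterV x; x] ++ w) //.
by apply: pi1_catl; rewrite -[in RHS](cat0s w); apply/pi1_catr/pi1_letterV.
Qed.

Lemma pi1_mulV : left_inverse (pi1_class [::]) pi1_inv pi1_mul.
Proof. by move=> x; rewrite -{2}(pi1_reprK x) -pi1_cat pi1_word_mulV. Qed.

Lemma pi1_Vmul : right_inverse (pi1_class [::]) pi1_inv pi1_mul.
Proof.
move=> x; rewrite -(pi1_mul1 (pi1_mul x _)) -{1}(pi1_mulV (pi1_inv x)).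
by rewrite -pi1_mulA [pi1_mul (pi1_inv x) _]pi1_mulA pi1_mulV pi1_mul1 pi1_mulV.
Qed.

HB.instance Definition _ := isGroup.Build pi1
  pi1_mulA pi1_mul1 pi1_1mul pi1_mulV pi1_Vmul.

Definition pi1_local (s : simplex K) (g : lgroup G s) : pi1 :=
  pi1_class [:: Lgroup g].
Definition pi1_k (s t : simplex K) (e : face t s) : pi1 := pi1_class [:: Lk e].

Definition developable : Prop := forall s, injective (@pi1_local s).

End FundamentalGroup.

(** * The development *)

Section Development.
Variables (R : realType) (V : finType) (K : simplicial_complex V).
Variables (G : complex_of_groups K) (T : {set edge K}).

(* The standard Euclidean simplex on [s], in barycentric coordinates. *)
Definition std_simplex (s : {set V}) : set {ffun V -> R} :=
  [set x | [/\ forall v, 0 <= x v, forall v, v \notin s -> x v = 0 &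
               \sum_v x v = 1]].

Record dev_pre : Type := DevPre {
  dev_elt : pi1 G T;
  dev_simplex : simplex K;
  dev_coord : {ffun V -> R};
  dev_coordP : std_simplex (sval dev_simplex) dev_coord }.

HB.instance Definition _ := gen_eqMixin dev_pre.
HB.instance Definition _ := gen_choiceMixin dev_pre.

Inductive dev_glue : dev_pre -> dev_pre -> Prop :=
| dev_glue_local g s (g' : lgroup G s) x (hx : std_simplex (sval s) x) :
    dev_glue (DevPre (g * pi1_local T g')%g hx) (DevPre g hx)
| dev_glue_face g s t (e : face t s) x
    (hs : std_simplex (sval s) x) (ht : std_simplex (sval t) x) :
    dev_glue (DevPre g hs) (DevPre (g * (pi1_k G T e)^-1)%g ht).

Inductive dev_piece : dev_pre -> dev_pre -> R -> Prop :=
| Dev_piece g s x y (hx : std_simplex (sval s) x) (hy : std_simplex (sval s) y) :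
    dev_piece (DevPre g hx) (DevPre g hy) (euclid x y).

Definition dev : Type := glued dev_glue.
HB.instance Definition _ := Choice.on dev.
HB.instance Definition _ := Quotient.on dev.

Definition dev_dist : dev -> dev -> R := @glue_dist R _ _ dev_piece.

Definition dev_act_pre (g : pi1 G T) (x : dev_pre) : dev_pre :=
  DevPre (g * dev_elt x)%g (@dev_coordP x).

Definition dev_act (g : pi1 G T) (x : dev) : dev :=
  \pi_dev (dev_act_pre g (repr x)).

Lemma dev_actE g x : dev_act g (\pi_dev x) = \pi_dev (dev_act_pre g x).
Proof.
rewrite /dev_act; apply/glued_eqP; apply: clos_map (glued_reprP _ _).
move=> _ _ [h s g' y hy|h s t e y hs ht]; rewrite /dev_act_pre /= mulgA.
- exact: dev_glue_local.
- exact: dev_glue_face.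
Qed.

Definition acylindrical : Prop :=
  exists2 A : R, 0 < A & forall D : set dev,
    (A%:E <= diameter dev_dist D)%E ->
    finite_set [set g : pi1 G T | forall x, D x -> dev_act g x = x].

Definition complex_of_hyperbolic_groups : Prop :=
  [/\ developable G T,
      forall s, hyperbolic_group R (lgroup G s),
      forall s t (e : face t s), group_qi_embedding R (lmap G e) &
      hyperbolic dev_dist].

End Development.

(** * Restriction to a subcomplex *)

Definition subcomplex (V : finType) (K1 K : simplicial_complex V) : Prop :=
  simplices K1 \subset simplices K.

Section Restriction.
Variables (V : finType) (K1 K : simplicial_complex V) (K1K : subcomplex K1 K).

Definition inc (s : simplex K1) : simplex K :=
  exist _ (sval s) (fintype.subsetP K1K _ (svalP s)).

Definition inc_edge (e : edge K1) : edge K :=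
  exist _ (inc (sval e).1, inc (sval e).2) (svalP e).

Variable G : complex_of_groups K.

Definition restriction : complex_of_groups K1 :=
  @ComplexOfGroups V K1 (fun s => lgroup G (inc s))
    (fun s t (e : face t s) => @lmap V K G (inc s) (inc t) e)
    (fun s t u (e : face u t) (e' : face t s) =>
       @twist V K G (inc s) (inc t) (inc u) e e')
    (fun s t e => @lmap_inj V K G (inc s) (inc t) e)
    (fun s t u e e' => @twist_ad V K G (inc s) (inc t) (inc u) e e')
    (fun s t u v e e' e'' =>
       @twist_cocycle V K G (inc s) (inc t) (inc u) (inc v) e e' e'').

Variables (T1 : {set edge K1}) (T : {set edge K}).
Hypothesis T1T : {in T1, forall e, inc_edge e \in T}.

Definition inc_letter (x : letter restriction) : letter G :=
  match x with
  | Lgroup s g => @Lgroup V K G (inc s) g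
  | Lk s t e => @Lk V K G (inc s) (inc t) e
  | LkV s t e => @LkV V K G (inc s) (inc t) e
  end.

Lemma inc_relation a b : relation T1 a b ->
  relation T (map inc_letter a) (map inc_letter b).
Proof.
case=> [s g h|s|s t e|s t e|s t e g|s t u e e'|s t e he].
- exact: (@rel_mul V K G T (inc s)).
- exact: (@rel_one V K G T (inc s)).
- exact: (@rel_kkV V K G T (inc s) (inc t)).
- exact: (@rel_kVk V K G T (inc s) (inc t)).
- exact: (@rel_conj V K G T (inc s) (inc t) e g).
- exact: (@rel_comp V K G T (inc s) (inc t) (inc u) e e').
- apply: (@rel_tree V K G T (inc s) (inc t) e).
  have -> : @mk_edge V K (inc s) (inc t) e = inc_edge (mk_edge e) by apply: val_inj.
  exact: T1T he.
Qed.

Lemma inc_word_eq u v : pi1_class T1 u = pi1_class T1 v ->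
  pi1_class T (map inc_letter u) = pi1_class T (map inc_letter v).
Proof.
move/pi1_eqP => h; apply/pi1_eqP; apply: (clos_map (f := map inc_letter)) h.
by move=> _ _ [x a b y h]; rewrite !map_cat; apply/Step/inc_relation.
Qed.

Definition pi1_map (x : pi1 restriction T1) : pi1 G T :=
  pi1_class T (map inc_letter (repr x)).

Lemma pi1_mapE w :
  pi1_map (pi1_class T1 w) = pi1_class T (map inc_letter w).
Proof. by apply: inc_word_eq; rewrite pi1_reprK. Qed.

Lemma pi1_mapM : {morph pi1_map : x y / (x * y)%g}.
Proof.
move=> x y; rewrite -(pi1_reprK x) -(pi1_reprK y) -[(_ * _)%g]pi1_cat.
by rewrite !pi1_mapE map_cat pi1_cat.
Qed.

Lemma pi1_mapV x : pi1_map (x^-1)%g = ((pi1_map x)^-1)%g.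
Proof.
apply: (mulIg (pi1_map x)); rewrite -pi1_mapM !mulVg.
exact: (pi1_mapE [::]).
Qed.

Definition pi1_hom : {multiplicative pi1 restriction T1 -> pi1 G T} :=
  HB.pack pi1_map (isMultiplicative.Build _ _ pi1_map pi1_mapM).

Variable R : realType.

Definition dev_map_pre (x : dev_pre R restriction T1) : dev_pre R G T :=
  @DevPre R V K G T (pi1_hom (dev_elt x)) (inc (dev_simplex x)) (dev_coord x)
    (dev_coordP x).

(* The natural map of developments, [[h, x] |-> [h, x]]. *)
Definition dev_map (x : dev R restriction T1) : dev R G T :=
  \pi_(dev R G T) (dev_map_pre (repr x)).

Lemma dev_mapE x :
  dev_map (\pi_(dev R restriction T1) x) = \pi_(dev R G T) (dev_map_pre x).
Proof.
rewrite /dev_map; apply/glued_eqP; apply: clos_map (glued_reprP _ _).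
move=> _ _ [h s g' y hy|h s t e y hs ht]; rewrite /dev_map_pre /=.
- have -> : pi1_map (h * pi1_local T1 g')%g
      = (pi1_map h * @pi1_local V K G T (inc s) g')%g.
    by rewrite pi1_mapM [X in (_ * X)%g]pi1_mapE.
  exact: dev_glue_local.
- have -> : pi1_map (h * (pi1_k restriction T1 e)^-1)%g
      = (pi1_map h * (@pi1_k V K G T (inc s) (inc t) e)^-1)%g.
    rewrite pi1_mapM pi1_mapV; congr (_ * _^-1)%g.
    by rewrite [LHS]pi1_mapE.
  exact: (@dev_glue_face R V K G T _ (inc s) (inc t)).
Qed.

Lemma dev_map_act g x : dev_map (dev_act g x) = dev_act (pi1_hom g) (dev_map x).
Proof.
rewrite -[x]reprK dev_actE !dev_mapE dev_actE; apply: (congr1 (\pi_(dev R G T))).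
rewrite /dev_map_pre /dev_act_pre /= pi1_mapM.
by congr DevPre; apply: Prop_irrelevance.
Qed.

End Restriction.

Arguments dev_dist R {V K} G T _ _.
Arguments dev_map {V K1 K K1K} G {T1 T} T1T R x.
Arguments restriction {V K1 K} K1K G.
Arguments pi1_hom {V K1 K K1K} G {T1 T} T1T.

(* Main.v *)
(** Groups carry word metrics with values in [nat]. A discrete geodesic space is
    hyperbolic as soon as the 1-forms [a db], with [a] a bump function around [m] and
    [b] the distance to [x], have potentials up to a bounded error, uniformly in [m],
    [x] and the radius of the bump: integrating along a geodesic through [m] and along
    a path avoiding [m] shows that detours have quadratic length. Conversely, on a
    hyperbolic space an edge function whose sums over short loops are bounded has a
    coarse potential.

    The combination theorem follows. The coset [g G_v] of a vertex group is seen as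
    the fibre over the vertex [g v] of [B]. Chains of vertices along CAT(0) geodesics
    and acylindricity bound the number of fibres that can be close to each other along
    an unbounded set. Hence potentials can be built on the coarse intersections of
    several fibres by downward induction on their number, and then on single fibres.
    The differences of these potentials form an edge function on the coned-off group,
    which is quasi-isometric to [B]; its sums over short loops are bounded because
    such loops are coned off along CAT(0) geodesics. Prescribing the potential on one
    fibre shows moreover that the vertex groups are quasi-isometrically embedded.

    Let [H] be the group of the subcomplex. A geodesic of [H] or [G] follows, in the
    coned-off metric, the geodesic of [B1] or [B] with the same ends. If the part of a
    geodesic of [H] lying over a large ball of [B1] is removed, Mitra's criterion
    shows that the ends of the remaining pieces are joined by geodesics of [G] far from
    [1]; the ends of the removed part are joined through boundedly many fibres, and
    are handled one fibre at a time. This gives the Cannon-Thurston map of the groups.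
    If [H] is not quasi-isometrically embedded, an ultralimit of geodesics of [H]
    through [1] is a line whose two ends get identified in the boundary of [G]: either
    the two ends define distinct points of the boundary of [B1] with the same image
    in the boundary of [B], or boundedly many fibres join them and one is back in the
    previous situation. If [H] is quasi-isometrically embedded, the Morse lemma makes
    the map of boundaries injective. *)
From HB Require Import structures.
From Stdlib Require Import Relation_Operators.
Require Import Defs.
From mathcomp Require Import all_boot all_order all_algebra.
From mathcomp Require Import all_classical all_reals.
From mathcomp Require Import ereal topology normedtype filter finmap zify ring lra.

Set Implicit Arguments.
Unset Strict Implicit.
Unset Printing Implicit Defensive.

Import Order.TTheory GRing.Theory Num.Theory.
Local Open Scope nat_scope.

(** * Discrete geodesic metrics *)

(** Both fundamental groups have to be treated, but acylindricity is assumed on [B] only. For [B1]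
    it is deduced: Mitra's criterion makes [B1 -> B] proper, uniformly by cocompactness, so that
    large subsets of [B1] have large images, and injectivity on groups carries the finiteness of
    stabilizers back. Potentials on two fibres have to agree, up to constants, along the parts where
    the fibres run close, and such requirements may conflict where more fibres meet. This is why
    sets of several fibres carry potentials of their own, those of larger sets being settled first.
    Infinitely many fibres and area forms occur at once, so most statements fix the constants before
    the space, the form or the fibre. In particular, the distance at which an edge group makes two
    fibres fellow-travel must not depend on how far apart the ends are ([edge_transport_mid]); this
    bounds the number of fibres independently of the scale ([finite_height]). Short loops are enough
    throughout because of a linear isoperimetric inequality: a closed walk is cut into short ones,
    at most a fixed multiple of its length in number. *)

Lemma crossing (P Q : nat -> Prop) n : P 0 -> Q n ->
  (forall i, i <= n -> P i \/ Q i) ->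
  exists2 i, i <= n & P i /\ (Q i \/ i < n /\ Q i.+1).
Proof.
elim: n => [|n IH] p0 qn pq; first by exists 0 => //; split=> //; left.
have [p|q] := pq n (leqnSn n).
  by exists n => //; split=> //; right.
have [|i hi [pi h]] := IH p0 q; first by move=> i hi; apply: pq; lia.
exists i; first lia.
by split=> //; case: h => [h|[h h']]; [left|right; split=> //; lia].
Qed.

Lemma argmax_nat (F : nat -> nat) n :
  exists2 t, t <= n & forall i, i <= n -> F i <= F t.
Proof.
elim: n => [|n [t ht IH]]; first by exists 0 => // -[].
have [h|h] := leqP (F n.+1) (F t).
  exists t; first lia.
  move=> i; rewrite leq_eqVlt => /orP[/eqP -> //|]; exact: IH.
exists n.+1 => // i; rewrite leq_eqVlt => /orP[/eqP -> //|hi].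
exact: leq_trans (IH _ hi) (ltnW h).
Qed.

Section DiscreteMetric.
Variables (V : Type) (d : V -> V -> nat).

Definition pmetric : Prop := [/\ forall x, d x x = 0,
  forall x y, d x y = d y x & forall x y z, d x z <= d x y + d y z].

Definition dgeodesic : Prop := (forall x y, d x y = 0 -> x = y) /\
  forall x y k, k <= d x y -> exists z, d x z = k /\ d z y = d x y - k.

Definition between x y m : Prop := d x m + d m y = d x y.

Definition thin_triangles delta : Prop := forall x y z m, between x y m ->
  exists2 m', between x z m' \/ between z y m' & d m m' <= delta.

Definition dpath n (g : nat -> V) : Prop :=
  forall i j, i <= n -> j <= n -> d (g i) (g j) = (i - j) + (j - i).

Hypothesis dP : pmetric.
Let dxx x : d x x = 0. Proof. by case: dP. Qed.
Let dC x y : d x y = d y x. Proof. by case: dP. Qed.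
Let dT x y z : d x z <= d x y + d y z. Proof. by case: dP. Qed.

Lemma dpath_between n g i j k : dpath n g -> i <= j <= k -> k <= n ->
  between (g i) (g k) (g j).
Proof. by move=> h ijk kn; rewrite /between !h; lia. Qed.

Lemma dpath_sub n g a b : dpath n g -> a <= b <= n ->
  dpath (b - a) (fun i => g (a + i)).
Proof. by move=> h ab i j hi hj; rewrite h; lia. Qed.

Lemma dpath_rev n g : dpath n g -> dpath n (fun i => g (n - i)).
Proof. by move=> h i j hi hj; rewrite h; lia. Qed.

Lemma between_sym x y m : between x y m -> between y x m.
Proof. by rewrite /between (dC y m) (dC m x) (dC y x); lia. Qed.

Lemma between_l x y : between x y x.
Proof. by rewrite /between dxx. Qed.

Lemma between_r x y : between x y y.
Proof. by rewrite /between dxx addn0. Qed.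

Lemma step_path n g k : (forall i, i < n -> d (g i) (g i.+1) <= k) ->
  forall i j, i <= j <= n -> d (g i) (g j) <= (j - i) * k.
Proof.
move=> h i j /andP[]; elim: j => [|j IH] ij jn.
  have -> : i = 0 by lia.
  by rewrite dxx.
have [->|ne] := eqVneq i j.+1; first by rewrite dxx.
have := IH ltac:(lia) ltac:(lia); have := h j jn; have := dT (g i) (g j) (g j.+1).
have -> : j.+1 - i = (j - i).+1 by lia.
by rewrite mulSn; lia.
Qed.

Lemma dpath_step n g : (forall i, i < n -> d (g i) (g i.+1) <= 1) ->
  d (g 0) (g n) = n -> dpath n g.
Proof.
move=> h e; have sp := step_path h.
have key i j : i <= j <= n -> d (g i) (g j) = j - i.
  move=> ij; have := sp i j ij; have := sp 0 i ltac:(lia); have := sp j n ltac:(lia).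
  have := dT (g 0) (g i) (g n); have := dT (g i) (g j) (g n); lia.
move=> i j hi hj; have [ij|ji] := leqP i j; first by rewrite key; lia.
by rewrite dC key; lia.
Qed.

Hypothesis dG : dgeodesic.

Lemma dpath_ex x y : exists g, [/\ g 0 = x, g (d x y) = y & dpath (d x y) g].
Proof.
have [d0 dg] := dG.
move: {2}(d x y) (erefl (d x y)) => n; elim: n x => [|n IH] x hn.
  exists (fun=> x); rewrite hn; split=> //; first exact: d0.
  by move=> i j hi hj; rewrite dxx; lia.
have [|z [xz zy]] := dg x y 1; first by rewrite hn.
have zn : d z y = n by lia.
have [g [g0 gn hg]] := IH z zn; rewrite zn in gn hg.
exists (fun i => if i is i'.+1 then g i' else x); rewrite hn; split=> //.
apply: dpath_step; last by rewrite gn.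
by move=> [|i] hi; rewrite ?g0 ?xz// hg; lia.
Qed.

Lemma dpath_through x y m : between x y m ->
  exists g, [/\ g 0 = x, g (d x m) = m, g (d x y) = y & dpath (d x y) g].
Proof.
move=> hm; have [g [g0 gn hg]] := dpath_ex x m.
have [h [h0 hn hh]] := dpath_ex m y.
pose f i := if i <= d x m then g i else h (i - d x m).
have fn : f (d x y) = y.
  rewrite /f -hm; case: ifP => [le|_]; last by rewrite addKn.
  have e : d m y = 0 by lia.
  by rewrite e addn0 gn; apply: (proj1 dG).
exists f; split=> //; first by rewrite /f leqnn.
apply: dpath_step; last by rewrite fn /f /= g0.
move=> i hi; rewrite /f; case: (ltnP i (d x m)) => him.
  by rewrite (ltnW him) /= hg; lia.
case: ifP => [le|gt].
  have -> : i = d x m by lia.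
  by rewrite gn -h0 hh; rewrite /between in hm; lia.
by rewrite hh; rewrite /between in hm; lia.
Qed.

Lemma between_at x y k : k <= d x y -> exists2 m, between x y m & d x m = k.
Proof. by move=> hk; have [_ /(_ _ _ _ hk) [m [h1 h2]]] := dG; exists m => //; rewrite /between; lia. Qed.

(** Thinness is applied with third vertex [g j], where [j] is the distance from [g 0] to [m]: the
    point of the other sides close to [m] is then within [delta] of [g j], by comparing distances to
    the ends. *)
Lemma between_dpath_near delta n g m : thin_triangles delta -> dpath n g ->
  between (g 0) (g n) m -> exists2 j, j <= n & d m (g j) <= 2 * delta.
Proof.
move=> th hg hm; pose j := d (g 0) m.
have e : d (g 0) (g n) = n by rewrite hg; lia.
have jn : j <= n by move: hm; rewrite /between /j; lia.
exists j => //; have e1 : d (g 0) (g j) = j by rewrite hg; lia.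
have e2 : d (g j) (g n) = n - j by rewrite hg; lia.
have [u hu du] := th _ _ (g j) _ hm.
have := dT (g 0) u m; have := dT m u (g j); have := dC u m; have := dT m u (g n).
have := dC u (g j); have ej : d (g 0) m = j by [].
clearbody j; by case: hu; move: hm; rewrite /between; lia.
Qed.

Lemma thin_dpaths delta n g n1 g1 n2 g2 : thin_triangles delta ->
  dpath n g -> dpath n1 g1 -> dpath n2 g2 ->
  g 0 = g1 0 -> g1 n1 = g2 0 -> g2 n2 = g n -> forall i, i <= n ->
  (exists2 j, j <= n1 & d (g i) (g1 j) <= 3 * delta) \/
  (exists2 j, j <= n2 & d (g i) (g2 j) <= 3 * delta).
Proof.
move=> th hg h1 h2 e0 e1 e2 i hi.
have bt : between (g 0) (g n) (g i) by apply: (dpath_between hg); lia.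
have [u [hu|hu] du] := th _ _ (g1 n1) _ bt; [left|right].
- rewrite e0 in hu; have [j hj dj] := between_dpath_near th h1 hu.
  by exists j => //; have := dT (g i) u (g1 j); lia.
- rewrite e1 -e2 in hu; have [j hj dj] := between_dpath_near th h2 hu.
  by exists j => //; have := dT (g i) u (g2 j); lia.
Qed.

Lemma quad_near delta e a b a' b' m : thin_triangles delta -> d a a' <= e ->
  d b b' <= e -> between a b m ->
  exists2 m', between a' b' m' & d m m' <= 2 * delta + e.
Proof.
move=> th aa bb hm; have [u [hu|hu] mu] := th _ _ b' _ hm; last first.
  exists b'; first exact: between_r.
  have := dT m u b'; have := dC u b'; have := dC b b'; move: hu; rewrite /between; lia.
have [w [hw|hw] uw] := th _ _ a' _ hu.
  exists a'; first exact: between_l.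
  by have := dT m u a'; have := dT u w a'; move: hw; rewrite /between; lia.
by exists w => //; have := dT m u w; lia.
Qed.

(** Away from the ends the two short sides are out of reach of [m], so that, unlike in [quad_near],
    the bound does not involve [e]. *)
Lemma quad_mid delta e a b a' b' m : thin_triangles delta -> d a a' <= e ->
  d b b' <= e -> between a b m -> e + 2 * delta < d a m -> e + 2 * delta < d m b ->
  exists2 m', between a' b' m' & d m m' <= 2 * delta.
Proof.
move=> th aa bb hm am mb; have [u [hu|hu] mu] := th _ _ b' _ hm; last first.
  have := dT m u b; have := dC b b'; have := dC u b; move: hu; rewrite /between; lia.
have [w [hw|hw] uw] := th _ _ a' _ hu; last by exists w => //; have := dT m u w; lia.
have := dT m u a; have := dT u w a; have := dC m a; have := dC w a.
by move: hw; rewrite /between; lia.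
Qed.
End DiscreteMetric.

(** * Hyperbolicity from potentials *)

Lemma absz_chain (a b c e : int) X Y Z W : absz (b - a)%R <= X -> absz (c - b)%R <= Y ->
  absz (e - c)%R <= Z -> X + Y + Z <= W -> absz (e - a)%R <= W.
Proof. lia. Qed.

Section AreaForms.
Variables (V : Type) (d : V -> V -> nat) (C : nat).
Hypotheses (dP : pmetric d) (dG : dgeodesic d).
Let dxx x : d x x = 0. Proof. by case: dP. Qed.
Let dC x y : d x y = d y x. Proof. by case: dP. Qed.
Let dT x y z : d x z <= d x y + d y z. Proof. by case: dP. Qed.

(* The 1-form [a db], where [a u = max (0, r - d u m)] and [b] is the distance to
   [x]. Its integral along a geodesic issuing from [x] and crossing the ball of
   radius [r] around [m] is about [r ^ 2]; it vanishes outside this ball. *)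
Definition area_form x m r (u v : V) : int :=
  ((r - d u m)%N%:Z * ((d x v)%:Z - (d x u)%:Z))%R.

(** A potential of [area_form x m r] up to the error [C] has this property, as the form vanishes
    outside the ball. It is all that a detour avoiding the ball uses. *)
Definition lipschitz_outside m r (K : V -> int) : Prop :=
  forall u v, d u v <= 1 -> r <= d u m -> (absz (K v - K u)%R <= C)%N.

Lemma lipschitz_outside_path m r K n g : lipschitz_outside m r K ->
  dpath d n g -> (forall i, i <= n -> r <= d (g i) m) ->
  forall i j, i <= n -> j <= n -> (absz (K (g j) - K (g i))%R <= C * ((i - j) + (j - i)))%N.
Proof.
move=> hK hg hm.
have key i k : i + k <= n -> (absz (K (g (i + k)%N) - K (g i))%R <= C * k)%N.
  elim: k => [|k IH] hk; first by rewrite addn0; lia.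
  have := IH ltac:(lia); have := hK (g (i + k)) (g (i + k.+1)).
  rewrite hg; try lia.
  have := hm (i + k) ltac:(lia) => h1 /(_ ltac:(lia) h1); rewrite mulnS; lia.
move=> i j hi hj; have [ij|ji] := leqP i j.
  have := key i (j - i); rewrite subnKC // => /(_ hj).
  by have -> : i - j + (j - i) = j - i by lia.
have := key j (i - j); rewrite subnKC ?(ltnW ji) // => /(_ hi).
have -> : i - j + (j - i) = i - j by lia.
by lia.
Qed.

Lemma lipschitz_outside_far m r K u v : lipschitz_outside m r K ->
  r + d u v <= d u m -> (absz (K v - K u)%R <= C * d u v)%N.
Proof.
move=> hK h; have [g [g0 gn hg]] := dpath_ex dP dG u v.
have := lipschitz_outside_path hK hg _ (leq0n _) (leqnn (d u v)).
rewrite g0 gn sub0n subn0; apply=> i hi.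
have := dT u (g i) m; have := hg 0 i; rewrite g0 => -> //; lia.
Qed.

Hypothesis potential : forall x m r, exists K : V -> int, forall u v, d u v <= 1 ->
  (absz (K v - K u - area_form x m r u v)%R <= C)%N.

(** The integral of the form along [g] is [r * r], the sum of its coefficients over the ball, up to
    an error [C] per edge, while [l] bounds the same integral computed along a detour outside the
    ball. *)
Lemma detour n g c r l : dpath d n g -> r <= c -> c + r <= n ->
  (forall K, lipschitz_outside (g c) r K -> (absz (K (g n) - K (g 0%N))%R <= l)%N) ->
  r * r <= l + C * n.
Proof.
move=> hg rc cn hl; have [K hK] := potential (g 0) (g c) r.
have /hl le : lipschitz_outside (g c) r K.
  move=> u v uv um; have := hK u v uv; rewrite /area_form.
  have -> : r - d u (g c) = 0 by lia.
  by rewrite mul0r subr0.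
have st i : i < n -> (K (g i) + (r - ((i - c) + (c - i)))%N%:Z <= K (g i.+1) + C%:Z)%R.
  move=> hi; have := hK (g i) (g i.+1); rewrite /area_form !hg; try lia.
have s1 k : k <= c - r -> (K (g 0%N) <= K (g k) + (C * k)%N%:Z)%R.
  elim: k => [|k IH] hk; first by lia.
  by have := IH ltac:(lia); have := st k ltac:(lia); rewrite mulnS; lia.
(* On the two halves of the ball the coefficients of the form are [0, 1, ..., r - 1] and
   [r, r - 1, ..., 1]. The inequalities are doubled to avoid halves. *)
have s2 t : t <= r -> (2 * K (g (c - r)%N) + (t * t)%N%:Z <=
    2 * K (g (c - r + t)%N) + (2 * C * t)%N%:Z + t%:Z)%R.
  elim: t => [|t IH] ht; first by rewrite addn0; lia.
  have := IH ltac:(lia); have := st (c - r + t) ltac:(lia); rewrite addnS.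
  have -> : r - (c - r + t - c + (c - (c - r + t))) = t by lia.
  have -> : t.+1 * t.+1 = t * t + 2 * t + 1 by lia.
  by rewrite mulnS; lia.
have s3 t : t <= r -> (2 * K (g c) + (2 * r * t)%N%:Z + t%:Z <=
    2 * K (g (c + t)%N) + (2 * C * t)%N%:Z + (t * t)%N%:Z)%R.
  elim: t => [|t IH] ht; first by rewrite addn0; lia.
  have := IH ltac:(lia); have := st (c + t) ltac:(lia); rewrite addnS.
  have -> : r - (c + t - c + (c - (c + t))) = r - t by lia.
  have -> : t.+1 * t.+1 = t * t + 2 * t + 1 by lia.
  by rewrite !mulnS; lia.
have s4 k : c + r + k <= n -> (K (g (c + r)%N) <= K (g (c + r + k)%N) + (C * k)%N%:Z)%R.
  elim: k => [|k IH] hk; first by rewrite addn0; lia.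
  have := IH ltac:(lia); have := st (c + r + k) ltac:(lia).
  by rewrite addnS mulnS; lia.
have := s1 _ (leqnn _); have := s2 _ (leqnn r); have := s3 _ (leqnn r).
have := s4 (n - (c + r)) ltac:(lia).
rewrite subnKC // subnK // !mulnBr !mulnDr.
have : C * c + C * r <= C * n by rewrite -mulnDr leq_mul.
have : C * r <= C * c by rewrite leq_mul.
rewrite -!mulnA; set Cn := C * n; set Cc := C * c; set Cr := C * r; set rr := r * r.
lia.
Qed.

Lemma setdist_ex (A : V -> Prop) : (exists a, A a) -> exists f : V -> nat,
  (forall u, exists2 a, A a & d u a = f u) /\ forall u a, A a -> f u <= d u a.
Proof.
move=> [a0 A0].
have h u : exists k, (exists2 a, A a & d u a = k) /\ forall a, A a -> k <= d u a.
  have ex : exists k, `[< exists2 a, A a & d u a = k >].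
    by exists (d u a0); apply/asboolP; exists a0.
  exists (ex_minn ex); case: ex_minnP => k /asboolP hk hmin; split=> // a Aa.
  by apply: hmin; apply/asboolP; exists a.
by have [f hf] := choice h; exists f; split=> u; have [h1 h2] := hf u.
Qed.

(** The detour leaves [g] at distance [2 r] on either side of [g t], or at an end of [g], goes to a
    nearest point of [A] and continues in [A]. As [f] grows from [t] with slope at most [1 / 4], the
    nearest points are within [3 r / 2] and the connecting segments miss the ball of radius [r / 4];
    moreover [7 r = 4 r + 2 * (3 r / 2)]. *)
Lemma detour_set (A : V -> Prop) f n g t r l :
  (forall u, exists2 a, A a & d u a = f u) -> (forall u a, A a -> f u <= d u a) ->
  dpath d n g -> t <= n -> f (g t) = r ->
  (forall i, i <= n -> 4 * f (g i) <= 4 * r + ((i - t) + (t - i))) ->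
  (t < 2 * r -> 4 * f (g 0) <= r) -> (n - t < 2 * r -> 4 * f (g n) <= r) ->
  (forall a b K, A a -> A b -> d a b <= 8 * r -> lipschitz_outside (g t) (r %/ 4) K ->
     (absz (K b - K a)%R <= l)%N) ->
  (r %/ 4) * (r %/ 4) <= l + C * (7 * r).
Proof.
move=> fA fle hg tn ft fmax f0 fn hl; set rho := r %/ 4.
have rho4 : 4 * rho <= r.
  by rewrite /rho; lia.
have flip u : r <= d u (g t) + f u.
  have [a Aa <-] := fA u; rewrite -ft.
  by have := fle (g t) a Aa; have := dT (g t) u a; rewrite (dC u (g t)); lia.
pose i := t - 2 * r; pose j := minn n (t + 2 * r).
have hdi : d (g i) (g t) = t - i.
  by rewrite hg /i; lia.
have hdj : d (g j) (g t) = j - t.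
  by rewrite hg /j; lia.
have hi : rho + f (g i) <= t - i.
  have [lt|ge] := ltnP t (2 * r).
    have e : i = 0.
      by rewrite /i; lia.
    by have := f0 lt; have := flip (g i); rewrite hdi e; lia.
  by have := fmax i ltac:(rewrite /i; lia); rewrite /i; lia.
have hj : rho + f (g j) <= j - t.
  have [lt|ge] := ltnP (n - t) (2 * r).
    have e : j = n.
      by rewrite /j; lia.
    by have := fn lt; have := flip (g j); rewrite hdj e; lia.
  by have := fmax j ltac:(rewrite /j; lia); rewrite /j; lia.
have fi : 2 * f (g i) <= 3 * r.
  by have := fmax i ltac:(rewrite /i; lia); rewrite /i; lia.
have fj : 2 * f (g j) <= 3 * r.
  by have := fmax j ltac:(rewrite /j; lia); rewrite /j; lia.
have ij : j - i <= 4 * r.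
  by rewrite /i /j; lia.
have hij : i <= j <= n.
  by rewrite /i /j; lia.
have [a Aa da] := fA (g i); have [b Ab db] := fA (g j).
have ab : d a b <= 8 * r.
  have := dT a (g i) b; have := dT (g i) (g j) b; have := dC a (g i).
  by rewrite (hg i j); lia.
have := @detour (j - i) (fun k => g (i + k)) (t - i) rho (C * f (g i) + l + C * f (g j)).
move=> /(_ (dpath_sub hg hij) ltac:(lia) ltac:(lia)).
have ij' : i + (j - i) = j by lia.
rewrite ij'.
have it : i + (t - i) = t.
  by rewrite /i; lia.
rewrite it.
rewrite addn0 => h; apply: leq_trans (h _) _.
  move=> K hK; have := hl a b K Aa Ab ab hK.
  have := @lipschitz_outside_far _ _ _ (g i) a hK; rewrite da hdi => /(_ hi).
  have := @lipschitz_outside_far _ _ _ (g j) b hK; rewrite db hdj => /(_ hj).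
  by lia.
have : C * (f (g i) + f (g j) + (j - i)) <= C * (7 * r).
  by rewrite leq_mul; lia.
by rewrite !mulnDr; lia.
Qed.

Lemma quadratic_bound r c : (r %/ 4) * (r %/ 4) <= c * r -> r <= 28 * c + 3.
Proof.
set p := r %/ 4 => h; have hr : r <= 4 * p + 3.
   by rewrite /p; lia.
have [p0|p0] := posnP p; first by lia.
have : p * p <= (7 * c) * p.
  by apply: leq_trans h _; rewrite (mulnC 7) -mulnA leq_mul //; lia.
by rewrite leq_pmul2r //; lia.
Qed.

(** From [quadratic_bound]: [420 = 28 * 15], where [15 r] is the [7 r] of [detour_set] plus [8 r]
    along the opposite geodesic. *)
Let k0 := 420 * C + 3.

(** Maximizing [4 f] minus the distance to [m] yields the slope condition of [detour_set] and keeps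
    [t] within [4 f t] of [m], hence away from the ends when [m] is. *)
Lemma weighted_max (f : nat -> nat) n m : m <= n -> exists2 t, t <= n &
  4 * f m + ((t - m) + (m - t)) <= 4 * f t /\
  forall i, i <= n -> 4 * f i <= 4 * f t + ((i - t) + (t - i)).
Proof.
move=> mn; have [t tn ht] := argmax_nat (fun i => 4 * f i + (n - ((i - m) + (m - i)))) n.
exists t => //; split=> [|i hi]; first by have := ht m mn; lia.
by have := ht i hi; lia.
Qed.

(** This is [detour_set] with [A] the opposite geodesic. If [t] is within [2 r] of an end, then [m]
    is within [6 r] of it, so the hypotheses on [m] give [4 s <= r], which is what the detour needs
    there. The final bound does not involve [s]. *)
Lemma quadrilateral n g n' g' s m : dpath d n g -> dpath d n' g' ->
  d (g 0) (g' 0) <= s -> d (g n) (g' n') <= s -> 24 * s <= m -> m + 24 * s <= n ->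
  exists2 j, j <= n' & d (g m) (g' j) <= k0.
Proof.
move=> hg hg' d0 dn m1 m2.
pose A a := exists2 j, j <= n' & a = g' j.
have [|f [fA fle]] := @setdist_ex A; first by exists (g' 0), 0.
have [|t tn [tm tmax]] := @weighted_max (fun i => f (g i)) n m; first lia.
have [r hr] : exists r, f (g t) = r by exists (f (g t)).
suff rk : r <= k0.
  by have [_ [j hj ->] e] := fA (g m); exists j => //; lia.
have f0 : f (g 0) <= s by apply: leq_trans d0; apply: fle; exists 0.
have fn : f (g n) <= s by apply: leq_trans dn; apply: fle; exists n'.
have := @detour_set A f n g t r (C * (8 * r)) fA fle hg tn hr.
rewrite hr in tmax tm.
move=> /(_ tmax ltac:(lia) ltac:(lia)) h.
have /h : forall a b K, A a -> A b -> d a b <= 8 * r ->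
    lipschitz_outside (g t) (r %/ 4) K -> (absz (K b - K a)%R <= C * (8 * r))%N.
  move=> _ _ K [i hi ->] [j hj ->]; rewrite hg' // => hij hK.
  apply: leq_trans (lipschitz_outside_path hK hg' _ hi hj) _; last by rewrite leq_mul.
  move=> k hk; have : f (g t) <= d (g t) (g' k) by apply: fle; exists k.
  by rewrite dC hr; lia.
rewrite -mulnDr -mulnDl => hq.
have /quadratic_bound : (r %/ 4) * (r %/ 4) <= (C * 15) * r by rewrite -mulnA.
by rewrite /k0; lia.
Qed.

Let k1 := 28 * (C * 783) + 3 + 2 * k0.

(** This is [detour_set] with [A] the union of the other two sides. The work lies in bounding,
    linearly in [r], the variation of a potential between nearby points of different sides. *)
Theorem potentials_thin : thin_triangles d k1.
Proof.
move=> x y z m hm.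
have [g [g0 gm gn hg]] := dpath_through dP dG hm; set n := d x y in gn hg.
have [g1 [g10 g1n hg1]] := dpath_ex dP dG x z; set n1 := d x z in g1n hg1.
have [g2 [g20 g2n hg2]] := dpath_ex dP dG z y; set n2 := d z y in g2n hg2.
pose A1 a := exists2 j, j <= n1 & a = g1 j.
pose A2 a := exists2 j, j <= n2 & a = g2 j.
pose A a := A1 a \/ A2 a.
have [|f [fA fle]] := @setdist_ex A; first by exists x; left; exists 0.
have [|t tn [tm tmax]] := @weighted_max (fun i => f (g i)) n (d x m).
  by move: hm; rewrite /between /n; lia.
have [r hr] : exists r, f (g t) = r by exists (f (g t)).
rewrite hr gm in tmax tm.
suff rk : r <= k1.
  have [a Aa e] := fA m; exists a; last by lia.
  case: Aa => -[j hj ->]; [left|right].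
    by rewrite -g10 -g1n; apply: (dpath_between hg1); lia.
  by rewrite -g20 -g2n; apply: (dpath_between hg2); lia.
have f0 : f (g 0) = 0.
  by have := fle (g 0) x; rewrite g0 dxx => /(_ ltac:(by left; exists 0)); lia.
have fn : f (g n) = 0.
  by have := fle (g n) y; rewrite gn dxx => /(_ ltac:(by right; exists n2)); lia.
have [r2|r2] := leqP r (2 * k0); first by rewrite /k1; lia.
have far a : A a -> r <= d a (g t) by move=> /(fle (g t)); rewrite dC hr.
have seg1 K : lipschitz_outside (g t) (r %/ 4) K -> forall i j, i <= n1 -> j <= n1 ->
    (absz (K (g1 j) - K (g1 i))%R <= C * d (g1 i) (g1 j))%N.
  move=> hK i j hi hj; rewrite hg1 //; apply: (lipschitz_outside_path hK hg1) => //.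
  by move=> k hk; have := far (g1 k) ltac:(by left; exists k); lia.
have seg2 K : lipschitz_outside (g t) (r %/ 4) K -> forall i j, i <= n2 -> j <= n2 ->
    (absz (K (g2 j) - K (g2 i))%R <= C * d (g2 i) (g2 j))%N.
  move=> hK i j hi hj; rewrite hg2 //; apply: (lipschitz_outside_path hK hg2) => //.
  by move=> k hk; have := far (g2 k) ltac:(by right; exists k); lia.
have hl : forall a b K, A a -> A b -> d a b <= 8 * r ->
    lipschitz_outside (g t) (r %/ 4) K -> (absz (K b - K a)%R <= C * (776 * r))%N.
  suff cross p q K : p <= n1 -> q <= n2 -> d (g1 p) (g2 q) <= 8 * r ->
      lipschitz_outside (g t) (r %/ 4) K ->
      (absz (K (g2 q) - K (g1 p))%R <= C * (776 * r))%N.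
    have le8 k : k <= 8 * r -> C * k <= C * (776 * r) by move=> hk; rewrite leq_mul //; lia.
    move=> a b K [[i hi ->]|[i hi ->]] [[j hj ->]|[j hj ->]] hd hK.
    - exact: leq_trans (seg1 K hK i j hi hj) (le8 _ hd).
    - exact: cross.
    - by rewrite dC in hd; have := cross j i K hj hi hd hK; lia.
    - exact: leq_trans (seg2 K hK i j hi hj) (le8 _ hd).
  (* Within [384 r] of [z] the path goes through [z]. Otherwise it follows the first side towards
     [z] for [192 r = 24 * (8 r)], where [quadrilateral] brings the sides within [k0 < r / 2] of
     each other, crosses over, and comes back along the second side. *)
  move=> hp hq hd hK; have [lt|ge] := ltnP (n1 - p) (384 * r).
    have e1 : d (g1 p) (g1 n1) = n1 - p.
      by rewrite hg1; lia.
    have e2 : d (g2 0) (g2 q) = q.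
      by rewrite hg2; lia.
    have := seg1 K hK p n1 hp (leqnn _); have := seg2 K hK 0 q (leq0n _) hq.
    have q3 : q <= n1 - p + 8 * r.
      by have := dT (g2 0) (g1 p) (g2 q); rewrite e2 g20 -g1n (dC (g1 n1)) e1; lia.
    have : C * (n1 - p + q) <= C * (776 * r).
      by rewrite leq_mul //; lia.
    by rewrite mulnDr e1 e2 g1n g20; lia.
  have [||||||j hj dj] := @quadrilateral (n1 - p) (fun i => g1 (n1 - i)) q g2 (8 * r)
     (n1 - p - 192 * r).
  - have := dpath_sub (dpath_rev hg1) (a := 0) (b := n1 - p); rewrite subn0; apply; lia.
  - have := dpath_sub hg2 (a := 0) (b := q); rewrite subn0; apply; lia.
  - by rewrite subn0 g1n g20 dxx.
  - by have -> : n1 - (n1 - p) = p by lia.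
  - lia.
  - lia.
  have e3 : n1 - (n1 - p - 192 * r) = p + 192 * r by lia.
  rewrite e3 in dj.
  have e4 : d (g1 p) (g1 (p + 192 * r)) = 192 * r.
    by rewrite hg1; lia.
  have := seg1 K hK p (p + 192 * r) hp ltac:(lia); rewrite e4.
  have := seg2 K hK j q ltac:(lia) hq.
  have := @lipschitz_outside_far _ _ _ (g1 (p + 192 * r)) (g2 j) hK.
  move=> /(_ ltac:(have := far (g1 (p + 192 * r)) ltac:(left; exists (p + 192 * r) => //; lia); lia)).
  have e5 : d (g2 j) (g2 q) <= k0 + 192 * r + 8 * r.
    have := dT (g2 j) (g1 (p + 192 * r)) (g2 q).
    have := dT (g1 (p + 192 * r)) (g1 p) (g2 q).
    by have := dC (g2 j) (g1 (p + 192 * r)); have := dC (g1 (p + 192 * r)) (g1 p); lia.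
  have h4 : C * (192 * r) + C * d (g1 (p + 192 * r)) (g2 j) + C * d (g2 j) (g2 q) <= C * (776 * r).
    by rewrite -(mulnDr C (192 * r)) -(mulnDr C (192 * r + _)) leq_mul2l; apply/orP; right; lia.
  move=> h2 h3 h1; exact: absz_chain h1 h2 h3 h4.
have := @detour_set A f n g t r _ fA fle hg tn hr tmax _ _ hl.
rewrite f0 fn => /(_ ltac:(lia) ltac:(lia)).
rewrite -mulnDr -mulnDl => hq.
have /quadratic_bound : (r %/ 4) * (r %/ 4) <= (C * 783) * r by rewrite -mulnA.
by rewrite /k1; lia.
Qed.
End AreaForms.

(** * Potentials on hyperbolic spaces *)

Section Walks.
Variables (V : Type) (d : V -> V -> nat) (H : V -> V -> int).

Fixpoint walk x p : Prop := if p is y :: q then d x y <= 1 /\ walk y q else True.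

Fixpoint walk_sum x p : int :=
  if p is y :: q then (H x y + walk_sum y q)%R else 0%R.

Lemma walk_cat x p q : walk x (p ++ q) <-> walk x p /\ walk (last x p) q.
Proof. by elim: p x => [|y p IH] x /=; [tauto|rewrite IH; tauto]. Qed.

Lemma walk_sum_cat x p q :
  walk_sum x (p ++ q) = (walk_sum x p + walk_sum (last x p) q)%R.
Proof. by elim: p x => [|y p IH] x /=; rewrite ?add0r // IH addrA. Qed.

Hypotheses (dP : pmetric d) (dG : dgeodesic d).
Let dxx x : d x x = 0. Proof. by case: dP. Qed.
Let dC x y : d x y = d y x. Proof. by case: dP. Qed.
Let dT x y z : d x z <= d x y + d y z. Proof. by case: dP. Qed.

Lemma walk_size x p : walk x p -> d x (last x p) <= size p.
Proof.
elim: p x => [|y p IH] x /=; first by rewrite dxx.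
by move=> [h /IH]; have := dT x y (last y p); lia.
Qed.

Lemma walk_ex x y : exists p, [/\ walk x p, last x p = y & size p = d x y].
Proof.
have [d0 dg] := dG.
move: {2}(d x y) (erefl (d x y)) => n; elim: n x => [|n IH] x hn.
  by exists [::]; rewrite hn; split=> //=; apply: d0.
have [|z [xz zy]] := dg x y 1; first by rewrite hn.
have [p [hp lp sp]] := IH z ltac:(lia).
by exists (z :: p); split=> //=; [rewrite xz|rewrite sp; lia].
Qed.

(** Otherwise the loop would be geodesic at scale [2 s]. If [c t] is a point of it farthest from
    [x], thinness of the triangle [c (t - s)], [c (t + s)], [x] would make [c t] closer to [x] than
    one of the other two vertices. *)
Lemma closed_walk_shortcut delta s x p : thin_triangles d delta -> 2 * delta < s ->
  walk x p -> last x p = x -> 2 * s <= size p ->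
  exists p1 p2 p3, [/\ p = p1 ++ p2 ++ p3, size p2 <= 2 * s &
    d (last x p1) (last x (p1 ++ p2)) < size p2].
Proof.
move=> th sd hp lp sp; apply: contrapT => nex.
set n := size p in sp; pose c i := last x (take i p).
have geo i k : i + k <= n -> k <= 2 * s -> d (c i) (c (i + k)) = k.
  move=> ik ks; have e : p = take i p ++ take k (drop i p) ++ drop k (drop i p).
    by rewrite !cat_take_drop.
  have sz : size (take k (drop i p)) = k.
    by rewrite size_take size_drop; case: ifP => //; rewrite -/n; lia.
  have cik : c (i + k) = last x (take i p ++ take k (drop i p)).
    by rewrite /c takeD.
  apply/eqP; rewrite eqn_leq; apply/andP; split.
    move: hp; rewrite e walk_cat => -[_]; rewrite walk_cat => -[/walk_size].
    by rewrite sz cik last_cat.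
  rewrite leqNgt; apply/negP => lt; apply: nex.
  by exists (take i p), (take k (drop i p)), (drop k (drop i p)); rewrite sz -cik.
have c0 : c 0 = x by rewrite /c take0.
have cn : c n = x by rewrite /c take_size.
have [t tn tmax] := argmax_nat (fun i => d x (c i)) n.
have ds : s <= d x (c t).
  by apply: leq_trans (tmax s _); [rewrite -{1}c0 -[s in c s]add0n geo; lia|lia].
have ts : s <= t.
  rewrite leqNgt; apply/negP => lt; move: ds.
  by rewrite -c0 -[t]add0n geo; lia.
have tns : t + s <= n.
  rewrite leqNgt; apply/negP => lt; move: ds.
  have e : t + (n - t) = n by lia.
  by rewrite -{1}cn dC -{1}e geo; lia.
have e1 : t - s + s = t by lia.
have e2 : t - s + 2 * s = t + s by lia.
have d1 := geo (t - s) s ltac:(lia) ltac:(lia); rewrite e1 in d1.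
have d2 := geo t s tns ltac:(lia).
have d3 := geo (t - s) (2 * s) ltac:(lia) ltac:(lia); rewrite e2 in d3.
have [|m [hm|hm] dm] := th (c (t - s)) (c (t + s)) x (c t); first by rewrite /between; lia.
- have := tmax (t - s) ltac:(lia); have := dT x m (c t); have := dT (c (t - s)) m (c t).
  have := dC m (c t); have := dC x m; have := dC x (c (t - s)).
  by move: hm; rewrite /between; lia.
- have := tmax (t + s) tns; have := dT x m (c t); have := dT (c t) m (c (t + s)).
  have := dC m (c t); by move: hm; rewrite /between; lia.
Qed.

Variables (delta M : nat).
Hypothesis th : thin_triangles d delta.
Hypothesis short_loops : forall x p, walk x p -> last x p = x ->
  size p <= 8 * delta + 4 -> absz (walk_sum x p) <= M.

(** A linear isoperimetric inequality: each shortcut removes at least one edge and costs two short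
    loops. *)
Lemma closed_walk_sum x p : walk x p -> last x p = x ->
  absz (walk_sum x p) <= 2 * M * size p.
Proof.
move: {2}(size p) (leqnn (size p)) => n; elim: n p => [|n IH] p hn hp lp.
  by case: p hn hp lp => //=.
have [le|gt] := leqP (size p) (8 * delta + 4).
  case: p hn hp lp le => // y p _ hp lp le; have := short_loops hp lp le.
  by rewrite /= mulnS; lia.
have [||p1 [p2 [p3 [e s2 sh]]]] := closed_walk_shortcut (s := 2 * delta + 1) th _ hp lp.
- lia.
- lia.
rewrite last_cat in sh; set y := last x p1 in sh; set z := last y p2 in sh.
move: hp lp hn gt; rewrite e !walk_cat !last_cat !size_cat -/y -/z => -[h1 [h2 h3]] lp hn gt.
have [q [hq lq sq]] := walk_ex y z; have [q' [hq' lq' sq']] := walk_ex z y.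
(* [H] is not assumed antisymmetric, so [p2] and its replacement [q] are compared through the loops
   that both form with a return path [q']. *)
have := short_loops (x := y) (p := p2 ++ q'); rewrite walk_cat last_cat size_cat -/z.
move=> /(_ (conj h2 hq') lq' ltac:(have := dC y z; lia)).
have := short_loops (x := y) (p := q ++ q'); rewrite walk_cat last_cat size_cat lq.
move=> /(_ (conj hq hq') lq' ltac:(have := dC y z; lia)).
have := IH (p1 ++ q ++ p3); rewrite !walk_cat !last_cat !size_cat -/y lq.
move=> /(_ ltac:(lia) (conj h1 (conj hq h3)) lp).
rewrite !walk_sum_cat -/y -/z lq => b1 b2 b3.
have : 2 * M * (size p1 + (size q + size p3) + 1) <= 2 * M * (size p1 + (size p2 + size p3)).
  by rewrite leq_mul //; lia.
rewrite mulnDr muln1; lia.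
Qed.

Lemma int_min (P : int -> Prop) (b : int) : (exists z, P z) ->
  (forall z, P z -> (b <= z)%R) -> exists2 z, P z & forall w, P w -> (z <= w)%R.
Proof.
move=> [z0 h0] hb.
have ex : exists n : nat, `[< P (b + n%:Z)%R >].
  exists (absz (z0 - b)%R); apply/asboolP.
  have -> : (b + (absz (z0 - b)%R)%:Z)%R = z0 by have := hb _ h0; lia.
  by [].
have [n /asboolP hn hmin] := ex_minnP ex.
exists (b + n%:Z)%R => // w hw; have bw := hb _ hw.
have := hmin (absz (w - b)%R) => /(_ _)/wrap[].
  apply/asboolP; have -> : (b + (absz (w - b)%R)%:Z)%R = w by lia.
  by [].
lia.
Qed.

(** [K v] is the least cost of a walk from [o] to [v], as for a distance in a weighted graph. The
    surcharge [2 * M] per edge makes the cost of closed walks nonnegative by [closed_walk_sum], so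
    costs are bounded below. *)
Theorem loops_potential : exists K : V -> int, forall x y, d x y <= 1 ->
  absz (K y - K x - H x y)%R <= 3 * M.
Proof.
have [[o]|no] := pselect (inhabited V); last first.
  by exists (fun=> 0%R) => x; exfalso; apply: no.
pose cost v z := exists p, [/\ walk o p, last o p = v &
  z = (walk_sum o p + (2 * M * size p)%N%:Z)%R].
have hK v : exists k, cost v k /\ forall z, cost v z -> (k <= z)%R.
  have [q [hq lq sq]] := walk_ex v o.
  have [||k hk hmin] := @int_min (cost v) (- walk_sum v q - (2 * M * size q)%N%:Z)%R.
  - have [p [hp lp _]] := walk_ex o v.
    by exists (walk_sum o p + (2 * M * size p)%N%:Z)%R, p.
  - move=> _ [p [hp lp ->]].
    have := @closed_walk_sum o (p ++ q); rewrite walk_cat last_cat lp => /(_ (conj hp hq) lq).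
    by rewrite walk_sum_cat lp size_cat mulnDr; lia.
  by exists k.
have [K hK'] := choice hK; exists K => x y xy.
have ext u v : d u v <= 1 -> (K v <= K u + H u v + (2 * M)%N%:Z)%R.
  move=> uv; have [[p [hp lp ->]] _] := hK' u; have [_ hmin] := hK' v.
  have /hmin : cost v (walk_sum o (rcons p v) + (2 * M * size (rcons p v))%N%:Z)%R.
    exists (rcons p v); split=> //; last by rewrite last_rcons.
    by rewrite -cats1 walk_cat /= lp.
  by rewrite size_rcons -cats1 walk_sum_cat /= lp mulnS; lia.
(* The two one-sided bounds involve [H x y] and [H y x]; the loop [x, y, x] shows that these are
   nearly opposite. *)
have := ext x y xy; have := ext y x; rewrite dC => /(_ xy).
have := @short_loops x [:: y; x]; rewrite /= (dC y x) => /(_ (conj xy (conj xy I)) erefl).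
lia.
Qed.
End Walks.

(** * Guessing geodesics *)

Section GraphMetric.
Variables (V : Type) (E : V -> V -> Prop).
Hypothesis E_sym : forall x y, E x y -> E y x.

Fixpoint reach n x y : Prop :=
  if n is m.+1 then exists z, (x = z \/ E x z) /\ reach m z y else x = y.

Lemma reach_cat n m x y z : reach n x y -> reach m y z -> reach (n + m) x z.
Proof.
elim: n x => [|n IH] x /=; first by move=> ->.
by move=> [t [xt hn]] hm; exists t; split=> //; apply: IH.
Qed.

Lemma reach_split n m x z : reach (n + m) x z -> exists2 y, reach n x y & reach m y z.
Proof.
elim: n x => [|n IH] x /=; first by exists x.
by move=> [t [xt /IH [y h1 h2]]]; exists y => //; exists t.
Qed.

Lemma reach_sym n x y : reach n x y -> reach n y x.
Proof.
elim: n x => [|n IH] x //= [z [xz /IH h]].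
have /(reach_cat h) : reach 1 z x.
  by exists x; split=> //; case: xz => [->|/E_sym]; [left|right].
by rewrite addn1.
Qed.

Hypothesis E_conn : forall x y, exists n, reach n x y.

Lemma reach_pred x y : exists n, `[< reach n x y >].
Proof. by have [n h] := E_conn x y; exists n; apply/asboolP. Qed.

Definition graph_dist x y : nat := ex_minn (reach_pred x y).

Lemma graph_distP x y : reach (graph_dist x y) x y.
Proof. by rewrite /graph_dist; case: ex_minnP => n /asboolP. Qed.

Lemma graph_dist_le n x y : reach n x y -> graph_dist x y <= n.
Proof.
by move=> h; rewrite /graph_dist; case: ex_minnP => m _; apply; apply/asboolP.
Qed.

Lemma graph_dist_pmetric : pmetric graph_dist.
Proof.
split=> [x|x y|x y z].
- by apply/eqP; rewrite -leqn0; apply: graph_dist_le.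
- by apply/eqP; rewrite eqn_leq; apply/andP; split; apply/graph_dist_le/reach_sym/graph_distP.
- apply: graph_dist_le; apply: reach_cat (graph_distP x y) (graph_distP y z).
Qed.

Lemma graph_dist_geodesic : dgeodesic graph_dist.
Proof.
split=> [x y h|x y k hk]; first by have := graph_distP x y; rewrite h.
have := graph_distP x y; rewrite -{1}(subnKC hk) => /reach_split [z h1 h2].
have := graph_dist_le h1; have := graph_dist_le h2; have [_ _ dT] := graph_dist_pmetric.
by have := dT x z y; exists z; lia.
Qed.

Lemma graph_dist_le1 x y : graph_dist x y <= 1 <-> x = y \/ E x y.
Proof.
split=> [h|h]; last first.
  by apply: graph_dist_le; exists y; split=> //.
have := graph_distP x y; case: (graph_dist x y) h => [_|[|//] _] /=; first by left.
by move=> [z [h <-]].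
Qed.
End GraphMetric.

Lemma exp_linear_bound a b : exists e0, forall e, 2 ^ e <= a * e + b -> e <= e0.
Proof.
exists (2 * (3 * a + b) + 1) => e h; pose q := e %/ 2.
have eq : 2 * q <= e <= 2 * q + 1 by rewrite /q; lia.
have q2 : q * q <= 2 ^ e.
  have : 2 ^ (q + q) <= 2 ^ e by rewrite leq_exp2l //; lia.
  by apply: leq_trans; rewrite expnD leq_mul // ltnW // ltn_expl.
have : q * q <= a * (2 * q + 1) + b.
  by apply: leq_trans (leq_trans q2 h) _; rewrite leq_add2r leq_mul //; lia.
have [q0|q0] := posnP q; first by lia.
move=> h'; suff : q <= 3 * a + b by lia.
rewrite -(leq_pmul2r q0); apply: leq_trans h' _.
have := leq_mul (leqnn a) q0; have := leq_mul (leqnn b) q0.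
by rewrite !mulnDl !mulnDr !muln1; lia.
Qed.

(** The second condition makes [e] at most logarithmic in [r], and a logarithm is beaten by [r]. *)
Lemma log_bound A B D E : exists k, forall r e, r <= D * e + E ->
  (e = 0 \/ 2 ^ e.-1 <= A * r + B) -> r <= k.
Proof.
have [e0 he0] := exp_linear_bound (A * D) (A * (D + E) + B).
exists (D * e0.+1 + E) => r e hr he; apply: (leq_trans hr).
rewrite leq_add2r leq_mul //; case: he => [->//|h].
case: e h hr => //= e h hr; rewrite ltnS; apply: he0; apply: leq_trans h _.
have := leq_mul (leqnn A) hr; rewrite !mulnDr mulnS mulnDr -!mulnA; lia.
Qed.

Section GuessingGeodesics.
Variables (V : Type) (d : V -> V -> nat).
Hypotheses (dP : pmetric d) (dG : dgeodesic d).
Let dxx x : d x x = 0. Proof. by case: dP. Qed.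
Let dC x y : d x y = d y x. Proof. by case: dP. Qed.
Let dT x y z : d x z <= d x y + d y z. Proof. by case: dP. Qed.

Definition quasi_path k N (a : nat -> V) : Prop :=
  (forall i, i < N -> d (a i) (a i.+1) <= k) /\
  forall i j, i <= N -> j <= N -> i - j <= k * d (a i) (a j) + k.

Fixpoint chain_in (S : V -> Prop) k n x y : Prop :=
  S x /\ (if n is m.+1 then exists z, d x z <= k /\ chain_in S k m z y else x = y).

Lemma chain_in_l S k n x y : chain_in S k n x y -> S x.
Proof. by case: n => [|n] []. Qed.

Lemma chain_in_cat S k n m x y z :
  chain_in S k n x y -> chain_in S k m y z -> chain_in S k (n + m) x z.
Proof.
elim: n x => [|n IH] x /=; first by move=> [_ ->].
by move=> [Sx [t [xt h]]] hm; split=> //; exists t; split=> //; apply: IH.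
Qed.

Lemma chain_in_split S k n m x z : chain_in S k (n + m) x z ->
  exists2 y, chain_in S k n x y & chain_in S k m y z.
Proof.
elim: n x => [|n IH] x /=; first by exists x => //; split=> //; apply: chain_in_l H.
move=> [Sx [t [xt /IH [y h1 h2]]]]; exists y => //; split=> //; by exists t.
Qed.

Lemma chain_in_sym S k n x y : chain_in S k n x y -> chain_in S k n y x.
Proof.
elim: n x => [|n IH] x /=; first by move=> [Sx e]; rewrite -e.
move=> [Sx [z [xz h]]].
have : chain_in S k (n + 1) y x.
  apply: chain_in_cat (IH _ h) _.
  by split; [exact: chain_in_l h|exists x; rewrite dC].
by rewrite addn1.
Qed.

Lemma chain_in_path S k g i j : i <= j ->
  (forall l, i <= l < j -> d (g l) (g l.+1) <= k) ->
  (forall l, i <= l <= j -> S (g l)) -> chain_in S k (j - i) (g i) (g j).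
Proof.
move=> ij hd hS; move: {2}(j - i) (erefl (j - i)) => n.
elim: n i ij hd hS => [|n IH] i ij hd hS e; rewrite e /=.
  split; first by apply: hS; lia.
  by have -> : i = j by lia.
split; first by apply: hS; lia.
exists (g i.+1); split; first by apply: hd; lia.
have <- : j - i.+1 = n by lia.
by apply: IH; try lia; move=> l hl; [apply: hd|apply: hS]; lia.
Qed.

Variables (L : nat -> (nat -> V) -> Prop) (D k Dk : nat).
Hypothesis L_sub : forall n g a b, L n g -> a <= b <= n -> L (b - a) (fun i => g (a + i)).
Hypothesis L_ex : forall x y, exists n g, [/\ L n g, g 0 = x & g n = y].
Hypothesis L_step : forall n g i, L n g -> i < n -> d (g i) (g i.+1) <= D.
Hypothesis L_thin : forall n g n1 g1 n2 g2, L n g -> L n1 g1 -> L n2 g2 ->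
  g 0 = g1 0 -> g1 n1 = g2 0 -> g2 n2 = g n -> forall i, i <= n ->
  (exists2 j, j <= n1 & d (g i) (g1 j) <= D) \/
  (exists2 j, j <= n2 & d (g i) (g2 j) <= D).
Hypothesis L_short : forall n g, L n g -> d (g 0) (g n) <= k ->
  forall i, i <= n -> d (g 0) (g i) <= Dk.

(** Bisection: each of the [e] halvings passes to a candidate path over one half of the chain and
    costs [D] by thinness. *)
Lemma log_chain S n x y e m g : chain_in S k n x y -> n <= 2 ^ e -> L m g ->
  g 0 = x -> g m = y -> forall i, i <= m ->
  exists2 s, S s & d (g i) s <= D * e + Dk.
Proof.
elim: e n x y m g => [|e IH] n x y m g hc hn hL g0 gm i hi.
  exists x; first exact: chain_in_l hc.
  rewrite dC -g0; apply: leq_trans (L_short hL _ hi) _; last lia.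
  rewrite g0 gm; case: n hc hn => [[_ ->]|[|//]]; first by rewrite dxx.
  by move=> [_ [z [xz [_ <-]]]].
have e1 : minn n (2 ^ e) + (n - 2 ^ e) = n by lia.
move: hc; rewrite -e1 => /chain_in_split [z h1 h2].
rewrite expnS in hn.
have [n1 [g1 [L1 g10 g1n]]] := L_ex x z; have [n2 [g2 [L2 g20 g2n]]] := L_ex z y.
have := L_thin hL L1 L2; rewrite g10 g1n g20 g2n => /(_ g0 erefl (esym gm) i hi).
move=> [[j hj dj]|[j hj dj]].
- have [|s Ss ds] := IH _ _ _ _ _ h1 _ L1 g10 g1n j hj; first lia.
  by exists s => //; have := dT (g i) (g1 j) s; rewrite mulnS; lia.
- have [|s Ss ds] := IH _ _ _ _ _ h2 _ L2 g20 g2n j hj; first lia.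
  by exists s => //; have := dT (g i) (g2 j) s; rewrite mulnS; lia.
Qed.

Lemma first_far g n (x : V) r : (forall i, i < n -> d (g i) (g i.+1) <= D) -> g 0 = x ->
  exists i, [/\ i <= n, d x (g i) <= 2 * r + D & 2 * r <= d x (g i) \/ i = n].
Proof.
move=> hs g0; elim: n hs => [|n IH] hs; first by exists 0; rewrite g0 dxx; split=> //; right.
have [|i [hi h1 [h2|h2]]] := IH; first by move=> i hi; apply: hs; lia.
  by exists i; split=> //; [lia|left].
have [le|gt] := leqP (2 * r) (d x (g n)).
  by exists n; rewrite -h2 in le *; split; [lia|lia|left].
exists n.+1; split=> //; last by right.
by have := dT x (g n) (g n.+1); have := hs n (leqnn _); lia.
Qed.

Variable K : nat.
Hypothesis K_log : forall r e, r <= D * e + Dk ->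
  (e = 0 \/ 2 ^ e.-1 <= (6 * k + 2) * r + (k * (2 * D) + k)) -> r <= K.
Hypothesis k_gt0 : 0 < k.

Lemma guessing_near_log n g N a : L n g ->
  quasi_path k N a -> g 0 = a 0 -> g n = a N ->
  (forall i, i <= n -> exists2 j, j <= N & d (g i) (a j) <= K) /\
  (forall j, j <= N -> exists2 i, i <= n &
     d (a j) (g i) <= K + k * (k * (2 * K + D) + k)).
Proof.
move=> hL [astep aqi] g0 gn.
(* The converse inclusion follows: by [crossing] some point of [g] is near a point of [a] before [m]
   and, up to one step, near one after it, and the parameters of these two points are then close
   together. *)
suff C1 : forall i, i <= n -> exists2 j, j <= N & d (g i) (a j) <= K.
  split=> // m hm.
  pose P i := exists2 l, l <= m & d (g i) (a l) <= K.
  pose Q i := exists2 l, m <= l <= N & d (g i) (a l) <= K.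
  have [||i hi|i hi [[l hl dl] hQ]] := @crossing P Q n.
  - by exists 0; rewrite ?g0 ?dxx.
  - by exists N; rewrite ?gn ?dxx //; lia.
  - by have [j hj dj] := C1 i hi; have [jm|mj] := leqP j m; [left|right]; exists j => //; lia.
  have [r hr dr] : exists2 r, m <= r <= N & d (g i) (a r) <= K + D.
    case: hQ => [[r hr dr]|[hi' [r hr dr]]]; exists r => //; first lia.
    by have := dT (g i) (g i.+1) (a r); have := L_step hL hi'; lia.
  have lr : r - l <= k * (2 * K + D) + k.
    have rN : r <= N by lia.
    have lN : l <= N by lia.
    apply: leq_trans (aqi r l rN lN) _; rewrite leq_add2r leq_mul //.
    by have := dT (a r) (g i) (a l); have := dC (a r) (g i); lia.
  exists i => //; have := @step_path _ d dP m a k.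
  move=> /(_ (fun i hi => astep i (leq_trans hi hm)) l m ltac:(lia)) am.
  have : (m - l) * k <= k * (k * (2 * K + D) + k) by rewrite mulnC leq_mul //; lia.
  have := dT (a m) (a l) (g i); have := dC (a m) (a l); have := dC (a l) (g i).
  by lia.
have fex i : exists m, (exists2 j, j <= N & d (g i) (a j) = m) /\
    forall j, j <= N -> m <= d (g i) (a j).
  have ex : exists m, `[< exists2 j, j <= N & d (g i) (a j) = m >].
    by exists (d (g i) (a 0)); apply/asboolP; exists 0.
  exists (ex_minn ex); case: ex_minnP => m /asboolP hm hmin; split=> // j hj.
  by apply: hmin; apply/asboolP; exists j.
have [f hf] := choice fex.
have [t tn tmax] := argmax_nat f n.
suff ft : f t <= K.
  move=> i hi; have [[j hj dj] _] := hf i; exists j => //.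
  by have := tmax i hi; lia.
set r := f t in tmax *.
have far j : j <= N -> r <= d (g t) (a j) by case: (hf t) => _; apply.
pose S z := r <= d (g t) z.
(* Both directions are treated at once: [h] is [g] read from [t] towards one of its ends, which lies
   on [a]. *)
have side (h : nat -> V) (m : nat) : m <= n -> h 0 = g t ->
    (forall i, i < m -> d (h i) (h i.+1) <= D) ->
    (forall i, i <= m -> exists2 i', i' <= n & h i = g i') ->
    (exists2 l, l <= N & h m = a l) -> exists i l, [/\ i <= m, l <= N,
      d (g t) (h i) <= 2 * r + D &
      d (h i) (a l) <= r /\ exists2 q, q <= r & chain_in S k q (h i) (a l)].
  move=> mn h0 hs hh [l hl hm].
  have [i [hi d1 d2]] := first_far (x := g t) r hs h0.
  case: d2 => [d2|e]; last first.
    exists i, l; split=> //; rewrite e hm dxx; split=> //; exists 0 => //.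
    by split=> //; apply: far.
  have [i' hi' e] := hh i hi; have [[l' hl' dl] _] := hf i'.
  have le := tmax i' hi'.
  have dle : d (h i) (a l') <= r by rewrite e dl.
  exists i, l'; split=> //; split=> //; exists (d (h i) (a l')) => //.
  have [p [p0 pn hp]] := dpath_ex dP dG (h i) (a l').
  have := @chain_in_path S k p 0 (d (h i) (a l')); rewrite subn0 p0 pn; apply=> //.
    by move=> q hq; rewrite hp; lia.
  move=> q hq; have e' : d (p q) (h i) = q.
    by rewrite -p0 hp; lia.
  by rewrite /S; have := dT (g t) (p q) (h i); lia.
have [i1 [l1 [hi1 hl1 d1 [e1 [q1 hq1 c1]]]]] := side (fun i => g (t - i)) t tn
  (f_equal g (subn0 t)) ltac:(by move=> i hi; rewrite dC; have := L_step hL (i := t - i.+1) ltac:(lia); have -> : (t - i.+1).+1 = t - i by lia)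
  ltac:(by move=> i hi; exists (t - i) => //; lia) ltac:(by exists 0 => //; rewrite subnn).
have [i2 [l2 [hi2 hl2 d2 [e2 [q2 hq2 c2]]]]] := side (fun i => g (t + i)) (n - t) (leq_subr _ _)
  (f_equal g (addn0 t)) ltac:(by move=> i hi; have := L_step hL (i := t + i) ltac:(lia); rewrite addnS)
  ltac:(by move=> i hi; exists (t + i) => //; lia) ltac:(by exists N => //; rewrite subnKC).
have dl : d (a l1) (a l2) <= 6 * r + 2 * D.
  have := dT (a l1) (g (t - i1)) (a l2); have := dT (g (t - i1)) (g t) (a l2).
  have := dT (g t) (g (t + i2)) (a l2); have := dC (a l1) (g (t - i1)).
  by have := dC (g t) (g (t - i1)); lia.
have [q3 hq3 c3] : exists2 q, q <= k * (6 * r + 2 * D) + k & chain_in S k q (a l1) (a l2).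
  have mono l l' : l <= l' -> l' <= N -> d (a l) (a l') <= 6 * r + 2 * D ->
      exists2 q, q <= k * (6 * r + 2 * D) + k & chain_in S k q (a l) (a l').
    move=> ll hl' hd; exists (l' - l).
      apply: leq_trans (aqi l' l hl' ltac:(lia)) _.
      by rewrite leq_add2r leq_mul // dC.
    apply: chain_in_path => // p hp; first by apply: astep; lia.
    by apply: far; lia.
  have [le|gt] := leqP l1 l2; first exact: mono.
  have [|q hq hc] := mono l2 l1 (ltnW gt) hl1; first by rewrite dC.
  by exists q => //; apply: chain_in_sym.
have c := chain_in_cat (chain_in_cat c1 c3) (chain_in_sym c2).
have hLs : L (t + i2 - (t - i1)) (fun i => g (t - i1 + i)).
  apply: L_sub hL _; lia.
set m := q1 + q3 + q2 in c.
have m_le : m <= (6 * k + 2) * r + (k * (2 * D) + k).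
  by rewrite /m; move: hq3; rewrite mulnDr mulnDl -mulnA (mulnCA k 6); lia.
have [e [he1 he2]] : exists e, m <= 2 ^ e /\ (e = 0 \/ 2 ^ e.-1 <= m).
  have ex : exists e, m <= 2 ^ e by exists m; rewrite ltnW // ltn_expl.
  exists (ex_minn ex); case: ex_minnP => e he hmin; split=> //.
  case: e he hmin => [|e] he hmin; [by left|right => /=].
  by rewrite leqNgt; apply/negP => lt; have := hmin e (ltnW lt); lia.
have := log_chain c he1 hLs; rewrite addn0.
have -> : t - i1 + (t + i2 - (t - i1)) = t + i2 by lia.
move=> /(_ erefl erefl i1 ltac:(lia)); rewrite subnK // => -[s Ss ds].
apply: (K_log (e := e)); first exact: leq_trans Ss ds.
by case: he2 => [->|he2]; [left|right; lia].
Qed.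
End GuessingGeodesics.

(** [L] is a family of candidates for geodesics: below, geodesics of [d] itself, geodesics of a
    finer metric, or sampled geodesics of a continuous space. The bound depends on the numerical
    data only. *)
Theorem guessing_near D k Dk : 0 < k -> exists K,
  forall (V : Type) (d : V -> V -> nat) (L : nat -> (nat -> V) -> Prop),
  pmetric d -> dgeodesic d ->
  (forall n g a b, L n g -> a <= b <= n -> L (b - a) (fun i => g (a + i))) ->
  (forall x y, exists n g, [/\ L n g, g 0 = x & g n = y]) ->
  (forall n g i, L n g -> i < n -> d (g i) (g i.+1) <= D) ->
  (forall n g n1 g1 n2 g2, L n g -> L n1 g1 -> L n2 g2 ->
    g 0 = g1 0 -> g1 n1 = g2 0 -> g2 n2 = g n -> forall i, i <= n ->
    (exists2 j, j <= n1 & d (g i) (g1 j) <= D) \/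
    (exists2 j, j <= n2 & d (g i) (g2 j) <= D)) ->
  (forall n g, L n g -> d (g 0) (g n) <= k ->
    forall i, i <= n -> d (g 0) (g i) <= Dk) ->
  forall n g N a, L n g -> quasi_path d k N a -> g 0 = a 0 -> g n = a N ->
  (forall i, i <= n -> exists2 j, j <= N & d (g i) (a j) <= K) /\
  (forall j, j <= N -> exists2 i, i <= n & d (a j) (g i) <= K).
Proof.
move=> k_gt0; have [K hK] := log_bound (6 * k + 2) (k * (2 * D) + k) D Dk.
exists (K + k * (k * (2 * K + D) + k)) => V d L dP dG h1 h2 h3 h4 h5 n g N a hL ha g0 gn.
have [c1 c2] := guessing_near_log dP dG h1 h2 h3 h4 h5 hK k_gt0 hL ha g0 gn.
by split=> // i hi; have [j hj dj] := c1 i hi; exists j => //; lia.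
Qed.

(** * Coned-off spaces *)

Section Polygons.
Variables (V : Type) (d : V -> V -> nat) (I : Type) (Z : I -> V -> Prop).
Variable K : I -> V -> int.
Hypotheses (dP : pmetric d) (dG : dgeodesic d).
Let dxx x : d x x = 0. Proof. by case: dP. Qed.
Let dC x y : d x y = d y x. Proof. by case: dP. Qed.
Let dT x y z : d x z <= d x y + d y z. Proof. by case: dP. Qed.

Definition quasiconvex_labels q : Prop := forall E x y m, Z E x -> Z E y ->
  between d x y m -> exists2 m', Z E m' & d m m' <= q.

Definition compatible s c : Prop := forall E E' x y x' y', Z E x -> Z E y ->
  Z E' x' -> Z E' y' -> d x x' <= s -> d y y' <= s ->
  absz (K E y - K E x - (K E' y' - K E' x'))%R <= c.

(* The triple [(E, p, q)] is a side from [p] to [q] inside [Z E]; consecutive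
   sides are joined by jumps of length at most [s]. *)
Fixpoint linked s x (l : seq (I * V * V)) : Prop :=
  if l is (E, p, q) :: l' then [/\ d x p <= s, Z E p, Z E q & linked s q l'] else True.

Fixpoint side_end x (l : seq (I * V * V)) : V :=
  if l is (_, _, q) :: l' then side_end q l' else x.

Fixpoint side_sum (l : seq (I * V * V)) : int :=
  if l is (E, p, q) :: l' then (K E q - K E p + side_sum l')%R else 0%R.

Lemma linked_cat s x l1 l2 : linked s x (l1 ++ l2) =
  (linked s x l1 /\ linked s (side_end x l1) l2).
Proof.
apply/propext; elim: l1 x => [|[[E p] q] l IH] x /=; first tauto.
by split=> [[h1 h2 h3 /IH[h4 h5]]|[[h1 h2 h3 h4] h5]]; split=> //; apply/IH.
Qed.

Lemma side_end_cat x l1 l2 : side_end x (l1 ++ l2) = side_end (side_end x l1) l2.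
Proof. by elim: l1 x => [|[[E p] q] l IH] x //=. Qed.

Lemma side_sum_cat l1 l2 : side_sum (l1 ++ l2) = (side_sum l1 + side_sum l2)%R.
Proof. by elim: l1 => [|[[E p] q] l IH] /=; rewrite ?add0r // IH addrA. Qed.

Lemma linked_mono s s' x l : s <= s' -> linked s x l -> linked s' x l.
Proof.
move=> ss; elim: l x => [|[[E p] q] l IH] x //= [h1 h2 h3 /IH h4].
by split=> //; lia.
Qed.

Variables (delta q : nat).
Hypothesis th : thin_triangles d delta.
Hypothesis qc : quasiconvex_labels q.

Lemma linked_near s a l u : l <> [::] -> linked s a l ->
  between d a (side_end a l) u ->
  exists l1 E p p' l2 w, [/\ l = l1 ++ (E, p, p') :: l2, Z E w &
    d u w <= delta * (size l).+1 + s + q].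
Proof.
elim: l a u => [//|[[E p] p'] l IH] a u _ /= [ap Zp Zp' hl] hu.
have [m [hm|hm] dm] := th p' hu.
  have [m2 [hm2|hm2] dm2] := th p hm.
    exists [::], E, p, p', l, p; split=> //.
    have := dT u m p; have := dT m m2 p; move: hm2; rewrite /between; lia.
  have [w Zw dw] := qc Zp Zp' hm2.
  exists [::], E, p, p', l, w; split=> //.
  by have := dT u m w; have := dT m m2 w; lia.
case: l IH hl hu hm => [|s0 l] IH hl hu hm.
  exists [::], E, p, p', [::], p'; split=> //.
  have := dT u m p'; have := dC m p'; move: hm; rewrite /between /= dxx; lia.
have [|l1 [F [r [r' [l2 [w [e Zw dw]]]]]]] := IH p' m _ hl hm; first by [].
exists ((E, p, p') :: l1), F, r, r', l2, w; rewrite e; split=> //.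
have := dT u m w; move: dw; rewrite e /= !mulnS; lia.
Qed.

Lemma polygon_near s p p' l u : l <> [::] -> linked s p' l ->
  d (side_end p' l) p <= s -> between d p p' u ->
  exists l1 F r r' l2 w, [/\ l = l1 ++ (F, r, r') :: l2, Z F w &
    d u w <= delta * (size l).+2 + s + q].
Proof.
move=> hl lk cl hu; have [m [hm|hm] dm] := th (side_end p' l) hu.
  case/lastP: l hl lk cl hm => [//|l [[F r] r']] _.
  rewrite -cats1 linked_cat side_end_cat /= => -[_ [_ _ Zr' _]] cl hm.
  exists l, F, r, r', [::], r'; split=> //.
  have := dT u m r'; have := dC p r'; move: hm; rewrite /between !mulnS; lia.
have [|l1 [F [r [r' [l2 [w [e Zw dw]]]]]]] := linked_near hl lk (u := m).
  by apply: (between_sym dP).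
exists l1, F, r, r', l2, w; split=> //.
by have := dT u m w; rewrite (mulnS _ (size l).+1); lia.
Qed.
End Polygons.

(** Induction on the number of sides. Each point of the first side is near another side; cutting
    there yields polygons with fewer sides but longer jumps, so [S] is taken large enough for the
    jumps of the whole recursion. *)
Lemma polygon_sum delta q r s : exists S N,
  forall (V : Type) (d : V -> V -> nat) (I : Type) (Z : I -> V -> Prop)
    (K : I -> V -> int) c,
  pmetric d -> dgeodesic d -> thin_triangles d delta -> quasiconvex_labels d Z q ->
  compatible d Z K S c ->
  forall x l, size l <= r -> linked d Z s x l -> side_end x l = x ->
  absz (side_sum K l) <= N * c.
Proof.
elim: r s => [|r IH] s.
  by exists 0, 0 => V d I Z K c _ _ _ _ _ x [|//].
pose kap := delta * r.+3 + s + q; pose s' := 2 * (kap + q + 1) + s.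
have [S [N hS]] := IH s'.
exists (S + s), (3 * N + 1) => V d I Z K c dP dG th qc comp x l sl lk cl.
have dxx z : d z z = 0 by case: dP.
have dC z y : d z y = d y z by case: dP.
have dT z y w : d z w <= d z y + d y w by case: dP.
have comp' : compatible d Z K S c.
  by move=> E E' a b a' b' h1 h2 h3 h4 h5 h6; apply: comp => //; lia.
have {}IH := hS V d I Z K c dP dG th qc comp'.
have ss : s <= s' by rewrite /s'; lia.
case: l sl lk cl => [|[[E p] p'] l] sl /=; first by [].
move=> [xp Zp Zp' lk] cl.
have clp : d (side_end p' l) p <= s by rewrite cl.
case: l sl lk cl clp => [|[[E2 p2] p2'] l] sl lk cl clp.
  have := comp E E p p' p p Zp Zp' Zp Zp; rewrite dxx /= in cl clp *.
  by move=> /(_ ltac:(lia) ltac:(lia)); lia.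
case/lastP: l sl lk cl clp => [|l [[Er pr] pr']] sl lk cl clp.
  move: lk => /= [h1 h2 h3 _]; rewrite /= in cl clp.
  have := comp E E2 p p' p2' p2 Zp Zp' h3 h2; rewrite (dC p).
  by move=> /(_ ltac:(lia) ltac:(lia)); lia.
set L := (E2, p2, p2') :: rcons l (Er, pr, pr') in sl lk cl clp *.
have szL : size L = (size l).+2 by rewrite /= size_rcons.
have sz : (size l).+3 <= r.+1 by rewrite -szL.
have lk2 : [/\ d p' p2 <= s, Z E2 p2, Z E2 p2', linked d Z s p2' l &
    d (side_end p2' l) pr <= s /\ Z Er pr /\ Z Er pr'].
  by move: lk; rewrite /L /= -cats1 linked_cat /= => -[h1 h2 h3 [h4 [h5 h6 h7 _]]].
have [j2 Z2 Z2' lkl [jr [Zr Zr']]] := lk2.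
have endr : side_end p' L = pr' by rewrite /L /= -cats1 side_end_cat.
rewrite endr in clp.
have [g [g0 gn hg]] := dpath_ex dP dG p p'; set n := d p p' in gn hg.
have side i : i <= n -> between d p p' (g i).
  by move=> hi; rewrite -g0 -gn; apply: (dpath_between hg); lia.
pose P i := exists2 w, Z Er w & d (g i) w <= kap.
pose Q i := exists2 w, Z E2 w & d (g i) w <= kap.
pose M i := exists l1 F a a' l2 w, [/\ l = l1 ++ (F, a, a') :: l2, Z F w & d (g i) w <= kap].
have near i : i <= n -> P i \/ Q i \/ M i.
  move=> hi; have [||l1 [F [a [a' [l2 [w [e Zw dw]]]]]]] :=
    polygon_near dP th qc _ lk _ (side i hi); [by []|by rewrite endr|].
  have {}dw : d (g i) w <= kap.
    apply: leq_trans dw _; rewrite /kap !leq_add2r leq_mul //; lia.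
  case: l1 e => [|s1 l1]; first by case=> e1 e2 e3 e4; right; left; exists w; rewrite ?e1.
  case/lastP: l2 => [|l2 s2]; rewrite /L /=.
    by rewrite cats1 => -[_ e']; have [_ e _ _] := rcons_inj e'; left; exists w; rewrite ?e.
  rewrite -(rcons_cons (F, a, a')) -rcons_cat => -[_ e']; have [e _] := rcons_inj e'.
  by right; right; exists l1, F, a, a', l2, w.
have sumR : side_sum K (rcons l (Er, pr, pr')) =
    (side_sum K l + (K Er pr' - K Er pr))%R.
  by rewrite -cats1 side_sum_cat /= addr0.
(* A point of the first side near a side other than its two neighbours cuts the polygon in two. *)
have [[i [hi [l1 [F [a [a' [l2 [w [e Zw dw]]]]]]]]]|nM] := pselect (exists i, i <= n /\ M i).
  have [u Zu du] := qc _ _ _ _ Zp Zp' (side i hi).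
  have uw : d u w <= kap + q by have := dT u (g i) w; have := dC u (g i); lia.
  have [lk1 [ja Za Za' lk3]] : linked d Z s p2' l1 /\
      [/\ d (side_end p2' l1) a <= s, Z F a, Z F a' & linked d Z s a' l2].
    by move: lkl; rewrite e linked_cat.
  have := IH w ((E, u, p') :: (E2, p2, p2') :: l1 ++ [:: (F, a, w)]).
  rewrite /= linked_cat /= !side_end_cat /= side_sum_cat /= addr0.
  have e2 : d w u <= s' by rewrite dC /s'; lia.
  rewrite size_cat /= => /(_ ltac:(move: sz; rewrite e size_cat /=; lia)).
  have lk1' := linked_mono ss lk1.
  have t2 : [/\ d w u <= s', Z E u, Z E p' & [/\ d p' p2 <= s', Z E2 p2, Z E2 p2' &
     linked d Z s' p2' l1 /\ [/\ d (side_end p2' l1) a <= s', Z F a, Z F w & True]]].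
    by repeat split=> //; lia.
  move=> /(_ t2 erefl) b1.
  have := IH pr' ((E, p, u) :: (F, w, a') :: l2 ++ [:: (Er, pr, pr')]).
  rewrite /= linked_cat /= !side_end_cat /= side_sum_cat /= addr0.
  rewrite size_cat /= => /(_ ltac:(move: sz; rewrite e size_cat /=; lia)).
  have jr' : d (side_end a' l2) pr <= s by move: jr; rewrite e side_end_cat.
  have lk3' := linked_mono ss lk3.
  have t3 : [/\ d pr' p <= s', Z E p, Z E u & [/\ d u w <= s', Z F w, Z F a' &
     linked d Z s' a' l2 /\ [/\ d (side_end a' l2) pr <= s', Z Er pr, Z Er pr' & True]]].
    by repeat split=> //; rewrite /s'; lia.
  move=> /(_ t3 erefl) b2.
  rewrite /= sumR e side_sum_cat /= mulnDl mul1n -mulnA; set Nc := N * c in b1 b2 *; lia.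
(* Otherwise some point of the first side is near both neighbours; cutting off two bigons there
   leaves a polygon without the first side. *)
have [||i hi|i hi [[wr Zwr dwr] hQ]] := @crossing P Q n.
- by exists pr' => //; rewrite g0 dC /kap; lia.
- by exists p2 => //; rewrite gn /kap; lia.
- by have [|[|h]] := near i hi; [left|right|case: nM; exists i].
have [w2 Zw2 dw2] : exists2 w, Z E2 w & d (g i) w <= kap + 1.
  case: hQ => [[w Zw dw]|[hi' [w Zw dw]]]; exists w => //; first lia.
  by have := dT (g i) (g i.+1) w; rewrite hg; lia.
have [u Zu du] := qc _ _ _ _ Zp Zp' (side i hi).
have uw2 : d u w2 <= kap + 1 + q by have := dT u (g i) w2; have := dC u (g i); lia.
have uwr : d u wr <= kap + 1 + q by have := dT u (g i) wr; have := dC u (g i); lia.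
have w2r : d wr w2 <= s'.
  by have := dT wr (g i) w2; have := dC wr (g i); rewrite /s'; lia.
have := IH w2 [:: (E, u, p'); (E2, p2, w2)].
rewrite /= addr0 => /(_ ltac:(lia)).
have t1 : [/\ d w2 u <= s', Z E u, Z E p' & [/\ d p' p2 <= s', Z E2 p2, Z E2 w2 & True]].
  by repeat split=> //; rewrite ?(dC w2) /s'; lia.
move=> /(_ t1 erefl) b1.
have := IH pr' [:: (E, p, u); (Er, wr, pr')].
rewrite /= addr0 => /(_ ltac:(lia)).
have t2 : [/\ d pr' p <= s', Z E p, Z E u & [/\ d u wr <= s', Z Er wr, Z Er pr' & True]].
  by repeat split=> //; rewrite /s'; lia.
move=> /(_ t2 erefl) b2.
have := IH wr ((E2, w2, p2') :: l ++ [:: (Er, pr, wr)]).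
rewrite /= linked_cat /= !side_end_cat /= side_sum_cat /= addr0 size_cat /=.
move=> /(_ ltac:(lia)).
have lkl' := linked_mono ss lkl.
have t3 : [/\ d wr w2 <= s', Z E2 w2, Z E2 p2' & linked d Z s' p2' l /\
    [/\ d (side_end p2' l) pr <= s', Z Er pr, Z Er wr & True]].
  by repeat split=> //; lia.
move=> /(_ t3 erefl) b3.
rewrite /L /= sumR mulnDl mul1n -mulnA; set Nc := N * c in b1 b2 b3 *; lia.
Qed.

Section ConedOff.
Variables (V : Type) (d : V -> V -> nat) (I : Type) (Z : I -> V -> Prop).
Hypotheses (dP : pmetric d) (dG : dgeodesic d).
Hypothesis cover : forall x y, d x y <= 1 -> exists E, Z E x /\ Z E y.
Let dxx x : d x x = 0. Proof. by case: dP. Qed.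

Definition share x y : Prop := exists E, Z E x /\ Z E y.

Lemma share_sym x y : share x y -> share y x.
Proof. by move=> [E [h1 h2]]; exists E. Qed.

Lemma share_reach x y : reach share (d x y) x y.
Proof.
have [d0 dg] := dG.
move: {2}(d x y) (erefl (d x y)) => n; elim: n x => [|n IH] x hn.
  by rewrite hn /=; apply: d0.
have [|z [xz zy]] := dg x y 1; first by rewrite hn.
have := IH z ltac:(lia); have -> : d z y = n by lia.
by rewrite hn => h /=; exists z; split=> //; right; apply: cover; rewrite xz.
Qed.

Lemma share_conn x y : exists n, reach share n x y.
Proof. by exists (d x y); apply: share_reach. Qed.

Definition coned := graph_dist share_conn.

Lemma coned_le x y : coned x y <= d x y.
Proof. exact/graph_dist_le/share_reach. Qed.

Lemma coned_pmetric : pmetric coned.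
Proof. exact/graph_dist_pmetric/share_sym. Qed.

Lemma coned_geodesic : dgeodesic coned.
Proof. exact/graph_dist_geodesic/share_sym. Qed.

Lemma coned_le1 x y : coned x y <= 1 <-> share x y.
Proof.
rewrite graph_dist_le1; split=> [[->|//]|]; last by right.
by apply: cover; rewrite dxx.
Qed.
End ConedOff.

(** The geodesics of [d] are a thin family for the coned-off metric, which is smaller, and
    quasiconvexity of the labels prevents them from wandering off when their ends share a label. So
    [guessing_near] applies to them. *)
Theorem coned_near delta q : exists kap,
  forall (V : Type) (d : V -> V -> nat) (I : Type) (Z : I -> V -> Prop)
    (cover : forall x y, d x y <= 1 -> exists E, Z E x /\ Z E y)
    (dP : pmetric d) (dG : dgeodesic d),
  thin_triangles d delta -> quasiconvex_labels d Z q ->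
  forall n g N a, dpath d n g -> dpath (coned dG cover) N a -> g 0 = a 0 -> g n = a N ->
  (forall i, i <= n -> exists2 j, j <= N & coned dG cover (g i) (a j) <= kap) /\
  (forall j, j <= N -> exists2 i, i <= n & coned dG cover (a j) (g i) <= kap).
Proof.
have [kap hk] := @guessing_near (3 * delta + 1) 1 (1 + q) isT.
exists kap => V d I Z cover dP dG th qc n g N a hg ha g0 gn.
pose dc := coned dG cover.
have cP : pmetric dc := coned_pmetric dG cover.
have [cxx cC cT] := cP.
have cle x y : dc x y <= d x y := coned_le dG cover x y.
apply: (hk V dc (dpath d)) => //.
- exact: (coned_geodesic dG cover).
- by move=> m f s t hf hst; exact: dpath_sub hf hst.
- by move=> x y; have [f [f0 fn hf]] := dpath_ex dP dG x y; exists (d x y), f.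
- by move=> m f i hf hi; apply: leq_trans (cle _ _) _; rewrite hf; lia.
- move=> m f n1 g1 n2 g2 hf h1 h2 e0 e1 e2 i hi.
  by have [[j hj dj]|[j hj dj]] := thin_dpaths dP th hf h1 h2 e0 e1 e2 hi;
    [left|right]; exists j => //; have := cle (f i) (g1 j); have := cle (f i) (g2 j); lia.
- move=> m f hf f1 i hi.
  have := coned_le1 dP dG cover (f 0) (f m); rewrite -/dc => -[/(_ f1) [E [Z0 Z1]] _].
  have bt : between d (f 0) (f m) (f i) by apply: (dpath_between hf); lia.
  have [w Zw dw] := qc _ _ _ _ Z0 Z1 bt.
  have : dc (f 0) w <= 1 by apply/(coned_le1 dP dG cover); exists E.
  by have := cT (f 0) w (f i); have := cle (f i) w; rewrite (cC w); lia.
- have ha' : dpath dc N a := ha.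
  split=> [i hi|i j hi hj]; first by rewrite ha'; lia.
  by rewrite ha' //; lia.
Qed.

Theorem coned_thin delta q : exists delta',
  forall (V : Type) (d : V -> V -> nat) (I : Type) (Z : I -> V -> Prop)
    (cover : forall x y, d x y <= 1 -> exists E, Z E x /\ Z E y)
    (dP : pmetric d) (dG : dgeodesic d),
  thin_triangles d delta -> quasiconvex_labels d Z q ->
  thin_triangles (coned dG cover) delta'.
Proof.
have [kap hk] := coned_near delta q; exists (2 * kap + 3 * delta).
move=> V d I Z cover dP dG th qc x y z m hm.
pose dc := coned dG cover; have near := hk V d I Z cover dP dG th qc.
have cP : pmetric dc := coned_pmetric dG cover.
have cG : dgeodesic dc := coned_geodesic dG cover.
have [cxx cC cT] := cP.
have cle u v : dc u v <= d u v := coned_le dG cover u v.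
have [a [a0 am an ha]] := dpath_through cP cG hm.
have [g [g0 gn hg]] := dpath_ex dP dG x y.
have [a1 [a10 a1n ha1]] := dpath_ex cP cG x z.
have [g1 [g10 g1n hg1]] := dpath_ex dP dG x z.
have [a2 [a20 a2n ha2]] := dpath_ex cP cG z y.
have [g2 [g20 g2n hg2]] := dpath_ex dP dG z y.
have [_ n2] := near _ _ _ _ hg ha ltac:(congruence) ltac:(congruence).
have [i hi di] := n2 (dc x m) ltac:(move: hm; rewrite /between -/dc; lia).
rewrite am in di.
have [n1 _] := near _ _ _ _ hg1 ha1 ltac:(congruence) ltac:(congruence).
have [n3 _] := near _ _ _ _ hg2 ha2 ltac:(congruence) ltac:(congruence).
have [[j hj dj]|[j hj dj]] := thin_dpaths dP th hg hg1 hg2 ltac:(congruence)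
  ltac:(congruence) ltac:(congruence) hi.
- have [l hl dl] := n1 j hj; exists (a1 l).
    by left; rewrite -a10 -a1n; apply: (dpath_between ha1); lia.
  have := cT m (g i) (a1 l); have := cT (g i) (g1 j) (a1 l); have := cle (g i) (g1 j).
  by rewrite -/dc in di dl *; lia.
- have [l hl dl] := n3 j hj; exists (a2 l).
    by right; rewrite -a20 -a2n; apply: (dpath_between ha2); lia.
  have := cT m (g i) (a2 l); have := cT (g i) (g2 j) (a2 l); have := cle (g i) (g2 j).
  by rewrite -/dc in di dl *; lia.
Qed.

(** An edge of the coned-off graph is given the variation of the potential of any label shared by
    its ends; a short loop becomes a polygon with few sides, whose sum [polygon_sum] bounds. *)
Theorem extend_potential delta q : exists S N,
  forall (V : Type) (d : V -> V -> nat) (I : Type) (Z : I -> V -> Prop)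
    (K : I -> V -> int) c,
  pmetric d -> dgeodesic d -> thin_triangles d delta -> quasiconvex_labels d Z q ->
  compatible d Z K S c -> (forall x y, d x y <= 1 -> exists E, Z E x /\ Z E y) ->
  exists f : V -> int, forall E x y, Z E x -> Z E y ->
    absz (f y - f x - (K E y - K E x))%R <= N * c.
Proof.
have [delta' hd] := coned_thin delta q.
have [S [N hN]] := polygon_sum delta q (8 * delta' + 4) 0.
exists S, (3 * N + 1) => V d I Z K c dP dG th qc comp cover.
have [dxx dC dT] := dP.
pose dc := coned dG cover.
have cth : thin_triangles dc delta' by apply: hd.
pose good (xy : V * V) E := share Z xy.1 xy.2 -> Z E xy.1 /\ Z E xy.2.
have ex xy : exists E, good xy E.
  case: xy => x y; have [[E hE]|nsh] := pselect (share Z x y); first by exists E.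
  have [E _] := cover x x ltac:(by rewrite dxx).
  by exists E.
have [lab hlab] := choice ex.
pose H x y := (K (lab (x, y)) y - K (lab (x, y)) x)%R.
have cP : pmetric dc := coned_pmetric dG cover.
have cG : dgeodesic dc := coned_geodesic dG cover.
have [|f hf] := @loops_potential V dc H cP cG delta' (N * c) cth.
  move=> x p hp lp sp.
  pose fix sides x p := if p is y :: p' then (lab (x, y), x, y) :: sides y p' else [::].
  have e1 : size (sides x p) = size p by elim: p x {hp lp sp} => //= y p IH x; rewrite IH.
  have e2 : side_end x (sides x p) = last x p by elim: p x {hp lp sp e1} => //= y p IH x.
  have e3 : side_sum K (sides x p) = walk_sum H x p.
    by elim: p x {hp lp sp e1 e2} => //= y p IH x; rewrite IH.
  rewrite -e3; apply: (hN V d I Z K c dP dG th qc comp x) => //; rewrite ?e1 ?e2 //.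
  elim: p x hp {lp sp e1 e2 e3} => //= y p IH x [/(coned_le1 dP dG cover) sh hp].
  by have [h1 h2] := hlab (x, y) sh; rewrite dxx; split=> //; apply: IH.
exists f => E x y Ex Ey.
have sh : share Z x y by exists E.
have [h1 h2] := hlab (x, y) sh.
have := hf x y; rewrite -/dc => /(_ ltac:(by apply/(coned_le1 dP dG cover))).
have := comp _ _ _ _ _ _ h1 h2 Ex Ey; rewrite !dxx => /(_ (leq0n _) (leq0n _)).
by rewrite /H mulnDl mul1n -mulnA /=; set Nc := N * c; lia.
Qed.

(** * Word metrics *)

Lemma finite_bound (T : eqType) (l : seq T) (P : T -> nat -> Prop) :
  (forall t q q', q <= q' -> P t q -> P t q') ->
  (forall t, t \in l -> exists q, P t q) -> exists q, forall t, t \in l -> P t q.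
Proof.
move=> mono; elim: l => [|x l IH] h; first by exists 0.
have [q hq] := h x (mem_head _ _).
have [t tl|q' hq'] := IH; first by apply: h; rewrite inE tl orbT.
exists (maxn q q') => t; rewrite inE => /orP[/eqP ->|tl].
  by apply: mono hq; rewrite leq_maxl.
by apply: mono (hq' t tl); rewrite leq_maxr.
Qed.

Section WordMetric.
Variables (G : groupType) (S : seq G).
Local Open Scope group_scope.
Local Open Scope nat_scope.
Hypothesis hS : generates S.

Definition cayley_edge (x y : G) : Prop :=
  exists2 s, s \in S & y = (x * s)%g \/ x = (y * s)%g.

Lemma cayley_edge_sym x y : cayley_edge x y -> cayley_edge y x.
Proof. by move=> [s hs [h|h]]; exists s => //; [right|left]. Qed.

Lemma cayley_edge_mul g x y : cayley_edge (g * x)%g (g * y)%g <-> cayley_edge x y.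
Proof.
split=> -[s hs h]; exists s => //; case: h => h; [left|right|left|right].
- by apply: (mulgI g); rewrite h mulgA.
- by apply: (mulgI g); rewrite h mulgA.
- by rewrite h mulgA.
- by rewrite h mulgA.
Qed.

Lemma cayley_reach x y : exists n, reach cayley_edge n x y.
Proof.
have [w [hw e]] := hS (x^-1 * y)%g.
exists (size w); have {e} : y = (x * \prod_(s <- w) s)%g by rewrite -e mulgA mulgV mul1g.
elim: w x hw => [|s w IH] x hw e /=; first by rewrite e big_nil mulg1.
exists (x * s)%g; split.
  right; have [hs|hs] := hw s (mem_head _ _); first by exists s => //; left.
  by exists (s^-1)%g => //; right; rewrite mulgK.
apply: IH; first by move=> t tw; apply: hw; rewrite inE tw orbT.
by rewrite e big_cons mulgA.
Qed.

Definition wd : G -> G -> nat := graph_dist cayley_reach.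

Lemma wd_pmetric : pmetric wd.
Proof. exact: (graph_dist_pmetric cayley_edge_sym). Qed.

Lemma wd_geodesic : dgeodesic wd.
Proof. exact: (graph_dist_geodesic cayley_edge_sym). Qed.

Lemma reach_mul g n x y :
  reach cayley_edge n (g * x)%g (g * y)%g <-> reach cayley_edge n x y.
Proof.
elim: n x => [|n IH] x /=; first by split=> [/mulgI|->].
split=> -[z [h1 h2]]; last first.
  exists (g * z)%g; split; last exact/IH.
  by case: h1 => [->|h]; [left|right; apply/cayley_edge_mul].
exists (g^-1 * z)%g; have e : z = (g * (g^-1 * z))%g by rewrite mulgA mulgV mul1g.
split; last by apply/IH; rewrite -e.
by case: h1 => [<-|]; [left; rewrite mulgA mulVg mul1g|rewrite {1}e => /cayley_edge_mul; right].
Qed.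

Lemma wd_mul g x y : wd (g * x)%g (g * y)%g = wd x y.
Proof.
apply/eqP; rewrite eqn_leq; apply/andP; split; apply: graph_dist_le.
  by apply/reach_mul; apply: graph_distP.
by apply/(reach_mul g); apply: graph_distP.
Qed.

Lemma wd_1 x y : wd x y = wd 1%g (x^-1 * y)%g.
Proof. by rewrite -(wd_mul x^-1%g) mulVg. Qed.

Lemma wd_gen s : s \in S -> wd 1%g s <= 1.
Proof.
by move=> hs; apply/graph_dist_le1; right; exists s => //; left; rewrite mul1g.
Qed.

Lemma wd_ball r : exists l : seq G, forall x, wd 1%g x <= r -> x \in l.
Proof.
elim: r => [|r [l IH]].
  exists [:: 1%g] => x hx; have [d0 _] := wd_geodesic.
  have e : wd 1%g x = 0 by lia.
  by rewrite inE -(d0 _ _ e).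
exists (l ++ [seq (x * s)%g | x <- l, s <- S] ++ [seq (x * s^-1)%g | x <- l, s <- S]) => x hx.
rewrite !mem_cat; have [le|gt] := leqP (wd 1%g x) r; first by rewrite IH.
have [_ dg] := wd_geodesic; have [z [z1 zx]] := dg 1%g x r (ltnW gt).
have zl : z \in l by apply: IH; rewrite z1.
have : wd z x <= 1 by lia.
move/graph_dist_le1 => [e|[s hs [e|e]]].
- by rewrite -e zl.
- by rewrite e (allpairs_f (fun x s => (x * s)%g) zl hs) /= orbT.
- have -> : x = (z * s^-1)%g by rewrite e mulgK.
  by rewrite (allpairs_f (fun x s => (x * s^-1)%g) zl hs) !orbT.
Qed.
End WordMetric.

Lemma word_lipschitz (G H : groupType) (S : seq G) (S' : seq H) (hS : generates S)
    (hS' : generates S') (f : {multiplicative G -> H}) : exists c, forall x y,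
  wd hS' (f x) (f y) <= c * wd hS x y.
Proof.
have [c hc] : exists c, forall s, s \in S -> wd hS' 1%g (f s) <= c.
  apply: finite_bound => [t q q' qq h|t _]; first exact: leq_trans h qq.
  by exists (wd hS' 1%g (f t)).
have [dxx dC dT] := wd_pmetric hS'; have [d0 dg] := wd_geodesic hS.
exists c => x y; move: {2 3}(wd hS x y) (erefl (wd hS x y)) => n.
elim: n x => [|n IH] x e; first by rewrite (d0 _ _ e) dxx.
have [|z [xz zy]] := dg x y 1; first by rewrite e.
have := IH z ltac:(lia); have := dT (f x) (f z) (f y).
suff : wd hS' (f x) (f z) <= c by rewrite mulnS; lia.
have : wd hS x z <= 1 by rewrite xz.
move/graph_dist_le1 => [->|[s hs [->|->]]]; first by rewrite dxx.
- by rewrite gmulfM -{1}(mulg1 (f x)) wd_mul; apply: hc.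
- by rewrite dC gmulfM -{1}(mulg1 (f z)) wd_mul; apply: hc.
Qed.

(** * Potentials on intersections of fibres *)

Section AreaBounded.
Variables (V : Type) (d : V -> V -> nat).
Hypotheses (dP : pmetric d) (dG : dgeodesic d).
Let dxx x : d x x = 0. Proof. by case: dP. Qed.
Let dC x y : d x y = d y x. Proof. by case: dP. Qed.
Let dT x y z : d x z <= d x y + d y z. Proof. by case: dP. Qed.

(** A 1-form given on all pairs of points, so that it can be pulled back to a fibre, whose edges
    need not be edges of the space; its integral over a triangle is bounded in terms of the
    diameter. *)
Definition area_bounded (h : V -> V -> int) (B : nat -> nat) : Prop :=
  forall l x y z, d x y <= l -> d y z <= l -> d x z <= l ->
  absz (h x y + h y z - h x z)%R <= B l.

Variables (h : V -> V -> int) (B : nat -> nat).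
Hypothesis hB : area_bounded h B.

Lemma walk_sum_area l x p : walk d x p -> size p <= l ->
  absz (walk_sum h x p - h x (last x p))%R <= size p * B l + B 0.
Proof.
move=> hp sp; elim/last_ind: p hp sp => [|p y IH] /=.
  by move=> _ _; have := @hB 0 x x x; rewrite dxx => /(_ isT isT isT); lia.
rewrite size_rcons -cats1 => hp sp; have [{}hp [py _]] := proj1 (@walk_cat _ d h x p [:: y]) hp.
rewrite walk_sum_cat last_cat /=.
have := IH hp ltac:(lia); have := walk_size dP hp.
have xy : d x y <= l by have := dT x (last x p) y; have := walk_size dP hp; lia.
move=> sz; have := @hB l x (last x p) y ltac:(lia) ltac:(lia) xy.
by rewrite mulSn; lia.
Qed.

Lemma potential_coarse (k : V -> int) c l :
  (forall x y, d x y <= 1 -> absz (k y - k x - h x y)%R <= c) ->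
  forall x y, d x y <= l -> absz (k y - k x - h x y)%R <= l * c + (l * B l + B 0).
Proof.
move=> hk x y xy; have [p [hp lp sp]] := walk_ex dG x y.
have e : absz (k (last x p) - k x - walk_sum h x p)%R <= size p * c.
  elim: p x hp {lp sp xy} => [|z p IH] x /=; first by lia.
  by move=> [xz hp]; have := IH z hp; have := hk x z xz; rewrite mulSn; lia.
have := walk_sum_area hp (l := l) ltac:(lia); rewrite lp in e *.
have : size p * c <= l * c by rewrite leq_mul //; lia.
have : size p * B l <= l * B l by rewrite leq_mul //; lia.
lia.
Qed.

Lemma area_potential delta : thin_triangles d delta -> exists k : V -> int,
  forall x y, d x y <= 1 -> absz (k y - k x - h x y)%R <=
    3 * ((8 * delta + 4) * B (8 * delta + 4) + 2 * B 0).
Proof.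
move=> th; apply: (loops_potential dP dG th) => x p hp lp sp.
have := walk_sum_area hp sp; rewrite lp.
have := @hB 0 x x x; rewrite dxx => /(_ isT isT isT).
have : size p * B (8 * delta + 4) <= (8 * delta + 4) * B (8 * delta + 4) by rewrite leq_mul.
lia.
Qed.
End AreaBounded.

Section Fibres.
Variables (G : Type) (d : G -> G -> nat) (W : choiceType).
Variables (A : W -> Type) (dA : forall v, A v -> A v -> nat) (iota : forall v, A v -> G).
Variables (delta lam n : nat) (rho : nat -> nat).
Hypotheses (dP : pmetric d) (dG : dgeodesic d).
Hypotheses (dAP : forall v, pmetric (@dA v)) (dAG : forall v, dgeodesic (@dA v)).
Hypothesis dA_thin : forall v, thin_triangles (@dA v) delta.
Hypothesis iota_lip : forall v (a b : A v), d (iota a) (iota b) <= lam * dA a b.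
Hypothesis iota_proper : forall v (a b : A v) l, d (iota a) (iota b) <= l ->
  dA a b <= rho l.
Let dxx x : d x x = 0. Proof. by case: dP. Qed.
Let dC x y : d x y = d y x. Proof. by case: dP. Qed.
Let dT x y z : d x z <= d x y + d y z. Proof. by case: dP. Qed.

Definition near C x v : Prop := exists a : A v, d x (iota a) <= C.

Definition near_all C x (D : {fset W}) : Prop := forall v, v \in D -> near C x v.

Hypothesis transport : forall C, exists c, forall v w (a b m : A v) (a' b' : A w),
  d (iota a) (iota a') <= C -> d (iota b) (iota b') <= C -> between (@dA v) a b m ->
  exists2 m', between (@dA w) a' b' m' & d (iota m) (iota m') <= c.
Hypothesis finite_height : forall C, exists L, forall (D : {fset W}) x y,
  n < #|` D|%fset -> near_all C x D -> near_all C y D -> d x y <= L.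
Hypothesis thickening : forall C c, exists q, forall (D : {fset W}) v x, v \in D ->
  near_all c x D -> (exists a : A v, near_all C (iota a) D) ->
  exists2 a : A v, near_all C (iota a) D & d x (iota a) <= q.

Lemma near_mono C C' x v : C <= C' -> near C x v -> near C' x v.
Proof. by move=> h [a ha]; exists a; lia. Qed.

Lemma near_move C c x y v : d x y <= c -> near C x v -> near (c + C) y v.
Proof. by move=> h [a ha]; exists a; have := dT y x (iota a); have := dC x y; lia. Qed.

Lemma near_all_mono C C' x D : C <= C' -> near_all C x D -> near_all C' x D.
Proof. by move=> h hD v /hD; apply: near_mono. Qed.

Lemma near_all_move C c x y D : d x y <= c -> near_all C x D -> near_all (c + C) y D.
Proof. by move=> h hD v /hD; apply: near_move. Qed.

Lemma near_all_sub C x (D F : {fset W}) : (D `<=` F)%fset -> near_all C x F -> near_all C x D.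
Proof. by move=> /fsubsetP h hF v /h; apply: hF. Qed.

(* The prescribed value [Some (v0, phi)] forces the potentials of the sets
   containing [v0] to be [phi]. *)
Definition prescription := option (W * (G -> int)).

Definition prescribed_ok (h : G -> G -> int) (B : nat -> nat) (p : prescription) : Prop :=
  if p is Some (v0, phi) then forall l x y, near l x v0 -> near l y v0 ->
    d x y <= l -> absz (phi y - phi x - h x y)%R <= B l else True.

(** The second condition is what the induction rests on: the potentials of two sets are compared
    through that of their union. *)
Definition potentials_from i C c (h : G -> G -> int) (p : prescription)
    (K : {fset W} -> G -> int) : Prop :=
  [/\ forall D x y, i <= #|` D|%fset -> near_all C x D -> near_all C y D -> d x y <= C ->
        absz (K D y - K D x - h x y)%R <= c,
      forall (D F : {fset W}) x y, i <= #|` D|%fset -> (D `<=` F)%fset ->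
        near_all C x F -> near_all C y F ->
        absz (K D y - K D x - (K F y - K F x))%R <= c &
      if p is Some (v0, phi) then forall D, v0 \in D -> K D = phi else True].

Variable B : nat -> nat.

(** The points near all fibres of such a [D] form a set of diameter at most [L], on which [h] taken
    from a base point serves as potential. *)
Lemma potentials_base C : exists c, forall h p, area_bounded d h B ->
  prescribed_ok h B p -> exists K, potentials_from n.+1 C c h p K.
Proof.
have [L hL] := finite_height C; pose l := maxn L C; exists (2 * B l).
move=> h p hB hp.
pose has D x := near_all C x D.
have ex D : exists x0 : option G, if x0 is Some x then near_all C x D else
    forall x, ~ near_all C x D.
  have [[x hx]|no] := pselect (exists x, near_all C x D); first by exists (Some x).
  by exists None => x hx; apply: no; exists x.
have [base hbase] := choice ex.
pose K0 D x := if base D is Some b then h b x else 0%R.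
pose K D := if p is Some (v0, phi) then if v0 \in D then phi else K0 D else K0 D.
have key D x y : n < #|` D|%fset -> near_all C x D -> near_all C y D ->
    absz (K D y - K D x - h x y)%R <= B l.
  move=> nD hx hy; have k0 : absz (K0 D y - K0 D x - h x y)%R <= B l.
    rewrite /K0; case e : (base D) (hbase D) => [b|] hb; last by case: (hb x hx).
    have := hB l b x y; have := hL D b x nD hb hx; have := hL D x y nD hx hy.
    have := hL D b y nD hb hy; rewrite /l => h1 h2 h3 /(_ ltac:(lia) ltac:(lia) ltac:(lia)).
    lia.
  rewrite /K; clear K; case: p hp => [[v0 phi]|] // hp; case: ifP => // v0D.
  apply: hp; last by have := hL D x y nD hx hy; rewrite /l; lia.
  - by apply: near_mono (hx _ v0D); rewrite /l; lia.
  - by apply: near_mono (hy _ v0D); rewrite /l; lia.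
exists K; split.
- by move=> D x y nD hx hy _; have := key D x y nD hx hy; lia.
- move=> D F x y nD DF hx hy.
  have := key F x y (leq_trans nD (fsubset_leq_card DF)) hx hy.
  have := key D x y nD (near_all_sub DF hx) (near_all_sub DF hy); lia.
- by rewrite /K; clear key K; case: p {hp} => // -[v0 phi] D ->.
Qed.

Section Step.
Variables (i C c1 q0 S N c2 : nat).
Let C1 := C + C.
Let C2 := C1 + lam * (2 * S + 1) + C.
Let B' l := B (lam * l).
Let ck := 3 * ((8 * delta + 4) * B' (8 * delta + 4) + 2 * B' 0).
Let pk l := l * ck + (l * B' l + B' 0).
Let e := c2 + pk (2 * S + 1).
Let cf := N * (2 * c2 + 2 * e).
Let l0 := rho (3 * C).
Let c := l0 * cf + pk l0 + 2 * B (3 * C) + 2 * c2 + cf.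
Hypothesis hc1 : forall v w (a b m : A v) (a' b' : A w),
  d (iota a) (iota a') <= C1 -> d (iota b) (iota b') <= C1 -> between (@dA v) a b m ->
  exists2 m', between (@dA w) a' b' m' & d (iota m) (iota m') <= c1.
Hypothesis hq0 : forall (D : {fset W}) v x, v \in D ->
  near_all c1 x D -> (exists a : A v, near_all C1 (iota a) D) ->
  exists2 a : A v, near_all C1 (iota a) D & d x (iota a) <= q0.
Hypothesis hSN :
  forall (V : Type) (d : V -> V -> nat) (I : Type) (Z : I -> V -> Prop)
    (K : I -> V -> int) c,
  pmetric d -> dgeodesic d -> thin_triangles d delta ->
  quasiconvex_labels d Z (maxn (rho q0) 1) ->
  compatible d Z K S c -> (forall x y, d x y <= 1 -> exists E, Z E x /\ Z E y) ->
  exists f : V -> int, forall E x y, Z E x -> Z E y ->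
    absz (f y - f x - (K E y - K E x))%R <= N * c.
Variables (h : G -> G -> int) (p : prescription) (K : {fset W} -> G -> int).
Hypotheses (hB : area_bounded d h B) (hK : potentials_from i.+1 C2 c2 h p K).

(** The potential is built inside one fibre [v] of [D]. On the parts of it close to a larger set [F]
    it is dictated by [K F]; [extend_potential] extends it to the whole fibre, and the choice [pr]
    of a nearby point of the fibre carries it to the points near [D]. *)
Lemma potential_on_one (D : {fset W}) v : v \in D -> i <= #|` D|%fset ->
  exists KD : G -> int,
  (forall x y, near_all C x D -> near_all C y D -> d x y <= C ->
     absz (KD y - KD x - h x y)%R <= c) /\
  (forall (F : {fset W}) x y, (D `<` F)%fset -> near_all C x F -> near_all C y F ->
     absz (KD y - KD x - (K F y - K F x))%R <= c).
Proof.
move=> vD iD; have [Kh KF _] := hK.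
have [[a0]|no] := pselect (inhabited (A v)); last first.
  have ab x (E : {fset W}) : v \in E -> near_all C x E -> False.
    by move=> vE /(_ v vE) [a _]; apply: no.
  exists (fun=> 0%R); split=> [x y /ab []//|F x y DF /ab []//].
  by move/fproper_sub/fsubsetP: DF; apply.
pose hv (a b : A v) := h (iota a) (iota b).
have hvB : area_bounded (@dA v) hv B'.
  move=> l x y z xy yz xz; apply: hB; apply: leq_trans (iota_lip _ _) _;
  by rewrite leq_mul.
have [k hk] := area_potential (dAP v) (dAG v) hvB (@dA_thin v).
have hkl l := potential_coarse (dAP v) (dAG v) hvB (l := l) hk.
(* The labels [inr] are the edges of the fibre; they make the labels cover it. *)
pose Z (I : {fset W} + A v * A v) (a : A v) := match I with
  | inl F => (D `<` F)%fset /\ near_all C1 (iota a) F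
  | inr uu => dA uu.1 uu.2 <= 1 /\ (a = uu.1 \/ a = uu.2) end.
(* [K F] and [k] are both potentials of [h] near [F], so their difference varies boundedly at
   bounded scale and is compatible with the zero potential on edges. *)
pose KI (I : {fset W} + A v * A v) (a : A v) := match I with
  | inl F => (K F (iota a) - k a)%R | inr _ => 0%R end.
have cardF (F : {fset W}) : (D `<` F)%fset -> i < #|` F|%fset.
  by move=> DF; apply: leq_ltn_trans iD (fproper_ltn_card DF).
have [axx aC aT] := dAP v.
have qc : quasiconvex_labels (@dA v) Z (maxn (rho q0) 1).
  move=> [F|[u u']] x y m /=.
    move=> [DF hx] [_ hy] hm; have vF : v \in F.
      by move/fproper_sub/fsubsetP: DF; apply.
    have hm' : near_all c1 (iota m) F.
      move=> w wF; have [x' dx] := hx w wF; have [y' dy] := hy w wF.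
      by have [m' _ dm] := hc1 dx dy hm; exists m'.
    have [a ha da] := hq0 vF hm' (ex_intro _ x hx).
    exists a => //; have := iota_proper da; lia.
  move=> [uu hx] [_ hy] hm; exists x => //.
  have : dA x y <= 1.
    by case: hx => ->; case: hy => ->; rewrite ?axx // aC.
  by have := aC x m; move: hm; rewrite /between; lia.
have lipI F x y : (D `<` F)%fset -> near_all C2 (iota x) F -> near_all C2 (iota y) F ->
    dA x y <= 2 * S + 1 -> absz (KI (inl F) y - KI (inl F) x)%R <= e.
  move=> DF hx hy xy; have := hkl _ x y xy.
  have xy' : d (iota x) (iota y) <= C2.
    apply: leq_trans (iota_lip _ _) _; have := leq_mul (leqnn lam) xy; rewrite /C2; lia.
  have := Kh F _ _ (cardF F DF) hx hy xy'; rewrite /= /hv -/ck -/(pk _).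
  by rewrite /e; lia.
have C12 : C1 <= C2 by rewrite /C2; lia.
have lamS : lam * S <= lam * (2 * S + 1) by rewrite leq_mul //; lia.
have comp : compatible (@dA v) Z KI S (2 * c2 + 2 * e).
  move=> [F|[u u']] [F'|[w w']] x y x' y'.
  - move=> [DF hx] [_ hy] [DF' hx'] [_ hy'] xx yy.
    have mv (a a' : A v) : dA a a' <= S -> near_all C1 (iota a') F' -> near_all C2 (iota a) F'.
      move=> aa ha; apply: near_all_mono (near_all_move (c := lam * S) _ ha).
        by rewrite /C2; lia.
      by rewrite dC; apply: leq_trans (iota_lip _ _) _; rewrite leq_mul.
    have hxF := mv _ _ xx hx'; have hyF := mv _ _ yy hy'.
    have un (a : A v) : near_all C1 (iota a) F -> near_all C2 (iota a) F' ->
        near_all C2 (iota a) (F `|` F')%fset.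
      move=> h1 h2 z; rewrite in_fsetU => /orP[zF|zF]; last exact: h2.
      exact: near_mono C12 (h1 z zF).
    have := KF F _ _ _ (cardF F DF) (fsubsetUl F F') (un x hx hxF) (un y hy hyF).
    have := KF F' _ _ _ (cardF F' DF') (fsubsetUr F F') (un x hx hxF) (un y hy hyF).
    have := lipI F' x x' DF' hxF (near_all_mono C12 hx') ltac:(lia).
    have := lipI F' y y' DF' hyF (near_all_mono C12 hy') ltac:(lia).
    by rewrite /=; lia.
  - move=> [DF hx] [_ hy] [uu hx'] [_ hy'] xx yy.
    have xy : dA x y <= 2 * S + 1.
      have : dA x' y' <= 1.
        by move: uu hx' hy' => /= uu [->|->] [->|->]; rewrite ?axx // aC.
      by have := aT x x' y; have := aT x' y' y; have := aC y y'; lia.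
    have := lipI F x y DF (near_all_mono C12 hx) (near_all_mono C12 hy) xy.
    by rewrite /=; lia.
  - move=> [uu hx'] [_ hy'] [DF hx] [_ hy] xx yy.
    have xy : dA x' y' <= 2 * S + 1.
      have : dA x y <= 1.
        by move: uu hx' hy' => /= uu [->|->] [->|->]; rewrite ?axx // aC.
      by have := aT x' x y'; have := aT x y y'; have := aC x x'; lia.
    have := lipI F' x' y' DF (near_all_mono C12 hx) (near_all_mono C12 hy) xy.
    by rewrite /=; lia.
  - by move=> _ _ _ _ _ _ /=; lia.
have cover x y : dA x y <= 1 -> exists E, Z E x /\ Z E y.
  by move=> xy; exists (inr (x, y)); split; split=> //; [left|right].
have [f hf] := hSN (dAP v) (dAG v) (@dA_thin v) qc comp cover.
have f1 x y : dA x y <= 1 -> absz (f y - f x - 0)%R <= cf.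
  move=> xy; have := hf (inr (x, y)) x y; rewrite /= => h1.
  have := h1 (conj xy (or_introl erefl)) (conj xy (or_intror erefl)).
  by rewrite /cf; lia.
have z0 : area_bounded (@dA v) (fun _ _ => 0%R) (fun=> 0) by move=> l x y z _ _ _.
have fl l := potential_coarse (dAP v) (dAG v) z0 (l := l) f1.
have [pr hpr] : exists pr : G -> A v, forall x, near C x v -> d x (iota (pr x)) <= C.
  have ex x : exists a : A v, near C x v -> d x (iota a) <= C.
    by have [[a ha]|nn] := pselect (near C x v); [exists a|exists a0].
  by have [pr hpr] := choice ex; exists pr.
exists (fun x => (f (pr x) + k (pr x) + h (iota (pr x)) x)%R); split.
- move=> x y hx hy xy; have px := hpr x (hx v vD); have py := hpr y (hy v vD).
  have dxy : dA (pr x) (pr y) <= l0.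
    apply: iota_proper; have := dT (iota (pr x)) x (iota (pr y)).
    by have := dT x y (iota (pr y)); have := dC x (iota (pr x)); lia.
  have := fl _ _ _ dxy; have := hkl _ _ _ dxy; rewrite /hv -/ck -/(pk l0) muln0.
  have dxy' : d (iota (pr x)) (iota (pr y)) <= 3 * C.
    have := dT (iota (pr x)) x (iota (pr y)).
    by have := dT x y (iota (pr y)); have := dC x (iota (pr x)); lia.
  have := hB (l := 3 * C) dxy' (z := y); have := dC (iota (pr y)) y.
  have := dC (iota (pr x)) x; have := dT (iota (pr x)) x y.
  move=> t1 t2 t3 /(_ ltac:(lia) ltac:(lia)) b1.
  have := hB (l := 3 * C) (x := iota (pr x)) (y := x) (z := y) ltac:(lia) ltac:(lia) ltac:(lia).
  move=> b2 b3 b4; rewrite /c; lia.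
- move=> F x y DF hx hy; have sub := fproper_sub DF.
  have px := hpr x (near_all_sub sub hx vD); have py := hpr y (near_all_sub sub hy vD).
  have nx : near_all C1 (iota (pr x)) F by apply: near_all_move hx.
  have ny : near_all C1 (iota (pr y)) F by apply: near_all_move hy.
  have := hf (inl F) (pr x) (pr y) (conj DF nx) (conj DF ny); rewrite -/cf /=.
  have CC2 : C <= C2 by rewrite /C2 /C1; lia.
  have := Kh F _ _ (cardF F DF) (near_all_mono C12 nx) (near_all_mono CC2 hx).
  have := Kh F _ _ (cardF F DF) (near_all_mono C12 ny) (near_all_mono CC2 hy).
  rewrite (dC _ x) (dC _ y) => /(_ ltac:(lia)) b1 /(_ ltac:(lia)) b2 b3.
  by rewrite /c; lia.
Qed.

(** Only sets with exactly [i] elements that do not contain the prescribed fibre receive a new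
    potential; the others keep theirs, which is already [phi] when they contain it. *)
Lemma potentials_step_one : prescribed_ok h B p ->
  0 < i -> exists K', potentials_from i C (c + B C) h p K'.
Proof.
move=> hp i0; have [Kh KF Kp] := hK.
have ex (D : {fset W}) : exists KD : G -> int, i <= #|` D|%fset ->
  (forall x y, near_all C x D -> near_all C y D -> d x y <= C ->
     absz (KD y - KD x - h x y)%R <= c) /\
  (forall (F : {fset W}) x y, (D `<` F)%fset -> near_all C x F -> near_all C y F ->
     absz (KD y - KD x - (K F y - K F x))%R <= c).
  have [iD|Di] := leqP i #|` D|%fset; last by exists (fun=> 0%R).
  have [v vD] : exists v, v \in D.
    by apply/fset0Pn; rewrite -cardfs_gt0; lia.
  by have [KD hKD] := potential_on_one vD iD; exists KD.
have [KD hKD] := choice ex.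
pose presc (D : {fset W}) := if p is Some (v0, phi) then v0 \in D else false.
exists (fun D => if (#|` D|%fset == i) && ~~ presc D then KD D else K D).
have CC2 : C <= C2 by rewrite /C2 /C1; lia.
have c2c : c2 <= c by rewrite /c; lia.
have presK (D : {fset W}) x y : presc D -> near_all C x D -> near_all C y D -> d x y <= C ->
    absz (K D y - K D x - h x y)%R <= B C.
  rewrite /presc; case: p hp Kp => [[v0 phi]|] //= hp Kp v0D hx hy xy.
  by rewrite Kp //; apply: hp => //; [apply: hx|apply: hy].
split.
- move=> D x y iD hx hy xy; case: ifP => [/andP[/eqP Di _]|/negbT].
    by have [h1 _] := hKD D iD; have := h1 x y hx hy xy; lia.
  rewrite negb_and negbK => /orP[Di|/presK h1]; last by have := h1 x y hx hy xy; lia.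
  have iD' : i < #|` D|%fset by lia.
  have := Kh D x y iD' (near_all_mono CC2 hx) (near_all_mono CC2 hy) ltac:(lia).
  by lia.
- move=> D F x y iD DF hx hy.
  have [->|DneF] := eqVneq D F; first by lia.
  have DF' : (D `<` F)%fset by rewrite fproperEneq DneF.
  have cF := fproper_ltn_card DF'.
  have -> : (#|` F|%fset == i) = false by apply/negbTE; lia.
  rewrite /=; case: ifP => [/andP[/eqP Di _]|/negbT].
    by have [_ h1] := hKD D iD; have := h1 F x y DF' hx hy; lia.
  rewrite negb_and negbK => /orP[Di|].
    have iD' : i < #|` D|%fset by lia.
    have := KF D F x y iD' DF (near_all_mono CC2 hx) (near_all_mono CC2 hy).
    by lia.
  rewrite /presc; case: p Kp => [[v0 phi]|] //= Kp v0D.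
  by rewrite !Kp //; [lia|apply: (fsubsetP DF)].
- rewrite /presc; case: p Kp => [[v0 phi]|] //= Kp D v0D.
  by rewrite v0D andbF Kp.
Qed.
End Step.

(* Downward induction on the cardinality of [D]: by finite height the points near
   more than [n] fibres form bounded sets. *)
Theorem potentials C : exists c, forall h p, area_bounded d h B ->
  prescribed_ok h B p -> exists K, potentials_from 1 C c h p K.
Proof.
suff key j C' : j <= n -> exists c, forall h p, area_bounded d h B ->
    prescribed_ok h B p -> exists K, potentials_from (n.+1 - j) C' c h p K.
  by have := key n C (leqnn n); rewrite subSnn.
elim: j C' => [|j IH] C' jn; first by rewrite subn0; apply: potentials_base.
have [c1 hc1] := transport (C' + C').
have [q0 hq0] := thickening (C' + C') c1.
have [S [N hSN]] := extend_potential delta (maxn (rho q0) 1).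
have [c2 hc2] := IH (C' + C' + lam * (2 * S + 1) + C') ltac:(lia).
eexists => h p hB hp; have [K hK] := hc2 h p hB hp.
have e1 : (n.+1 - j) = (n.+1 - j.+1).+1 by lia.
rewrite e1 in hK.
apply: (potentials_step_one hc1 hq0 hSN hB hK hp); lia.
Qed.
End Fibres.

Section Global.
Variables (G : Type) (d : G -> G -> nat) (W : choiceType).
Variables (A : W -> Type) (dA : forall v, A v -> A v -> nat) (iota : forall v, A v -> G).
Variables (delta lam n : nat) (rho : nat -> nat).
Hypotheses (dP : pmetric d) (dG : dgeodesic d).
Hypotheses (dAP : forall v, pmetric (@dA v)) (dAG : forall v, dgeodesic (@dA v)).
Hypothesis dA_thin : forall v, thin_triangles (@dA v) delta.
Hypothesis iota_lip : forall v (a b : A v), d (iota a) (iota b) <= lam * dA a b.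
Hypothesis rho_mono : {homo rho : x y / x <= y}.
Hypothesis iota_proper : forall v (a b : A v) l, d (iota a) (iota b) <= l ->
  dA a b <= rho l.
Let dxx x : d x x = 0. Proof. by case: dP. Qed.
Let dC x y : d x y = d y x. Proof. by case: dP. Qed.
Let dT x y z : d x z <= d x y + d y z. Proof. by case: dP. Qed.
Let near := (near d iota).
Let near_all := (near_all d iota).
Hypothesis transport : forall C, exists c, forall v w (a b m : A v) (a' b' : A w),
  d (iota a) (iota a') <= C -> d (iota b) (iota b') <= C -> between (@dA v) a b m ->
  exists2 m', between (@dA w) a' b' m' & d (iota m) (iota m') <= c.
Hypothesis finite_height : forall C, exists L, forall (D : {fset W}) x y,
  n < #|` D|%fset -> near_all C x D -> near_all C y D -> d x y <= L.
Hypothesis thickening : forall C c, exists q, forall (D : {fset W}) v x, v \in D ->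
  near_all c x D -> (exists a : A v, near_all C (iota a) D) ->
  exists2 a : A v, near_all C (iota a) D & d x (iota a) <= q.
Hypothesis cover : forall x y, d x y <= 1 -> exists v, near 1 x v /\ near 1 y v.
Let dc := coned (Z := fun v x => near 1 x v) dG cover.
Variables (delta' r0 : nat).
Hypothesis dc_thin : thin_triangles dc delta'.

Fixpoint conear_path v (l : seq W) : Prop :=
  if l is w :: l' then (exists g, near 1 g v /\ near 1 g w) /\ conear_path w l' else True.

Hypothesis filling : forall r, exists N, forall (c : W -> W -> int) M,
  (forall v1 v2 v3 g, near r0 g v1 -> near r0 g v2 -> near r0 g v3 ->
     absz (c v1 v2 + c v2 v3 - c v1 v3)%R <= M) ->
  forall v l, conear_path v l -> last v l = v -> size l <= r ->
  absz (walk_sum c v l) <= N * M.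

(** Where two fibres meet, their potentials differ by a nearly constant function. Its value [cc v w]
    is a coarse cocycle, so [filling] bounds its sums over short loops of fibres, and these control
    the loops of the coned-off space. *)
Theorem global_potential (B : nat -> nat) : exists c, forall h p, area_bounded d h B ->
  prescribed_ok d iota h B p -> exists K : G -> int,
  (forall x y, d x y <= 1 -> absz (K y - K x - h x y)%R <= c) /\
  if p is Some (v0, phi) then forall x y, near 1 x v0 -> near 1 y v0 ->
    absz (K y - K x - (phi y - phi x))%R <= c else True.
Proof.
have [C [r1C r0C]] : exists C, 1 <= C /\ r0 <= C by exists (maxn 1 r0); lia.
have [c hc] := potentials dP dAP dAG dA_thin iota_lip iota_proper
  transport finite_height thickening B C.
have [N hN] := filling (8 * delta' + 4).
pose M := N * (6 * c) + (8 * delta' + 4) * (2 * c).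
exists (3 * M + 3 * c) => h p hB hp.
have [[g0]|nG] := pselect (inhabited G); last first.
  exists (fun=> 0%R); split=> [x|]; first by case: nG.
  by case: p hp => // -[v0 phi] _ x; case: nG.
have [KD [Kh KF Kp]] := hc h p hB hp.
pose K v := KD [fset v]%fset.
have nall x v : near C x v -> near_all C x [fset v]%fset.
  by move=> hx w; rewrite in_fset1 => /eqP ->.
have nC x v : near 1 x v -> near C x v by apply: near_mono.
have nC0 x v : near r0 x v -> near C x v by apply: near_mono.
have KK v w x y : near C x v -> near C x w -> near C y v -> near C y w ->
    absz (K v y - K v x - (K w y - K w x))%R <= 2 * c.
  move=> xv xw yv yw; have all2 z : near C z v -> near C z w -> near_all C z [fset v; w]%fset.
    by move=> zv zw u; rewrite in_fset2 => /orP[/eqP ->|/eqP ->].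
  have := KF [fset v]%fset [fset v; w]%fset x y; rewrite cardfs1 => /(_ isT).
  move=> /(_ ltac:(by rewrite fsub1set in_fset2 eqxx) (all2 _ xv xw) (all2 _ yv yw)).
  have := KF [fset w]%fset [fset v; w]%fset x y; rewrite cardfs1 => /(_ isT).
  move=> /(_ ltac:(by rewrite fsub1set in_fset2 eqxx orbT) (all2 _ xv xw) (all2 _ yv yw)).
  by rewrite /K; lia.
have ex vw : exists g : G, (exists g, near C g vw.1 /\ near C g vw.2) ->
    near C g vw.1 /\ near C g vw.2.
  have [[g hg]|no] := pselect (exists g, near C g vw.1 /\ near C g vw.2); first by exists g.
  by exists g0.
have [gg hgg] := choice ex.
pose cc v w := (K v (gg (v, w)) - K w (gg (v, w)))%R.
have ccE v w x : near C x v -> near C x w -> absz (cc v w - (K v x - K w x))%R <= 2 * c.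
  move=> xv xw; have [gv gw] := hgg (v, w) (ex_intro _ x (conj xv xw)).
  by have := KK v w x _ xv xw gv gw; rewrite /cc; lia.
have ccM v1 v2 v3 g : near r0 g v1 -> near r0 g v2 -> near r0 g v3 ->
    absz (cc v1 v2 + cc v2 v3 - cc v1 v3)%R <= 6 * c.
  move=> /nC0 h1 /nC0 h2 /nC0 h3; have := ccE v1 v2 g h1 h2; have := ccE v2 v3 g h2 h3.
  by have := ccE v1 v3 g h1 h3; lia.
have {}hN := hN cc (6 * c) ccM.
pose share1 x y := exists v, near 1 x v /\ near 1 y v.
have exl xy : exists v, share1 xy.1 xy.2 -> near 1 xy.1 v /\ near 1 xy.2 v.
  have [[v hv]|no] := pselect (share1 xy.1 xy.2); first by exists v.
  by have [v _] := cover (x := xy.1) (y := xy.1) ltac:(by rewrite dxx); exists v.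
have [lab hlab] := choice exl.
pose H x y := (K (lab (x, y)) y - K (lab (x, y)) x)%R.
have cP : pmetric dc := coned_pmetric dG cover.
have cG : dgeodesic dc := coned_geodesic dG cover.
have [|KG hKG] := @loops_potential G dc H cP cG delta' M dc_thin.
  move=> x p0 hp0 lp sp.
  pose fix labs x q := if q is y :: q' then lab (x, y) :: labs y q' else [::].
  pose fix T v x q := if q is y :: q' then
    (K v x - K (lab (x, y)) x + T (lab (x, y)) y q')%R else 0%R.
  (* Summation by parts: variations of potentials along the walk are traded for the jumps of the
     potential at the points where the label changes. *)
  have sE v q z : walk_sum H z q =
      (K (last v (labs z q)) (last z q) - K v z + T v z q)%R.
    elim: q v z => [|y q IH] v z /=; first by lia.
    by rewrite (IH (lab (z, y)) y) /H; lia.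
  have szl z q : size (labs z q) = size q by elim: q z => //= y q IH z; rewrite IH.
  have TE q v z : walk dc z q -> near 1 z v -> conear_path v (labs z q) /\
      absz (T v z q - walk_sum cc v (labs z q))%R <= size q * (2 * c).
    elim: q v z => [|y q IH] v z /=; first by split=> //; lia.
    move=> [/(coned_le1 dP dG cover) sh hq] zv.
    have [z1 y1] := hlab (z, y) sh.
    have [cp le] := IH (lab (z, y)) y hq y1.
    have := ccE v (lab (z, y)) z (nC _ _ zv) (nC _ _ z1).
    rewrite mulSn => le2; split; last by lia.
    by split=> //; exists z.
  case: p0 hp0 lp sp => [|y q] hq lp sp; first by rewrite /=; lia.
  (* Starting from the last label, which also contains [x], closes up the walk of labels. *)
  set v := last (lab (x, y)) (labs y q).
  have vE : last v (labs x (y :: q)) = v by [].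
  have xv : near 1 x v.
    suff : near 1 (last x (y :: q)) v by rewrite lp.
    rewrite /v; elim: q x y hq {lp sp v vE} => [|z q IH] x' y [/(coned_le1 dP dG cover) sh hq] /=.
      by have [_ h2] := hlab (x', y) sh; exact: h2.
    exact: IH.
  have [cp le] := TE _ v x hq xv.
  have := hN v _ cp vE; rewrite szl => /(_ sp) le2.
  rewrite (sE v) vE lp; have : size (y :: q) * (2 * c) <= (8 * delta' + 4) * (2 * c).
    by rewrite leq_mul.
  by rewrite /M; lia.
have KGE v x y : near 1 x v -> near 1 y v ->
    absz (KG y - KG x - (K v y - K v x))%R <= 3 * M + 2 * c.
  move=> xv yv; have sh : share1 x y by exists v.
  have [h1 h2] := hlab (x, y) sh.
  have := hKG x y ltac:(by apply/(coned_le1 dP dG cover)).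
  by have := KK v (lab (x, y)) x y (nC _ _ xv) (nC _ _ h1) (nC _ _ yv) (nC _ _ h2); rewrite /H; lia.
exists KG; split=> [x y xy|].
  have [v [xv yv]] := cover xy; have := KGE v x y xv yv.
  have := Kh [fset v]%fset x y; rewrite cardfs1 => /(_ isT (nall _ _ (nC _ _ xv))).
  move=> /(_ (nall _ _ (nC _ _ yv)) ltac:(lia)); rewrite /K; lia.
case: p hp Kp => [[v0 phi]|] // hp Kp x y xv yv.
have := KGE v0 x y xv yv; rewrite /K Kp ?in_fset1 //; lia.
Qed.

(** On a triangle the defect of an area form is a product of differences of two 1-Lipschitz
    functions, whence the bound [l * l], uniform in the form. *)
Theorem global_thin : exists delta, thin_triangles d delta.
Proof.
have [c hc] := global_potential (fun l => l * l).
eexists; apply: (potentials_thin (C := c) dP dG) => x m r.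
have [|//|K [hK _]] := hc (area_form d x m r) None; last by exists K.
move=> l u v w uv vw uw; rewrite /area_form.
set a := ((r - d u m)%N%:Z)%R; set b := ((r - d v m)%N%:Z)%R.
set p := ((d x u)%:Z)%R; set q := ((d x v)%:Z)%R; set s := ((d x w)%:Z)%R.
have -> : (a * (q - p) + b * (s - q) - a * (s - p) = (b - a) * (s - q))%R.
  by ring.
rewrite abszM; apply: leq_mul.
- by rewrite /a /b; have := dT u v m; have := dT v u m; have := dC u v; lia.
- by rewrite /s /q; have := dT x v w; have := dT x w v; have := dC v w; lia.
Qed.

Theorem fibre_qi : exists c, forall v (a b : A v),
  dA a b <= c * d (iota a) (iota b) + c.
Proof.
(* The distance to [a] inside the fibre of [v] extends to a Lipschitz function on
   the whole space. *)
pose B l := rho (3 * l).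
have [c hc] := global_potential B; exists (c + 2 * rho 0) => v a b.
have ex x : exists a' : A v, forall b' : A v, d x (iota a') <= d x (iota b').
  have ex : exists k, `[< exists a' : A v, d x (iota a') = k >].
    by exists (d x (iota a)); apply/asboolP; exists a.
  case: (ex_minnP ex) => k /asboolP [a' ha'] hmin; exists a' => b'.
  by rewrite ha'; apply: hmin; apply/asboolP; exists b'.
have [pr hpr] := choice ex; pose phi x : int := ((dA a (pr x))%:Z)%R.
have [axx aC aT] := dAP v.
have [||K [hK hphi]] := hc (fun _ _ => 0%R) (Some (v, phi)).
- by move=> l x y z _ _ _.
- move=> l x y [x' hx] [y' hy] xy; rewrite subr0 /phi.
  have : dA (pr x) (pr y) <= rho (3 * l).
    apply: iota_proper; have := hpr x x'; have := hpr y y'.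
    have := dT (iota (pr x)) x (iota (pr y)); have := dC x (iota (pr x)).
    by have := dT x y (iota (pr y)); lia.
  have := aT a (pr x) (pr y); have := aT a (pr y) (pr x); have := aC (pr x) (pr y).
  by rewrite /B; lia.
have path l x y : d x y <= l -> absz (K y - K x)%R <= l * c.
  have [d0 dg] := dG; elim: l x => [|l IH] x xy.
    have -> : x = y by apply: d0; lia.
    by rewrite subrr.
  have [e|ne] := posnP (d x y); first by rewrite (d0 _ _ e) subrr.
  have [z [xz zy]] := dg x y 1 ne.
  have := IH z ltac:(lia); have := hK x z ltac:(lia); rewrite mulSn; lia.
have na (b' : A v) : near 1 (iota b') v by exists b'; rewrite dxx.
have := hphi _ _ (na a) (na b); have := path _ _ _ (leqnn (d (iota a) (iota b))).
have pE (b' : A v) : dA b' (pr (iota b')) <= rho 0.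
  by apply: iota_proper; have := hpr (iota b') b'; rewrite dxx.
have := pE a; have := pE b; rewrite /phi.
have := aT a (pr (iota b)) b; have := aC b (pr (iota b)); have := axx a.
by rewrite mulnDl (mulnC c); lia.
Qed.
End Global.

(** * Graphs of cosets *)

Lemma mono_bound (P : nat -> nat -> Prop) :
  (forall l q q', q <= q' -> P l q -> P l q') -> (forall l, exists q, P l q) ->
  exists rho, {homo rho : x y / x <= y} /\ forall l, P l (rho l).
Proof.
move=> mono /choice[f hf]; exists (fun l => \sum_(i < l.+1) f i); split.
  move=> x y xy; rewrite -(subnKC (xy : x.+1 <= y.+1)) -!(big_mkord predT f).
  by rewrite /index_iota !subn0 iotaD big_cat leq_addr.
by move=> l; apply: mono (hf l); rewrite big_ord_recr leq_addl.
Qed.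

Lemma hom1 (G H : groupType) (f : {multiplicative G -> H}) : f 1%g = 1%g.
Proof. by apply: (mulgI (f 1%g)); rewrite -gmulfM !mulg1. Qed.

Lemma homV (G H : groupType) (f : {multiplicative G -> H}) x : f x^-1%g = ((f x)^-1)%g.
Proof. by apply: (mulgI (f x)); rewrite -gmulfM !mulgV hom1. Qed.

Theorem quasi_path_near delta k : exists kap,
  forall (X : Type) (dX : X -> X -> nat), pmetric dX -> dgeodesic dX ->
  thin_triangles dX delta ->
  forall n z N g, quasi_path dX k.+1 n z -> dpath dX N g -> g 0 = z 0 -> g N = z n ->
  (forall i, i <= N -> exists2 j, j <= n & dX (g i) (z j) <= kap) /\
  (forall j, j <= n -> exists2 i, i <= N & dX (z j) (g i) <= kap).
Proof.
have [kap hk] := @guessing_near (3 * delta + 1) k.+1 k.+1 isT.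
exists kap => X dX dP dG th n z N g hz hg g0 gn.
apply: (hk X dX (dpath dX)) => //.
- by move=> m h a b hh hab; exact: dpath_sub hh hab.
- by move=> x y; have [h [h0 hn hh]] := dpath_ex dP dG x y; exists (dX x y), h.
- by move=> m h i hh hi; rewrite hh; lia.
- move=> m h n1 g1 n2 g2 hh h1 h2 e0 e1 e2 i hi.
  by have [[j hj dj]|[j hj dj]] := thin_dpaths dP th hh h1 h2 e0 e1 e2 hi;
    [left|right]; exists j => //; lia.
- by move=> m h hh; rewrite hh; try lia; move=> hm i hi; rewrite hh; lia.
Qed.

Theorem morse delta q : exists kap,
  forall (V X : Type) (dV : V -> V -> nat) (dX : X -> X -> nat) (f : V -> X),
  pmetric dX -> dgeodesic dX -> thin_triangles dX delta ->
  (forall x y, dX (f x) (f y) <= q * dV x y /\ dV x y <= q * dX (f x) (f y) + q) ->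
  forall n z N g, dpath dV n z -> dpath dX N g -> g 0 = f (z 0) -> g N = f (z n) ->
  (forall i, i <= N -> exists2 j, j <= n & dX (g i) (f (z j)) <= kap) /\
  (forall j, j <= n -> exists2 i, i <= N & dX (f (z j)) (g i) <= kap).
Proof.
have [kap hk] := quasi_path_near delta q.
exists kap => V X dV dX f dP dG th qi n z N g hz hg g0 gn.
apply: (hk X dX dP dG th n (f \o z)) => //; split=> [i hi|i j hi hj] /=.
  have [h _] := qi (z i) (z i.+1); have e : dV (z i) (z i.+1) = 1 by (rewrite hz; lia).
  by rewrite e muln1 in h; lia.
have [_ h] := qi (z i) (z j); rewrite hz // in h.
by rewrite mulSn; lia.
Qed.

Section CosetGraph.
Variables (G : groupType) (S : seq G) (hS : generates S).
Variables (J : finType) (L : J -> groupType) (loc : forall j, {multiplicative L j -> G}).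
Variables (SL : forall j, seq (L j)) (hSL : forall j, generates (SL j)).
Variables (E : finType) (src tgt : E -> J) (LE : E -> groupType).
Variables (locE : forall e, {multiplicative LE e -> G}) (ks kt : E -> G).
Variables (SE : forall e, seq (LE e)) (hSE : forall e, generates (SE e)).
Variables (al : forall e, {multiplicative LE e -> L (src e)}).
Variables (be : forall e, {multiplicative LE e -> L (tgt e)}).
Variables (delta q : nat) (j0 : J).
Let d := wd hS.
Let dL j := wd (@hSL j).
Let dE e := wd (@hSE e).
Hypothesis loc_inj : forall j, injective (loc j).
Hypothesis loc_gen : forall j s, s \in SL j -> loc j s \in S.
Hypothesis dL_thin : forall j, thin_triangles (@dL j) delta.
Hypothesis ks_comm : forall e l, (locE e l * ks e = ks e * loc (src e) (al e l))%g.
Hypothesis kt_comm : forall e l, (locE e l * kt e = kt e * loc (tgt e) (be e l))%g.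
Hypothesis ks_short : forall e, d 1%g (ks e) <= 1.
Hypothesis kt_short : forall e, d 1%g (kt e) <= 1.
Hypothesis al_qi : forall e x y, dL (al e x) (al e y) <= q * dE x y /\
  dE x y <= q * dL (al e x) (al e y) + q.
Hypothesis be_qi : forall e x y, dL (be e x) (be e y) <= q * dE x y /\
  dE x y <= q * dL (be e x) (be e y) + q.

Let dP : pmetric d := wd_pmetric hS.
Let dG : dgeodesic d := wd_geodesic hS.
Let dxx x : d x x = 0. Proof. by case: dP. Qed.
Let dC x y : d x y = d y x. Proof. by case: dP. Qed.
Let dT x y z : d x z <= d x y + d y z. Proof. by case: dP. Qed.
Let dM g x y : d (g * x)%g (g * y)%g = d x y. Proof. exact: wd_mul. Qed.

Definition same_coset j (g h : G) : Prop := exists l : L j, h = (g * loc j l)%g.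

Lemma same_coset_refl j g : same_coset j g g.
Proof. by exists 1%g; rewrite hom1 mulg1. Qed.

Lemma same_coset_sym j g h : same_coset j g h -> same_coset j h g.
Proof. by move=> [l ->]; exists (l^-1)%g; rewrite -mulgA -gmulfM mulgV hom1 mulg1. Qed.

Lemma same_coset_trans j g h k : same_coset j g h -> same_coset j h k -> same_coset j g k.
Proof. by move=> [l ->] [l' ->]; exists (l * l')%g; rewrite gmulfM mulgA. Qed.

Lemma same_coset_mul j x g h : same_coset j g h -> same_coset j (x * g)%g (x * h)%g.
Proof. by move=> [l ->]; exists l; rewrite mulgA. Qed.

Definition coset_rep j g : G := xget 1%g [set h | same_coset j g h].

Lemma coset_repP j g : same_coset j g (coset_rep j g).
Proof.
rewrite /coset_rep; case: xgetP => [h -> //|/(_ g)]; last by move=> []; exact: same_coset_refl.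
Qed.

Lemma coset_rep_eq j g h : same_coset j g h -> coset_rep j g = coset_rep j h.
Proof.
move=> gh; congr xget; apply/funext => k; apply/propext; split.
  exact/same_coset_trans/same_coset_sym.
exact: same_coset_trans.
Qed.

(** A coset is encoded by its type and a canonical representative, so that cosets inherit a choice
    structure and can be elements of finite sets. *)
Definition cosets : Type := {p : J * G | coset_rep p.1 p.2 == p.2}.
HB.instance Definition _ := Choice.on cosets.

Lemma mk_coset_proof j g : coset_rep (j, coset_rep j g).1 (j, coset_rep j g).2
  == (j, coset_rep j g).2.
Proof. by apply/eqP => /=; apply/esym/coset_rep_eq/coset_repP. Qed.

Definition mk_coset j g : cosets := exist _ (j, coset_rep j g) (mk_coset_proof j g).

Definition ty (w : cosets) : J := (sval w).1.
Definition rp (w : cosets) : G := (sval w).2.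

Lemma mk_coset_rp w : mk_coset (ty w) (rp w) = w.
Proof. by apply: val_inj; case: w => -[j g] h; rewrite /ty /rp /=; congr pair; apply/eqP. Qed.

Lemma mk_coset_eq j g h : mk_coset j g = mk_coset j h <-> same_coset j g h.
Proof.
split=> [[e]|/coset_rep_eq h']; last by apply: val_inj; rewrite /= h'.
apply: same_coset_trans (coset_repP j g) _; rewrite e.
exact/same_coset_sym/coset_repP.
Qed.

Lemma mk_coset_inj j g j' g' : mk_coset j g = mk_coset j' g' -> j = j' /\ same_coset j g g'.
Proof. by move=> e; have jj : j = j' := congr1 ty e; subst j'; split=> //; apply/mk_coset_eq. Qed.

Definition fib (w : cosets) (x : G) : Prop := mk_coset (ty w) x = w.

Definition iota (w : cosets) (a : L (ty w)) : G := (rp w * loc (ty w) a)%g.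

Lemma fib_iota w (a : L (ty w)) : fib w (iota a).
Proof.
rewrite /fib -[RHS]mk_coset_rp; apply/mk_coset_eq/same_coset_sym; by exists a.
Qed.

Lemma fibP w x : fib w x -> exists a : L (ty w), x = iota a.
Proof. by rewrite /fib -{2}(mk_coset_rp w) => /mk_coset_eq/same_coset_sym. Qed.

Definition act g (w : cosets) : cosets := mk_coset (ty w) (g * rp w)%g.

Lemma act_mk g j h : act g (mk_coset j h) = mk_coset j (g * h)%g.
Proof. by apply/mk_coset_eq/same_coset_mul/same_coset_sym/coset_repP. Qed.

Lemma act1 w : act 1%g w = w.
Proof. by rewrite -(mk_coset_rp w) act_mk mul1g. Qed.

Lemma actM g h w : act (g * h)%g w = act g (act h w).
Proof. by rewrite -(mk_coset_rp w) !act_mk mulgA. Qed.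

Lemma actK g w : act g (act g^-1%g w) = w.
Proof. by rewrite -actM mulgV act1. Qed.

Lemma actKV g w : act g^-1%g (act g w) = w.
Proof. by rewrite -actM mulVg act1. Qed.

Lemma act_inj g : injective (act g).
Proof. by move=> v w e; rewrite -(actKV g v) e actKV. Qed.

Lemma fib_act g w x : fib w x -> fib (act g w) (g * x)%g.
Proof. by rewrite /fib => e; rewrite -{2}e act_mk. Qed.

Definition dA (w : cosets) : L (ty w) -> L (ty w) -> nat := @dL (ty w).
Let near := near d iota.
Let near_all := near_all d iota.

Lemma nearP C x w : near C x w <-> exists2 y, fib w y & d x y <= C.
Proof.
split=> [[a h]|[y /fibP[a ->] h]]; last by exists a.
by exists (iota a) => //; apply: fib_iota.
Qed.

Lemma near_act g C x w : near C x w -> near C (g * x)%g (act g w).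
Proof.
move=> /nearP [y fy xy]; apply/nearP; exists (g * y)%g; first exact: fib_act.
by rewrite dM.
Qed.

Lemma near_act1 C x w : near C x w -> near C 1%g (act x^-1%g w).
Proof. by move/(near_act x^-1%g); rewrite mulVg. Qed.

(** Balls and [J] are finite, so up to translation only finitely many cosets come close to a point.
    Many uniform constants below come from this. *)
Lemma near_finite C : exists F : seq cosets, forall x w, near C x w -> act x^-1%g w \in F.
Proof.
have [b hb] := wd_ball hS C.
exists [seq mk_coset j g | j <- enum J, g <- b] => x w /near_act1 /nearP [y fy dy].
by rewrite -fy; apply: allpairs_f; [rewrite mem_enum|apply: hb].
Qed.

Lemma iota_lip w (a b : L (ty w)) : d (iota a) (iota b) <= 1 * dA a b.
Proof.
rewrite mul1n /iota dM /dA /dL.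
have [d0 dg] := wd_geodesic (@hSL (ty w)).
move: {2 3}(wd (@hSL (ty w)) a b) (erefl (wd (@hSL (ty w)) a b)) => n.
elim: n a => [|n IH] a e; first by rewrite (d0 _ _ e) dxx.
have [|z [az zb]] := dg a b 1; first by rewrite e.
have := IH z ltac:(lia); have := dT (loc _ a) (loc _ z) (loc _ b).
suff : d (loc (ty w) a) (loc (ty w) z) <= 1 by lia.
have : wd (@hSL (ty w)) a z <= 1 by rewrite az.
move/graph_dist_le1 => [->|[s hs [->|->]]]; first by rewrite dxx.
- by rewrite gmulfM -{1}(mulg1 (loc _ a)) dM; apply/wd_gen/loc_gen.
- by rewrite dC gmulfM -{1}(mulg1 (loc _ z)) dM; apply/wd_gen/loc_gen.
Qed.

Lemma rho_ex : exists rho, {homo rho : x y / x <= y} /\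
  forall l w (a b : L (ty w)), d (iota a) (iota b) <= l -> dA a b <= rho l.
Proof.
have [||rho [h1 h2]] := @mono_bound (fun l q => forall j (a b : L j),
    d (loc j a) (loc j b) <= l -> dL a b <= q).
- by move=> l p p' pp h j a b /h; lia.
- move=> l; have [bl hb] := wd_ball hS l.
  have [||c hc] := @finite_bound _ (enum J) (fun j q => forall a b : L j,
    d (loc j a) (loc j b) <= l -> dL a b <= q).
  + by move=> j p p' pp h a b /h; lia.
  + move=> j _; have [||c hc] := @finite_bound _ bl (fun g q => forall a : L j,
        loc j a = g -> dL 1%g a <= q).
    * by move=> g p p' pp h a /h; lia.
    * move=> g _; have [[a <-]|no] := pselect (exists a, loc j a = g).
        by exists (dL 1%g a) => a' /loc_inj ->.
      by exists 0 => a e; case: no; exists a.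
    exists c => a b; rewrite /d /dL wd_1 [X in _ -> X <= _]wd_1 => /hb h.
    by apply: (hc _ h); rewrite gmulfM homV.
  by exists c => j a b; apply: hc; rewrite mem_enum.
exists rho; split=> // l w a b; rewrite /iota dM; exact: h2.
Qed.

Lemma cosets_cover x y : d x y <= 1 -> exists v, near 1 x v /\ near 1 y v.
Proof.
move=> xy; exists (mk_coset j0 x); split; apply/nearP; exists x; rewrite /fib ?dxx //.
by rewrite dC.
Qed.

(** By [near_finite] only finitely many pairs [(D, v)] occur up to translation, and for each of them
    one point [y] is enough. *)
Lemma thickening C c : exists p, forall (D : {fset cosets}) v x, v \in D ->
  near_all c x D -> (exists a : L (ty v), near_all C (iota a) D) ->
  exists2 a : L (ty v), near_all C (iota a) D & d x (iota a) <= p.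
Proof.
have [F hF] := near_finite c.
pose P (Dv : {fset cosets} * cosets) p := (exists2 y, fib Dv.2 y & near_all C y Dv.1) ->
  exists y, [/\ fib Dv.2 y, near_all C y Dv.1 & d 1%g y <= p].
have [||p hp] := @finite_bound _
    [seq (D, v) | D <- enum_fset (fpowerset [fset v in F]%fset), v <- F] P.
- by move=> t p p' pp h /h [y [h1 h2 h3]]; exists y; split=> //; lia.
- move=> t _; have [[y h1 h2]|no] := pselect (exists2 y, fib t.2 y & near_all C y t.1).
    by exists (d 1%g y) => _; exists y.
  by exists 0 => /no.
exists p => D v x vD hx [a ha].
have tr (y g : G) (D' : {fset cosets}) : near_all C y D' ->
    near_all C (g * y)%g [fset act g w | w in D']%fset.
  by move=> h w /imfsetP[/= u uD ->]; apply/near_act/h.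
have := hp ([fset act x^-1%g w | w in D]%fset, act x^-1%g v).
move=> /(_ _)/wrap[|h].
  apply: allpairs_f; last by apply: hF; apply: hx.
  rewrite -[_ \in _]/(_ \in fpowerset _) fpowersetE; apply/fsubsetP => w /imfsetP[/= u uD ->].
  by rewrite !inE; apply/hF/hx.
have [|y [fy ny dy]] := h.
  by exists (x^-1 * iota a)%g; [apply/fib_act/fib_iota|apply: tr].
have /= fy' := fib_act x fy; rewrite actK in fy'.
have [a' ea] := fibP fy'; exists a'; rewrite -ea.
  move=> w wD; have := near_act x (ny (act x^-1%g w) _); rewrite actK; apply.
  exact: in_imfset.
by rewrite -{1}(mulg1 x) dM.
Qed.

Hypothesis adj_unique : forall e g e' g',
  mk_coset (src e) (g * ks e)%g = mk_coset (src e') (g' * ks e')%g ->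
  mk_coset (tgt e) (g * kt e)%g = mk_coset (tgt e') (g' * kt e')%g ->
  exists2 l : LE e, e' = e & g' = (g * locE e l)%g.

Definition adj v w : Prop := exists e g,
  v = mk_coset (src e) (g * ks e)%g /\ w = mk_coset (tgt e) (g * kt e)%g.

(** Up to translation finitely many pairs of fibres come near [x], and by [adj_unique] the edges
    with given ends differ by elements of the edge group. *)
Lemma edge_near C : exists C', forall e g x, near C x (mk_coset (src e) (g * ks e)%g) ->
  near C x (mk_coset (tgt e) (g * kt e)%g) ->
  exists l : LE e, d x (g * locE e l)%g <= C'.
Proof.
have [F hF] := near_finite C.
pose P (vw : cosets * cosets) p := forall e g, vw.1 = mk_coset (src e) (g * ks e)%g ->
  vw.2 = mk_coset (tgt e) (g * kt e)%g -> exists l : LE e, d 1%g (g * locE e l)%g <= p.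
have [||p hp] := @finite_bound _ [seq (v, w) | v <- F, w <- F] P.
- by move=> t p p' pp h e g h1 h2; have [l hl] := h e g h1 h2; exists l; lia.
- move=> [v w] _; have [[e [g [ev ew]]]|no] := pselect (adj v w); last first.
    by exists 0 => e g h1 h2; case: no; exists e, g.
  exists (d 1%g g) => e' g'; rewrite /= ev ew => h1 h2.
  have [l ee eg] := adj_unique (esym h1) (esym h2).
  by subst e; exists l; rewrite -eg.
exists p => e g x h1 h2; have := hp (_, _) (allpairs_f _ (hF _ _ h1) (hF _ _ h2)) e (x^-1 * g)%g.
rewrite /= !act_mk !mulgA => /(_ erefl erefl) [l hl]; exists l.
by rewrite -(dM x^-1%g) mulVg mulgA.
Qed.

(** A geodesic of the edge group between points near the two ends is a quasi-geodesic in both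
    fibres, which therefore fellow-travel along it. Away from the ends the distance is controlled by
    [delta] and [q] alone; [r] only enters the required depth [T]. *)
Lemma edge_transport_mid : exists c0, forall r, exists T,
  forall e g (a b m : L (src e)) (a' b' : L (tgt e)),
  let v := mk_coset (src e) (g * ks e)%g in let w := mk_coset (tgt e) (g * kt e)%g in
  d (@iota v a) (@iota w a') <= r -> d (@iota v b) (@iota w b') <= r ->
  between (@dL (src e)) a b m -> T <= dL a m -> T <= dL m b ->
  exists2 m', between (@dL (tgt e)) a' b' m' & d (@iota v m) (@iota w m') <= c0.
Proof.
have [kap hk] := morse delta q.
have [rho [rho_mono hrho]] := rho_ex.
pose c0 := 6 * delta + 2 * kap + 2.
exists c0 => r; have [C' hC'] := edge_near r.
pose e0 := rho (r + C' + 1).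
exists (e0 + 2 * delta + 1 + rho (c0 + (e0 + 2 * delta) + r + C' + 1 + 1)).
move=> e g a b m a' b' v w haa hbb hm am mb.
have rv : rp v = coset_rep (src e) (g * ks e)%g by [].
have rw : rp w = coset_rep (tgt e) (g * kt e)%g by [].
have [l0 hl0] := coset_repP (src e) (g * ks e)%g; rewrite -rv in hl0.
have [l1 hl1] := coset_repP (tgt e) (g * kt e)%g; rewrite -rw in hl1.
pose fa l : L (src e) := (l0^-1 * al e l)%g.
pose fb l : L (tgt e) := (l1^-1 * be e l)%g.
have fa1 l : d (g * locE e l)%g (@iota v (fa l)) <= 1.
  have -> : @iota v (fa l) = (g * locE e l * ks e)%g.
    rewrite /iota hl0 /fa gmulfM homV -[RHS]mulgA ks_comm.
    by rewrite -!mulgA; congr (_ * (_ * _))%g; rewrite mulgA mulgV mul1g.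
  by rewrite -{1}(mulg1 (g * _)%g) dM.
have fb1 l : d (g * locE e l)%g (@iota w (fb l)) <= 1.
  have -> : @iota w (fb l) = (g * locE e l * kt e)%g.
    rewrite /iota hl1 /fb gmulfM homV -[RHS]mulgA kt_comm.
    by rewrite -!mulgA; congr (_ * (_ * _))%g; rewrite mulgA mulgV mul1g.
  by rewrite -{1}(mulg1 (g * _)%g) dM.
have nv (x : L (src e)) : near r (@iota v x) v by exists x; rewrite dxx.
have nw (x : L (src e)) (x' : L (tgt e)) : d (@iota v x) (@iota w x') <= r -> near r (@iota v x) w.
  by exists x'.
have [la hla] := hC' _ _ _ (nv a) (nw _ _ haa); have [lb hlb] := hC' _ _ _ (nv b) (nw _ _ hbb).
have vle (x y : L (src e)) : d (@iota v x) (@iota v y) <= @dL (src e) x y.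
  by have := @iota_lip v x y; rewrite mul1n.
have wle (x y : L (tgt e)) : d (@iota w x) (@iota w y) <= @dL (tgt e) x y.
  by have := @iota_lip w x y; rewrite mul1n.
have pa : dL a (fa la) <= e0.
  by apply: (hrho _ v); have := dT (@iota v a) (g * locE e la)%g (@iota v (fa la)); have := fa1 la; lia.
have pb : dL b (fa lb) <= e0.
  by apply: (hrho _ v); have := dT (@iota v b) (g * locE e lb)%g (@iota v (fa lb)); have := fa1 lb; lia.
have pa' : dL (fb la) a' <= e0.
  apply: (hrho _ w); have := dT (@iota w (fb la)) (g * locE e la)%g (@iota w a').
  have := dT (g * locE e la)%g (@iota v a) (@iota w a'); have := fb1 la.
  have := dC (@iota v a) (g * locE e la)%g; have := dC (@iota w (fb la)) (g * locE e la)%g; lia.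
have pb' : dL (fb lb) b' <= e0.
  apply: (hrho _ w); have := dT (@iota w (fb lb)) (g * locE e lb)%g (@iota w b').
  have := dT (g * locE e lb)%g (@iota v b) (@iota w b'); have := fb1 lb.
  have := dC (@iota v b) (g * locE e lb)%g; have := dC (@iota w (fb lb)) (g * locE e lb)%g; lia.
have EP : pmetric (@dE e) := wd_pmetric _.
have EG : dgeodesic (@dE e) := wd_geodesic _.
have [z [z0 zn hz]] := dpath_ex EP EG la lb.
have VP : pmetric (@dL (src e)) := wd_pmetric _.
have VG : dgeodesic (@dL (src e)) := wd_geodesic _.
have WP : pmetric (@dL (tgt e)) := wd_pmetric _.
have WG : dgeodesic (@dL (tgt e)) := wd_geodesic _.
have [m1 hm1 dm1] := @quad_mid _ (@dL (src e)) VP _ _ _ _ _ _ _ (@dL_thin _) pa pb hm ltac:(lia) ltac:(lia).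
have [g1 [g10 g1n hg1]] := dpath_ex VP VG (fa la) (fa lb).
have [g2 [g20 g2n hg2]] := dpath_ex WP WG (fb la) (fb lb).
have qia x y : dL (fa x) (fa y) <= q * dE x y /\ dE x y <= q * dL (fa x) (fa y) + q.
  by rewrite /fa /dL wd_mul; apply: al_qi.
have qib x y : dL (fb x) (fb y) <= q * dE x y /\ dE x y <= q * dL (fb x) (fb y) + q.
  by rewrite /fb /dL wd_mul; apply: be_qi.
have [near1 _] := hk _ _ _ _ fa VP VG (@dL_thin _) qia _ _ _ _ hz hg1
  ltac:(by rewrite g10 z0) ltac:(by rewrite g1n zn).
have [_ near2] := hk _ _ _ _ fb WP WG (@dL_thin _) qib _ _ _ _ hz hg2
  ltac:(by rewrite g20 z0) ltac:(by rewrite g2n zn).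
rewrite -g10 -g1n in hm1.
have [j hj dj] := between_dpath_near VP (@dL_thin _) hg1 hm1.
have [i hi di] := near1 j hj; have [k hk' dk] := near2 i hi.
have hm2 : between (@dL (tgt e)) (fb la) (fb lb) (g2 k).
  by rewrite -g20 -g2n; apply: (dpath_between hg2); lia.
have [vxx vC vT] := VP.
have c1 : d (@iota v m) (@iota w (g2 k)) <= 4 * delta + 2 * kap + 2.
  have := vle m (fa (z i)); have := vT m m1 (fa (z i)); have := vT m1 (g1 j) (fa (z i)).
  have := wle (fb (z i)) (g2 k); have := fa1 (z i); have := fb1 (z i).
  have := dT (@iota v m) (@iota v (fa (z i))) (@iota w (g2 k)).
  have := dT (@iota v (fa (z i))) (g * locE e (z i))%g (@iota w (g2 k)).
  have := dT (g * locE e (z i))%g (@iota w (fb (z i))) (@iota w (g2 k)).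
  have := dC (@iota v (fa (z i))) (g * locE e (z i))%g; lia.
(* If [g2 k] were near an end, then so would be [m], against the choice of [T]; hence [quad_mid]
   applies in the second fibre too. *)
have deep (x : L (src e)) x' lx : dL x (fa lx) <= e0 -> d (@iota v x) (g * locE e lx)%g <= C' ->
    e0 + 2 * delta + 1 + rho (c0 + (e0 + 2 * delta) + r + C' + 1 + 1) <= dL x m ->
    dL (fb lx) (g2 k) <= x' -> x' <= e0 + 2 * delta -> False.
  move=> h1 h2 h3 h4 h5; have : dL x m <= rho (c0 + (e0 + 2 * delta) + r + C' + 1 + 1).
    apply: (hrho _ v); have := wle (fb lx) (g2 k); have := fb1 lx.
    have := dT (@iota v x) (g * locE e lx)%g (@iota v m).
    have := dT (g * locE e lx)%g (@iota w (fb lx)) (@iota v m).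
    have := dT (@iota w (fb lx)) (@iota w (g2 k)) (@iota v m).
    have := dC (@iota v m) (@iota w (g2 k)); rewrite /c0; lia.
  lia.
have [wxx wC wT] := WP.
have [||m' hm' dm'] := @quad_mid _ (@dL (tgt e)) WP _ _ _ _ _ _ _ (@dL_thin _) pa' pb' hm2.
- rewrite ltnNge; apply/negP => h; apply: (deep a _ la pa hla am (leqnn _)); lia.
- rewrite ltnNge; apply/negP => h; rewrite vC in mb; rewrite wC in h.
  by apply: (deep b _ lb pb hlb mb (leqnn _)); lia.
exists m' => //; have := wle (g2 k) m'.
by have := dT (@iota v m) (@iota w (g2 k)) (@iota w m'); rewrite /c0; lia.
Qed.

(** Points within [T] of an end are simply sent to the corresponding end. *)
Lemma edge_transport C : exists c, forall v w, adj v w ->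
  forall (a b m : L (ty v)) (a' b' : L (ty w)),
  d (iota a) (iota a') <= C -> d (iota b) (iota b') <= C -> between (@dA v) a b m ->
  exists2 m', between (@dA w) a' b' m' & d (iota m) (iota m') <= c.
Proof.
have [c0 hc0] := edge_transport_mid; have [T hT] := hc0 C.
exists (c0 + T + C) => v w [e [g [-> ->]]] a b m a' b' haa hbb hm.
set w1 := mk_coset (tgt e) (g * kt e)%g in a' b' haa hbb *.
set v1 := mk_coset (src e) (g * ks e)%g in a b m haa hbb hm *.
have [WP [_ wC _]] : pmetric (@dA w1) /\ pmetric (@dA w1) by split; apply: wd_pmetric.
have lip (x y : L (ty v1)) : d (iota x) (iota y) <= dA x y by have := @iota_lip v1 x y; rewrite mul1n.
have [am|ma] := leqP T (dA a m); last first.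
  exists a'; first exact: (between_l WP).
  have := lip a m; have := dT (iota m) (iota a) (iota a'); have := dC (iota m) (iota a); lia.
have [mb|bm] := leqP T (dA m b); last first.
  exists b'; first exact: (between_r WP).
  have := lip m b; have := dT (iota m) (iota b) (iota b'); lia.
have [m' h1 h2] := hT e g a b m a' b' haa hbb hm am mb.
by exists m' => //; apply: leq_trans h2 _; rewrite -addnA leq_addr.
Qed.

Fixpoint adj_path v (l : seq cosets) : Prop :=
  if l is w :: l' then adj v w /\ adj_path w l' else True.

Lemma adj_act g v w : adj v w -> adj (act g v) (act g w).
Proof. by move=> [e [h [-> ->]]]; exists e, (g * h)%g; rewrite !act_mk !mulgA. Qed.

Lemma adj_path_act g v l : adj_path v l -> adj_path (act g v) (map (act g) l).
Proof. by elim: l v => [|w l IH] v //= [h /IH]; split=> //; apply: adj_act. Qed.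

Lemma path_transport k C : exists c, forall l v, size l <= k -> adj_path v l ->
  forall (a b m : L (ty v)) (a' b' : L (ty (last v l))),
  (forall u, u \in l -> near C (iota a) u /\ near C (iota b) u) ->
  d (iota a) (iota a') <= C -> d (iota b) (iota b') <= C -> between (@dA v) a b m ->
  exists2 m', between (@dA (last v l)) a' b' m' & d (iota m) (iota m') <= c.
Proof.
have [rho [rho_mono hrho]] := rho_ex.
have base C' v (a b m a' b' : L (ty v)) : d (iota a) (iota a') <= C' ->
    d (iota b) (iota b') <= C' -> between (@dA v) a b m ->
    exists2 m', between (@dA v) a' b' m' & d (iota m) (iota m') <= 2 * delta + rho C'.
  move=> aa bb hm; have VP : pmetric (@dA v) := wd_pmetric _.
  have [m' h1 h2] := quad_near VP (@dL_thin _) (hrho _ _ _ _ aa) (hrho _ _ _ _ bb) hm.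
  by exists m' => //; have := @iota_lip v m m'; rewrite mul1n; lia.
elim: k C => [|k IH] C.
  by exists (2 * delta + rho C) => -[|//] v _ _ a b m a' b' _; apply: base.
have [c1 hc1] := edge_transport C; have [c2 hc2] := IH (C + C).
exists (2 * delta + rho C + c1 + c2) => -[|u l] v sl /=.
  move=> _ a b m a' b' _ aa bb hm; have [m' h1 h2] := base C v a b m a' b' aa bb hm.
  by exists m' => //; lia.
move=> [vu ul] a b m a' b' hn aa bb hm.
have [[a1 ha1] [b1 hb1]] := hn u (mem_head _ _).
have [m1 hm1 dm1] := hc1 v u vu a b m a1 b1 ha1 hb1 hm.
have mv (x y z : G) : d x y <= C -> d x z <= C -> d y z <= C + C.
  by move=> h1 h2; have := dT y x z; have := dC x y; lia.
have [|||m' h1 h2] := hc2 l u sl ul a1 b1 m1 a' b' _ _ _ hm1.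
- move=> u' hu'; have [[x hx] [y hy]] := hn u' ltac:(by rewrite inE hu' orbT).
  by split; [exists x|exists y]; apply: mv; eassumption.
- exact: mv ha1 aa.
- exact: mv hb1 bb.
by exists m' => //; have := dT (iota m) (iota m1) (iota m'); lia.
Qed.

Definition pair_stab_finite v w : Prop :=
  exists s : seq G, forall g, act g v = v -> act g w = w -> g \in s.

Variable N : nat.
Hypothesis chain_ex : forall v w, exists l, [/\ adj_path v l, last v l = w,
  forall g, act g v = v -> act g w = w -> forall u, u \in l -> act g u = u &
  ~ pair_stab_finite v w -> size l <= N].

(** The elements fixing [v] and [w] fix the chain between them. So one chain for each of the
    finitely many pairs near [1] suffices, and its translates do not depend on the translating
    element, only on the translated pair. *)
Lemma chain_near C : exists k C', forall v w, (exists x, near C x v /\ near C x w) ->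
  exists l, [/\ adj_path v l, last v l = w, size l <= k & forall x, near C x v ->
    near C x w -> forall u, u \in l -> near C' x u].
Proof.
have [F hF] := near_finite C.
have ex (p : cosets * cosets) : exists l, [/\ adj_path p.1 l, last p.1 l = p.2 &
  forall g, act g p.1 = p.1 -> act g p.2 = p.2 -> forall u, u \in l -> act g u = u].
  by have [l [h1 h2 h3 _]] := chain_ex p.1 p.2; exists l.
have [ch hch] := choice ex.
pose FF := [seq (v, w) | v <- F, w <- F].
pose P p n := size (ch p) <= n /\ forall p2 k u, p2 \in FF -> act k p.1 = p2.1 ->
  act k p.2 = p2.2 -> u \in ch p -> near n 1%g (act k u).
have [||n hn] := @finite_bound _ FF P.
- move=> p n n' nn [h1 h2]; split; first lia.
  by move=> p2 k u hp2 e1 e2 hu; apply: near_mono (h2 p2 k u hp2 e1 e2 hu).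
- move=> p _; have [||n hn] := @finite_bound _ [seq (p2, u) | p2 <- FF, u <- ch p]
    (fun t n => forall k, act k p.1 = t.1.1 -> act k p.2 = t.1.2 -> t.2 \in ch p ->
       near n 1%g (act k t.2)).
  + by move=> t n n' nn h k e1 e2 hu; apply: near_mono (h k e1 e2 hu).
  + move=> [p2 u] _ /=; have [[k0 [e1 [e2 hu]]]|no] := pselect (exists k, act k p.1 = p2.1 /\
        act k p.2 = p2.2 /\ u \in ch p); last first.
      by exists 0 => k e1 e2 hu; case: no; exists k.
    exists (d 1%g (rp (act k0 u))) => k f1 f2 _.
    have -> : act k u = act k0 u.
      have [_ _ fx] := hch p; have := fx (k0^-1 * k)%g; rewrite !actM f1 f2 -e1 -e2 !actKV.
      by move=> /(_ erefl erefl u hu); rewrite actM => /(congr1 (act k0)); rewrite actK.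
    by apply/nearP; exists (rp (act k0 u)) => //; apply: mk_coset_rp.
  exists (maxn n (size (ch p))); split; first by rewrite leq_maxr.
  move=> p2 k u hp2 e1 e2 hu; apply: (near_mono (leq_maxl _ _)).
  by apply: (hn (p2, u)) => //; apply: allpairs_f.
exists n, n => v w [x0 [xv xw]].
set p := (act x0^-1%g v, act x0^-1%g w).
have pF : p \in FF by apply: allpairs_f; apply: hF.
have [sz hnear] := hn p pF; have [c1 c2 _] := hch p.
exists (map (act x0) (ch p)); split.
- by have := adj_path_act x0 c1; rewrite /= actK.
- by rewrite -{1}(actK x0 v) last_map c2 /= actK.
- by rewrite size_map.
- move=> x hv hw _ /mapP[u hu ->].
  have := hnear (act x^-1%g v, act x^-1%g w) (x^-1 * x0)%g u.
  rewrite /= !actM !actK => /(_ (allpairs_f _ (hF _ _ hv) (hF _ _ hw)) erefl erefl hu).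
  by move/(near_act x); rewrite mulg1 actK.
Qed.

Lemma transport C : exists c, forall v w (a b m : L (ty v)) (a' b' : L (ty w)),
  d (iota a) (iota a') <= C -> d (iota b) (iota b') <= C -> between (@dA v) a b m ->
  exists2 m', between (@dA w) a' b' m' & d (iota m) (iota m') <= c.
Proof.
have [k [C' hch]] := chain_near C; have [c hc] := path_transport k (C + C').
exists c => v w a b m a' b' aa bb hm.
have nv (x : L (ty v)) : near C (iota x) v by exists x; rewrite dxx.
have na : near C (iota a) w by exists a'.
have nb : near C (iota b) w by exists b'.
have [l [lp ll sl hl]] := hch v w ltac:(by exists (iota a)).
subst w; apply: (hc l v sl lp a b m a' b' _ (leq_trans aa (leq_addr _ _))
  (leq_trans bb (leq_addr _ _)) hm).
move=> u hu; split; apply: (near_mono (leq_addl C C')); exact: hl.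
Qed.

Definition stab_finite (D : {fset cosets}) : Prop :=
  exists s : seq G, forall g, (forall u, u \in D -> act g u = u) -> g \in s.

(** An element [gam] of the stabilizer that moves [rp v] far away gives a long geodesic in the fibre
    of [v], and a deep point of it is transported to every fibre of [D] through at most [N] edges.
    So all fibres of [D] pass within [N * c0] of one point. The depth needed depends on [D], but
    [N * c0] does not. *)
Lemma infinite_stab_card : exists n, forall D : {fset cosets}, ~ stab_finite D ->
  #|` D|%fset <= n.
Proof.
have [c0 hc0] := edge_transport_mid; have [F hF] := near_finite (N * c0).
have [rho [rho_mono hrho]] := rho_ex.
exists (size F) => D nD.
have [->|/fset0Pn [v vD]] := eqVneq D fset0; first by rewrite cardfs0.
have exl w : exists l, w \in D -> [/\ adj_path v l, last v l = w, size l <= N &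
    forall g, (forall u, u \in D -> act g u = u) -> forall u, u \in l -> act g u = u].
  have [wD|nw] := boolP (w \in D); last by exists [::].
  have [l [h1 h2 h3 h4]] := chain_ex v w; exists l => _; split=> //.
    by apply: h4 => -[s hs]; apply: nD; exists s => g hg; apply: hs; apply: hg.
  by move=> g hg; apply: h3; apply: hg.
have [ch hch] := choice exl.
pose U := v :: flatten [seq ch w | w <- enum_fset D].
have [||r hr] := @finite_bound _ U (fun u n => d (rp v) (rp u) <= n).
- by move=> t n n' nn h; lia.
- by move=> u _; exists (d (rp v) (rp u)).
have [T hT] := hc0 (r + r).
pose M := rho (T + r + N * c0).
have i1 u : @iota u 1%g = rp u by rewrite /iota hom1 mulg1.
have [gam [b [hgam hb far]]] : exists gam b, [/\ forall u, u \in D -> act gam u = u,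
    @iota v b = (gam * rp v)%g & 2 * M.+1 <= dA 1%g b].
  apply: contrapT => no; apply: nD; have [bl hbl] := wd_ball hS (2 * M.+1).
  exists [seq (rp v * x * (rp v)^-1)%g | x <- bl] => g hg.
  have fg : fib v (g * rp v)%g.
    by rewrite -{1}(hg v vD); apply: fib_act; apply: mk_coset_rp.
  have [b eb] := fibP fg; have [le|gt] := leqP (2 * M.+1) (dA 1%g b).
    by case: no; exists g, b.
  apply/mapP; exists ((rp v)^-1 * (g * rp v))%g; last by rewrite mulgA mulgV mul1g mulgK.
  apply: hbl; rewrite -[wd _ _ _]/(d _ _) -(dM (rp v)) mulg1 mulgA mulgV mul1g eb -i1.
  by have := @iota_lip v 1%g b; rewrite mul1n; lia.
have VP : pmetric (@dA v) := wd_pmetric _.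
have VG : dgeodesic (@dA v) := wd_geodesic _.
have [m hm m1] := between_at VG (k := M.+1) ltac:(lia) (x := 1%g) (y := b).
have deep1 : T + r + N * c0 < d (rp v) (iota m).
  rewrite ltnNge; apply/negP => h; rewrite -i1 in h; have := hrho _ _ _ _ h; rewrite -/M; lia.
have deep2 : T + r + N * c0 < d (gam * rp v)%g (iota m).
  rewrite ltnNge; apply/negP => h; rewrite -hb in h; have := hrho _ _ _ _ h; rewrite -/M.
  have [_ aC _] := VP; rewrite aC; move: hm; rewrite /between; lia.
have key l u (a' b' m' : L (ty u)) : adj_path u l -> u \in U ->
    {in l, forall u', u' \in U /\ act gam u' = u'} ->
    iota a' = rp u -> iota b' = (gam * rp u)%g -> between (@dA u) a' b' m' ->
    T + r + size l * c0 < d (rp v) (iota m') ->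
    T + r + size l * c0 < d (gam * rp v)%g (iota m') ->
    near (size l * c0) (iota m') (last u l).
  elim: l u a' b' m' => [|w l IH] u a' b' m' /=; first by move=> *; exists m'; rewrite dxx.
  move=> [uw wl] uU hl ea eb hm' d1 d2.
  have [wU gw] := hl w (mem_head _ _).
  have fw : fib w (gam * rp w)%g by rewrite -{1}gw; apply: fib_act; apply: mk_coset_rp.
  have [b2 eb2] := fibP fw.
  have ru := hr u uU; have rw := hr w wU.
  have duw : d (rp u) (rp w) <= r + r.
    by have := dT (rp u) (rp v) (rp w); have := dC (rp u) (rp v); lia.
  have lip (x y : L (ty u)) : d (iota x) (iota y) <= dA x y by have := @iota_lip u x y; rewrite mul1n.
  have [m2 hm2 dm2] : exists2 m2, between (@dA w) 1%g b2 m2 & d (iota m') (iota m2) <= c0.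
    have lipa := lip a' m'; have lipb := lip m' b'; rewrite ea in lipa; rewrite eb in lipb.
    have T1 : T <= dA a' m' by have := dT (rp v) (rp u) (iota m'); lia.
    have T2 : T <= dA m' b'.
      have := dT (gam * rp v)%g (gam * rp u)%g (iota m'); rewrite dM.
      by have := dC (iota m') (gam * rp u)%g; lia.
    have d3 : d (iota a') (@iota w 1%g) <= r + r by rewrite ea i1.
    have d4 : d (iota b') (iota b2) <= r + r by rewrite eb -eb2 dM.
    case: uw => e [g [eu ew]]; clear -hT eu ew T1 T2 d3 d4 hm'.
    by subst u w; apply: (hT e g a' b' m').
  have := IH w 1%g b2 m2 wl wU _ (i1 w) (esym eb2) hm2.
  have d5 : T + r + size l * c0 < d (rp v) (iota m2).
    by have := dT (rp v) (iota m2) (iota m'); have := dC (iota m2) (iota m'); rewrite mulSn in d1; lia.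
  have d6 : T + r + size l * c0 < d (gam * rp v)%g (iota m2).
    by have := dT (gam * rp v)%g (iota m2) (iota m'); have := dC (iota m2) (iota m'); rewrite mulSn in d2; lia.
  move=> /(_ _ d5 d6)/wrap[|[x hx]].
    by move=> u' hu'; apply: hl; rewrite inE hu' orbT.
  by exists x; have := dT (iota m') (iota m2) (iota x); rewrite mulSn; lia.
have hall w : w \in D -> near (N * c0) (iota m) w.
  move=> wD; have [h1 h2 h3 h4] := hch w wD.
  have le : size (ch w) * c0 <= N * c0 by rewrite leq_mul.
  have d1 : T + r + size (ch w) * c0 < d (rp v) (iota m) by lia.
  have d2 : T + r + size (ch w) * c0 < d (gam * rp v)%g (iota m) by lia.
  rewrite -h2; apply: (near_mono le).
  apply: (key _ _ 1%g b _ h1 (mem_head _ _) _ (i1 v) hb hm d1 d2).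
  move=> u hu; split; last exact: h4.
  rewrite inE; apply/orP; right; apply/flattenP; exists (ch w) => //.
  exact: map_f.
have sub : {subset [seq act (iota m)^-1%g w | w <- enum_fset D] <= F}.
  by move=> x /mapP[y yD ->]; apply: hF; exact: (hall y yD).
have := uniq_leq_size _ sub; rewrite size_map; apply.
by rewrite map_inj_uniq ?fset_uniq //; exact: act_inj.
Qed.

(** A set of more than [n] fibres has a finite stabilizer, and only finitely many sets near a point
    occur up to translation. An element keeping such a set near [1] is determined, up to the
    stabilizer, by its finitely many possible actions on the set. *)
Lemma finite_height : exists n, forall C, exists M, forall (D : {fset cosets}) x y,
  n < #|` D|%fset -> near_all C x D -> near_all C y D -> d x y <= M.
Proof.
have [n hn] := infinite_stab_card; exists n => C.
have [F hF] := near_finite C.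
(* [Kl] realizes all actions of inverses of elements on [l] with values in [F]. *)
have reps (l : seq cosets) : exists Kl : seq G, forall k,
    (forall v, v \in l -> act k^-1%g v \in F) ->
    exists2 k0, k0 \in Kl & forall v, v \in l -> act k0^-1%g v = act k^-1%g v.
  elim: l => [|v l [Kl IH]]; first by exists [:: 1%g] => k _; exists 1%g; rewrite ?mem_head.
  have ex (p : G * cosets) : exists k, forall k', (forall u, u \in l ->
      act p.1^-1%g u = act k'^-1%g u) -> act k'^-1%g v = p.2 ->
      forall u, u \in v :: l -> act k^-1%g u = act k'^-1%g u.
    have [[k [h1 h2]]|no] := pselect (exists k, (forall u, u \in l ->
      act p.1^-1%g u = act k^-1%g u) /\ act k^-1%g v = p.2).
      exists k => k' h3 h4 u; rewrite inE => /orP[/eqP ->|ul]; first by rewrite h2 h4.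
      by rewrite -h1 // h3.
    by exists 1%g => k' h1 h2; case: no; exists k'.
  have [kk hkk] := choice ex.
  exists [seq kk (k, f) | k <- Kl, f <- F] => k hk.
  have [|k0 k0l e0] := IH k; first by move=> u ul; apply: hk; rewrite inE ul orbT.
  exists (kk (k0, act k^-1%g v)).
    apply: (allpairs_f (fun k f => kk (k, f))) => //; apply: hk; exact: mem_head.
  by apply: hkk.
pose P (D1 : {fset cosets}) p := n < #|` D1|%fset -> forall k,
  (forall w, w \in D1 -> act k^-1%g w \in F) -> d 1%g k <= p.
have [||p hp] := @finite_bound _ (enum_fset (fpowerset [fset v in F]%fset)) P.
- by move=> t p p' pp h h1 k hk; have := h h1 k hk; lia.
- move=> D1 _; have [big|small] := ltnP n #|` D1|%fset; last by exists 0 => h; lia.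
  have [s hs] : stab_finite D1 by apply: contrapT => /hn; lia.
  have [Kl hKl] := reps (enum_fset D1).
  have [||c hc] := @finite_bound _ [seq (g * k)%g | g <- s, k <- Kl] (fun g c => d 1%g g <= c).
  + by move=> g c c' cc h; lia.
  + by move=> g _; exists (d 1%g g).
  exists c => _ k hk; have [k0 k0l e0] := hKl k hk; apply: hc.
  have -> : k = (k * k0^-1 * k0)%g by rewrite mulgVK.
  apply: allpairs_f k0l; apply: hs => u uD.
  by rewrite actM e0 // actK.
exists p => D x y big hx hy.
have := hp [fset act x^-1%g w | w in D]%fset.
move=> /(_ _)/wrap[|h].
  rewrite -[_ \in _]/(_ \in fpowerset _) fpowersetE; apply/fsubsetP => w /imfsetP[/= u uD ->].
  by rewrite !inE; apply/hF/hx.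
rewrite -[d x y](dM x^-1%g) mulVg; apply: h.
  by rewrite card_imfset //; apply: act_inj.
move=> w /imfsetP[/= u uD ->]; rewrite -actM invgM invgK -mulgA mulgV mulg1.
exact/hF/hy.
Qed.

Let dc := coned (Z := fun v x => near 1 x v) dG cosets_cover.
Variables (delta' r0 : nat).
Hypothesis dc_thin : thin_triangles dc delta'.
Hypothesis filling : forall r, exists N, forall (c : cosets -> cosets -> int) M,
  (forall v1 v2 v3 g, near r0 g v1 -> near r0 g v2 -> near r0 g v3 ->
     absz (c v1 v2 + c v2 v3 - c v1 v3)%R <= M) ->
  forall v l, conear_path d iota v l -> last v l = v -> size l <= r ->
  absz (walk_sum c v l) <= N * M.

Theorem coset_graph_thin : exists delta, thin_triangles d delta.
Proof.
have [n hn] := finite_height; have [rho [rm hrho]] := rho_ex.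
apply: (@global_thin G d cosets (fun w => L (ty w)) dA iota delta 1 n rho dP dG _ _
  (fun v => @dL_thin _) iota_lip (fun v a b l => hrho l v a b) transport hn thickening
  cosets_cover delta' r0 dc_thin filling).
- by move=> v; apply: wd_pmetric.
- by move=> v; apply: wd_geodesic.
Qed.

Theorem coset_graph_fibre_qi : exists c, forall j (a b : L j),
  dL a b <= c * d (loc j a) (loc j b) + c.
Proof.
have [n hn] := finite_height; have [rho [rm hrho]] := rho_ex.
have [||c hc] := @fibre_qi G d cosets (fun w => L (ty w)) dA iota delta 1 n rho dP dG _ _
  (fun v => @dL_thin _) iota_lip (fun v a b l => hrho l v a b) transport hn thickening
  cosets_cover delta' r0 dc_thin filling.
- by move=> v; apply: wd_pmetric.
- by move=> v; apply: wd_geodesic.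
exists c => j a b; have := hc (mk_coset j 1%g) a b; rewrite /iota dM; exact.
Qed.
End CosetGraph.

(** * Gromov products *)

Section GeodesicSpace.
Local Open Scope classical_set_scope.
Local Open Scope ring_scope.
Variables (R : realType) (X : Type) (d : X -> X -> R).
Hypothesis gX : geodesic_space d.

Let d_ge0 x y : 0 <= d x y.
Proof. by have [[h _ _ _] _] := gX. Qed.

Lemma geodesic_left x y c t : geodesic d x y c -> 0 <= t <= d x y ->
  d x (c t) = t.
Proof.
move=> [c0 _ h] /[dup] ht /andP[t0 _]; rewrite -{1}c0 h ?lexx ?d_ge0//.
by rewrite sub0r normrN ger0_norm.
Qed.

Lemma geodesic_right x y c t : geodesic d x y c -> 0 <= t <= d x y ->
  d (c t) y = d x y - t.
Proof.
move=> [_ c1 h] /[dup] ht /andP[_ t1]; rewrite -{1}c1 h ?lexx ?d_ge0//.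
by rewrite distrC ger0_norm // subr_ge0.
Qed.

End GeodesicSpace.

Section GromovProduct.
Local Open Scope classical_set_scope.
Local Open Scope ring_scope.
Variables (R : realType) (X : Type) (d : X -> X -> R).
Hypothesis hyp : hyperbolic d.

Let d_ge0 x y : 0 <= d x y.
Proof. by have [[[h _ _ _] _] _] := hyp. Qed.

Let dC x y : d x y = d y x.
Proof. by have [[[_ _ h _] _] _] := hyp. Qed.

Let dT x y z : d x z <= d x y + d y z.
Proof. by have [[[_ _ _ h] _] _] := hyp. Qed.

Let geod x y : exists c, geodesic d x y c.
Proof. by have [[_ h] _] := hyp. Qed.

Let geodesic_left x y c t : geodesic d x y c -> 0 <= t <= d x y -> d x (c t) = t.
Proof. by apply: geodesic_left; case: hyp. Qed.

Let geodesic_right x y c t : geodesic d x y c -> 0 <= t <= d x y ->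
  d (c t) y = d x y - t.
Proof. by apply: geodesic_right; case: hyp. Qed.

Lemma gromov_product_le_geodesic p x y c t : geodesic d x y c ->
  0 <= t <= d x y -> gromov_product d p x y <= d p (c t).
Proof.
move=> hc ht; have := geodesic_left hc ht; have := geodesic_right hc ht.
have := dT p (c t) x; have := dT p (c t) y; rewrite /gromov_product (dC (c t) x).
lra.
Qed.

Lemma gromov_product_basepoint p q x y :
  gromov_product d p x y - d p q <= gromov_product d q x y.
Proof.
have := dT p q x; have := dT p q y; rewrite /gromov_product; lra.
Qed.

Lemma thin : exists2 k : R, 0 <= k & forall x y z a b c,
    geodesic d x y a -> geodesic d y z b -> geodesic d x z c ->
    forall t, 0 <= t <= d x y ->
      (exists2 s, 0 <= s <= d y z & d (a t) (b s) <= k) \/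
      (exists2 s, 0 <= s <= d x z & d (a t) (c s) <= k).
Proof.
have [_ [k hk]] := hyp; exists (Num.max 0 k); first by rewrite le_max lexx.
move=> x y z a b c ha hb hc t ht.
by have [[s hs hs']|[s hs hs']] := hk _ _ _ _ _ _ ha hb hc _ ht; [left|right];
  exists s => //; rewrite le_max hs' orbT.
Qed.

(** Just below the supremum of the parameters where [c] is close to the geodesic from [x] to [p],
    the geodesic [c] is close to both sides ending at [p], and there the Gromov product is nearly
    the distance to [p]. *)
Lemma geodesic_le_gromov_product : exists k : R, forall p x y c,
  geodesic d x y c -> exists2 t, 0 <= t <= d x y &
    d p (c t) <= gromov_product d p x y + k.
Proof.
have [k k0 hk] := thin; exists (2 * k + 2) => p x y c hc.
have [b hb] := geod y p; have [e he] := geod x p.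
pose A := [set t | 0 <= t <= d x y /\
  exists2 s, 0 <= s <= d x p & d (c t) (e s) <= k].
have A0 : A 0.
  split; first by rewrite lexx d_ge0.
  exists 0; first by rewrite lexx d_ge0.
  case: hc he => c0 _ _ [e0 _ _]; rewrite c0 e0.
  by have [[[_ h _ _] _] _] := hyp; rewrite (h x x).2.
have Aub : has_sup A.
  split; first by exists 0.
  by exists (d x y) => t [/andP[]].
have [t1 A1 ht1] := sup_adherent (ltr01 : 0 < 1 :> R) Aub.
have le1 : t1 <= sup A by apply: ub_le_sup => //; case: Aub.
have [h1 [s1 hs1 hd1]] := A1.
(* One unit further, or at the end [y], the point is beyond the supremum or on the last side, so it
   is close to the geodesic from [y] to [p]. *)
have [t2 [h2 le12 le21 [s2 hs2 hd2]]] : exists t2, [/\ 0 <= t2 <= d x y,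
    t1 <= t2, t2 <= t1 + 1 &
    exists2 s, 0 <= s <= d y p & d (c t2) (b s) <= k].
  have [lt|ge] := ltP (t1 + 1) (d x y).
    exists (t1 + 1); have ht : 0 <= t1 + 1 <= d x y.
      by case/andP: h1 => ? ?; apply/andP; split; lra.
    split=> //; first lra.
    have [//|h] := hk _ _ _ _ _ _ hc hb he _ ht.
    have : t1 + 1 <= sup A by apply: ub_le_sup; [case: Aub|split].
    lra.
  exists (d x y); case/andP: (h1) => ? ?; split=> //; rewrite ?lexx ?d_ge0//.
  exists 0; first by rewrite lexx d_ge0.
  case: hc hb => _ c1 _ [b0 _ _]; rewrite c1 b0.
  by have [[[_ h _ _] _] _] := hyp; rewrite (h y y).2.
exists t1 => //.
have d12 : d (c t1) (c t2) <= 1.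
  by case: hc => _ _ -> //; rewrite ler_norml; apply/andP; split; lra.
have := geodesic_left he hs1; have := geodesic_right he hs1.
have := geodesic_left hb hs2; have := geodesic_right hb hs2.
have := geodesic_left hc h1; have := geodesic_right hc h1.
have := dT (c t1) (e s1) p; have := dT x (e s1) (c t1).
have := dT (c t1) (c t2) (b s2); have := dT (c t1) (b s2) p.
have := dT (c t1) (b s2) y; rewrite /gromov_product.
rewrite (dC (e s1) (c t1)) (dC (b s2) y) (dC p x) (dC p y) (dC p (c t1)).
lra.
Qed.

Lemma gromov_product_ultra : exists k : R, forall p x y z r,
  r <= gromov_product d p x y -> r <= gromov_product d p y z ->
  r - k <= gromov_product d p x z.
Proof.
have [k k0 hk] := thin; have [k' hk'] := geodesic_le_gromov_product.
exists (k + k') => p x y z r hxy hyz.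
have [c hc] := geod x z; have [a ha] := geod x y; have [b hb] := geod z y.
have [t ht hm] := hk' p _ _ _ hc.
have hz : r <= gromov_product d p z y.
  by move: hyz; rewrite /gromov_product (dC z y); lra.
have [[s hs hd]|[s hs hd]] := hk _ _ _ _ _ _ hc hb ha _ ht.
- have := gromov_product_le_geodesic p hb hs; have := dT p (c t) (b s); lra.
- have := gromov_product_le_geodesic p ha hs; have := dT p (c t) (a s); lra.
Qed.

Lemma gromov_close_sym x y : gromov_close d x y -> gromov_close d y x.
Proof.
move=> h p r; have [N hN] := h p r; exists N => i j hi hj.
by have := hN _ _ hj hi; rewrite /gromov_product (dC (y i) (x j)); lra.
Qed.

Lemma gromov_close_trans x y z :
  gromov_close d x y -> gromov_close d y z -> gromov_close d x z.
Proof.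
move=> hxy hyz p r; have [k hk] := gromov_product_ultra.
have [N hN] := hxy p (r + k); have [N' hN'] := hyz p (r + k).
exists (maxn N N') => i j; rewrite !geq_max => /andP[iN iN'] /andP[jN jN'].
have := hk p (x i) (y (maxn N N')) (z j) (r + k).
rewrite addrK; apply; first by apply: hN => //; rewrite leq_maxl.
by apply: hN' => //; rewrite leq_maxr.
Qed.

End GromovProduct.

Section MitraCT.
Local Open Scope classical_set_scope.
Local Open Scope ring_scope.
Variables (R : realType) (Y X : Type) (dY : Y -> Y -> R) (dX : X -> X -> R).
Variable f : Y -> X.
Hypotheses (hY : hyperbolic dY) (hX : hyperbolic dX).
Hypothesis mitra : mitra_criterion dY dX f.

(** Gromov products coarsely measure the distance from a point to a geodesic. In these terms Mitra's
    criterion no longer mentions geodesics and can be read on orbit points. *)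
Lemma mitra_gromov_product y0 (r : R) : exists N : nat, forall x y,
  N%:R <= gromov_product dY y0 x y ->
  r <= gromov_product dX (f y0) (f x) (f y).
Proof.
have [M [_ Moo hM]] := mitra y0; have [k hk] := geodesic_le_gromov_product hX.
have [N _ hN] : \forall N \near \oo, r + k <= M N.
  by move/cvgryPge : Moo; apply.
exists N => x y hxy.
have [[_ gY] _] := hY; have [[_ gX] _] := hX.
have [c hc] := gY x y; have [c' hc'] := gX (f x) (f y).
have [t ht hm] := hk (f y0) _ _ _ hc'.
have : M N <= dX (f y0) (c' t).
  apply: (hM _ _ _ _ hc) hc' _ ht => s hs.
  exact: le_trans hxy (gromov_product_le_geodesic hY _ hc hs).
have := hN N (leqnn N); rewrite /=; lra.
Qed.

End MitraCT.

Section GromovProductCT.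
Local Open Scope classical_set_scope.
Local Open Scope ring_scope.
Variables (R : realType) (Y X : Type) (dY : Y -> Y -> R) (dX : X -> X -> R).
Variable f : Y -> X.
Hypotheses (hY : hyperbolic dY) (hX : hyperbolic dX).
Hypothesis f_product : forall y0 (r : R), exists N : nat, forall x y,
  N%:R <= gromov_product dY y0 x y ->
  r <= gromov_product dX (f y0) (f x) (f y).

Lemma product_gromov_close x y :
  gromov_close dY x y -> gromov_close dX (f \o x) (f \o y).
Proof.
move=> h p r; pose y0 := x 0%N.
have [N hN] := f_product y0 (r + dX (f y0) p).
have [n hn] := h y0 N%:R; exists n => i j hi hj.
have := hN _ _ (hn _ _ hi hj).
have := gromov_product_basepoint hX (f y0) p (f (x i)) (f (y j)).
by rewrite /=; lra.
Qed.

(** The same estimate serves twice: for sequences with the same limit it gives the map, and for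
    sequences with different but close limits its continuity. *)
Theorem product_admits_CT : admits_CT dY dX f.
Proof.
have ex (xi : boundary dY) : exists eta : boundary dX,
    forall y, converges_to y xi -> converges_to (f \o y) eta.
  case: (bseq_class xi) => x xx E.
  have xx' := product_gromov_close xx.
  have cls : exists2 u, gromov_close dX u u &
      [set y | gromov_close dX y y /\ gromov_close dX (f \o x) y] =
      [set y | gromov_close dX y y /\ gromov_close dX u y].
    by exists (f \o x).
  exists (Boundary cls) => y; rewrite /converges_to E => -[yy xy] /=.
  by split; apply: product_gromov_close.
pose F xi := projT1 (cid (ex xi)).
have hF xi y : converges_to y xi -> converges_to (f \o y) (F xi).
  exact: projT2 (cid (ex xi)) y.
exists F; split=> //.
have openE (S : Type) (dS : S -> S -> R) (A : set (boundary dS)) :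
  open A = boundary_open A by [].
apply/continuousP => U; rewrite !openE => oU xi UF p.
have [r hr] := oU _ UF (f p).
have [N hN] := f_product p r.
exists N%:R => eta [x [y [xxi yeta [n hn]]]].
apply: hr; exists (f \o x), (f \o y); split; [exact: hF|exact: hF|].
by exists n => i j hi hj; apply: hN; apply: hn.
Qed.

End GromovProductCT.

(** * Nets in hyperbolic spaces *)

Lemma nat_ge (R : realType) (r : R) : exists n : nat, (r <= n%:R)%R.
Proof.
by exists (Num.truncn r).+1; apply/ltW/truncnS_gt.
Qed.

Section GeodesicCat.
Local Open Scope ring_scope.
Variables (R : realType) (X : Type) (d : X -> X -> R).
Hypothesis dm : is_metric d.

Let d_ge0 x y : 0 <= d x y. Proof. by have [h _ _ _] := dm. Qed.
Let d0 x y : d x y = 0 <-> x = y. Proof. by have [_ h _ _] := dm. Qed.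
Let dC x y : d x y = d y x. Proof. by have [_ _ h _] := dm. Qed.
Let dT x y z : d x z <= d x y + d y z. Proof. by have [_ _ _ h] := dm. Qed.

Lemma geodesic_cat x m y c1 c2 : geodesic d x m c1 -> geodesic d m y c2 ->
  d x m + d m y = d x y -> exists2 c, geodesic d x y c & c (d x m) = m.
Proof.
move=> h1 h2 hm; have [e10 e11 i1] := h1; have [e20 e21 i2] := h2.
exists (fun t => if t <= d x m then c1 t else c2 (t - d x m)); last by rewrite lexx.
have key s t : 0 <= s <= d x m -> 0 <= t <= d m y -> d (c1 s) (c2 t) = d x m + t - s.
  move=> hs ht; have hs' : 0 <= d x m <= d x m by rewrite d_ge0 lexx.
  have ht' : 0 <= d m y <= d m y by rewrite d_ge0 lexx.
  have z1 : 0 <= (0 : R) <= d x m by rewrite lexx d_ge0.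
  have z2 : 0 <= (0 : R) <= d m y by rewrite lexx d_ge0.
  have := i1 _ _ hs hs'; have := i1 _ _ z1 hs; have := i2 _ _ z2 ht; have := i2 _ _ ht ht'.
  rewrite e10 e11 e20 e21 !sub0r !normrN.
  case/andP: hs => s0 s1; case/andP: ht => t0 t1.
  rewrite (ger0_norm s0) (ger0_norm t0) (distrC t) (distrC s) !ger0_norm ?subr_ge0 //.
  move=> f1 f2 f3 f4; apply: le_anti; apply/andP; split.
    by have := dT (c1 s) m (c2 t); lra.
  by have := dT x (c1 s) y; have := dT (c1 s) (c2 t) y; lra.
split.
- by rewrite d_ge0.
- case: leP => [le|_]; last by rewrite -hm addrC addKr.
  have e : d m y = 0 by have := d_ge0 m y; lra.
  by rewrite -hm e addr0 e11; apply/d0.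
- have main s t : 0 <= s <= d x y -> 0 <= t <= d x y -> s <= t ->
    d (if s <= d x m then c1 s else c2 (s - d x m))
      (if t <= d x m then c1 t else c2 (t - d x m)) = `|s - t|.
    move=> /andP[s0 s1] /andP[u0 u1] st.
    case: (leP t (d x m)) => ht; case: (leP s (d x m)) => hs.
    + by rewrite i1 ?s0 ?u0.
    + by lra.
    + rewrite key; first by rewrite distrC ger0_norm; lra.
        by rewrite s0.
      by apply/andP; split; lra.
    + rewrite i2; first by congr `|_|; ring.
        by apply/andP; split; lra.
      by apply/andP; split; lra.
  move=> s t hs ht; have [st|ts] := leP s t; first exact: main.
  by rewrite dC main // ?(ltW ts) // distrC.
Qed.

Lemma lipschitz_geodesic (f : R -> X) l : 0 <= l ->
  (forall s t, 0 <= s <= l -> 0 <= t <= l -> s <= t -> d (f s) (f t) <= t - s) ->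
  d (f 0) (f l) = l -> geodesic d (f 0) (f l) f.
Proof.
move=> l0 lip e; split=> //; first by rewrite e.
rewrite e; have main s t : 0 <= s <= l -> 0 <= t <= l -> s <= t -> d (f s) (f t) = `|s - t|.
  move=> hs ht st; rewrite distrC ger0_norm ?subr_ge0 //.
  have [/andP[s0 s1] /andP[t0 t1]] := (hs, ht).
  have z : 0 <= (0 : R) <= l by rewrite lexx l0.
  have z' : 0 <= l <= l by rewrite lexx l0.
  have := lip _ _ hs ht st; have := lip _ _ z hs s0; have := lip _ _ ht z' t1.
  have := dT (f 0) (f s) (f l); have := dT (f s) (f t) (f l).
  by move=> *; apply: le_anti; apply/andP; split=> //; lra.
move=> s t hs ht; have [st|ts] := leP s t; first exact: main.
by rewrite dC main // ?(ltW ts) // distrC.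
Qed.

Lemma geodesic_rev x y c : geodesic d x y c -> geodesic d y x (fun t => c (d x y - t)).
Proof.
move=> [c0 c1 h]; split; rewrite ?subr0 ?subrr // dC ?subrr // => s t /andP[s0 s1] /andP[t0 t1].
rewrite h; first by rewrite distrC; congr `|_|; ring.
  by apply/andP; split; lra.
by apply/andP; split; lra.
Qed.
End GeodesicCat.

Section Geodesics.
Local Open Scope ring_scope.
Variables (R : realType) (B : Type) (d : B -> B -> R).
Hypothesis gB : geodesic_space d.

Let d_ge0 x y : 0 <= d x y. Proof. by have [[h _ _ _] _] := gB. Qed.
Let d0 x y : d x y = 0 <-> x = y. Proof. by have [[_ h _ _] _] := gB. Qed.
Let dC x y : d x y = d y x. Proof. by have [[_ _ h _] _] := gB. Qed.
Let dT x y z : d x z <= d x y + d y z. Proof. by have [[_ _ _ h] _] := gB. Qed.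
Let geod x y : exists c, geodesic d x y c. Proof. by have [_ h] := gB. Qed.

Definition segment (l : R) (c : R -> B) : Prop :=
  0 <= l /\ forall s t, 0 <= s <= l -> 0 <= t <= l -> d (c s) (c t) = `|s - t|.

Lemma segment_dist l c : segment l c -> d (c 0) (c l) = l.
Proof. by move=> [l0 h]; rewrite h ?lexx ?l0 // sub0r normrN ger0_norm. Qed.

Lemma segment_geodesic l c : segment l c -> geodesic d (c 0) (c l) c.
Proof.
by move=> hs; have [l0 h] := hs; rewrite /geodesic (segment_dist hs).
Qed.

Lemma geodesic_segment x y c : geodesic d x y c -> segment (d x y) c.
Proof. by case=> _ _ h; split. Qed.

Lemma segment_sub l c a b : segment l c -> 0 <= a -> 0 <= b -> a + b <= l ->
  segment b (fun t => c (a + t)).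
Proof.
move=> [l0 h] a0 b0 ab; split=> // s t /andP[s0 sb] /andP[t0 tb].
rewrite h; first by congr `|_|; ring.
  by apply/andP; split; lra.
by apply/andP; split; lra.
Qed.

Lemma segment_rev l c : segment l c -> segment l (fun t => c (l - t)).
Proof.
move=> [l0 h]; split=> // s t /andP[s0 sl] /andP[t0 tl].
rewrite h; first by rewrite distrC; congr `|_|; ring.
  by apply/andP; split; lra.
by apply/andP; split; lra.
Qed.

Variable delta : R.
Hypothesis delta0 : 0 <= delta.
Hypothesis thinB : forall x y z a b c,
    geodesic d x y a -> geodesic d y z b -> geodesic d x z c ->
    forall t, 0 <= t <= d x y ->
      (exists2 s, 0 <= s <= d y z & d (a t) (b s) <= delta) \/
      (exists2 s, 0 <= s <= d x z & d (a t) (c s) <= delta).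

Lemma quad_thin K l c l' c' : segment l c -> segment l' c' ->
  d (c 0) (c' 0) <= K -> d (c l) (c' l') <= K ->
  forall t, 0 <= t <= l -> exists2 s, 0 <= s <= l' & d (c t) (c' s) <= 2 * delta + K.
Proof.
move=> hc hc' K0 Kl t ht; have [c1 h1] := geod (c l) (c' l').
have [c2 h2] := geod (c 0) (c' l'); have [c3 h3] := geod (c 0) (c' 0).
have hl' := segment_dist hc'; have hl := segment_dist hc.
have [l0 _] := hc; have [l0' _] := hc'.
have := thinB (segment_geodesic hc) h1 h2; rewrite hl => /(_ _ ht) [[s hs ds]|[s hs ds]].
  exists l'; first by rewrite l0' lexx.
  have := dT (c t) (c1 s) (c' l'); have := geodesic_right gB h1 hs.
  move: hs => /andP[s0 s1]; move=> e1 e2; have := delta0; lra.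
have [c4 h4] := geod (c' l') (c' 0).
have h5 := segment_rev hc'.
have h5' : geodesic d (c' l') (c' 0) (fun t => c' (l' - t)).
  by have := segment_geodesic h5; rewrite subr0 subrr.
have := thinB h2 h5' h3 hs; rewrite (dC (c' l')) hl' => -[[u /andP[u0 ul] du]|[u hu du]].
  exists (l' - u); first by apply/andP; split; lra.
  by have := dT (c t) (c2 s) (c' (l' - u)); have := d_ge0 (c 0) (c' 0); lra.
exists 0; first by rewrite l0' lexx.
have := dT (c t) (c3 u) (c' 0); have := dT (c t) (c2 s) (c3 u).
by have := geodesic_right gB h3 hu; case/andP: hu; lra.
Qed.

Lemma hexagon_thin K l c l1 c1 l2 c2 : segment l c -> segment l1 c1 -> segment l2 c2 ->
  d (c 0) (c1 0) <= K -> d (c1 l1) (c2 0) <= K -> d (c2 l2) (c l) <= K ->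
  forall t, 0 <= t <= l ->
  (exists2 s, 0 <= s <= l1 & d (c t) (c1 s) <= 3 * delta + K) \/
  (exists2 s, 0 <= s <= l2 & d (c t) (c2 s) <= 3 * delta + K).
Proof.
move=> hc hc1 hc2 K0 K1 K2 t ht.
have Kpos : 0 <= K by apply: le_trans (d_ge0 _ _) K0.
have [a1 h1] := geod (c l) (c1 l1); have [a2 h2] := geod (c 0) (c1 l1).
have := thinB (segment_geodesic hc) h1 h2; rewrite (segment_dist hc) => /(_ _ ht).
move=> [[s hs ds]|[s hs ds]]; last first.
  left; have [e1 e2 _] := h2.
  have [||u hu du] := quad_thin (K := K) (geodesic_segment h2) hc1 _ _ hs.
  - by rewrite e1.
  - by rewrite e2 (d0 _ _).2.
  by exists u => //; have := dT (c t) (a2 s) (c1 u); lra.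
right; have [e1 e2 _] := h1.
have [||u hu du] := quad_thin (K := K) (geodesic_segment h1) (segment_rev hc2) _ _ hs.
- by rewrite e1 subr0 dC.
- by rewrite e2 subrr.
exists (l2 - u); first by case/andP: hu => ? ?; apply/andP; split; lra.
by have := dT (c t) (a1 s) (c2 (l2 - u)); lra.
Qed.
End Geodesics.

Section Net.
Local Open Scope nat_scope.
Variables (R : realType) (B : Type) (dB : B -> B -> R).
Hypothesis hB : hyperbolic dB.
Variables (V : Type) (d : V -> V -> nat).
Hypotheses (dP : pmetric d) (dG : dgeodesic d).
Variables (o : V -> B) (kappa : nat).
Hypothesis o_le : forall x y, (dB (o x) (o y) <= (kappa * d x y)%:R)%R.
Hypothesis o_ge : forall x y n, (dB (o x) (o y) <= n%:R)%R -> d x y <= kappa * n + kappa.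
Hypothesis o_onto : forall p, exists x, (dB (o x) p <= kappa%:R)%R.

Let d_ge0 x y : (0 <= dB x y)%R. Proof. by have [[[h _ _ _] _] _] := hB. Qed.
Let d0 x y : dB x y = 0%R <-> x = y. Proof. by have [[[_ h _ _] _] _] := hB. Qed.
Let dC x y : dB x y = dB y x. Proof. by have [[[_ _ h _] _] _] := hB. Qed.
Let dT x y z : (dB x z <= dB x y + dB y z)%R. Proof. by have [[[_ _ _ h] _] _] := hB. Qed.

(** The step [tau] is at most [1] and divides the length exactly, so that both ends of the geodesic
    are sampled. *)
Definition sampled n (a : nat -> V) : Prop := exists tau c,
  [/\ (0 <= tau <= 1)%R, segment dB (n%:R * tau)%R c &
      forall i, i <= n -> (dB (o (a i)) (c (i%:R * tau)%R) <= kappa%:R)%R].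

Lemma sample_ex x y c : geodesic dB (o x) (o y) c -> exists tau n a,
  [/\ (0 <= tau <= 1)%R, (n%:R * tau)%R = dB (o x) (o y), a 0 = x, a n = y &
      forall i, i <= n -> (dB (o (a i)) (c (i%:R * tau)%R) <= kappa%:R)%R].
Proof.
move=> hc; set l := dB (o x) (o y).
have [m hm] := nat_ge l; pose n := m.+1.
have n0 : (0 < n%:R :> R)%R by rewrite ltr0n.
pose tau := (l / n%:R)%R.
have [f hf] := choice (fun i : nat => o_onto (c (i%:R * tau)%R)).
exists tau, n, (fun i => if i == 0 then x else if i == n then y else f i).
have ntau : (n%:R * tau = l)%R by rewrite /tau mulrC divfK // gt_eqF.
split=> //; rewrite ?eqxx //.
  rewrite divr_ge0 ?d_ge0 ?ler0n //= ler_pdivrMr // mul1r.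
  by apply: le_trans hm _; rewrite ler_nat.
have [c0 c1 _] := hc; move=> i hi; case: eqP => [->|_].
  by rewrite mul0r c0 (d0 _ _).2 // ler0n.
case: eqP => [->|_]; last exact: hf.
by rewrite ntau /l c1 (d0 _ _).2 // ler0n.
Qed.

Lemma near_sample (n : nat) (tau s : R) : (0 <= tau <= 1)%R -> (0 <= s <= n%:R * tau)%R ->
  exists2 j, j <= n & (`|s - j%:R * tau| <= 1)%R.
Proof.
move=> /andP[t0 t1]; elim: n => [|n IH] /andP[s0 sn].
  exists 0 => //; rewrite mul0r in sn *; have -> : s = 0%R by lra.
  by rewrite subrr normr0.
have [le|gt] := leP s (n%:R * tau)%R.
  have [|j jn hj] := IH; first by rewrite s0.
  by exists j => //; apply: leqW.
exists n.+1 => //; rewrite ler_norml; move: sn; rewrite -natr1 mulrDl mul1r => sn.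
by apply/andP; split; lra.
Qed.

(** Geodesics of the net are not geodesics of [B]; they are compared by [guessing_near], the sampled
    geodesics of [B] being the candidates, with thinness coming from hexagons in [B]. *)
Theorem net_near : exists K : nat, forall x y c n a, geodesic dB (o x) (o y) c ->
  dpath d n a -> a 0 = x -> a n = y ->
  (forall t, (0 <= t <= dB (o x) (o y))%R ->
     exists2 i, i <= n & (dB (o (a i)) (c t) <= K%:R)%R) /\
  (forall i, i <= n -> exists2 t, (0 <= t <= dB (o x) (o y))%R &
     (dB (o (a i)) (c t) <= K%:R)%R).
Proof.
have [del del0 thB] := thin hB; have [nd hnd] := nat_ge del.
have gB : geodesic_space dB by case: hB.
pose D := maxn (kappa * (2 * kappa + 1) + kappa) (kappa * (3 * nd + 4 * kappa + 1) + kappa).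
have [K hK] := @guessing_near D 1 (kappa * (kappa + 4 * kappa) + kappa) isT.
have near : forall n g N a, sampled n g -> quasi_path d 1 N a -> g 0 = a 0 -> g n = a N ->
    (forall i, i <= n -> exists2 j, j <= N & d (g i) (a j) <= K) /\
    (forall j, j <= N -> exists2 i, i <= n & d (a j) (g i) <= K).
  apply: (hK V d sampled dP dG).
  - move=> n g a b [tau [c [ht hc hg]]] /andP[ab bn].
    have [t0 t1] := andP ht.
    exists tau, (fun t => c (a%:R * tau + t)%R); split=> //.
      apply: (segment_sub hc); rewrite ?mulr_ge0 ?ler0n //.
      by rewrite -mulrDl -natrD subnKC // ler_wpM2r // ler_nat.
    by move=> i hi; rewrite -mulrDl -natrD; apply: hg; lia.
  - move=> x y; have [_ ge] := gB; have [c hc] := ge (o x) (o y).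
    have [tau [n [a [ht hn a0 an ha]]]] := sample_ex hc.
    exists n, a; split=> //; exists tau, c; split=> //.
    by rewrite hn; apply: geodesic_segment.
  - move=> n g i [tau [c [ht [hc0 hc] hg]]] hi; have [t0 t1] := andP ht.
    apply: leq_trans (leq_maxl _ _); apply: o_ge.
    have mono j : j <= n -> (0 <= j%:R * tau <= n%:R * tau)%R.
      by move=> jn; rewrite mulr_ge0 ?ler0n //= ler_wpM2r // ler_nat.
    have h1 := hg i (ltnW hi); have h2 := hg _ hi.
    have h3 := hc _ _ (mono i (ltnW hi)) (mono _ hi).
    have h4 : (`|i%:R * tau - i.+1%:R * tau| <= 1)%R.
      by rewrite -mulrBl -natr1 opprD addrA subrr sub0r mulN1r normrN ger0_norm.
    have := dT (o (g i)) (c (i%:R * tau)%R) (o (g i.+1)).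
    have := dT (c (i%:R * tau)%R) (c (i.+1%:R * tau)%R) (o (g i.+1)).
    by rewrite (dC (c (i.+1%:R * tau)%R)) h3 natrD natrM; lra.
  - move=> n g n1 g1 n2 g2 [tau [c [ht hc hg]]] [tau1 [c1 [ht1 hc1 hg1]]].
    move=> [tau2 [c2 [ht2 hc2 hg2]]] e0 e1 e2 i hi.
    have eqd x y z w : x = y -> (dB (o x) z <= kappa%:R)%R -> (dB (o y) w <= kappa%:R)%R ->
        (dB z w <= 2 * kappa%:R)%R.
      by move=> -> h1 h2; have := dT z (o y) w; rewrite (dC z (o _)); lra.
    have k0 : (dB (c 0%R) (c1 0%R) <= 2 * kappa%:R)%R.
      have := hg 0 isT; have := hg1 0 isT; rewrite !mul0r => h1 h2.
      exact: eqd e0 h2 h1.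
    have k1 : (dB (c1 (n1%:R * tau1)%R) (c2 0%R) <= 2 * kappa%:R)%R.
      have := hg2 0 isT; have := hg1 n1 (leqnn _); rewrite mul0r => h1 h2.
      exact: eqd e1 h1 h2.
    have k2 : (dB (c2 (n2%:R * tau2)%R) (c (n%:R * tau)%R) <= 2 * kappa%:R)%R.
      exact: eqd e2 (hg2 _ (leqnn _)) (hg _ (leqnn _)).
    have hit : (0 <= i%:R * tau <= n%:R * tau)%R.
      by have [t0 t1] := andP ht; rewrite mulr_ge0 ?ler0n //= ler_wpM2r // ler_nat.
    have concl m (h : nat -> V) ta ca s : (0 <= ta <= 1)%R -> segment dB (m%:R * ta)%R ca ->
        (forall j, j <= m -> (dB (o (h j)) (ca (j%:R * ta)%R) <= kappa%:R)%R) ->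
        (0 <= s <= m%:R * ta)%R ->
        (dB (c (i%:R * tau)%R) (ca s) <= 3 * del + 2 * kappa%:R)%R ->
        exists2 j, j <= m & d (g i) (h j) <= D.
      move=> hta hca hh hs hd; have [j jm hj] := near_sample hta hs.
      exists j => //; apply: leq_trans (leq_maxr _ _); apply: o_ge.
      have jt : (0 <= j%:R * ta <= m%:R * ta)%R.
        by have [t0 t1] := andP hta; rewrite mulr_ge0 ?ler0n //= ler_wpM2r // ler_nat.
      have [_ /(_ _ _ hs jt) h3] := hca; have h1 := hg i hi; have h2 := hh j jm.
      have := dT (o (g i)) (c (i%:R * tau)%R) (o (h j)).
      have := dT (c (i%:R * tau)%R) (ca s) (o (h j)).
      have := dT (ca s) (ca (j%:R * ta)%R) (o (h j)).
      by rewrite (dC (ca (j%:R * ta)%R)) (natrD _ (3 * nd + 4 * kappa)) (natrD _ (3 * nd)) !natrM; lra.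
    have [[s hs ds]|[s hs ds]] := hexagon_thin gB del0 thB hc hc1 hc2 k0 k1 k2 hit.
      by left; apply: concl hs ds.
    by right; apply: concl hs ds.
  - move=> n g [tau [c [ht [hl hc] hg]]] hd i hi; have [t0 t1] := andP ht.
    apply: o_ge.
    have mono j : j <= n -> (0 <= j%:R * tau <= n%:R * tau)%R.
      by move=> jn; rewrite mulr_ge0 ?ler0n //= ler_wpM2r // ler_nat.
    have h0 := hg 0 isT; have h1 := hg i hi; have h2 := hg n (leqnn _).
    have e1 := hc _ _ (mono 0 isT) (mono n (leqnn _)).
    have e2 := hc _ _ (mono 0 isT) (mono i hi).
    rewrite mul0r sub0r normrN ger0_norm in e1; last by case/andP: (mono n (leqnn _)).
    rewrite mul0r sub0r normrN ger0_norm in e2; last by case/andP: (mono i hi).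
    have h3 : (dB (o (g 0)) (o (g n)) <= kappa%:R)%R.
      apply: le_trans (o_le _ _) _; rewrite ler_nat -[leqRHS]muln1 leq_mul2l.
      by rewrite hd orbT.
    rewrite mul0r in h0.
    have := dT (c 0%R) (o (g 0)) (c (n%:R * tau)%R); have := dT (o (g 0)) (o (g n)) (c (n%:R * tau)%R).
    have := dT (o (g 0)) (c 0%R) (o (g i)); have := dT (c 0%R) (c (i%:R * tau)%R) (o (g i)).
    rewrite !(dC (c 0%R) (o _)) (dC (c (i%:R * tau)%R) (o _)).
    by case/andP: (mono i hi) => _; rewrite natrD natrM; lra.
exists (kappa * K + kappa + 1) => x y c n a hc ha a0 an.
have [tau [m [g [ht hm g0 gm hg]]]] := sample_ex hc.
have hs : sampled m g by exists tau, c; split=> //; rewrite hm; apply: geodesic_segment.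
have qa : quasi_path d 1 n a.
  split=> [i hi|i j hi hj]; first by rewrite ha //; lia.
  by rewrite ha //; lia.
have [n1 n2] := near m g n a hs qa ltac:(congruence) ltac:(congruence).
have oK u v : d u v <= K -> (dB (o u) (o v) <= kappa%:R * K%:R)%R.
  move=> h; apply: le_trans (o_le _ _) _; rewrite natrM ler_wpM2l ?ler0n // ler_nat //.
split=> [t htt|i hi].
  have [|j jm hj] := @near_sample m tau t ht; first by rewrite hm.
  have [i ii di] := n1 j jm; exists i => //.
  have := dT (o (a i)) (o (g j)) (c t); have := dT (o (g j)) (c (j%:R * tau)%R) (c t).
  have := oK _ _ di; rewrite (dC (o (g j)) (o (a i))).
  have jt : (0 <= j%:R * tau <= dB (o x) (o y))%R.
    by have [t0 t1] := andP ht; rewrite -hm mulr_ge0 ?ler0n //= ler_wpM2r // ler_nat.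
  have [_ _ /(_ _ _ htt jt)] := hc; rewrite (dC (c t)).
  by have := hg j jm; rewrite (natrD _ (kappa * K + kappa)) (natrD _ (kappa * K)) natrM; lra.
have [j jm dj] := n2 i hi; exists (j%:R * tau)%R.
  by have [t0 t1] := andP ht; rewrite -hm mulr_ge0 ?ler0n //= ler_wpM2r // ler_nat.
have := dT (o (a i)) (o (g j)) (c (j%:R * tau)%R); have := oK _ _ dj; have := hg j jm.
by rewrite (natrD _ (kappa * K + kappa)) (natrD _ (kappa * K)) natrM; lra.
Qed.

Theorem net_thin : exists delta, thin_triangles d delta.
Proof.
have [K hK] := net_near; have [del del0 thB] := thin hB.
have [nd hnd] := nat_ge del; exists (kappa * (2 * K + nd) + kappa) => x y z m hm.
have [_ ge] : geodesic_space dB by case: hB.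
have [c hc] := ge (o x) (o y); have [c1 hc1] := ge (o y) (o z).
have [c2 hc2] := ge (o x) (o z).
have [a [a0 am an ha]] := dpath_through dP dG hm.
have [a1 [a10 a1n ha1]] := dpath_ex dP dG y z.
have [a2 [a20 a2n ha2]] := dpath_ex dP dG x z.
have [_ n1] := hK _ _ _ _ _ hc ha a0 an.
have [t ht dt] := n1 (d x m) ltac:(move: hm; rewrite /between; lia).
rewrite am in dt.
have [[s hs ds]|[s hs ds]] := thB _ _ _ _ _ _ hc hc1 hc2 t ht.
  have [/(_ s hs) [i hi di] _] := hK _ _ _ _ _ hc1 ha1 a10 a1n.
  exists (a1 i); last first.
    apply: o_ge; have := dT (o m) (c t) (o (a1 i)); have := dT (c t) (c1 s) (o (a1 i)).
    by rewrite (dC (c1 s) (o _)) natrD natrM; lra.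
  right; have := dpath_between ha1 (i := 0) (j := i) (k := d y z).
  by rewrite a10 a1n => /(_ hi (leqnn _)); apply: (between_sym dP).
have [/(_ s hs) [i hi di] _] := hK _ _ _ _ _ hc2 ha2 a20 a2n.
exists (a2 i); last first.
  apply: o_ge; have := dT (o m) (c t) (o (a2 i)); have := dT (c t) (c2 s) (o (a2 i)).
  by rewrite (dC (c2 s) (o _)) natrD natrM; lra.
left; have := dpath_between ha2 (i := 0) (j := i) (k := d x z).
by rewrite a20 a2n; apply=> //.
Qed.
End Net.

(** * CAT(0) geometry *)

Section CAT0.
Local Open Scope ring_scope.
Variables (R : realType) (X : Type) (d : X -> X -> R).
Hypothesis hd : cat0 d.

Let gX : geodesic_space d. Proof. by case: hd. Qed.
Let d_ge0 x y : 0 <= d x y. Proof. by have [[h _ _ _] _] := gX. Qed.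
Let d0 x y : d x y = 0 <-> x = y. Proof. by have [[_ h _ _] _] := gX. Qed.
Let dC x y : d x y = d y x. Proof. by have [[_ _ h _] _] := gX. Qed.
Let dT x y z : d x z <= d x y + d y z. Proof. by have [[_ _ _ h] _] := gX. Qed.

Definition planar (p q : R) : {ffun 'I_2 -> R} :=
  [ffun i => if i == ord0 then p else q].

Lemma euclid_planar p q p' q' r : 0 <= r -> (p - p') ^+ 2 + (q - q') ^+ 2 = r ^+ 2 ->
  euclid (planar p q) (planar p' q') = r.
Proof.
move=> r0 e; rewrite /euclid big_ord_recr big_ord_recr big_ord0 /= !ffunE /= add0r e.
by rewrite sqrtr_sqr ger0_norm.
Qed.

Lemma cat0_contract x y z c c' t : geodesic d x y c -> geodesic d x z c' ->
  0 <= t <= 1 -> d (c (t * d x y)) (c' (t * d x z)) <= t * d y z.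
Proof.
move=> hc hc' /andP[t0 t1]; have [_ cmp] := hd.
have tb r : 0 <= r -> 0 <= t * r <= r.
  by move=> r0; rewrite mulr_ge0 //= ler_piMl.
have [e|/eqP ne] := pselect (d x y = 0).
  move/d0: (e) => yx; subst y; rewrite e mulr0; have [-> _ _] := hc.
  by rewrite (geodesic_left gX hc') // tb.
have := dT x y z; have := dT x z y; have := dT y x z; rewrite (dC y x) (dC z y).
have a0 : 0 < d x y by rewrite lt_neqAle eq_sym ne d_ge0.
have b0 := d_ge0 x z; have e0 := d_ge0 y z.
have ha := tb _ (d_ge0 x y); have hb := tb _ b0.
have := cmp _ _ _ _ _ hc hc' _ _ ha hb.
set a := d x y in a0 ha ne *; set b := d x z in b0 hb *; set e := d y z in e0 *.
move=> main h1 h2 h3.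
(* The comparison triangle has vertices [(0, 0)], [(a, 0)] and [(p, q)], with [p] given by the law
   of cosines. *)
pose p := (a ^+ 2 + b ^+ 2 - e ^+ 2) / (2 * a).
have hp : 2 * a * p = a ^+ 2 + b ^+ 2 - e ^+ 2.
  by rewrite /p; field; rewrite gt_eqF.
have q2 : 0 <= b ^+ 2 - p ^+ 2.
  (* Heron's formula: the triangle inequalities make all factors nonnegative, so [q] is real. *)
  have h4 : 0 <= (e ^+ 2 - (a - b) ^+ 2) * ((a + b) ^+ 2 - e ^+ 2).
    have ee : e ^+ 2 - (a - b) ^+ 2 = (e - a + b) * (e + a - b) by ring.
    have ee' : (a + b) ^+ 2 - e ^+ 2 = (a + b - e) * (a + b + e) by ring.
    by rewrite ee ee'; do !apply: mulr_ge0; lra.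
  have h5 : (e ^+ 2 - (a - b) ^+ 2) * ((a + b) ^+ 2 - e ^+ 2) = 4 * a ^+ 2 * (b ^+ 2 - p ^+ 2).
    have -> : 4 * a ^+ 2 * (b ^+ 2 - p ^+ 2) = (2 * a * b - 2 * a * p) * (2 * a * b + 2 * a * p) by ring.
    by rewrite hp; ring.
  move: h4; rewrite h5 pmulr_rge0 // mulr_gt0 ?exprn_gt0 //.
pose q := Num.sqrt (b ^+ 2 - p ^+ 2); have hq : q ^+ 2 = b ^+ 2 - p ^+ 2 by rewrite sqr_sqrtr.
have te0 : 0 <= t * e by rewrite mulr_ge0.
rewrite -(euclid_planar te0 (p := t * a) (q := 0) (p' := t * p) (q' := t * q)).
  apply: (main (planar 0 0) (planar a 0) (planar p q)); apply: euclid_planar => //.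
  - by rewrite ltW.
  - by ring.
  - by rewrite !sub0r !sqrrN hq; ring.
  - by rewrite sub0r sqrrN hq -[LHS]addr0 -(subrr (2 * a * p)) {2}hp; ring.
  - by case/andP: ha.
  - by ring.
  - by case/andP: ha; lra.
  - by ring.
  - by case/andP: hb.
  - have -> : (0 - t * p) ^+ 2 + (0 - t * q) ^+ 2 = t ^+ 2 * (p ^+ 2 + q ^+ 2) by ring.
    by rewrite hq; ring.
  - by case/andP: hb; lra.
  - have -> : (t * p - p) ^+ 2 + (t * q - q) ^+ 2 = (1 - t) ^+ 2 * (p ^+ 2 + q ^+ 2) by ring.
    by rewrite hq; ring.
have -> : (t * a - t * p) ^+ 2 + (0 - t * q) ^+ 2 =
  t ^+ 2 * (a ^+ 2 - 2 * a * p + p ^+ 2 + q ^+ 2) by ring.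
by rewrite hp hq; ring.
Qed.

Lemma cat0_unique x y c c' t : geodesic d x y c -> geodesic d x y c' ->
  0 <= t <= d x y -> c t = c' t.
Proof.
move=> hc hc' /andP[t0 t1]; have [e|/eqP ne] := pselect (d x y = 0).
  have -> : t = 0 by lra.
  by have [-> _ _] := hc; have [-> _ _] := hc'.
have a0 : 0 < d x y by rewrite lt_neqAle eq_sym ne d_ge0.
have := @cat0_contract x y y c c' (t / d x y) hc hc'.
rewrite (d0 y y).2 // mulr0 divfK // divr_ge0 ?d_ge0 //= ler_pdivrMr // mul1r => /(_ t1) le.
by apply/d0/le_anti; rewrite le d_ge0.
Qed.

Lemma geodesic_via x m y : d x m + d m y = d x y ->
  exists2 c, geodesic d x y c & c (d x m) = m.
Proof.
move=> hm; have [dm ge] := gX; have [c1 h1] := ge x m; have [c2 h2] := ge m y.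
exact: (geodesic_cat dm h1 h2 hm).
Qed.

Lemma cat0_midpoint x y m m' : d x m + d m y = d x y -> d x m' + d m' y = d x y ->
  d x m = d x m' -> m = m'.
Proof.
move=> hm hm' e; have [c hc cm] := geodesic_via hm; have [c' hc' cm'] := geodesic_via hm'.
rewrite -cm -cm' -e; apply: cat0_unique hc hc' _; rewrite d_ge0 -hm lerDl d_ge0 //.
Qed.
End CAT0.

(** * The development *)

Section EuclideanDistance.
Local Open Scope ring_scope.
Variables (R : realType) (I : finType).
Implicit Types x y : {ffun I -> R}.

Lemma euclid_coord x y i : `|x i - y i| <= euclid x y.
Proof.
rewrite -sqrtr_sqr; apply: ler_wsqrtr; rewrite (bigD1 i) //= lerDl.
by apply: sumr_ge0 => j _; apply: sqr_ge0.
Qed.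

(** The difference of two barycentric coordinates varies from [1] to [-1] along an edge, so that
    this bound yields the exact length of edges in [vpt_adj_dist]; a single coordinate would lose a
    factor. *)
Lemma euclid_coord2 x y i j : i != j ->
  `|(x i - x j) - (y i - y j)| <= Num.sqrt 2 * euclid x y.
Proof.
move=> ij; rewrite -sqrtr_sqr -sqrtrM // ; apply: ler_wsqrtr.
rewrite (bigD1 i) //= (bigD1 j) 1?eq_sym //=.
set s := \sum_(_ | _) _; have s0 : 0 <= s by apply: sumr_ge0 => k _; apply: sqr_ge0.
have := sqr_ge0 (x i - y i + (x j - y j)).
rewrite -subr_ge0 => h; rewrite -subr_ge0.
have -> : 2 * ((x i - y i) ^+ 2 + ((x j - y j) ^+ 2 + s)) - (x i - x j - (y i - y j)) ^+ 2 =
  (x i - y i + (x j - y j)) ^+ 2 + 2 * s by ring.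
by rewrite addr_ge0 ?sqr_ge0 // mulr_ge0.
Qed.

Lemma euclid_le x y : (forall i, `|x i - y i| <= 1) -> euclid x y <= #|I|%:R.
Proof.
move=> h; rewrite -[leRHS]ger0_norm ?ler0n // -sqrtr_sqr; apply: ler_wsqrtr.
apply: (@le_trans _ _ (\sum_(i : I) 1)).
  by apply: ler_sum => i _; rewrite -real_normK ?num_real //; apply: exprn_ile1; rewrite ?normr_ge0.
by rewrite sumr_const -natrX ler_nat; case: #|_| => // n; rewrite leq_pmulr.
Qed.
End EuclideanDistance.

Lemma simplex_eq (V : finType) (K : simplicial_complex V) (s t : simplex K) :
  sval t \subset sval s -> (t = s) \/ face t s.
Proof.
rewrite finset.subEproper => /orP[/eqP e|]; last by right.
by left; apply: val_inj.
Qed.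

Section LocalGroups.
Local Open Scope group_scope.
Variables (V : finType) (K : simplicial_complex V) (G : complex_of_groups K).
Variable T : {set edge K}.

Lemma pi1_localM s : {morph @pi1_local V K G T s : x y / x * y}.
Proof. by move=> x y; rewrite /pi1_local -(pi1_rel (rel_mul T x y)) -[RHS]pi1_cat. Qed.

Definition locm s : {multiplicative lgroup G s -> pi1 G T} :=
  HB.pack (@pi1_local V K G T s) (isMultiplicative.Build _ _ _ (@pi1_localM s)).

Lemma pi1_kV s t (e : face t s) : pi1_class T [:: LkV G e] = (pi1_k G T e)^-1.
Proof.
apply: (mulgI (pi1_k G T e)); rewrite mulgV -[LHS]pi1_cat.
exact/pi1_rel/rel_kkV.
Qed.

Lemma pi1_k_conj s t (e : face t s) (g : lgroup G s) :
  pi1_k G T e * locm s g = locm t (lmap G e g) * pi1_k G T e.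
Proof.
apply: (mulIg (pi1_k G T e)^-1); rewrite mulgK -pi1_kV.
rewrite -[RHS]/(pi1_class T _) -(pi1_rel (rel_conj T e g)) -mulgA.
by rewrite -[X in _ * X]pi1_cat -[LHS]pi1_cat.
Qed.

Lemma pi1_k_comp s t u (e : face u t) (e' : face t s) :
  pi1_k G T e * pi1_k G T e' = locm u (twist G e e') * pi1_k G T (edge_comp e e').
Proof. by rewrite -[LHS]pi1_cat -[RHS]pi1_cat; apply/pi1_rel/rel_comp. Qed.

(* [k_e] for [e = (s, t)], and [kk s s = 1]; a junk value if [t] is not contained in
   [s]. *)
Definition kk (s t : simplex K) : pi1 G T :=
  if pselect (face t s) is left e then pi1_k G T e else 1.

Lemma kkE s t (e : face t s) : kk s t = pi1_k G T e.
Proof.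
by rewrite /kk; case: pselect => // e'; rewrite (bool_irrelevance e e').
Qed.

Lemma kk_refl s : kk s s = 1.
Proof. by rewrite /kk; case: pselect => // e; have := e; rewrite /face fintype.properxx. Qed.

Lemma kk_conj (s t : simplex K) (g : lgroup G s) : sval t \subset sval s ->
  exists g' : lgroup G t, kk s t * locm s g = locm t g' * kk s t.
Proof.
move=> /simplex_eq[e|e]; first by subst t; exists g; rewrite kk_refl mul1g mulg1.
by exists (lmap G e g); rewrite (kkE e) pi1_k_conj.
Qed.

Lemma kk_comp (s t u : simplex K) : sval u \subset sval t -> sval t \subset sval s ->
  exists g : lgroup G u, kk t u * kk s t = locm u g * kk s u.
Proof.
move=> /simplex_eq[e|e]; first by subst u; exists 1; rewrite kk_refl hom1.
move=> /simplex_eq[e'|e']; first by subst t; exists 1; rewrite kk_refl hom1 mul1g mulg1.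
by exists (twist G e e'); rewrite (kkE e) (kkE e') pi1_k_comp (kkE (edge_comp e e')).
Qed.

Lemma coset_conj (s t : simplex K) g (g' : lgroup G s) : sval t \subset sval s ->
  same_coset locm t (g * (kk s t)^-1) (g * locm s g' * (kk s t)^-1).
Proof.
move=> ts; have [l hl] := kk_conj (g'^-1) ts; exists (l^-1).
by rewrite -!mulgA homV -invgM -hl invgM homV invgK.
Qed.

Lemma coset_comp (s t u : simplex K) (g : pi1 G T) : sval u \subset sval t -> sval t \subset sval s ->
  same_coset locm u (g * (kk s t)^-1 * (kk t u)^-1) (g * (kk s u)^-1).
Proof.
move=> ut ts; have [l hl] := kk_comp ut ts; exists l.
by rewrite -!mulgA; congr (_ * _); rewrite mulgA -invgM hl invgM -mulgA mulVg mulg1.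
Qed.
End LocalGroups.

Section DevPoints.
Local Open Scope ring_scope.
Local Open Scope quotient_scope.
Variables (R : realType) (V : finType) (K : simplicial_complex V) (G : complex_of_groups K).
Variable T : {set edge K}.
Local Notation dev := (dev R G T).
Local Notation dev_pre := (dev_pre R G T).
Local Notation dist := (dev_dist R G T).
Local Notation sc := (same_coset (locm G T)).
Local Notation pi1 := (pi1 G T).
Implicit Types (a b : dev) (p q : dev_pre) (s t : simplex K) (v : V).

Definition dpt g s x (hx : std_simplex (sval s) x) : dev := \pi_dev (DevPre g hx).

Definition coord b : {ffun V -> R} := dev_coord (repr b).

(** Translates of the simplex [t] correspond to cosets of its local group. This element represents
    the translate that is a face of the simplex of [p], when [t] is contained in that simplex. *)
Definition pre_coset t p : pi1 := (dev_elt p * (kk G T (dev_simplex p) t)^-1)%g.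

Definition dcoset t b : pi1 := pre_coset t (repr b).

Definition carried t (x : {ffun V -> R}) : Prop := forall v, v \in sval t -> x v != 0.

Lemma carried_sub t p : carried t (dev_coord p) -> sval t \subset sval (dev_simplex p).
Proof.
move=> h; apply/fintype.subsetP => v /h; apply: contra_neqT.
by case: (dev_coordP p) => _ + _; apply.
Qed.

(** The gluing is a generated equivalence, so points of the development can only be told apart by
    invariants of the generating moves, such as these two. *)
Lemma glue_invariant p q : clos_refl_sym_trans _ (@dev_glue R V K G T) p q ->
  dev_coord p = dev_coord q /\
  forall t, carried t (dev_coord p) -> sc t (pre_coset t p) (pre_coset t q).
Proof.
elim=> [_ _ [g s g' x hx|g s u e x hs hu]|{}p|{}p {}q _ [e h]|{}p {}q r _ [e h] _ [e' h']].
- split=> // t ht; apply: same_coset_sym; apply: coset_conj.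
  exact: (carried_sub (p := DevPre g hx)).
- split=> // t ht; apply: same_coset_sym; rewrite /pre_coset /= -(kkE G T e).
  have us : sval u \subset sval s by apply: fintype.proper_sub e.
  by apply: coset_comp us; apply: (carried_sub (p := DevPre g hu)).
- by split=> // t _; apply: same_coset_refl.
- by split=> // t; rewrite -e => /h; apply: same_coset_sym.
- split; first by rewrite e.
  by move=> t ht; apply: same_coset_trans (h t ht) (h' t _); rewrite -e.
Qed.

Lemma coordE p : coord (\pi_dev p) = dev_coord p.
Proof. by have [] := glue_invariant (glued_reprP _ p). Qed.

Lemma dcosetE t p : carried t (dev_coord p) -> sc t (dcoset t (\pi_dev p)) (pre_coset t p).
Proof. by move=> h; apply: (glue_invariant (glued_reprP _ p)).2; rewrite -/(coord _) coordE. Qed.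

Lemma coordP b : [/\ forall v, 0 <= coord b v, \sum_v coord b v = 1 &
  forall t, carried t (coord b) -> exists s, sval t \subset sval s].
Proof.
have [h1 h2 h3] := dev_coordP (repr b); split=> // t ht.
by exists (dev_simplex (repr b)); apply: (carried_sub (p := repr b)).
Qed.

Lemma dpt_coord g s x hx : coord (@dpt g s x hx) = x.
Proof. exact: coordE. Qed.

Lemma dpt_coset t g s x hx : carried t x ->
  sc t (dcoset t (@dpt g s x hx)) (g * (kk G T s t)^-1)%g.
Proof. by move=> h; apply: (@dcosetE t (DevPre g hx)). Qed.

Lemma dpt_local g s (l : lgroup G s) x hx :
  @dpt (g * locm G T s l)%g s x hx = @dpt g s x hx.
Proof. by apply/glued_eqP/rst_step/dev_glue_local. Qed.

Lemma dpt_face g s t x hs ht : sval t \subset sval s ->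
  @dpt g s x hs = @dpt (g * (kk G T s t)^-1)%g t x ht.
Proof.
move=> /simplex_eq[e|e].
  by subst t; rewrite kk_refl invg1 mulg1; congr (\pi_dev (DevPre _ _)); apply: Prop_irrelevance.
by apply/glued_eqP/rst_step; rewrite (kkE G T e); apply: dev_glue_face.
Qed.

Lemma dptE b : exists g s x (hx : std_simplex (sval s) x), b = dpt g hx.
Proof.
rewrite -[b]reprK; case: (repr b) => g s x hx; by exists g, s, x, hx.
Qed.

Lemma dpt_eq g h s x (hx : std_simplex (sval s) x) : sc s g h -> dpt g hx = dpt h hx.
Proof. by move=> [l ->]; rewrite dpt_local. Qed.

Lemma act_dpt g h s x hx : dev_act g (@dpt h s x hx) = @dpt (g * h)%g s x hx.
Proof. by rewrite dev_actE; congr (\pi_dev (DevPre _ _)); apply: Prop_irrelevance. Qed.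

Lemma dev_act1 b : dev_act 1%g b = b.
Proof. by have [g [s [x [hx ->]]]] := dptE b; rewrite act_dpt mul1g. Qed.

Lemma dev_actM g h b : dev_act (g * h)%g b = dev_act g (dev_act h b).
Proof. by have [k [s [x [hx ->]]]] := dptE b; rewrite !act_dpt mulgA. Qed.

Lemma coord_act g b : coord (dev_act g b) = coord b.
Proof. by have [k [s [x [hx ->]]]] := dptE b; rewrite !act_dpt !dpt_coord. Qed.

Lemma dcoset_act t g b : carried t (coord b) ->
  sc t (g * dcoset t b)%g (dcoset t (dev_act g b)).
Proof.
have [k [s [x [hx ->]]]] := dptE b; rewrite act_dpt dpt_coord => ct.
apply: same_coset_trans (same_coset_mul _ (dpt_coset k hx ct)) _.
by rewrite mulgA; apply/same_coset_sym/dpt_coset.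
Qed.

Local Notation chn := (@chain R _ _ (@dev_piece R V K G T)).

(** For the last part: along a chain shorter than the coordinate at [v] this coordinate stays
    positive, so the chain never leaves the open star of one translate of the vertex. *)
Lemma chain_dist a b l : chn a b l -> [/\ 0 <= l, forall v, `|coord a v - coord b v| <= l,
  forall i j, i != j -> `|(coord a i - coord a j) - (coord b i - coord b j)| <= Num.sqrt 2 * l &
  forall t v, sval t = [set v]%SET -> l < coord a v ->
    coord b v != 0 /\ sc t (dcoset t a) (dcoset t b)].
Proof.
elim=> [{}a|_ _ _ {}b m [g s x y hx hy] _ [m0 h1 h2 h3]].
  split=> // [v|i j _|t v _ h]; rewrite ?subrr ?normr0 ?mulr0 //.
  by split; [rewrite gt_eqF|apply: same_coset_refl].
rewrite -/(dpt g hx) -/(dpt g hy) in h1 h2 h3 *.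
rewrite !dpt_coord in h1 h2 h3 *; set k := euclid x y.
have l0 : 0 <= k by apply: sqrtr_ge0.
split=> [|v|i j ij|t v tv lt].
- by rewrite addr_ge0.
- apply: le_trans (ler_distD (y v) _ _) _; apply: lerD (h1 v); exact: euclid_coord.
- apply: le_trans (ler_distD (y i - y j) _ _) _; rewrite mulrDr.
  by apply: lerD (h2 _ _ ij); apply: euclid_coord2.
have xy : `|x v - y v| <= k by apply: euclid_coord.
have [|b0 e] := h3 t v tv.
  by move: xy; rewrite ler_norml => /andP[? ?]; lra.
split=> //; apply: same_coset_trans e.
have ct (z : {ffun V -> R}) : 0 < z v -> carried t z by move=> zv w; rewrite tv inE => /eqP ->; rewrite gt_eqF.
have cx : carried t x by apply: ct; apply: le_lt_trans lt; rewrite addr_ge0.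
have cy : carried t y.
  by apply: ct; move: xy; rewrite ler_norml => /andP[? ?]; lra.
exact: same_coset_trans (dpt_coset g hx cx) (same_coset_sym (dpt_coset g hy cy)).
Qed.

Lemma dist_le_chain a b l : chn a b l -> dist a b <= l.
Proof.
move=> h; apply: ge_inf => //; exists 0 => m /= hm; by have [] := chain_dist hm.
Qed.

Lemma piece_dist g s x y (hx : std_simplex (sval s) x) (hy : std_simplex (sval s) y) :
  dist (dpt g hx) (dpt g hy) <= euclid x y.
Proof.
rewrite -[leRHS]addr0; apply: dist_le_chain; apply: chain_cons; last exact: chain_nil.
exact: Dev_piece.
Qed.

Lemma chain_act g a b l : chn a b l -> chn (dev_act g a) (dev_act g b) l.
Proof.
elim=> [{}a|_ _ _ {}b m [k s x y hx hy] _ h]; first exact: chain_nil.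
rewrite -/(dpt k hx) -/(dpt k hy) !act_dpt in h *.
by apply: chain_cons h; apply: Dev_piece.
Qed.

Lemma dist_act g a b : dist (dev_act g a) (dev_act g b) = dist a b.
Proof.
congr inf; apply/seteqP; split=> l /=; last exact: chain_act.
by move/(chain_act g^-1%g); rewrite -!dev_actM mulVg !dev_act1.
Qed.

Hypothesis dist_metric : is_metric dist.

Lemma chain_ge0 a b l : chn a b l -> 0 <= l.
Proof. by move=> h; have [] := chain_dist h. Qed.

Lemma dist_chain a b r : dist a b < r -> a = b \/ exists2 l, l < r & chn a b l.
Proof.
move=> lt; have [ab|ab] := pselect (a = b); [by left|right].
(* Without any chain the infimum would be [0] by convention, and the metric axioms would force
   [a = b]. *)
have ne : exists l, chn a b l.
  apply: contrapT => no; apply: ab; apply/(proj1 (_ : dist a b = 0 <-> a = b)).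
    by case: dist_metric.
  rewrite /dev_dist /glue_dist (_ : mkset _ = set0)%classic ?inf0 //.
  by apply/seteqP; split=> // l hl; case: no; exists l.
have hi : has_inf [set l | chn a b l]%classic.
  by split=> //; exists 0 => l; apply: chain_ge0.
by have [l hl lt'] := inf_lt hi.1 lt; exists l.
Qed.

Lemma dist_coord2 a b i j : i != j ->
  `|(coord a i - coord a j) - (coord b i - coord b j)| <= Num.sqrt 2 * dist a b.
Proof.
move=> ij; rewrite leNgt; apply/negP; rewrite mulrC -ltr_pdivlMr ?sqrtr_gt0 // => lt.
have [e|[l lt' /chain_dist[_ _ /(_ _ _ ij) h _]]] := dist_chain lt.
  have [h _ _ _] := dist_metric; move: lt; rewrite e subrr normr0 mul0r.
  by rewrite ltNge h.
by move: lt'; rewrite ltr_pdivlMr ?sqrtr_gt0 // mulrC ltNge h.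
Qed.

Lemma dist_coset a b t v : sval t = [set v]%SET -> dist a b < coord a v ->
  coord b v != 0 /\ sc t (dcoset t a) (dcoset t b).
Proof.
move=> tv lt; have [e|[l lt' /chain_dist[_ _ _ h]]] := dist_chain lt; last exact: h.
rewrite -e; split; last exact: same_coset_refl.
by rewrite gt_eqF //; apply: le_lt_trans lt; case: dist_metric.
Qed.
End DevPoints.

Section Vertices.
Variables (V : finType) (K : simplicial_complex V).

Definition vtx : Type := {v : V | [set v]%SET \in simplices K}.
HB.instance Definition _ := Finite.on vtx.

(* [proj2_sig] rather than the opaque [svalP], for [sv] to commute with restriction definitionally. *)
Definition sv (j : vtx) : simplex K := exist _ [set sval j]%SET (proj2_sig j).

Definition ledge : Type := {p : vtx * vtx | (sval p.1 != sval p.2) &&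
  ([set sval p.1; sval p.2]%SET \in simplices K)}.
HB.instance Definition _ := Finite.on ledge.

Definition lsrc (e : ledge) : vtx := (sval e).1.
Definition ltgt (e : ledge) : vtx := (sval e).2.

Lemma lneq e : sval (lsrc e) != sval (ltgt e).
Proof. by have := svalP e => /andP[]. Qed.

Lemma lsimplex_proof e : [set sval (lsrc e); sval (ltgt e)]%SET \in simplices K.
Proof. by have := svalP e => /andP[]. Qed.

Definition lsimplex e : simplex K :=
  exist _ [set sval (lsrc e); sval (ltgt e)]%SET (lsimplex_proof e).

Lemma lsrc_sub e : sval (sv (lsrc e)) \subset sval (lsimplex e).
Proof. by rewrite /= finset.sub1set !inE eqxx. Qed.

Lemma ltgt_sub e : sval (sv (ltgt e)) \subset sval (lsimplex e).
Proof. by rewrite /= finset.sub1set !inE eqxx orbT. Qed.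

Lemma lsrc_face e : face (sv (lsrc e)) (lsimplex e).
Proof.
rewrite /face fintype.properE lsrc_sub /=; apply/fintype.subsetPn; exists (sval (ltgt e)).
  by rewrite !inE eqxx orbT.
by rewrite inE eq_sym lneq.
Qed.

Lemma ltgt_face e : face (sv (ltgt e)) (lsimplex e).
Proof.
rewrite /face fintype.properE ltgt_sub /=; apply/fintype.subsetPn; exists (sval (lsrc e)).
  by rewrite !inE eqxx.
by rewrite inE lneq.
Qed.

Variable R : realType.
Local Open Scope ring_scope.

Definition dirac (v : V) : {ffun V -> R} := [ffun u => (u == v)%:R].

Definition segpt (v w : V) (t : R) : {ffun V -> R} :=
  [ffun u => (u == v)%:R * (1 - t) + (u == w)%:R * t].

Lemma segpt0 v w : segpt v w 0 = dirac v.
Proof. by apply/ffunP => u; rewrite !ffunE subr0 mulr1 mulr0 addr0. Qed.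

Lemma segpt1 v w : segpt v w 1 = dirac w.
Proof. by apply/ffunP => u; rewrite !ffunE subrr mulr1 mulr0 add0r. Qed.

Lemma dirac_std (j : vtx) : std_simplex (sval (sv j)) (dirac (sval j)).
Proof.
split=> [u|u|]; rewrite ?ffunE ?ler0n //.
  by rewrite inE => /negbTE ->.
rewrite (bigD1 (sval j)) //= ffunE eqxx big1 ?addr0 // => u /negbTE uj.
by rewrite ffunE uj.
Qed.

Lemma segpt_std (e : ledge) t : 0 <= t <= 1 ->
  std_simplex (sval (lsimplex e)) (segpt (sval (lsrc e)) (sval (ltgt e)) t).
Proof.
move=> /andP[t0 t1]; have ne := lneq e.
split=> [u|u|]; rewrite ?ffunE.
- by rewrite addr_ge0 // mulr_ge0 ?ler0n ?subr_ge0.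
- by rewrite !inE negb_or => /andP[/negbTE -> /negbTE ->]; rewrite !mul0r addr0.
rewrite (bigD1 (sval (lsrc e))) //= (bigD1 (sval (ltgt e))) 1?eq_sym //= !ffunE !eqxx.
rewrite (negbTE ne) eq_sym (negbTE ne) big1 => [|u /andP[/negbTE h1 /negbTE h2]].
  by rewrite !mul1r !mul0r !addr0 add0r subrK.
by rewrite ffunE h1 h2 !mul0r addr0.
Qed.

Lemma euclid_segpt v w s t : v != w -> euclid (segpt v w s) (segpt v w t) = Num.sqrt 2 * `|s - t|.
Proof.
move=> ne; rewrite /euclid (bigD1 v) //= (bigD1 w) 1?eq_sym //= !ffunE !eqxx.
rewrite (negbTE ne) eq_sym (negbTE ne) big1 => [|u /andP[/negbTE h1 /negbTE h2]].
  rewrite !mul1r !mul0r -sqrtr_sqr -sqrtrM //; congr Num.sqrt; ring.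
by rewrite !ffunE h1 h2 !mul0r subrr expr0n.
Qed.
End Vertices.

Section DevVertices.
Local Open Scope ring_scope.
Variables (R : realType) (V : finType) (K : simplicial_complex V) (G : complex_of_groups K).
Variable T : {set edge K}.
Local Notation dev := (dev R G T).
Local Notation dist := (dev_dist R G T).
Local Notation sc := (same_coset (locm G T)).
Local Notation pi1 := (pi1 G T).
Local Notation vtx := (vtx K).

Definition locv (j : vtx) : {multiplicative lgroup G (sv j) -> pi1} := locm G T (sv j).
Definition kks (e : ledge K) : pi1 := ((kk G T (lsimplex e) (sv (lsrc e)))^-1)%g.
Definition kkt (e : ledge K) : pi1 := ((kk G T (lsimplex e) (sv (ltgt e)))^-1)%g.
Local Notation W := (cosets locv).
Local Notation mk := (mk_coset locv).

Definition vpt (w : W) : dev := dpt (rp w) (dirac_std R (ty w)).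

Lemma vpt_mk j g : vpt (mk j g) = dpt g (dirac_std R j).
Proof. by apply/esym/dpt_eq; exact: (coset_repP locv j g). Qed.

Lemma vpt_act g w : dev_act g (vpt w) = vpt (act g w).
Proof. by rewrite -(mk_coset_rp w) act_mk !vpt_mk act_dpt. Qed.

Definition vtx_at (j : vtx) (b : dev) : W := mk j (dcoset (sv j) b).

Lemma carriedv (j : vtx) (x : {ffun V -> R}) : x (sval j) != 0 -> carried (sv j) x.
Proof. by move=> h v; rewrite inE => /eqP ->. Qed.

Lemma vtx_at_dpt j g s x (hx : std_simplex (sval s) x) : x (sval j) != 0 ->
  vtx_at j (dpt g hx) = mk j (g * (kk G T s (sv j))^-1)%g.
Proof. by move=> h; apply/mk_coset_eq; apply: (dpt_coset g hx (carriedv h)). Qed.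

Lemma vtx_at_act g j b : coord b (sval j) != 0 -> vtx_at j (dev_act g b) = act g (vtx_at j b).
Proof.
move=> h; rewrite act_mk; apply/mk_coset_eq/same_coset_sym.
exact: (dcoset_act g (carriedv h)).
Qed.

(* Some barycentric coordinate of any point exceeds [eps], so that its vertex still
   belongs to the support of all points at distance at most [eps]. *)
Definition eps : R := #|V|.+1%:R^-1.

Lemma eps_gt0 : 0 < eps. Proof. by rewrite invr_gt0 ltr0n. Qed.

Lemma vtx_ex (b : dev) : exists j : vtx, eps < coord b (sval j).
Proof.
have [h0 h1 _] := coordP b.
have [v hv] : exists v, eps < coord b v.
  apply: contrapT => no; have : \sum_v coord b v <= \sum_(v : V) eps.
    by apply: ler_sum => v _; rewrite leNgt; apply/negP => hv; case: no; exists v.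
  rewrite h1 sumr_const -mulr_natl ler_pdivlMr ?ltr0n // mul1r ler_nat ltnn //.
have hs : [set v]%SET \in simplices K.
  apply: simplex_sub (svalP (dev_simplex (repr b))) _ _; first by apply/set0Pn; exists v; rewrite inE.
  rewrite finset.sub1set; apply: contraTT hv => vs.
  have [_ /(_ _ vs) e _] := dev_coordP (repr b).
  by rewrite /coord e -leNgt ltW // eps_gt0.
by exists (exist _ v hs).
Qed.

(** The default branch never occurs, so the choice depends on the coordinates only and [bv] is
    equivariant. *)
Definition mainv (b : dev) : vtx :=
  if [pick j : vtx | eps < coord b (sval j)] is Some j then j else projT1 (cid (vtx_ex b)).

Lemma mainvP b : eps < coord b (sval (mainv b)).
Proof. by rewrite /mainv; case: pickP => [j //|_]; case: cid. Qed.

Lemma mainv_neq0 b : coord b (sval (mainv b)) != 0.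
Proof. by rewrite gt_eqF // (lt_trans eps_gt0 (mainvP b)). Qed.

Lemma mainv_eq a b : coord a = coord b -> mainv a = mainv b.
Proof.
move=> e; rewrite /mainv (eq_pick (Q := fun j : vtx => eps < coord b (sval j))); last first.
  by move=> j; rewrite e.
by case: pickP => // no; have [j] := vtx_ex b; rewrite no.
Qed.

Definition bv b : W := vtx_at (mainv b) b.

Lemma bv_act g b : bv (dev_act g b) = act g (bv b).
Proof.
by rewrite /bv (mainv_eq (coord_act g b)) vtx_at_act // mainv_neq0.
Qed.

Lemma bv_vpt w : bv (vpt w) = w.
Proof.
have e : mainv (vpt w) = ty w.
  have := mainv_neq0 (vpt w); rewrite dpt_coord ffunE.
  by case: (sval (mainv (vpt w)) =P _) => [h _|_]; [apply: val_inj|rewrite eqxx].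
rewrite /bv e vtx_at_dpt; last by rewrite ffunE eqxx oner_eq0.
by rewrite kk_refl invg1 mulg1 mk_coset_rp.
Qed.

Definition adjv : W -> W -> Prop := adj (@lsrc V K) (@ltgt V K) kks kkt.

Lemma vtx_at_adj j j' b : coord b (sval j) != 0 -> coord b (sval j') != 0 ->
  j = j' \/ adjv (vtx_at j b) (vtx_at j' b).
Proof.
move=> hj hj'; have [e|ne] := eqVneq (sval j) (sval j'); [by left; apply: val_inj|right].
have [g [s [x [hx eb]]]] := dptE b; rewrite eb !dpt_coord in hj hj'.
have sub : [set sval j; sval j']%SET \subset sval s.
  have [_ h _] := hx; apply/fintype.subsetP => v; rewrite !inE => /orP[]/eqP ->.
    by apply: contra_neqT hj; apply: h.
  by apply: contra_neqT hj'; apply: h.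
have hs : [set sval j; sval j']%SET \in simplices K.
  apply: simplex_sub (svalP s) _ sub.
  by apply/set0Pn; exists (sval j); rewrite !inE eqxx.
have he : (sval j != sval j') && ([set sval j; sval j']%SET \in simplices K) by rewrite ne.
pose e : ledge K := exist _ (j, j') he.
exists e, (g * (kk G T s (lsimplex e))^-1)%g.
have lsub : sval (lsimplex e) \subset sval s by [].
rewrite eb !vtx_at_dpt //; split; apply/mk_coset_eq/same_coset_sym.
  by apply: (coset_comp g (lsrc_sub e) lsub).
by apply: (coset_comp g (ltgt_sub e) lsub).
Qed.

Definition ept (e : ledge K) g t (ht : 0 <= t <= 1) : dev := dpt g (segpt_std e ht).

Lemma ept0 e g h : @ept e g 0 h = vpt (mk (lsrc e) (g * kks e)%g).
Proof.
rewrite vpt_mk /ept; move: (segpt_std e h); rewrite segpt0 => hx.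
by apply: (dpt_face g hx (dirac_std R (lsrc e)) (lsrc_sub e)).
Qed.

Lemma ept1 e g h : @ept e g 1 h = vpt (mk (ltgt e) (g * kkt e)%g).
Proof.
rewrite vpt_mk /ept; move: (segpt_std e h); rewrite segpt1 => hx.
by apply: (dpt_face g hx (dirac_std R (ltgt e)) (ltgt_sub e)).
Qed.

Lemma ept_dist e g s t hs ht : dist (@ept e g s hs) (@ept e g t ht) <= Num.sqrt 2 * `|s - t|.
Proof. by rewrite -(euclid_segpt _ _ (lneq e)); apply: piece_dist. Qed.

Lemma ept_vtx e g t ht j : coord (@ept e g t ht) (sval j) != 0 ->
  vtx_at j (ept e g ht) = mk (lsrc e) (g * kks e)%g \/
  vtx_at j (ept e g ht) = mk (ltgt e) (g * kkt e)%g.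
Proof.
rewrite dpt_coord => h; rewrite vtx_at_dpt //.
move: h; rewrite ffunE; case: (sval j =P sval (lsrc e)) => [/val_inj -> _|_]; first by left.
case: (sval j =P sval (ltgt e)) => [/val_inj -> _|_]; first by right.
by rewrite !mul0r addr0 eqxx.
Qed.

Hypothesis dist_cat0 : cat0 dist.
Let geod_dist : geodesic_space dist. Proof. by case: dist_cat0. Qed.
Let dist_metric : is_metric dist. Proof. by case: geod_dist. Qed.

Lemma vtx_at_near j a b : dist a b < coord a (sval j) ->
  coord b (sval j) != 0 /\ vtx_at j b = vtx_at j a.
Proof.
move=> /(dist_coset dist_metric (t := sv j) erefl) [h1 h2]; split=> //.
by apply/mk_coset_eq/same_coset_sym.
Qed.

Lemma bv_near a b : dist a b <= eps ->
  coord b (sval (mainv a)) != 0 /\ vtx_at (mainv a) b = bv a.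
Proof. by move=> h; apply: vtx_at_near; apply: le_lt_trans h (mainvP a). Qed.

Lemma bv_adj a b : dist a b <= eps -> bv a = bv b \/ adjv (bv a) (bv b).
Proof.
move=> /bv_near[h <-]; have [e|//] := vtx_at_adj h (mainv_neq0 b); last by right.
by left; rewrite e.
Qed.

Lemma vpt_adj_dist e g : dist (vpt (mk (lsrc e) (g * kks e)%g)) (vpt (mk (ltgt e) (g * kkt e)%g)) =
  Num.sqrt 2.
Proof.
have h0 : 0 <= (0 : R) <= 1 by rewrite lexx ler01.
have h1 : 0 <= (1 : R) <= 1 by rewrite lexx ler01.
apply: le_anti; apply/andP; split.
  rewrite -(ept0 e g h0) -(ept1 e g h1); apply: le_trans (ept_dist _ _ _ _) _.
  by rewrite sub0r normrN normr1 mulr1.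
have s0 : 0 < Num.sqrt 2 :> R by rewrite sqrtr_gt0.
have := dist_coord2 dist_metric (vpt (mk (lsrc e) (g * kks e)%g))
  (vpt (mk (ltgt e) (g * kkt e)%g)) (lneq e).
rewrite !dpt_coord !ffunE !eqxx (negbTE (lneq e)) eq_sym (negbTE (lneq e)) => h.
rewrite -(ler_pM2l s0) -expr2 sqr_sqrtr //; apply: le_trans h.
by rewrite subr0 sub0r opprK ger0_norm.
Qed.

(** Two edges with the same ends have the same midpoint by uniqueness of CAT(0) geodesics, and the
    invariants of the midpoint determine the coset of the edge group. *)
Lemma adj_unique_dev e g e' g' : mk (lsrc e) (g * kks e)%g = mk (lsrc e') (g' * kks e')%g ->
  mk (ltgt e) (g * kkt e)%g = mk (ltgt e') (g' * kkt e')%g ->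
  exists2 l : lgroup G (lsimplex e), e' = e & g' = (g * locm G T (lsimplex e) l)%g.
Proof.
move=> hs ht; have [es _] := mk_coset_inj hs; have [et _] := mk_coset_inj ht.
have ee : e' = e by apply: val_inj; rewrite [LHS]surjective_pairing [RHS]surjective_pairing; congr pair; apply: esym; [exact: es|exact: et].
subst e'; have h2 : 0 <= (2^-1 : R) <= 1 by apply/andP; split; lra.
have h0 : 0 <= (0 : R) <= 1 by rewrite lexx ler01.
have h1 : 0 <= (1 : R) <= 1 by rewrite lexx ler01.
have [dge0 _ dC dT] := dist_metric.
pose x := vpt (mk (lsrc e) (g * kks e)%g); pose y := vpt (mk (ltgt e) (g * kkt e)%g).
have mid k : vpt (mk (lsrc e) (k * kks e)%g) = x -> vpt (mk (ltgt e) (k * kkt e)%g) = y ->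
    dist x (ept e k h2) + dist (ept e k h2) y = dist x y /\ dist x (ept e k h2) = Num.sqrt 2 / 2.
  move=> ex ey; have := ept_dist e k h0 h2; have := ept_dist e k h2 h1.
  rewrite ept0 ept1 ex ey sub0r normrN.
  have -> : 2^-1 - 1 = - 2^-1 :> R by lra.
  rewrite normrN ger0_norm; last by lra.
  have := dT x (ept e k h2) y; have := vpt_adj_dist e g; rewrite -/x -/y.
  by move=> h3 h4 h5 h6; split; lra.
have [m1 m2] := mid g erefl erefl.
have [m1' m2'] := mid g' (esym (congr1 vpt hs)) (esym (congr1 vpt ht)).
have := cat0_midpoint dist_cat0 m1 m1' (etrans m2 (esym m2')) => em.
have car : carried (lsimplex e) (segpt (sval (lsrc e)) (sval (ltgt e)) (2^-1 : R)).
  move=> v; rewrite !inE ffunE;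
  have e2 : 1 - 2^-1 = 2^-1 :> R by lra.
  move=> /orP[]/eqP ->; rewrite !eqxx gt_eqF //.
    by rewrite ltr_wpDr ?mulr_ge0 ?ler0n ?invr_ge0 // mul1r e2 invr_gt0.
  by rewrite ltr_wpDl ?mulr_ge0 ?ler0n ?e2 ?invr_ge0 // mul1r invr_gt0.
have c1 := dpt_coset (t := lsimplex e) g (segpt_std e h2) car.
have c2 := dpt_coset (t := lsimplex e) g' (segpt_std e h2) car.
rewrite kk_refl invg1 mulg1 in c1; rewrite kk_refl invg1 mulg1 -[dpt _ _]em in c2.
by have [l hl] := same_coset_trans (same_coset_sym c1) c2; exists l.
Qed.

Lemma compress (u : nat -> W) n :
  (forall i, (i < n)%N -> u i = u i.+1 \/ adjv (u i) (u i.+1)) ->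
  exists l, [/\ adj_path (@lsrc V K) (@ltgt V K) kks kkt (u 0%N) l, last (u 0%N) l = u n,
    (size l <= n)%N & forall x, x \in l -> exists2 i, (i <= n)%N & x = u i].
Proof.
elim: n u => [|n IH] u h; first by exists [::].
have [|l [h1 h2 h3 h4]] := IH (fun i => u i.+1); first by move=> i hi; apply: h.
have mem x : x \in l -> exists2 i, (i <= n.+1)%N & x = u i.
  by move=> /h4[i hi ->]; exists i.+1.
have [e|a] := h 0%N isT.
  by exists l; rewrite e; split=> //; apply: leqW.
exists (u 1%N :: l); split=> // x; rewrite inE => /orP[/eqP ->|/mem //].
by exists 1%N.
Qed.

Definition adjv_path := adj_path (loc := locv) (@lsrc V K) (@ltgt V K) kks kkt.

(* The vertices of the supports along the CAT(0) geodesic, which is fixed pointwise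
   by all isometries fixing its ends. *)
Lemma vertex_chain v w n : dist (vpt v) (vpt w) <= n%:R * eps ->
  exists l, [/\ adjv_path v l, last v l = w, (size l <= n)%N &
    forall g, act g v = v -> act g w = w -> forall u, u \in l -> act g u = u].
Proof.
move=> hn; have [_ ge] := geod_dist; have [c hc] := ge (vpt v) (vpt w).
have [d_ge0 d0 dC dT] := dist_metric; have [c0 c1 hcc] := hc.
pose t i : R := Num.min (i%:R * eps) (dist (vpt v) (vpt w)).
have eps0 := eps_gt0.
have ht i : 0 <= t i <= dist (vpt v) (vpt w).
  apply/andP; split; last by rewrite /t ge_min lexx orbT.
  by rewrite /t le_min d_ge0 mulr_ge0 ?ler0n ?ltW.
have tstep i : `|t i - t i.+1| <= eps.
  rewrite /t -natr1 mulrDl mul1r ler_norml.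
  set D := dist _ _; case: (leP (i%:R * eps) D) => h1;
    case: (leP (i%:R * eps + eps) D) => h2; apply/andP; split; lra.
pose u i := bv (c (t i)).
have u0 : u 0%N = v by rewrite /u /t mul0r min_l ?d_ge0 // c0 bv_vpt.
have un : u n = w by rewrite /u /t min_r // c1 bv_vpt.
have [|l [h1 h2 h3 h4]] := compress (u := u) (n := n).
  by move=> i _; apply: bv_adj; rewrite hcc.
exists l; rewrite -u0 -un; split=> // g gv gw x /h4[i hi ->].
rewrite /u -bv_act; congr bv; rewrite u0 in gv; rewrite un in gw.
have hgc : geodesic dist (vpt v) (vpt w) (fun s => dev_act g (c s)).
  split; rewrite ?c0 ?c1 ?vpt_act ?gv ?gw // => s s' hs hs'.
  by rewrite dist_act; apply: hcc.
exact: (cat0_unique dist_cat0 hgc hc (ht i)).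
Qed.

Hypothesis acyl : acylindrical R G T.

(** Two vertices at distance at least [A] have a finite common stabilizer by acylindricity, so the
    length of the chain needs a bound for closer pairs only. *)
Lemma chain_ex_dev : exists N, forall v w, exists l, [/\ adjv_path v l, last v l = w,
  forall g, act g v = v -> act g w = w -> forall u, u \in l -> act g u = u &
  ~ pair_stab_finite v w -> (size l <= N)%N].
Proof.
have [A A0 hA] := acyl; have eps0 := eps_gt0.
have [N hN] := nat_ge (A / eps); exists N => v w.
have [lt|ge] := ltP (dist (vpt v) (vpt w)) A.
  have [|l [h1 h2 h3 h4]] := @vertex_chain v w N.
    by apply: le_trans (ltW lt) _; rewrite -ler_pdivrMr.
  by exists l; split.
have [n hn] := nat_ge (dist (vpt v) (vpt w) / eps).
have [|l [h1 h2 h3 h4]] := @vertex_chain v w n; first by rewrite -ler_pdivrMr.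
exists l; split=> //; case.
have := hA [set vpt v; vpt w]%classic _.
have diam : (A%:E <= diameter dist [set vpt v; vpt w]%classic)%E.
  apply: (@le_trans _ _ (dist (vpt v) (vpt w))%:E); first by rewrite lee_fin.
  apply: ereal_sup_ubound; exists (vpt v, vpt w) => //=; split; [by left|by right].
move=> /(_ diam) /finite_seqP[s hs]; exists s => g gv gw.
suff : [set` s]%classic g by [].
by rewrite -hs /= => x [->|->]; rewrite vpt_act ?gv ?gw.
Qed.
End DevVertices.

(** The walk is coned off from its last vertex, one triangle for each edge; in the applications [ok]
    says that a fibre is near a fixed point. *)
Lemma walk_sum_cone (W : eqType) (c : W -> W -> int) (ok : W -> Prop) M :
  (forall v1 v2 v3, ok v1 -> ok v2 -> ok v3 -> absz (c v1 v2 + c v2 v3 - c v1 v3)%R <= M) ->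
  forall v l, ok v -> (forall u, u \in l -> ok u) ->
  absz (walk_sum c v l - c v (last v l))%R <= (size l).+1 * M.
Proof.
move=> tri v l; elim: l v => [|w l IH] v hv hl /=; first by have := tri v v v hv hv hv; lia.
have hw := hl w (mem_head _ _).
have hl' u : u \in l -> ok u by move=> ul; apply: hl; rewrite inE ul orbT.
have hlast : ok (last w l).
  by have := mem_last w l; rewrite inE => /orP[/eqP ->|/hl'].
have := IH w hw hl'; have := tri v w _ hv hw hlast.
rewrite (mulSn (size l).+1); lia.
Qed.

Section ComplexGroup.
Variables (R : realType) (V : finType) (K : simplicial_complex V) (G : complex_of_groups K).
Variable T : {set edge K}.
Local Notation dev := (dev R G T).
Local Notation dist := (dev_dist R G T).
Local Notation pi1 := (pi1 G T).
Local Notation locv := (locv G T).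
Local Notation W := (cosets locv).
Local Notation mk := (mk_coset locv).
Local Notation eps := (eps R V).

Variables (SL : forall s : simplex K, seq (lgroup G s)) (hSL : forall s, generates (SL s)).

Definition pi1_gens : seq pi1 :=
  [seq kk G T p.1 p.2 | p <- enum {: simplex K * simplex K}] ++
  flatten [seq [seq locm G T s x | x <- SL s] | s <- enum {: simplex K}].

Lemma kk_gens s t : kk G T s t \in pi1_gens.
Proof. by rewrite mem_cat; apply/orP; left; apply/mapP; exists (s, t); rewrite ?mem_enum. Qed.

Lemma locm_gens s x : x \in SL s -> locm G T s x \in pi1_gens.
Proof.
move=> h; rewrite mem_cat; apply/orP; right; apply/flatten_mapP; exists s; rewrite ?mem_enum //.
exact: map_f.
Qed.

Lemma pi1_generates : generates pi1_gens.
Proof.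
pose gen (x : pi1) := exists w : seq pi1,
  {in w, forall y, y \in pi1_gens \/ (y^-1)%g \in pi1_gens} /\ x = (\prod_(y <- w) y)%g.
have genM x y : gen x -> gen y -> gen (x * y)%g.
  move=> [w [h1 ->]] [w' [h2 ->]]; exists (w ++ w'); rewrite big_cat; split=> // z.
  by rewrite mem_cat => /orP[/h1|/h2].
have gen1 x : x \in pi1_gens \/ (x^-1)%g \in pi1_gens -> gen x.
  by move=> h; exists [:: x]; rewrite big_seq1; split=> // z; rewrite inE => /eqP ->.
move=> x; rewrite -(pi1_reprK x); elim: (repr x) => [|l w IH].
  by exists [::]; rewrite big_nil.
rewrite -[_ :: _]/([:: l] ++ w) pi1_cat; apply: genM IH.
case: l => [s g|s t e|s t e].
- have [u [hu ->]] := hSL g; exists [seq locm G T s y | y <- u]; split.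
    move=> _ /mapP[y yu ->]; rewrite -homV.
    by case: (hu y yu) => h; [left|right]; apply: locm_gens.
  rewrite big_map; elim: u {hu} => [|y u IHu]; first by rewrite !big_nil; exact: (hom1 (locm G T s)).
  by rewrite !big_cons -IHu; exact: pi1_localM.
- by apply: gen1; left; rewrite -[pi1_class _ _]/(pi1_k G T e) -kkE; apply: kk_gens.
- by apply: gen1; right; rewrite pi1_kV invgK -kkE; apply: kk_gens.
Qed.

Local Notation d := (wd pi1_generates).
Let dP : pmetric d := wd_pmetric pi1_generates.
Let dG : dgeodesic d := wd_geodesic pi1_generates.
Let dxx x : d x x = 0. Proof. by case: dP. Qed.
Let dC x y : d x y = d y x. Proof. by case: dP. Qed.
Let dT x y z : d x z <= d x y + d y z. Proof. by case: dP. Qed.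
Let dM g x y : d (g * x)%g (g * y)%g = d x y. Proof. exact: wd_mul. Qed.
Local Notation near := (near d (@iota _ _ _ locv)).

Lemma kkV_short s t : d 1%g (kk G T s t)^-1%g <= 1.
Proof.
have := dM (kk G T s t)^-1%g (kk G T s t) 1%g; rewrite mulVg mulg1 => ->.
by rewrite dC; apply/wd_gen/kk_gens.
Qed.

Lemma near_mk x j : near 1 x (mk j x).
Proof. by apply/nearP; exists x; rewrite ?dxx //. Qed.

Lemma near_face g s j : near 1 g (mk j (g * (kk G T s (sv j))^-1)%g).
Proof.
apply/nearP; exists (g * (kk G T s (sv j))^-1)%g => //.
by rewrite -{1}(mulg1 g) dM; apply: kkV_short.
Qed.

Lemma common_near (b : dev) : exists g, forall j, coord b (sval j) != 0%R -> near 1 g (vtx_at j b).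
Proof.
have [g [s [x [hx ->]]]] := dptE b; exists g => j; rewrite dpt_coord => h.
by rewrite vtx_at_dpt //; apply: near_face.
Qed.

Lemma adjv_near v w : adjv (G := G) (T := T) v w -> exists g, near 1 g v /\ near 1 g w.
Proof. by move=> [e [g [-> ->]]]; exists g; split; apply: near_face. Qed.

Hypothesis dist_hyp : hyperbolic dist.
Hypothesis dist_cat0 : cat0 dist.
Hypothesis acyl : acylindrical R G T.
Variable j0 : vtx K.
Let geod_dist : geodesic_space dist. Proof. by case: dist_cat0. Qed.
Let dist_metric : is_metric dist. Proof. by case: geod_dist. Qed.

Definition basept (x : pi1) : dev := vpt R (mk j0 x).
Local Notation o := basept.

Lemma basept_act g x : dev_act g (o x) = o (g * x)%g.
Proof. by rewrite /o vpt_act act_mk. Qed.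

Lemma dist_near : exists D0 : nat, forall x v, near 1 x v -> (dist (o x) (vpt R v) <= D0%:R)%R.
Proof.
have [F hF] := near_finite pi1_generates locv 1.
have [||D0 hD] := @finite_bound _ F (fun w q => (dist (o 1%g) (vpt R w) <= q%:R)%R).
- by move=> t q q' qq h; apply: le_trans h _; rewrite ler_nat.
- by move=> t _; apply: nat_ge.
exists D0 => x v /hF /hD; rewrite -vpt_act.
by rewrite -(dist_act x) basept_act mulg1 -dev_actM mulgV dev_act1.
Qed.

Lemma vpt_main_dist (p : dev) : (dist (vpt R (bv p)) p <= #|V|%:R)%R.
Proof.
have [g [s [x [hx e]]]] := dptE p; have hm := mainv_neq0 p; rewrite /bv e in hm *.
set j := mainv _ in hm *; rewrite dpt_coord in hm; rewrite vtx_at_dpt // vpt_mk.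
have js : sval (sv j) \subset sval s by apply: (carried_sub (p := DevPre g hx)); apply: carriedv.
have hs : std_simplex (sval s) (dirac R (sval j)).
  have [h1 h2 h3] := dirac_std R j; split=> // v vs; apply: h2.
  by apply: contra vs; apply/fintype.subsetP.
rewrite -(dpt_face g hs (dirac_std R j) js); apply: le_trans (piece_dist _ _ _) _.
apply: euclid_le => i; have [h1 _ h3] := hx.
have x1 : (x i <= 1)%R by rewrite -h3 (bigD1 i) //= lerDl sumr_ge0.
have x0 := h1 i; rewrite ffunE; case: (i == _) => /=; rewrite ler_norml; apply/andP; split; lra.
Qed.

Let cover := cosets_cover (hS := pi1_generates) locv j0.
Definition coned_pi1 : pi1 -> pi1 -> nat := coned (Z := fun v x => near 1 x v) dG cover.
Local Notation dc := coned_pi1.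
Let cP : pmetric dc := coned_pmetric dG cover.
Let cG : dgeodesic dc := coned_geodesic dG cover.

Lemma basept_le : exists D : nat, forall x y, (dist (o x) (o y) <= (D * dc x y)%:R)%R.
Proof.
have [D hD] := dist_near; exists (2 * D) => x y.
have [_ /(_ _ _)/proj2 h0 distC distT] := dist_metric; have [c0 cg] := cG.
move: {2 3}(dc x y) (erefl (dc x y)) => n; elim: n x => [|n IH] x e.
  by rewrite (c0 _ _ e) h0 // ler0n.
have [|z [xz zy]] := cg x y 1; first by rewrite e.
have : dc x z <= 1 by rewrite xz.
move=> /(coned_le1 dP dG cover)[v [xv zv]].
have := IH z ltac:(lia); have := hD _ _ xv; have := hD _ _ zv.
have := distT (o x) (vpt R v) (o y); have := distT (vpt R v) (o z) (o y).
by rewrite (distC (vpt R v) (o z)) mulnS !natrD !natrM; lra.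
Qed.

(** The chain of vertices along a geodesic of [B] has length linear in [n], and fibres over adjacent
    vertices come close, so each step of the chain costs one edge of the coned-off graph. *)
Lemma basept_ge : exists D : nat, forall x y n, (dist (o x) (o y) <= n%:R)%R -> dc x y <= D * n + D.
Proof.
exists #|V|.+2 => x y n hn.
have [|l [h1 h2 h3 _]] := vertex_chain dist_cat0 (v := mk j0 x) (w := mk j0 y) (n := n * #|V|.+1).
  by rewrite /eps natrM mulfK // pnatr_eq0.
suff : dc x y <= size l + 1 by nia.
move: h1 h2 (near_mk x j0) (near_mk y j0); rewrite /adjv_path.
have [_ _ cT] := cP.
move: (mk j0 x) (mk j0 y) => v w {hn h3}; elim: l x v => [|u l IH] x v /=.
  move=> _ -> xw yw; apply/(coned_le1 dP dG cover); by exists w.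
move=> [vu ul] lw xv yw; have [g [gv gu]] := adjv_near vu.
have := IH g u ul lw gu yw; have := cT x g y.
have : dc x g <= 1 by apply/(coned_le1 dP dG cover); exists v.
by rewrite addSn; lia.
Qed.

Lemma basept_onto : exists D : nat, forall p, exists x, (dist (o x) p <= D%:R)%R.
Proof.
have [D hD] := dist_near; exists (D + #|V|) => p; have [g hg] := common_near p; exists g.
have := hD _ _ (hg _ (mainv_neq0 p)); rewrite -/(bv p).
have [_ _ _ /(_ (o g) (vpt R (bv p)) p)] := dist_metric.
by have := vpt_main_dist p; rewrite natrD; lra.
Qed.

Lemma coned_comparison : (exists delta, thin_triangles dc delta) /\
  exists K : nat, forall x y c n a, geodesic dist (o x) (o y) c -> dpath dc n a ->
    a 0 = x -> a n = y ->
    (forall t, (0 <= t <= dist (o x) (o y))%R ->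
       exists2 i, i <= n & (dist (o (a i)) (c t) <= K%:R)%R) /\
    (forall i, i <= n -> exists2 t, (0 <= t <= dist (o x) (o y))%R &
       (dist (o (a i)) (c t) <= K%:R)%R).
Proof.
have [D1 h1] := basept_le; have [D2 h2] := basept_ge; have [D3 h3] := basept_onto.
pose D := maxn D1 (maxn D2 D3).
have h1' x y : (dist (o x) (o y) <= (D * dc x y)%:R)%R.
  by apply: le_trans (h1 x y) _; rewrite ler_nat leq_mul2r leq_maxl orbT.
have h2' x y n : (dist (o x) (o y) <= n%:R)%R -> dc x y <= D * n + D.
  move/h2 => h; apply: leq_trans h _; have : D2 <= D by rewrite /D; lia.
  by move=> le; rewrite leq_add // leq_mul2r le orbT.
have h3' p : exists x, (dist (o x) p <= D%:R)%R.
  have [x hx] := h3 p; exists x; apply: le_trans hx _; rewrite ler_nat /D; lia.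
split; first exact: (net_thin dist_hyp cP cG h1' h2' h3').
exact: (net_near dist_hyp cP cG h1' h2' h3').
Qed.

Definition main_weight (c : W -> W -> int) (a b : dev) : int := c (bv a) (bv b).

Section Filling.
Variables (c : W -> W -> int) (M r0 : nat).
Local Notation cb := (main_weight c).
Hypothesis r01 : 1 <= r0.
Hypothesis tri : forall v1 v2 v3 g, near r0 g v1 -> near r0 g v2 -> near r0 g v3 ->
  absz (c v1 v2 + c v2 v3 - c v1 v3)%R <= M.

Lemma tri_pts p a b e : (dist a p <= eps)%R -> (dist b p <= eps)%R -> (dist e p <= eps)%R ->
  absz (cb a b + cb b e - cb a e)%R <= M.
Proof.
move=> ha hb he; have [g hg] := common_near p.
have nr x : (dist x p <= eps)%R -> near r0 g (bv x).
  by move=> /(bv_near dist_cat0)[h <-]; apply: near_mono r01 (hg _ h).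
by apply: (tri (nr _ ha) (nr _ hb) (nr _ he)).
Qed.

(** A discrete Stokes formula: consecutive rows differ by the defects of the cells between them, two
    triangles each, the vertical sides cancelling as [P 0 j = P N j]; row [0] is constant. *)
Lemma grid_sum N n (P : nat -> nat -> dev) : (forall j, P 0 j = P N j) ->
  (forall i, P i 0 = P 0 0) ->
  (forall i j, i < N -> j <= n -> (dist (P i j) (P i.+1 j) <= eps)%R) ->
  (forall i j, i <= N -> j < n -> (dist (P i j) (P i j.+1) <= eps)%R) ->
  absz (\sum_(i < N) cb (P i n) (P i.+1 n))%R <= (2 * n).+1 * N * M.
Proof.
move=> hN h0 hi hj; have [_ /(_ _ _)/proj2 d00 distC distT] := dist_metric.
have eps0 : (0 <= eps)%R by apply/ltW/eps_gt0.
elim: n hi hj => [|n IH] hi hj.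
  have le : forall k, k <= N -> absz (\sum_(i < k) cb (P i 0) (P i.+1 0))%R <= k * M.
    elim=> [|k IHk] kN; first by rewrite big_ord0.
    rewrite big_ord_recr /= !h0; have dz : (dist (P 0 0) (P 0 0) <= eps)%R by rewrite d00.
    have := tri_pts dz dz dz; have := IHk (ltnW kN).
    by rewrite mulSn; set s := (\sum_(_ < _) _)%R; set x := cb _ _; lia.
  by rewrite mul1n; apply: le.
have IH' := IH (fun i j a b => hi i j a (leqW b)) (fun i j a b => hj i j a (leqW b)).
have key : forall k, k <= N -> absz (\sum_(i < k) cb (P i n.+1) (P i.+1 n.+1) -
    \sum_(i < k) cb (P i n) (P i.+1 n) + cb (P 0 n) (P 0 n.+1) - cb (P k n) (P k n.+1))%R <= 2 * k * M.
  elim=> [|k IHk] kN; first by rewrite !big_ord0 subrr add0r subrr.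
  rewrite !big_ord_recr /=; have := IHk (ltnW kN).
  have dxx' x : (dist x x <= eps)%R by rewrite d00.
  have dd1 := hi k n kN (leqnSn _); have dd2 := hi k n.+1 kN (leqnn _).
  have dd3 := hj k n (ltnW kN) (leqnn _); have dd4 := hj k.+1 n kN (leqnn _).
  have t1 := @tri_pts (P k.+1 n) (P k n) (P k.+1 n) (P k.+1 n.+1) dd1 (dxx' _)
    ltac:(by rewrite distC).
  have t2 := @tri_pts (P k n.+1) (P k n) (P k n.+1) (P k.+1 n.+1) dd3 (dxx' _)
    ltac:(by rewrite distC).
  move: t1 t2; rewrite mulnS mulnDl.
  set s := (\sum_(_ < _) _)%R; set s' := (\sum_(_ < _) _)%R.
  set x1 := cb (P k n) (P k.+1 n); set x2 := cb (P k.+1 n) _; set x3 := cb (P k n) (P k.+1 n.+1).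
  set x4 := cb (P k n) (P k n.+1); set x5 := cb (P k n.+1) _; set x6 := cb (P 0 n) _; lia.
have := key N (leqnn N); rewrite -(hN n) -(hN n.+1).
have -> : (2 * n.+1).+1 * N * M = (2 * n).+1 * N * M + 2 * N * M by ring.
move: IH'; set s := (\sum_(_ < _) _)%R; set s' := (\sum_(_ < _) _)%R; set x := cb (P 0 n) _.
by rewrite addrK; lia.
Qed.

(* The loop is coned off from [q 0] along geodesics, which the CAT(0) inequality
   subdivides into a grid of mesh [eps]. *)
Lemma fan_sum N (q : nat -> dev) : q 0 = q N ->
  (forall i, i < N -> (dist (q i) (q i.+1) <= eps)%R) ->
  absz (\sum_(i < N) cb (q i) (q i.+1))%R <= (2 * N).+1 * N * M.
Proof.
case: N => [|N]; first by rewrite big_ord0.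
move=> hN hq; have [_ ge] := geod_dist; have [e he] := choice (fun i : nat => ge (q 0) (q i)).
have [d_ge0 h0 distC distT] := dist_metric.
have eps0 : (0 < eps)%R by apply/eps_gt0.
pose t (j : nat) : R := (j%:R / N.+1%:R)%R.
have N0 : (0 < N.+1%:R :> R)%R by rewrite ltr0n.
have t01 j : j <= N.+1 -> (0 <= t j <= 1)%R.
  by move=> jN; rewrite /t divr_ge0 ?ler0n //= ler_pdivrMr // mul1r ler_nat.
pose P i j := e i (t j * dist (q 0) (q i))%R.
have PN i : P i N.+1 = q i.
  by have [_ h _] := he i; rewrite /P /t divff ?gt_eqF // mul1r h.
have far i : i <= N.+1 -> (dist (q 0) (q i) <= N.+1%:R * eps)%R.
  move=> iN; apply: (@le_trans _ _ (i%:R * eps)%R); last by rewrite ler_wpM2r ?ler_nat // ltW.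
  elim: i iN => [|i IH] iN; first by rewrite mul0r (h0 _ _).2.
  have := distT (q 0) (q i) (q i.+1); have := IH (ltnW iN); have := hq i iN.
  by rewrite -natr1 mulrDl mul1r; lra.
have := @grid_sum N.+1 N.+1 P; under eq_bigr do rewrite !PN; apply.
- move=> j; have [a1 _ _] := he 0; have [a2 _ _] := he N.+1.
  by rewrite /P -hN (h0 (q 0) (q 0)).2 // mulr0 a1 a2.
- by move=> i; have [a1 _ _] := he 0; have [a2 _ _] := he i; rewrite /P /t !mul0r a1 a2.
- move=> i j iN jN; apply: le_trans (cat0_contract dist_cat0 (he i) (he i.+1) (t01 _ jN)) _.
  have [_ tt] := andP (t01 _ jN); apply: le_trans (hq i iN); exact: ler_piMl.
- move=> i j iN jN; have [_ _ hi] := he i.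
  have b k : k <= N.+1 -> (0 <= t k * dist (q 0) (q i) <= dist (q 0) (q i))%R.
    by move=> /t01/andP[u1 u2]; rewrite mulr_ge0 //= ler_piMl.
  have tj : (t j - t j.+1 = - N.+1%:R^-1)%R.
    by rewrite /t -mulrBl -(natr1 j) opprD addrA subrr sub0r mulN1r.
  rewrite (hi _ _ (b j (ltnW jN)) (b j.+1 jN)) -mulrBl tj normrM normrN (ger0_norm (d_ge0 _ _)).
  by rewrite ger0_norm ?invr_ge0 ?ler0n // mulrC ler_pdivrMr // mulrC; apply: far.
Qed.

Fixpoint eps_path (a : dev) (p : seq dev) : Prop :=
  if p is b :: q then (dist a b <= eps)%R /\ eps_path b q else True.

Lemma eps_path_cat a p q : eps_path a p -> eps_path (last a p) q -> eps_path a (p ++ q).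
Proof. by elim: p a => [|b p IH] a //= [h1 h2] h3; split=> //; apply: IH. Qed.

Lemma eps_path_nth a p i : eps_path a p -> i < size p ->
  (dist (nth a (a :: p) i) (nth a (a :: p) i.+1) <= eps)%R.
Proof.
elim: p a i => [|b p IH] a [|i] //= [h1 h2] // hi.
have := IH b i h2 hi; rewrite /= (set_nth_default a) ?(set_nth_default a (s := p)) //.
by rewrite /=; lia.
Qed.

Lemma walk_sum_nth a p : walk_sum cb a p = (\sum_(i < size p) cb (nth a (a :: p) i) (nth a (a :: p) i.+1))%R.
Proof.
elim: p a => [|b p IH] a; first by rewrite big_ord0.
rewrite /= big_ord_recl /= IH; congr (_ + _)%R; apply: eq_bigr => -[i hi] _ /=.
by rewrite (set_nth_default a) ?(set_nth_default a (s := p)) //= ltnW.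
Qed.

Let m := 2 * #|V|.+1.

Let zz : (0 <= (0 : R) <= 1)%R. Proof. by rewrite lexx ler01. Qed.
Let oo : (0 <= (1 : R) <= 1)%R. Proof. by rewrite lexx ler01. Qed.

Lemma ept_eq e g (s t : R) hs ht : s = t -> @ept R V K G T e g s hs = @ept R V K G T e g t ht.
Proof. by move=> st; subst t; congr ept; apply: bool_irrelevance. Qed.

(** The length of an edge is at most [2], so its [m] pieces have length at most [eps]. The vertices
    attached to its points are [u] or [w], both near [g], so [walk_sum_cone] evaluates the sum. *)
Lemma adj_fill u w : adjv u w -> exists p : seq dev, [/\ size p = m, eps_path (vpt R u) p,
  last (vpt R u) p = vpt R w & absz (walk_sum cb (vpt R u) p - c u w)%R <= m.+1 * M].
Proof.
move=> [e [g [eu ew]]].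
have m0 : (0 < m%:R :> R)%R by rewrite ltr0n /m; lia.
have tk (k : nat) : (0 <= Num.min (1 : R) (k%:R / m%:R) <= (1 : R))%R.
  by apply/andP; split; [rewrite le_min ler01 divr_ge0 ?ler0n|rewrite ge_min lexx].
pose q k := ept (R := R) e g (tk k).
have q0 : q 0 = vpt R u.
  by rewrite eu -(ept0 e g zz); apply: ept_eq; rewrite mul0r min_r ?ler01.
have qm : q m = vpt R w.
  by rewrite ew -(ept1 e g oo); apply: ept_eq; rewrite divff ?gt_eqF // min_l.
have qstep k : (dist (q k) (q k.+1) <= eps)%R.
  apply: le_trans (ept_dist _ _ _ _) _.
  have st : (`|Num.min (1 : R) (k%:R / m%:R) - Num.min (1 : R) (k.+1%:R / m%:R)| <= m%:R^-1 :> R)%R.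
    have i0 : (0 < m%:R^-1 :> R)%R by rewrite invr_gt0.
    rewrite -natr1 mulrDl mul1r; set z := (k%:R / m%:R)%R; set y := (m%:R^-1)%R in i0 *.
    rewrite ler_norml; case: (leP 1%R z) => h1; case: (leP 1%R (z + y)%R) => h2; apply/andP; split; lra.
  have s2 : (Num.sqrt 2 <= 2 :> R)%R.
    rewrite -[leRHS]ger0_norm // -sqrtr_sqr; apply: ler_wsqrtr; rewrite expr2; lra.
  apply: (@le_trans _ _ (2 * m%:R^-1)%R).
    by apply: ler_pM => //; apply: sqrtr_ge0.
  by rewrite /m natrM invfM mulrA divff ?mul1r // pnatr_eq0.
have path (n k : nat) : eps_path (q k) [seq q i | i <- seq.iota k.+1 n] /\
    last (q k) [seq q i | i <- seq.iota k.+1 n] = q (k + n).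
  elim: n k => [|n IH] k /=; first by rewrite addn0.
  by have [h1 h2] := IH k.+1; rewrite addnS -addSn.
have [h1 h2] := path m 0; rewrite add0n qm q0 in h1 h2.
exists [seq q i | i <- seq.iota 1 m]; split=> //; first by rewrite size_map seq.size_iota.
have gu : near 1 g u by rewrite eu; apply: near_face.
have gw : near 1 g w by rewrite ew; apply: near_face.
have bq k : near r0 g (bv (q k)).
  have := mainv_neq0 (q k) => h; have := ept_vtx h; rewrite -/(bv (q k)) -eu -ew.
  by move=> [->|->]; apply: near_mono r01 _.
have ws a p : walk_sum cb a p = walk_sum c (bv a) (map (@bv _ _ _ G T) p).
  by elim: p a => [|b p IH] a //=; rewrite IH.
have := @walk_sum_cone W c (near r0 g) M (fun v1 v2 v3 => @tri v1 v2 v3 g) u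
  [seq bv (q i) | i <- seq.iota 1 m].
rewrite size_map seq.size_iota ws bv_vpt -map_comp => /(_ (near_mono r01 gu)).
have -> : last u [seq bv (q i) | i <- seq.iota 1 m] = w.
  have := congr1 (@bv _ _ _ G T) h2.
  by rewrite -(last_map (@bv R V K G T)) -map_comp !bv_vpt.
by apply=> x /mapP[k _ ->].
Qed.

Lemma adj_path_fill v l : adjv_path v l -> exists p : seq dev, [/\ size p = size l * m,
  eps_path (vpt R v) p, last (vpt R v) p = vpt R (last v l) &
  absz (walk_sum cb (vpt R v) p - walk_sum c v l)%R <= size l * (m.+1 * M)].
Proof.
elim: l v => [|w l IH] v /=; first by move=> _; exists [::].
move=> [vw hl]; have [p [h1 h2 h3 h4]] := adj_fill vw; have [p' [k1 k2 k3 k4]] := IH w hl.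
exists (p ++ p'); split; first by rewrite size_cat h1 k1 mulSn.
- by apply: eps_path_cat h2 _; rewrite h3.
- by rewrite last_cat h3.
- by rewrite walk_sum_cat h3 mulSn; lia.
Qed.

Lemma adj_loop v l : adjv_path v l -> last v l = v ->
  absz (walk_sum c v l) <= (2 * (size l * m)).+1 * (size l * m) * M + size l * (m.+1 * M).
Proof.
move=> hl lv; have [p [h1 h2 h3 h4]] := adj_path_fill hl.
have := @fan_sum (size p) (nth (vpt R v) (vpt R v :: p)).
rewrite -walk_sum_nth -last_nth h3 lv /= => /(_ erefl (fun i => eps_path_nth h2)).
by rewrite h1; move: h4; set a := absz _; set b := absz _; set e := _ * M; lia.
Qed.
End Filling.

(** A step between fibres that merely come close is replaced by a chain of adjacent vertices, all
    near the common point, at the cost of a cone; the resulting loop of adjacent vertices is filled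
    in [B] by [adj_loop]. *)
Lemma conear_filling : exists r0, forall r, exists N, forall (c : W -> W -> int) M,
  (forall v1 v2 v3 g, near r0 g v1 -> near r0 g v2 -> near r0 g v3 ->
     absz (c v1 v2 + c v2 v3 - c v1 v3)%R <= M) ->
  forall v l, conear_path d (@iota _ _ _ locv) v l -> last v l = v -> size l <= r ->
  absz (walk_sum c v l) <= N * M.
Proof.
have [N0 hN0] := chain_ex_dev dist_cat0 acyl.
have [k [C' hC]] := chain_near pi1_generates hN0 1.
exists C'.+1 => r; pose m := 2 * #|V|.+1; pose n := r * k.
exists ((2 * (n * m)).+1 * (n * m) + n * m.+1 + r * k.+1) => c M tri v l hl lv lr.
have key : exists p, [/\ adjv_path v p, last v p = last v l, size p <= size l * k &
    absz (walk_sum c v p - walk_sum c v l)%R <= size l * (k.+1 * M)].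
  elim: l v hl {lv lr} => [|w l IH] v /=; first by move=> _; exists [::].
  move=> [[g [gv gw]] hl]; have [p' [k1 k2 k3 k4]] := IH w hl.
  have [p [h1 h2 h3 h4]] := hC v w (ex_intro _ g (conj gv gw)).
  exists (p ++ p'); split.
  - elim: p v h1 h2 {gv h3 h4} => [|u p IHp] v /=; first by move=> _ ->.
    by move=> [vu up] lu; split=> //; apply: IHp.
  - by rewrite last_cat h2.
  - by rewrite size_cat mulSn leq_add.
  - rewrite walk_sum_cat h2 mulSn.
    have := @walk_sum_cone W c (near C'.+1 g) M (fun v1 v2 v3 => @tri v1 v2 v3 g) v p (near_mono (isT : 1 <= C'.+1) gv)
      (fun u up => near_mono (leqnSn _) (h4 g gv gw u up)).
    have : (size p).+1 * M <= k.+1 * M by rewrite leq_mul2r ltnS h3 orbT.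
    rewrite h2; move: k4; set a1 := walk_sum c v p; set a2 := walk_sum c w p'.
    set a3 := walk_sum c w l; set a4 := c v w.
    by set m1 := (size p).+1 * M; set m2 := k.+1 * M; set m3 := size l * _; lia.
have [p [h1 h2 h3 h4]] := key.
have b0 := @adj_loop c M C'.+1 isT tri v p h1 ltac:(by rewrite h2).
have pn : size p <= n by apply: leq_trans h3 _; rewrite leq_mul2r lr orbT.
have b1 : (2 * (size p * m)).+1 * (size p * m) * M <= (2 * (n * m)).+1 * (n * m) * M.
  by rewrite leq_mul2r leq_mul ?orbT // ?ltnS ?leq_mul2l ?leq_mul2r ?pn ?orbT.
have b2 : size p * (m.+1 * M) <= n * m.+1 * M by rewrite -mulnA leq_mul2r pn orbT.
have b3 : size l * (k.+1 * M) <= r * k.+1 * M by rewrite -mulnA leq_mul2r lr orbT.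
rewrite (mulnDl _ (r * k.+1)) (mulnDl _ (n * m.+1)).
move: b0 b1 b2 b3 h4; rewrite -/m.
set X := (2 * (size p * m)).+1 * (size p * m) * M; set Y := size p * (m.+1 * M).
set Z := size l * (k.+1 * M); set A := (2 * (n * m)).+1 * (n * m) * M.
set B := n * m.+1 * M; set C := r * k.+1 * M.
by set x := walk_sum c v p; set y := walk_sum c v l; lia.
Qed.
End ComplexGroup.

(** * The combination theorem *)

Section Combination.
Variables (R : realType) (V : finType) (K : simplicial_complex V) (G : complex_of_groups K).
Variable T : {set edge K}.
Local Notation dist := (dev_dist R G T).
Local Notation pi1 := (pi1 G T).
Local Notation locv := (locv G T).
Variables (SL : forall s : simplex K, seq (lgroup G s)) (hSL : forall s, generates (SL s)).
Local Notation d := (wd (@pi1_generates V K G T SL hSL)).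
Hypothesis dev_inj : developable G T.
Hypothesis SL_thin : forall s, exists delta, thin_triangles (wd (@hSL s)) delta.
Hypothesis lmap_qi : forall s t (e : face t s), exists q, forall x y,
  wd (@hSL t) (lmap G e x) (lmap G e y) <= q * wd (@hSL s) x y /\
  wd (@hSL s) x y <= q * wd (@hSL t) (lmap G e x) (lmap G e y) + q.
Hypothesis dist_hyp : hyperbolic dist.
Hypothesis dist_cat0 : cat0 dist.
Hypothesis acyl : acylindrical R G T.
Variable j0 : vtx K.

Lemma vertex_delta : exists delta, forall j : vtx K, thin_triangles (wd (@hSL (sv j))) delta.
Proof.
have [||c hc] := @finite_bound _ (enum {: vtx K})
  (fun j q => thin_triangles (wd (@hSL (sv j))) q).
- move=> j q q' qq h x y z m hm; have [m' h1 h2] := h x y z m hm.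
  by exists m' => //; apply: leq_trans h2 qq.
- by move=> j _; apply: (SL_thin (sv j)).
by exists c => j; apply: hc; rewrite mem_enum.
Qed.

Lemma edge_qi : exists q, forall e : ledge K, forall f, f = lsrc e \/ f = ltgt e ->
  forall h : face (sv f) (lsimplex e), forall x y,
  wd (@hSL (sv f)) (lmap G h x) (lmap G h y) <= q * wd (@hSL (lsimplex e)) x y /\
  wd (@hSL (lsimplex e)) x y <= q * wd (@hSL (sv f)) (lmap G h x) (lmap G h y) + q.
Proof.
have [||q hq] := @finite_bound _ (enum {: ledge K * vtx K}) (fun p q =>
  forall h : face (sv p.2) (lsimplex p.1), forall x y,
  wd (@hSL (sv p.2)) (lmap G h x) (lmap G h y) <= q * wd (@hSL (lsimplex p.1)) x y /\
  wd (@hSL (lsimplex p.1)) x y <= q * wd (@hSL (sv p.2)) (lmap G h x) (lmap G h y) + q).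
- move=> p q q' qq h h' x y; have [h1 h2] := h h' x y; split.
    by apply: leq_trans h1 _; rewrite leq_mul2r qq orbT.
  by apply: leq_trans h2 _; rewrite leq_add // leq_mul2r qq orbT.
- move=> [e f] _ /=; have [h|no] := pselect (face (sv f) (lsimplex e)); last first.
    by exists 0 => h; case: no.
  by have [q hq] := lmap_qi h; exists q => h'; rewrite (bool_irrelevance h' h).
by exists q => e f _; apply: (hq (e, f)); rewrite mem_enum.
Qed.

Lemma kks_comm e (l : lgroup G (lsimplex e)) :
  (locm G T (lsimplex e) l * kks G T e = kks G T e * locv (lsrc e) (lmap G (lsrc_face e) l))%g.
Proof.
apply: (mulgI (kk G T (lsimplex e) (sv (lsrc e)))); rewrite /kks mulgA (kkE G T (lsrc_face e)).
by rewrite pi1_k_conj mulgK mulgA mulgV mul1g.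
Qed.

Lemma kkt_comm e (l : lgroup G (lsimplex e)) :
  (locm G T (lsimplex e) l * kkt G T e = kkt G T e * locv (ltgt e) (lmap G (ltgt_face e) l))%g.
Proof.
apply: (mulgI (kk G T (lsimplex e) (sv (ltgt e)))); rewrite /kkt mulgA (kkE G T (ltgt_face e)).
by rewrite pi1_k_conj mulgK mulgA mulgV mul1g.
Qed.

Theorem complex_thin : exists delta, thin_triangles d delta.
Proof.
have [delta hd] := vertex_delta; have [q hq] := edge_qi.
have [N hN] := chain_ex_dev dist_cat0 acyl.
have [[delta' hd'] _] := coned_comparison hSL dist_hyp dist_cat0 j0.
have [r0 hr0] := conear_filling hSL dist_cat0 acyl.
apply: (@coset_graph_thin pi1 (pi1_gens T SL) (@pi1_generates V K G T SL hSL) (vtx K)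
  (fun j => lgroup G (sv j)) locv (fun j => SL (sv j)) (fun j => @hSL (sv j)) (ledge K)
  (@lsrc V K) (@ltgt V K) (fun e => lgroup G (lsimplex e)) (fun e => locm G T (lsimplex e))
  (kks G T) (kkt G T) (fun e => SL (lsimplex e)) (fun e => @hSL (lsimplex e))
  (fun e => lmap G (lsrc_face e)) (fun e => lmap G (ltgt_face e)) delta q j0
  _ _ hd kks_comm kkt_comm _ _ _ _ (@adj_unique_dev R V K G T dist_cat0) N hN delta' r0 hd' hr0).
- by move=> j; apply: dev_inj.
- by move=> j s hs; apply: locm_gens.
- by move=> e; apply: kkV_short.
- by move=> e; apply: kkV_short.
- by move=> e; apply: hq; left.
- by move=> e; apply: hq; right.
Qed.

Theorem complex_vertex_qi : exists c, forall (j : vtx K) (a b : lgroup G (sv j)),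
  wd (@hSL (sv j)) a b <= c * d (locv j a) (locv j b) + c.
Proof.
have [delta hd] := vertex_delta; have [q hq] := edge_qi.
have [N hN] := chain_ex_dev dist_cat0 acyl.
have [[delta' hd'] _] := coned_comparison hSL dist_hyp dist_cat0 j0.
have [r0 hr0] := conear_filling hSL dist_cat0 acyl.
apply: (@coset_graph_fibre_qi pi1 (pi1_gens T SL) (@pi1_generates V K G T SL hSL) (vtx K)
  (fun j => lgroup G (sv j)) locv (fun j => SL (sv j)) (fun j => @hSL (sv j)) (ledge K)
  (@lsrc V K) (@ltgt V K) (fun e => lgroup G (lsimplex e)) (fun e => locm G T (lsimplex e))
  (kks G T) (kkt G T) (fun e => SL (lsimplex e)) (fun e => @hSL (lsimplex e))
  (fun e => lmap G (lsrc_face e)) (fun e => lmap G (ltgt_face e)) delta q j0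
  _ _ hd kks_comm kkt_comm _ _ _ _ (@adj_unique_dev R V K G T dist_cat0) N hN delta' r0 hd' hr0).
- by move=> j; apply: dev_inj.
- by move=> j s hs; apply: locm_gens.
- by move=> e; apply: kkV_short.
- by move=> e; apply: kkV_short.
- by move=> e; apply: hq; left.
- by move=> e; apply: hq; right.
Qed.
End Combination.

(** * Cayley graphs *)

Section RealCayley.
Local Open Scope ring_scope.
Local Open Scope quotient_scope.
Variables (R : realType) (G : groupType) (S : seq G) (hS : generates S).
Local Notation X := (cayley R S).
Local Notation dist := (@cayley_dist R G S).
Local Notation chn := (@chain R _ _ (@cayley_piece R G S)).
Implicit Types (a b : X) (g : G).
Let d := wd hS.
Let dP : pmetric d := wd_pmetric hS.
Let dxx x : d x x = 0%N. Proof. by case: dP. Qed.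
Let dC x y : d x y = d y x. Proof. by case: dP. Qed.
Let dT x y z : (d x z <= d x y + d y z)%N. Proof. by case: dP. Qed.

Definition edge_pt g s t (hs : s \in S) (ht : 0 <= t <= 1) : X := \pi_X (Cedge g hs ht).

Lemma edge_pt0 g s hs ht : @edge_pt g s 0 hs ht = cvert R S g.
Proof. by apply/glued_eqP/rst_step/cayley_glue0. Qed.

Lemma edge_pt1 g s hs ht : @edge_pt g s 1 hs ht = cvert R S (g * s)%g.
Proof. by apply/glued_eqP/rst_step/cayley_glue1. Qed.

Lemma cayleyE a : (exists g, a = cvert R S g) \/ (exists g s hs t ht, a = @edge_pt g s t hs ht).
Proof.
rewrite -[a]reprK; case: (repr a) => [g|g s t hs ht]; first by left; exists g.
by right; exists g, s, hs, t, ht.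
Qed.

(** Distances are infima over chains: explicit chains bound them from above, and functions of this
    kind, which descend to the graph, from below. *)
Definition lipschitz_pre (phi : cayley_pre R S -> R) : Prop :=
  (forall p q, cayley_glue p q -> phi p = phi q) /\
  forall p q l, cayley_piece p q l -> phi q <= phi p + l.

Lemma chain_ge0c a b l : chn a b l -> 0 <= l.
Proof. by elim=> // _ _ _ {}b m [g s t t' hs ht hs' ht'] _ h; rewrite addr_ge0. Qed.

Lemma lipschitz_pre_pi phi p : lipschitz_pre phi -> phi (repr (\pi_X p)) = phi p.
Proof.
move=> [hphi _]; have : forall x y, clos_refl_sym_trans _ (@cayley_glue R G S) x y -> phi x = phi y.
  by move=> x y; elim=> [z w /hphi||z w|u v w] // _ -> _ ->.
by apply; apply: glued_reprP.
Qed.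

Lemma lipschitz_pre_chain phi a b l : lipschitz_pre phi -> chn a b l ->
  phi (repr b) <= phi (repr a) + l.
Proof.
move=> hphi; elim=> [{}a|p q m {}b n hpq _]; first by rewrite addr0.
rewrite !lipschitz_pre_pi //; have [_ /(_ _ _ _ hpq)] := hphi; lra.
Qed.

Lemma chain_catc a b c l m : chn a b l -> chn b c m -> chn a c (l + m).
Proof.
elim=> [{}a|p q k {}b n hpq _ IH] h; first by rewrite add0r.
by rewrite -addrA; apply: chain_cons hpq (IH h).
Qed.

Lemma chain_piece g s hs t ht t' ht' :
  chn (@edge_pt g s t hs ht) (@edge_pt g s t' hs ht') `|t - t'|.
Proof.
rewrite -[X in chn _ _ X]addr0; apply: chain_cons; last exact: chain_nil.
exact: Cayley_piece.
Qed.

Lemma chain_symc a b l : chn a b l -> chn b a l.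
Proof.
elim=> [{}a|p q k {}b n hpq _ IH]; first exact: chain_nil.
rewrite addrC; apply: chain_catc IH _.
case: hpq => g s t t' hs ht hs' ht'; rewrite (bool_irrelevance hs' hs) distrC.
exact: chain_piece.
Qed.

Let zz : 0 <= (0 : R) <= 1. Proof. by rewrite lexx ler01. Qed.
Let oo : 0 <= (1 : R) <= 1. Proof. by rewrite lexx ler01. Qed.

Lemma chain_edge g s : s \in S -> chn (cvert R S g) (cvert R S (g * s)%g) 1.
Proof.
move=> hs; rewrite -(edge_pt0 g hs zz) -(edge_pt1 g hs oo).
by have := chain_piece g hs zz oo; rewrite sub0r normrN normr1.
Qed.

Lemma chain_cvert g h : chn (cvert R S g) (cvert R S h) (d g h)%:R.
Proof.
have [d0 dg] := wd_geodesic hS.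
move: {2 3}(d g h) (erefl (d g h)) => n; elim: n g => [|n IH] g e.
  by rewrite (d0 _ _ e); apply: chain_nil.
have [|z [gz zh]] := dg g h 1%N; first by rewrite -/d e.
rewrite -add1n natrD; apply: (@chain_catc _ (cvert R S z)); last first.
  by apply: IH; rewrite /d zh -/d e subn1.
have : (d g z <= 1)%N by rewrite /d gz.
have gnz : g <> z by move=> ez; move: gz; rewrite ez -/d dxx.
move/graph_dist_le1 => [//|[s hs [->|->]]]; first exact: chain_edge.
exact/chain_symc/chain_edge.
Qed.

Lemma dist_le_chainc a b l : chn a b l -> dist a b <= l.
Proof. by move=> h; apply: ge_inf => //; exists 0 => m; apply: chain_ge0c. Qed.

Lemma cayley_chain a b : exists l, chn a b l.
Proof.
have to_vert c : exists g l, chn c (cvert R S g) l.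
  have [[g ->]|[g [s [hs [t [ht ->]]]]]] := cayleyE c; first by exists g, 0; apply: chain_nil.
  by exists g; rewrite -(edge_pt0 g hs zz); eexists; apply: chain_piece.
have [g [l hl]] := to_vert a; have [h [m hm]] := to_vert b.
by eexists; apply: chain_catc hl (chain_catc (chain_cvert g h) (chain_symc hm)).
Qed.

Lemma lipschitz_dist phi a b : lipschitz_pre phi ->
  phi (repr b) <= phi (repr a) + dist a b.
Proof.
move=> hphi; rewrite -lerBlDl; apply: lb_le_inf; first by have [l] := cayley_chain a b; exists l.
by move=> l /= /(lipschitz_pre_chain hphi); lra.
Qed.

Definition vdist (g : G) (p : cayley_pre R S) : R :=
  match p with
  | Cvert h => (d g h)%:R
  | Cedge h s t _ _ => Num.min ((d g h)%:R + t) ((d g (h * s)%g)%:R + (1 - t))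
  end.

Lemma d_edge g h s : s \in S -> (d g (h * s)%g)%:R <= (d g h)%:R + 1 :> R /\
  (d g h)%:R <= (d g (h * s)%g)%:R + 1 :> R.
Proof.
move=> hs; have : (d h (h * s)%g <= 1)%N.
  by rewrite -{1}(mulg1 h) /d wd_mul; apply: wd_gen.
move=> e; rewrite !natr1 !ler_nat; have := dT g h (h * s)%g; have := dT g (h * s)%g h.
by have := dC h (h * s)%g; split; lia.
Qed.

Lemma vdist_lipschitz g : lipschitz_pre (vdist g).
Proof.
split=> [_ _ [h s hs _|h s hs _]|_ _ _ [h s t t' hs ht hs' ht']] /=; have [e1 e2] := d_edge g h hs.
- by rewrite addr0 subr0 min_l.
- by rewrite subrr addr0 min_r.
move: ht ht' => /andP[t0 t1] /andP[u0 u1].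

have [k1 k2] : t' <= t + `|t - t'| /\ t <= t' + `|t - t'|.
  by have := ler_norm (t - t'); have := ler_norm (t' - t); rewrite distrC; lra.
by rewrite ge_min !minEle; case: ifP => _; apply/orP; [left|right]; lra.
Qed.

Lemma cvert_dist g h : dist (cvert R S g) (cvert R S h) = (d g h)%:R.
Proof.
apply: le_anti; rewrite (dist_le_chainc (chain_cvert g h)) /=.
have := lipschitz_dist (cvert R S g) (cvert R S h) (vdist_lipschitz g).
by rewrite !lipschitz_pre_pi ?[_ (Cvert _ _ _)]/= ?dxx ?add0r //; exact: vdist_lipschitz.
Qed.

Lemma edge_pt_eq g s hs t t' ht ht' : t = t' -> @edge_pt g s t hs ht = @edge_pt g s t' hs ht'.
Proof. by move=> e; subst t'; congr edge_pt; apply: bool_irrelevance. Qed.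

Lemma cayley_dist_ge0 a b : 0 <= dist a b.
Proof.
apply: lb_le_inf; first by have [l] := cayley_chain a b; exists l.
by move=> l /=; apply: chain_ge0c.
Qed.

Lemma cayley_distC a b : dist a b = dist b a.
Proof. by congr inf; apply/seteqP; split=> l /=; apply: chain_symc. Qed.

Lemma cayley_distT a b c : dist a c <= dist a b + dist b c.
Proof.
rewrite -lerBlDl; apply: lb_le_inf; first by have [l] := cayley_chain b c; exists l.
move=> m /= hm; rewrite lerBlDl -lerBlDr.
apply: lb_le_inf; first by have [l] := cayley_chain a b; exists l.
by move=> l /= hl; rewrite lerBlDr; apply/dist_le_chainc/(chain_catc hl hm).
Qed.

Lemma cayley_distxx a : dist a a = 0.
Proof. by apply: le_anti; rewrite cayley_dist_ge0 (dist_le_chainc (chain_nil _ _)). Qed.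

Lemma edge_dist_le g s hs t ht t' ht' :
  dist (@edge_pt g s t hs ht) (@edge_pt g s t' hs ht') <= `|t - t'|.
Proof. exact/dist_le_chainc/chain_piece. Qed.

Lemma cvert_edge_le g s hs t ht : dist (cvert R S g) (@edge_pt g s t hs ht) <= t /\
  dist (cvert R S (g * s)%g) (@edge_pt g s t hs ht) <= 1 - t.
Proof.
have [t0 t1] := andP ht; rewrite -(edge_pt0 g hs zz) -(edge_pt1 g hs oo).
split; apply: le_trans (edge_dist_le _ _ _ _) _.
  by rewrite sub0r normrN ger0_norm.
by rewrite ger0_norm // subr_ge0.
Qed.

Lemma vdistE g b : dist (cvert R S g) b = vdist g (repr b).
Proof.
have hl := vdist_lipschitz g.
apply: le_anti; apply/andP; split; last first.
  have := lipschitz_dist (cvert R S g) b hl.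
  by rewrite (lipschitz_pre_pi _ hl) /= dxx add0r.
have [[h ->]|[h [s [hs [t [ht ->]]]]]] := cayleyE b; rewrite (lipschitz_pre_pi _ hl) /=.
  by rewrite cvert_dist.
have [h1 h2] := cvert_edge_le h hs ht.
rewrite le_min; apply/andP; split; apply: le_trans (cayley_distT _ _ _) _; rewrite -cvert_dist;
  by apply: lerD.
Qed.

(** A path from [a] stays in the edge or leaves it through an end. The minimum of the resulting
    candidates satisfies [lipschitz_pre], hence bounds the distance from below. *)
Lemma edge_dist_cases g s hs t0 ht0 b (a := @edge_pt g s t0 hs ht0) :
  [\/ exists t ht, b = @edge_pt g s t hs ht /\ dist a b = `|t0 - t|,
      dist a b = t0 + dist (cvert R S g) b |
      dist a b = (1 - t0) + dist (cvert R S (g * s)%g) b].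
Proof.
pose m p := Num.min (t0 + vdist g p) ((1 - t0) + vdist (g * s)%g p).
pose on p t := exists ht, p = @Cedge R G S g s t hs ht.
pose phi p := if p is Cedge h s' t _ _ then
  (if (h == g) && (s' == s) then Num.min `|t0 - t| (m p) else m p) else m p.
have [g1 l1] := vdist_lipschitz g; have [g2 l2] := vdist_lipschitz (g * s)%g.
have mg p q : cayley_glue p q -> m p = m q by move=> h; rewrite /m (g1 _ _ h) (g2 _ _ h).
have ml p q l : cayley_piece p q l -> m q <= m p + l.
  move=> h; have := l1 _ _ _ h; have := l2 _ _ _ h.
  by rewrite /m /= ge_min !minEle; case: ifP => _ h2 h1; apply/orP; [left|right]; lra.
have [t0a t0b] := andP ht0.
have hphi : lipschitz_pre phi.
  split=> [p q h|p q l h].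
    have e := mg _ _ h; case: h e => h s' hs' ht' e; rewrite /phi -{}e;
      case: andP => // -[/eqP eh /eqP es]; subst h s'; apply: min_r; rewrite /m /= ge_min dxx.
      apply/orP; left; rewrite !subr0 ger0_norm // gerDl ge_min.
      by rewrite addr0; apply/orP; left; apply: lexx.
    apply/orP; right; rewrite distrC ger0_norm ?subr_ge0 // gerDl ge_min.
    by rewrite dxx subrr addr0; apply/orP; right; apply: lexx.
  have := ml _ _ _ h; case: h => h s' t t' hs1 ht hs2 ht' /=; rewrite /phi.
  case: ifP => // _ hm; rewrite ge_min; have [lt|le] := leP `|t0 - t| (m (Cedge h hs1 ht)).
    by apply/orP; left; apply: ler_distD.
  by apply/orP; right.
have le : phi (repr b) <= dist a b.
  have := lipschitz_dist a b hphi; rewrite (lipschitz_pre_pi _ hphi) /= !eqxx /= => h.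
  apply: le_trans h _; rewrite gerDr ge_min; apply/orP; left; by rewrite subrr normr0.
have h1 : dist a b <= t0 + dist (cvert R S g) b.
  have [h _] := cvert_edge_le g hs ht0; apply: le_trans (cayley_distT _ (cvert R S g) _) _.
  by rewrite lerD2r cayley_distC.
have h2 : dist a b <= (1 - t0) + dist (cvert R S (g * s)%g) b.
  have [_ h] := cvert_edge_le g hs ht0; apply: le_trans (cayley_distT _ (cvert R S (g * s)%g) _) _.
  by rewrite lerD2r cayley_distC.
have hm : m (repr b) <= dist a b -> dist a b = t0 + dist (cvert R S g) b \/
    dist a b = (1 - t0) + dist (cvert R S (g * s)%g) b.
  rewrite /m -!vdistE ge_min => /orP[] h; [left|right]; apply: le_anti; apply/andP; by split.
have hmE p : b = \pi p -> m p = m (repr b).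
  by move=> ->; apply/esym/lipschitz_pre_pi; split.
have [[h e]|[h [s' [hs' [t [ht e]]]]]] := cayleyE b.
  have /hm[] : m (repr b) <= dist a b; [|by constructor 2|by constructor 3].
  by rewrite -(hmE _ e); move: le; rewrite {1}e (lipschitz_pre_pi _ hphi).
have mE : m (Cedge h hs' ht) = m (repr b) by apply: hmE.
have : phi (Cedge h hs' ht) <= dist a b.
  by move: le; rewrite {1}e (lipschitz_pre_pi _ hphi).
rewrite /phi mE; case: andP => [[/eqP eh /eqP es]|_ /hm[]]; [|by constructor 2|by constructor 3].
subst h s'; rewrite ge_min => /orP[le'|/hm[]]; [|by constructor 2|by constructor 3].
constructor 1; exists t, ht; rewrite e (bool_irrelevance hs' hs); split=> //.
apply: le_anti; rewrite edge_dist_le /=; move: le'; rewrite e (bool_irrelevance hs' hs); exact.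
Qed.

Lemma cvert_dist0 g b : dist (cvert R S g) b = 0 -> b = cvert R S g.
Proof.
have [d0 _] := wd_geodesic hS.
have [[h ->]|[h [s [hs [t [ht ->]]]]]] := cayleyE b.
  by rewrite cvert_dist => /eqP; rewrite pnatr_eq0 => /eqP /d0 ->.
have [t0 t1] := andP ht.
rewrite vdistE (lipschitz_pre_pi _ (vdist_lipschitz g)) /= minEle.
have z n (r : R) : 0 <= r -> n%:R + r = 0 -> n = 0%N /\ r = 0.
  move=> r0 e; have n0 := ler0n R n; have en : n%:R = 0 :> R by lra.
  by split; [apply/eqP; rewrite -(pnatr_eq0 R) en|lra].
case: ifP => _ e; have [|/d0 -> {}e] := z _ _ _ e; rewrite ?subr_ge0 //.
  by rewrite (edge_pt_eq h hs ht zz e) edge_pt0.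
by rewrite (edge_pt_eq h hs ht oo) ?edge_pt1 //; lra.
Qed.

Lemma cayley_metric : is_metric dist.
Proof.
split; [exact: cayley_dist_ge0| |exact: cayley_distC|exact: cayley_distT].
move=> a b; split=> [|->]; last exact: cayley_distxx.
have [[g ->]|[g [s [hs [t [ht ->]]]]]] := cayleyE a; first by move/cvert_dist0.
have [t0 t1] := andP ht.
have [[t' [ht' [-> ->]]]|->|->] := edge_dist_cases g hs ht b.
- by move/eqP; rewrite normr_eq0 subr_eq0 => /eqP e; apply: edge_pt_eq.
- move=> e; have g0 := cayley_dist_ge0 (cvert R S g) b.
  have /cvert_dist0 -> : dist (cvert R S g) b = 0 by lra.
  by rewrite (edge_pt_eq g hs ht zz) ?edge_pt0 //; lra.
- move=> e; have g0 := cayley_dist_ge0 (cvert R S (g * s)%g) b.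
  have /cvert_dist0 -> : dist (cvert R S (g * s)%g) b = 0 by lra.
  by rewrite (edge_pt_eq g hs ht oo) ?edge_pt1 //; lra.
Qed.

Let has a b := exists c, geodesic dist a b c.

Let has_sym a b : has a b -> has b a.
Proof. by move=> [c /(geodesic_rev cayley_metric) h]; eexists; exact: h. Qed.

Let has_trans a b c : has a b -> has b c -> dist a b + dist b c = dist a c -> has a c.
Proof.
move=> [c1 h1] [c2 h2] e; have [c3 h3 _] := geodesic_cat cayley_metric h1 h2 e; by exists c3.
Qed.

Lemma edge_geodesic g s hs t ht t' ht' :
  dist (@edge_pt g s t hs ht) (@edge_pt g s t' hs ht') = `|t - t'| ->
  has (@edge_pt g s t hs ht) (@edge_pt g s t' hs ht').
Proof.
wlog tt : t ht t' ht' / t <= t'.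
  move=> H e; have [le|/ltW le] := leP t t'; first exact: H.
  by apply/has_sym/H => //; rewrite cayley_distC distrC.
move=> e; have [t0 t1] := andP ht; have [u0 u1] := andP ht'.
(* [edge_pt] requires a parameter in the unit interval, so parameters are clamped; inside the
   relevant range this changes nothing. *)
have hc (r : R) : 0 <= Num.min 1 (Num.max 0 r) <= 1.
  apply/andP; split; last by rewrite ge_min lexx.
  by rewrite le_min ler01 le_max lexx.
have cl (r : R) : 0 <= r <= 1 -> Num.min 1 (Num.max 0 r) = r.
  by move=> /andP[r0 r1]; rewrite max_r // min_r.
pose f u := edge_pt g hs (hc (t + u)).
have f0 : f 0 = edge_pt g hs ht by apply: edge_pt_eq; rewrite addr0 cl.
have fl : f (t' - t) = edge_pt g hs ht' by apply: edge_pt_eq; rewrite addrC subrK cl.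
exists f; rewrite -f0 -fl; apply: (lipschitz_geodesic cayley_metric).
- by rewrite subr_ge0.
- move=> u w /andP[a0 a1] /andP[b0 b1] uw; apply: le_trans (edge_dist_le _ _ _ _) _.
  rewrite !cl; last 2 first.
  + by apply/andP; split; lra.
  + by apply/andP; split; lra.
  by rewrite distrC ger0_norm; lra.
by rewrite f0 fl e distrC ger0_norm // subr_ge0.
Qed.

Lemma cvert_edge_geodesic g s hs t ht :
  (t <= dist (cvert R S g) (@edge_pt g s t hs ht) ->
    has (cvert R S g) (@edge_pt g s t hs ht)) /\
  (1 - t <= dist (cvert R S (g * s)%g) (@edge_pt g s t hs ht) ->
    has (cvert R S (g * s)%g) (@edge_pt g s t hs ht)).
Proof.
have [t0 t1] := andP ht; have [h1 h2] := cvert_edge_le g hs ht.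
split=> h; [rewrite -(edge_pt0 g hs zz)|rewrite -(edge_pt1 g hs oo)]; apply: edge_geodesic.
  by rewrite edge_pt0 sub0r normrN ger0_norm //; apply: le_anti; rewrite h h1.
by rewrite edge_pt1 ger0_norm ?subr_ge0 //; apply: le_anti; rewrite h h2.
Qed.

Lemma cvert_geodesic g h : has (cvert R S g) (cvert R S h).
Proof.
have [d0 dg] := wd_geodesic hS.
move: {2}(d g h) (erefl (d g h)) => n; elim: n g => [|n IH] g e.
  exists (fun=> cvert R S g); rewrite (d0 _ _ e); split=> // s t.
  rewrite cayley_distxx => /andP[a0 a1] /andP[b0 b1].
  by have -> : s = t; [lra|rewrite subrr normr0].
have [|z [gz zh]] := dg g h 1%N; first by rewrite -/d e.
have zn : d z h = n by rewrite /d zh -/d e subn1.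
apply: (has_trans (b := cvert R S z)); [|exact: IH|]; last first.
  by rewrite !cvert_dist zn e -natrD /d gz.
have ez : dist (cvert R S g) (cvert R S z) = 1 by rewrite cvert_dist /d gz.
have : (d g z <= 1)%N by rewrite /d gz.
have gnz : g <> z by move=> eg; move: gz; rewrite eg -/d dxx.
move/graph_dist_le1 => [//|[s hs [ez'|ez']]].
  subst z; rewrite -(edge_pt1 g hs oo); apply: (cvert_edge_geodesic g hs oo).1.
  by rewrite edge_pt1 ez.
subst g; apply: has_sym; rewrite -(edge_pt1 z hs oo); apply: (cvert_edge_geodesic z hs oo).1.
by rewrite edge_pt1 cayley_distC ez.
Qed.

Lemma cvert_any_geodesic g b : has (cvert R S g) b.
Proof.
have [[h ->]|[h [s [hs [t [ht ->]]]]]] := cayleyE b; first exact: cvert_geodesic.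
have [h1 h2] := cvert_edge_le h hs ht.
have := vdistE g (edge_pt h hs ht); rewrite (lipschitz_pre_pi _ (vdist_lipschitz g)) /= minEle.
have T x := cayley_distT (cvert R S g) (cvert R S x) (edge_pt h hs ht).
have T1 := T h; have T2 := T (h * s)%g; rewrite !cvert_dist in T1 T2.
case: ifP => _ e.
  apply: (has_trans (cvert_geodesic g h)); first by apply: (cvert_edge_geodesic h hs ht).1; lra.
  by rewrite cvert_dist; lra.
apply: (has_trans (cvert_geodesic g (h * s)%g)); first by apply: (cvert_edge_geodesic h hs ht).2; lra.
by rewrite cvert_dist; lra.
Qed.

Theorem cayley_geodesic_space : geodesic_space dist.
Proof.
split; first exact: cayley_metric.
move=> a b; have [[g ->]|[g [s [hs [t [ht ->]]]]]] := cayleyE a.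
  exact: cvert_any_geodesic.
have [h1 h2] := cvert_edge_le g hs ht.
have [[t' [ht' [-> e]]]|e|e] := edge_dist_cases g hs ht b; first exact: edge_geodesic.
  have T := cayley_distT (edge_pt g hs ht) (cvert R S g) b.
  have C := cayley_distC (edge_pt g hs ht) (cvert R S g).
  apply: (has_trans (has_sym _) (cvert_any_geodesic g b)); last by lra.
  by apply: (cvert_edge_geodesic g hs ht).1; lra.
have T := cayley_distT (edge_pt g hs ht) (cvert R S (g * s)%g) b.
have C := cayley_distC (edge_pt g hs ht) (cvert R S (g * s)%g).
apply: (has_trans (has_sym _) (cvert_any_geodesic (g * s)%g b)); last by lra.
by apply: (cvert_edge_geodesic g hs ht).2; lra.
Qed.

Lemma cayley_near_vertex a : exists g, dist a (cvert R S g) <= 1.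
Proof.
have [[g ->]|[g [s [hs [t [ht ->]]]]]] := cayleyE a; exists g.
  by rewrite cayley_distxx ler01.
by rewrite cayley_distC; have [h _] := cvert_edge_le g hs ht; have [? ?] := andP ht; lra.
Qed.

Theorem hyperbolic_cayley_thin : hyperbolic dist -> exists delta, thin_triangles d delta.
Proof.
move=> hyp; apply: (@net_thin R X dist hyp G d dP (wd_geodesic hS) (cvert R S) 1).
- by move=> x y; rewrite cvert_dist mul1n.
- by move=> x y n; rewrite cvert_dist ler_nat mul1n; lia.
- by move=> a; have [g hg] := cayley_near_vertex a; exists g; rewrite cayley_distC.
Qed.

(** Ends of geodesics of the graph may lie inside edges. A geodesic is replaced by vertices near its
    points at integer times, a quasi-path, which [quasi_path_near] compares with geodesics between
    vertices. *)
Theorem thin_hyperbolic_cayley delta : thin_triangles d delta -> hyperbolic dist.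
Proof.
move=> th; split; first exact: cayley_geodesic_space.
have [kap hk] := quasi_path_near delta 3.
have [nv hnv] := choice cayley_near_vertex.
exists ((kap + (3 * delta + 1) + kap)%:R + 3) => x y z a b c ha hb hc t ht.
have samp u w e : geodesic dist u w e -> exists n p, [/\ quasi_path d 4 n p,
    p 0%N = nv u, p n = nv w,
    forall s, 0 <= s <= dist u w -> exists2 i, (i <= n)%N & dist (e s) (cvert R S (p i)) <= 2 &
    forall i, (i <= n)%N -> exists2 s, 0 <= s <= dist u w & dist (e s) (cvert R S (p i)) <= 1].
  move=> he; have [e0 e1 ei] := he.
  pose p (i : nat) := nv (e (Num.min i%:R (dist u w))).
  have hp i : dist (e (Num.min i%:R (dist u w))) (cvert R S (p i)) <= 1 by apply: hnv.
  have w0 := cayley_dist_ge0 u w; pose n := (Num.truncn (dist u w)).+1.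
  have hn : dist u w < n%:R by apply: truncnS_gt.
  have tm i : 0 <= Num.min i%:R (dist u w) <= dist u w.
    by apply/andP; split; [rewrite le_min ler0n|rewrite ge_min lexx orbT].
  exists n, p; split.
  - have step g h (r : R) k : dist (cvert R S g) (cvert R S h) <= r -> r <= k%:R -> (d g h <= k)%N.
      by rewrite cvert_dist => h1 h2; rewrite -(ler_nat R); apply: le_trans h1 h2.
    have pe i : `|Num.min i%:R (dist u w) - Num.min i.+1%:R (dist u w)| <= 1.
      rewrite -natr1; set D := dist u w; rewrite ler_norml; case: (leP i%:R D) => k1;
        case: (leP (i%:R + 1) D) => k2; apply/andP; split; lra.
    split=> [i _|i j hi hj].
      apply: (step _ _ 3); last by rewrite ler_nat.
      have := cayley_distT (cvert R S (p i)) (e (Num.min i%:R (dist u w))) (cvert R S (p i.+1)).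
      have := cayley_distT (e (Num.min i%:R (dist u w))) (e (Num.min i.+1%:R (dist u w))) (cvert R S (p i.+1)).
      rewrite ei // (cayley_distC (cvert R S (p i)) (e _)).
      by have := hp i; have := hp i.+1; have := pe i; lra.
    have [ij|ji] := leqP i j; first by lia.
    have : (i%:R - j%:R : R) <= (d (p i) (p j) + 3)%:R.
      have lo k : (k <= n)%N -> k%:R - 1 <= Num.min k%:R (dist u w) :> R.
        move=> kn; rewrite le_min; apply/andP; split; first lra.
        have [->|] := eqVneq k 0%N; first by lra.
        move=> k0; have : ((k.-1)%:R <= dist u w).
          have /andP[tr _] := truncn_itv w0; apply: le_trans tr; rewrite ler_nat; lia.
        by have -> : k%:R = k.-1%:R + 1 :> R; [rewrite natr1 prednK ?lt0n|lra].
      have := lo i hi; have : Num.min j%:R (dist u w) <= j%:R by rewrite ge_min lexx.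
      have := cayley_distT (e (Num.min i%:R (dist u w))) (cvert R S (p i)) (e (Num.min j%:R (dist u w))).
      have := cayley_distT (cvert R S (p i)) (cvert R S (p j)) (e (Num.min j%:R (dist u w))).
      have := hp i; have := hp j; rewrite ei // cvert_dist (cayley_distC (cvert R S (p j))) natrD.
      have := ler_norm (Num.min i%:R (dist u w) - Num.min j%:R (dist u w)); lra.
    rewrite -natrB ?(ltnW ji) // ler_nat; lia.
  - by rewrite /p min_l // e0.
  - by rewrite /p min_r ?(ltW hn) // e1.
  - move=> s /andP[s0 s1]; exists (Num.truncn s); first by rewrite ltnW // ltnS le_truncn.
    have /andP[k2 k1] := truncn_itv s0.
    have := hp (Num.truncn s); rewrite min_l; last by apply: le_trans k2 s1.
    move=> k3; apply: le_trans (cayley_distT _ (e (Num.truncn s)%:R) _) _.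
    rewrite ei ?s0 ?s1 ?ler0n //=; last by apply: le_trans k2 s1.
    by rewrite -natr1 in k1; rewrite ger0_norm ?subr_ge0 //; lra.
  - by move=> i _; exists (Num.min i%:R (dist u w)).
have [n [p [qp p0 pn pa _]]] := samp _ _ _ ha.
have [n1 [p1 [qp1 p10 p1n _ pb1]]] := samp _ _ _ hb.
have [n2 [p2 [qp2 p20 p2n _ pb2]]] := samp _ _ _ hc.
have dG := wd_geodesic hS.
have [f [f0 fn hf]] := dpath_ex dP dG (nv x) (nv y).
have [f1 [f10 f1n hf1]] := dpath_ex dP dG (nv y) (nv z).
have [f2 [f20 f2n hf2]] := dpath_ex dP dG (nv x) (nv z).
have [i hi di] := pa t ht.
have [_ /(_ i hi) [j hj dj]] := hk G d dP dG th _ _ _ _ qp hf ltac:(congruence) ltac:(congruence).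
pose f1' k := f1 (d (nv y) (nv z) - k)%N; have hf1' : dpath d (d (nv y) (nv z)) f1'.
  exact: dpath_rev hf1.
have fin m q e u w k : quasi_path d 4 m q -> q 0%N = nv u -> q m = nv w ->
    (forall i, (i <= m)%N -> exists2 s, 0 <= s <= dist u w & dist (e s) (cvert R S (q i)) <= 1) ->
    forall N h, dpath d N h -> h 0%N = nv u -> h N = nv w -> (k <= N)%N ->
    (d (f j) (h k) <= 3 * delta)%N ->
    exists2 s, 0 <= s <= dist u w & dist (a t) (e s) <= (kap + (3 * delta + 1) + kap)%:R + 3.
  move=> hq q0 qm qe N h hh h0 hN kN dk.
  have [/(_ k kN) [l lm dl] _] := hk G d dP dG th _ _ _ _ hq hh ltac:(congruence) ltac:(congruence).
  have [s hs ds] := qe l lm; exists s => //.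
  have : (d (p i) (q l) <= kap + (3 * delta + 1) + kap)%N.
    by have := dT (p i) (f j) (q l); have := dT (f j) (h k) (q l); lia.
  rewrite -(ler_nat R) -cvert_dist => hd.
  have := cayley_distT (a t) (cvert R S (p i)) (e s).
  have := cayley_distT (cvert R S (p i)) (cvert R S (q l)) (e s).
  by rewrite (cayley_distC (cvert R S (q l))); lra.
have [[k kN dk]|[k kN dk]] := thin_dpaths dP th hf hf2 hf1' ltac:(congruence)
    ltac:(by rewrite /f1' subn0; congruence) ltac:(by rewrite /f1' subnn; congruence) hj.
  by right; apply: (fin n2 p2 c x z k qp2 p20 p2n pb2 _ _ hf2).
left; apply: (fin n1 p1 b y z (d (nv y) (nv z) - k)%N qp1 p10 p1n pb1 _ _ hf1) => //.
by rewrite leq_subr.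
Qed.
End RealCayley.

(** * Geodesics avoiding large balls *)

Section Far.
Variables (X : Type) (d : X -> X -> nat).
Hypothesis dP : pmetric d.
Let dxx x : d x x = 0. Proof. by case: dP. Qed.
Let dC x y : d x y = d y x. Proof. by case: dP. Qed.
Let dT x y z : d x z <= d x y + d y z. Proof. by case: dP. Qed.

(** Up to an additive constant this says that the Gromov product of [x] and [y] at [z] is at least
    [N]; see [far_product] and [product_far]. *)
Definition far z x y N : Prop := forall m, between d x y m -> N <= d z m.

Lemma far_mono z x y N M : M <= N -> far z x y N -> far z x y M.
Proof. by move=> MN h m /h; apply: leq_trans MN. Qed.

Lemma far_sym z x y N : far z x y N -> far z y x N.
Proof. by move=> h m /(between_sym dP)/h. Qed.

Lemma far_l z x y N : far z x y N -> N <= d z x.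
Proof. by apply; rewrite /between dxx. Qed.

Lemma far_r z x y N : far z x y N -> N <= d z y.
Proof. by apply; rewrite /between dxx addn0. Qed.

Lemma far_base z z' x y N : far z x y N -> far z' x y (N - d z z').
Proof. by move=> h m /h; have := dT z z' m; lia. Qed.

Lemma far_close z x y c N : d x y <= c -> N + c <= d z x -> far z x y N.
Proof.
by move=> h1 h2 m; rewrite /between; have := dT z m x; have := dC m x; lia.
Qed.

Lemma far_beyond z x m : between d z x m -> far z m x (d z m).
Proof.
move=> hm m'; move: hm; rewrite /between.
by have := dT z m' x; lia.
Qed.

Lemma far_product z x y N : d x y + 2 * N <= d z x + d z y -> far z x y N.
Proof.
by move=> h m; rewrite /between; have := dT z m x; have := dT z m y; have := dC x m; lia.
Qed.

Variable delta : nat.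
Hypothesis th : thin_triangles d delta.

Lemma far_ultra z x y w N : far z x y N -> far z y w N -> far z x w (N - delta).
Proof.
move=> h1 h2 m hm; have [m' hm' dm] := th y hm.
have : N <= d z m' by case: hm'; [apply: h1|apply: h2].
by have := dT z m m'; lia.
Qed.

Hypothesis dG : dgeodesic d.

(** By [crossing] some point of a geodesic from [x] to [y] is close to both other sides; there the
    triangle inequalities towards [z] are nearly equalities. *)
Lemma product_far z x y N : far z x y N -> d x y + 2 * N <= d z x + d z y + (6 * delta + 4).
Proof.
move=> h; have [g [g0 gn hg]] := dpath_ex dP dG x y.
pose P i := exists2 m, between d x z m & d (g i) m <= delta.
pose Q i := exists2 m, between d z y m & d (g i) m <= delta.
have PQ i : i <= d x y -> P i \/ Q i.
  move=> hi; have := dpath_between hg (i := 0) (j := i) (k := d x y).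
  rewrite g0 gn => /(_ ltac:(lia) (leqnn _)) hm.
  by have [m [hm'|hm'] dm] := th z hm; [left|right]; exists m.
have P0 : P 0 by exists x; rewrite /between ?g0 dxx.
have Qn : Q (d x y) by exists y; rewrite /between ?gn dxx ?addn0.
have [i hi [[m hm dm] hQ]] := crossing P0 Qn PQ.
have [m' hm' dm'] : exists2 m, between d z y m & d (g i) m <= delta + 1.
  case: hQ => [[m' hm' dm']|[lt [m' hm' dm']]]; exists m' => //; first by lia.
  by have := dT (g i) (g i.+1) m'; rewrite hg //; lia.
have hi' : between d x y (g i).
  by have := dpath_between hg (i := 0) (j := i) (k := d x y); rewrite g0 gn => /(_ ltac:(lia) (leqnn _)).
have := h _ hi'; move: hm hm' hi'; rewrite /between.
have := dT z m (g i); have := dT z m' (g i); have := dT x m (g i); have := dT (g i) m' y.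
have := dC (g i) m; have := dC (g i) m'; have := dC x z; have := dC m z; have := dC m' z; lia.
Qed.

Lemma between_ex x y n : n <= d x y -> exists2 m, between d x y m & d x m = n.
Proof.
by move=> hn; have [_ dg] := dG; have [m [h1 h2]] := dg x y n hn; exists m => //; rewrite /between; lia.
Qed.
End Far.

Lemma reach_pad (V : Type) (E : V -> V -> Prop) n x y : reach E n x y -> reach E n.+1 x y.
Proof. by move=> h; exists x; split=> //; left. Qed.

(** * Transfer of the relation [far] along chains of boundedly many fibres *)

Section Transfer.
Variables (H X1 X2 : Type) (i1 : H -> X1) (i2 : H -> X2).
Variables (d1 : X1 -> X1 -> nat) (d2 : X2 -> X2 -> nat) (delta kap : nat).
Hypotheses (P1 : pmetric d1) (G1 : dgeodesic d1) (T1 : thin_triangles d1 delta).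
Hypotheses (P2 : pmetric d2) (T2 : thin_triangles d2 delta).
Variable share : H -> H -> Prop.
Hypothesis share_refl : forall x, share x x.
Hypothesis share_sym : forall x y, share x y -> share y x.
Hypothesis share_qc : forall x y m, share x y -> between d1 (i1 x) (i1 y) m ->
  exists p, [/\ d1 m (i1 p) <= kap, share x p & share p y].
Hypothesis share_far : forall r, exists N, forall z x y, share x y ->
  far d1 (i1 z) (i1 x) (i1 y) N -> far d2 (i2 z) (i2 x) (i2 y) r.
Hypothesis le12 : forall n, exists rho, forall x y,
  d1 (i1 x) (i1 y) <= n -> d2 (i2 x) (i2 y) <= rho.
Hypothesis le21 : forall n, exists rho, forall x y,
  d2 (i2 x) (i2 y) <= n -> d1 (i1 x) (i1 y) <= rho.

Let c1 x y : d1 x y = d1 y x. Proof. by case: P1. Qed.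
Let t1 x y z : d1 x z <= d1 x y + d1 y z. Proof. by case: P1. Qed.
Let x1 x : d1 x x = 0. Proof. by case: P1. Qed.
Local Notation far1 z x y N := (far d1 (i1 z) (i1 x) (i1 y) N).
Local Notation far2 z x y N := (far d2 (i2 z) (i2 x) (i2 y) N).

Let ultra2 z x y w r : far2 z x y (r + delta) -> far2 z y w (r + delta) -> far2 z x w r.
Proof. by move=> h1 h2; apply: far_mono (far_ultra P2 T2 h1 h2); lia. Qed.

Let ultra1 z x y w r : far d1 z x y (r + delta) -> far d1 z y w (r + delta) -> far d1 z x w r.
Proof. by move=> h1 h2; apply: far_mono (far_ultra P1 T1 h1 h2); lia. Qed.

Lemma close_far c r : exists N, forall z x y, d1 (i1 x) (i1 y) <= c ->
  N <= d1 (i1 z) (i1 x) -> far2 z x y r.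
Proof.
have [rho hrho] := le12 c; have [s hs] := le21 (r + rho).
exists s.+1 => z x y /hrho xy zx; apply: (far_close P2 xy).
have [le|] := leqP (d2 (i2 z) (i2 x)) (r + rho); last by lia.
by have := hs _ _ le; lia.
Qed.

Lemma share_poly n : exists c, forall x y m, reach share n x y ->
  between d1 (i1 x) (i1 y) m -> exists p, [/\ d1 m (i1 p) <= c, reach share n x p & reach share n p y].
Proof.
elim: n => [|n [c IH]].
  exists 0 => x y m /= e hm; subst y; exists x; split=> //.
  by move: hm; rewrite /between x1 (c1 m (i1 x)); lia.
exists (delta + kap + c) => x y m [z [xz zy]] hm.
have {}xz : share x z by case: xz => [->|].
have [m' [hm'|hm'] dm] := T1 (i1 z) hm.
  have [p [h1 h2 h3]] := share_qc xz hm'; exists p; split.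
  - by have := t1 m m' (i1 p); lia.
  - by exists p; split; [right|elim: (n) => //= k hk; exists p; split=> //; left].
  - by exists z; split=> //; right.
have [p [h1 h2 h3]] := IH z y m' zy hm'; exists p; split.
- by have := t1 m m' (i1 p); lia.
- by exists z; split=> //; right.
- exact: reach_pad.
Qed.

Let transfer n := forall r, exists N, forall z x y, reach share n x y ->
  far1 z x y N -> far2 z x y r.

(** In the triangle [z], [p1], [x] the point [m] is close to one of the sides at [p1]. This gives a
    point [q] near [m] that either shares a fibre with [p1] or is joined to [x] by only [n] fibres;
    what lies beyond [m] is far from [z], so [share_far] and the induction hypothesis apply. *)
Lemma transfer_side n c r : transfer n -> exists N, forall z x p m, reach share n.+1 z x ->
  between d1 (i1 z) (i1 x) m -> d1 m (i1 p) <= c -> N <= d1 (i1 z) m -> far2 z x p r.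
Proof.
move=> Sn; have [cn hcn] := share_poly n.
pose c' := delta + cn + kap + c.
have [N1 h1] := share_far (r + delta + delta); have [N2 h2] := Sn (r + delta + delta).
have [N3 h3] := close_far (2 * c') (r + delta + delta).
exists (N1 + N2 + N3 + 4 * c' + 10 * delta) => z x p m [p1 [zp1 p1x]] hm mp zm.
have {}zp1 : share z p1 by case: zp1 => [->|].
have mx := far_beyond P1 hm.
have close u w : d1 m (i1 u) <= c' -> d1 m (i1 w) <= c' -> far2 z u w (r + delta + delta).
  move=> hu hw; apply: h3; first by have := t1 (i1 u) m (i1 w); have := c1 m (i1 u); lia.
  by have := t1 (i1 z) (i1 u) m; have := c1 m (i1 u); lia.
have pc : d1 m (i1 p) <= c' by lia.
have [m' [hm'|hm'] dm] := T1 (i1 p1) hm; last first.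
  have [q [mq _ qx]] := hcn p1 x m' p1x hm'.
  have qc : d1 m (i1 q) <= c' by have := t1 m m' (i1 q); lia.
  apply: (far_sym P2); apply: (@ultra2 z p q x r).
    by apply: far_mono (close _ _ pc qc); lia.
  apply: far_mono (h2 z q x qx _); first by lia.
  apply: (@ultra1 _ _ m).
    apply: (far_close P1 (c := c')); first by rewrite c1.
    by have := t1 (i1 z) (i1 q) m; have := c1 m (i1 q); lia.
  by apply: far_mono mx; lia.
have [q [mq zq qp1]] := share_qc zp1 hm'.
have qc : d1 m (i1 q) <= c' by have := t1 m m' (i1 q); lia.
have m'p1 := far_beyond P1 hm'.
have zm' := t1 (i1 z) m' m; have mm' := c1 m m'.
have fq : far1 z q p1 (N1 + N2 + delta).
  apply: (@ultra1 _ _ m'); last by apply: far_mono m'p1; lia.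
  apply: (far_close P1 (c := kap)); first by rewrite c1.
  by have := t1 (i1 z) (i1 q) m'; have := c1 m' (i1 q); lia.
have fx : far1 z p1 x N2.
  apply: (@ultra1 _ _ m'); first by apply: far_mono (far_sym P1 m'p1); lia.
  apply: (@ultra1 _ _ m); last by apply: far_mono mx; lia.
  by apply: (far_close P1 (c := delta)); [rewrite c1|lia].
apply: (far_sym P2); apply: (@ultra2 z p q x r); first by apply: far_mono (close _ _ pc qc); lia.
apply: (@ultra2 z q p1 x); last by apply: far_mono (h2 z p1 x p1x fx); lia.
by apply: (h1 z q p1 qp1); apply: far_mono fq; lia.
Qed.

(** Since the geodesic from [x] to [y] is far, those from [z] to [x] and to [y] stay together for a
    long time. [transfer_side] is used on both of them, with a common point [p] near the place where
    they are still close. *)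
Lemma transfer_base n r : transfer n -> exists N, forall z x y, reach share n.+1 z x ->
  reach share n.+1 z y -> far1 z x y N -> far2 z x y r.
Proof.
move=> Sn; have [c hc] := share_poly n.+1.
have [N hN] := transfer_side (c + delta) (r + delta) Sn.
exists (N + 2 * delta + 2) => z x y zx zy hxy.
have [|m hm zm] := between_ex G1 (x := i1 z) (y := i1 x) (n := N + delta).
  by have := far_l P1 hxy; lia.
have [m' [hm'|hm'] dm] := T1 (i1 y) hm; last first.
  by have := far_sym P1 hxy hm'; have := t1 (i1 z) m m'; lia.
have [p [mp _ _]] := hc z x m zx hm.
have mm' := c1 m m'; apply: (@ultra2 z x p y r).
  by apply: (hN z x p m zx hm); lia.
apply: (far_sym P2); apply: (hN z y p m' zy hm').
  by have := t1 m' m (i1 p); lia.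
by have := t1 (i1 z) m' m; lia.
Qed.

(** If both parts of the chain are far from [b], they are concatenated. Otherwise, by thinness, the
    geodesic over the first fibre comes close to [b], and [b] may be replaced by a point [q] of that
    fibre; [q] is joined to [x] and to [y] by at most [n.+1] fibres, which is the case of
    [transfer_base]. *)
Theorem transfer_far n : transfer n.
Proof.
elim: n => [|n IH] r.
  by have [N hN] := share_far r; exists N => z x y <-; apply: hN.
have [N1 h1] := share_far (r + delta); have [N2 h2] := IH (r + delta).
pose c := N1 + N2 + delta + kap; have [rho hrho] := le12 c.
have [N3 h3] := transfer_base (r + rho) IH.
exists (N1 + N2 + N3 + c + 4 * delta) => b x y [z [xz zy]] hxy.
have {}xz : share x z by case: xz => [->|].
have [[ha hb]|no] := pselect (far1 b x z N1 /\ far1 b z y N2).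
  apply: (@ultra2 b x z y r); first exact: h1.
  exact: h2.
have [m hm bm] : exists2 m, between d1 (i1 x) (i1 z) m & d1 (i1 b) m <= N1 + N2 + delta.
  apply: contrapT => no'; apply: no; split=> m hm; rewrite leqNgt; apply/negP => lt.
    by apply: no'; exists m => //; lia.
  have [m' [hm'|hm'] dm] := T1 (i1 x) hm.
    apply: no'; exists m'; first exact: (between_sym P1).
    by have := t1 (i1 b) m m'; lia.
  by have := hxy _ hm'; have := t1 (i1 b) m m'; lia.
have [q [mq xq qz]] := share_qc xz hm.
have bq : d1 (i1 b) (i1 q) <= c by have := t1 (i1 b) m (i1 q); lia.
have qx : reach share n.+1 q x.
  exists x; split; first by right; apply: share_sym.
  by elim: (n) => //= k hk; exists x; split=> //; left.
have qy : reach share n.+1 q y by exists z; split=> //; right.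
have hf : far1 q x y N3.
  by apply: far_mono (far_base P1 (i1 q) hxy); have := c1 (i1 b) (i1 q); lia.
have := far_base P2 (i2 b) (h3 q x y qx qy hf); apply: far_mono.
have [_ cc _] := P2; have := hrho _ _ bq; have := cc (i2 q) (i2 b); lia.
Qed.
End Transfer.

(** * Cannon-Thurston maps *)

Lemma hom_le21 (H G : groupType) (SH : seq H) (SG : seq G) (hSH : generates SH)
    (hSG : generates SG) (f : {multiplicative H -> G}) : injective f ->
  forall n, exists rho, forall x y, wd hSG (f x) (f y) <= n -> wd hSH x y <= rho.
Proof.
move=> f_inj n; have [b hb] := wd_ball hSG n.
have [||c hc] := @finite_bound _ b (fun g q => forall a : H, f a = g -> wd hSH 1%g a <= q).
- by move=> g p p' pp h a /h; lia.
- move=> g _; have [[a <-]|no] := pselect (exists a, f a = g).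
    by exists (wd hSH 1%g a) => a' /f_inj ->.
  by exists 0 => a e; case: no; exists a.
exists c => x y; rewrite wd_1 [X in _ -> X <= _]wd_1 => /hb h.
by apply: (hc _ h); rewrite gmulfM homV.
Qed.

Lemma far_mul (G : groupType) (S : seq G) (hS : generates S) g z x y N :
  far (wd hS) (g * z)%g (g * x)%g (g * y)%g N <-> far (wd hS) z x y N.
Proof.
split=> h m hm; last first.
  have e : m = (g * (g^-1 * m))%g by rewrite mulgA mulgV mul1g.
  by rewrite e wd_mul; apply: h; move: hm; rewrite {1}e /between !wd_mul.
by rewrite -(wd_mul hS g); apply: h; move: hm; rewrite /between !wd_mul.
Qed.

(** Image points near consecutive points of a geodesic of [G] have preimages within [rho] of each
    other, and these form a path of proportional length in [H]. *)
Lemma near_image_qi (H G : groupType) (SH : seq H) (SG : seq G) (hSH : generates SH)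
    (hSG : generates SG) (f : {multiplicative H -> G}) C : injective f ->
  (forall x y, exists2 g, [/\ g 0 = f x, g (wd hSG (f x) (f y)) = f y &
      dpath (wd hSG) (wd hSG (f x) (f y)) g] &
    forall j, j <= wd hSG (f x) (f y) -> exists h, wd hSG (g j) (f h) <= C) ->
  exists q, forall x y, wd hSH x y <= q * wd hSG (f x) (f y) + q.
Proof.
move=> f_inj qc; have [rho hrho] := hom_le21 hSH hSG f_inj (2 * C + 1).
have [Hxx HC HT] := wd_pmetric hSH; have [Gxx GC GT] := wd_pmetric hSG.
exists (2 * rho) => x y; have [g [g0 gn hg] near] := qc x y; set n := wd hSG (f x) (f y) in gn hg near *.
suff main : forall j, j <= n -> forall h, wd hSG (g j) (f h) <= C -> wd hSH x h <= rho * j + rho.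
  have [h hh] := near n (leqnn n); have := main n (leqnn n) h hh.
  have := hrho h y; rewrite -gn; have := GC (g n) (f h); have := HT x h y; nia.
elim=> [|j IH] hj h hh.
  by apply: leq_trans (hrho x h _) _; [rewrite -g0; lia|rewrite muln0].
have [h' hh'] := near j (ltnW hj); have := IH (ltnW hj) h' hh'; have := HT x h' h.
have := hrho h' h; have := GT (f h') (g j) (f h); have := GT (g j) (g j.+1) (f h).
by have := GC (f h') (g j); rewrite (hg _ _ (ltnW hj) hj) mulnS; lia.
Qed.

Lemma ultra_pigeonhole (U : set_system nat) (T : eqType) (g : nat -> T) (l : seq T) :
  UltraFilter U -> U [set n | g n \in l]%classic -> exists v, U [set n | g n = v]%classic.
Proof.
move=> UU; elim: l => [|v l IH] hl.
  by have [n] := filter_ex hl.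
have [h|h] := in_ultra_setVsetC [set n | g n = v]%classic UU; first by exists v.
apply: IH; apply: filterS (filterI hl h) => n [/= + nv]; rewrite inE => /orP[/eqP e|//].
by case: nv.
Qed.

Lemma boundary_eq (R : realType) (X : Type) (d : X -> X -> R) (xi eta : boundary d) x y :
  hyperbolic d -> converges_to x xi -> converges_to y eta -> gromov_close d x y -> xi = eta.
Proof.
move=> hyp hx hy xy; suff e : Defs.bseq xi = Defs.bseq eta.
  case: xi eta e {hx hy} => [A hA] [B hB] /= e; subst B; congr Boundary; exact: Prop_irrelevance.
move: hx hy; rewrite /converges_to; case: (bseq_class xi) => u _ ->; case: (bseq_class eta) => w _ ->.
move=> /= [xx ux] [yy wy]; apply/seteqP; split=> z /= [zz h]; split=> //.
  apply: (gromov_close_trans hyp wy); apply: (gromov_close_trans hyp (gromov_close_sym hyp xy)).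
  exact: (gromov_close_trans hyp (gromov_close_sym hyp ux) h).
apply: (gromov_close_trans hyp ux); apply: (gromov_close_trans hyp xy).
exact: (gromov_close_trans hyp (gromov_close_sym hyp wy) h).
Qed.

Section CannonThurston.
Variables (R : realType) (H G : groupType) (SH : seq H) (SG : seq G).
Variables (hSH : generates SH) (hSG : generates SG) (f : {multiplicative H -> G}).
Hypothesis f_inj : injective f.
Let dH := wd hSH.
Let dG := wd hSG.
Variables (dcH : H -> H -> nat) (dcG : G -> G -> nat) (delta kap kappa : nat).
Hypotheses (thH : thin_triangles dH delta) (thG : thin_triangles dG delta).
Hypotheses (cPH : pmetric dcH) (cGH : dgeodesic dcH) (cPG : pmetric dcG) (cGG : dgeodesic dcG).
Hypothesis cleH : forall x y, dcH x y <= dH x y.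
Hypothesis cleG : forall x y, dcG x y <= dG x y.
Hypothesis coneH : forall n g N a, dpath dH n g -> dpath dcH N a -> g 0 = a 0 -> g n = a N ->
  (forall i, i <= n -> exists2 j, j <= N & dcH (g i) (a j) <= kap) /\
  (forall j, j <= N -> exists2 i, i <= n & dcH (a j) (g i) <= kap).
Hypothesis coneG : forall n g N a, dpath dG n g -> dpath dcG N a -> g 0 = a 0 -> g n = a N ->
  (forall i, i <= n -> exists2 j, j <= N & dcG (g i) (a j) <= kap) /\
  (forall j, j <= N -> exists2 i, i <= n & dcG (a j) (g i) <= kap).
Variables (B1 B : Type) (dB1 : B1 -> B1 -> R) (dB : B -> B -> R) (oH : H -> B1) (oG : G -> B).
Hypotheses (hypB1 : hyperbolic dB1) (hypB : hyperbolic dB).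
Hypothesis oH_le : forall x y, (dB1 (oH x) (oH y) <= (kappa * dcH x y)%:R)%R.
Hypothesis oH_ge : forall x y n, (dB1 (oH x) (oH y) <= n%:R)%R -> dcH x y <= kappa * n + kappa.
Hypothesis oH_onto : forall p, exists x, (dB1 (oH x) p <= kappa%:R)%R.
Hypothesis oG_le : forall x y, (dB (oG x) (oG y) <= (kappa * dcG x y)%:R)%R.
Hypothesis oG_ge : forall x y n, (dB (oG x) (oG y) <= n%:R)%R -> dcG x y <= kappa * n + kappa.
Hypothesis oG_onto : forall p, exists x, (dB (oG x) p <= kappa%:R)%R.
Variable phi : B1 -> B.
Hypothesis phi_o : forall x, phi (oH x) = oG (f x).
Hypothesis phi_le : forall x y, (dB (phi x) (phi y) <= dB1 x y)%R.
Hypothesis phi_gp : forall y0 (r : R), exists N : nat, forall x y,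
  (N%:R <= gromov_product dB1 y0 x y -> r <= gromov_product dB (phi y0) (phi x) (phi y))%R.
Hypothesis fibre_path : forall x y, dcH x y <= 1 -> exists P : H -> Prop,
  [/\ forall p, P p -> dcH x p <= 1 /\ dcH p y <= 1,
      forall p, P p -> exists2 m, between dH x y m & dH p m <= kap,
      forall m, between dH x y m -> exists2 p, P p & dH m p <= kap,
      forall p, P p -> exists2 m, between dG (f x) (f y) m & dG (f p) m <= kap &
      forall m, between dG (f x) (f y) m -> exists2 p, P p & dG m (f p) <= kap].

Let PH : pmetric dH := wd_pmetric hSH.
Let PG : pmetric dG := wd_pmetric hSG.
Let GH : dgeodesic dH := wd_geodesic hSH.
Let GG : dgeodesic dG := wd_geodesic hSG.
Let HC x y : dH x y = dH y x. Proof. by case: PH. Qed.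
Let HT x y z : dH x z <= dH x y + dH y z. Proof. by case: PH. Qed.
Let Hxx x : dH x x = 0. Proof. by case: PH. Qed.
Let GC x y : dG x y = dG y x. Proof. by case: PG. Qed.
Let GT x y z : dG x z <= dG x y + dG y z. Proof. by case: PG. Qed.
Let cHC x y : dcH x y = dcH y x. Proof. by case: cPH. Qed.
Let cHT x y z : dcH x z <= dcH x y + dcH y z. Proof. by case: cPH. Qed.
Let cGC x y : dcG x y = dcG y x. Proof. by case: cPG. Qed.
Let cGT x y z : dcG x z <= dcG x y + dcG y z. Proof. by case: cPG. Qed.
Let B1C x y : dB1 x y = dB1 y x. Proof. by case: hypB1 => -[[]]. Qed.
Let B1T x y z : (dB1 x z <= dB1 x y + dB1 y z)%R. Proof. by case: hypB1 => -[[]]. Qed.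
Let BC x y : dB x y = dB y x. Proof. by case: hypB => -[[]]. Qed.
Let BT x y z : (dB x z <= dB x y + dB y z)%R. Proof. by case: hypB => -[[]]. Qed.

Lemma le12 n : exists rho, forall x y, dH x y <= n -> dG (f x) (f y) <= rho.
Proof.
have [c hc] := word_lipschitz hSH hSG f; exists (c * n) => x y h.
by apply: leq_trans (hc x y) _; rewrite leq_mul2l h orbT.
Qed.

Lemma le21 n : exists rho, forall x y, dG (f x) (f y) <= n -> dH x y <= rho.
Proof. exact: hom_le21. Qed.

(** The set [P] of [fibre_path] follows geodesics of both [H] and [G], so distances to it are
    compared by [le21]. *)
Lemma fibre_far12 r : exists N, forall z x y, dcH x y <= 1 ->
  far dH z x y N -> far dG (f z) (f x) (f y) r.
Proof.
have [rho hrho] := le21 (r + kap); exists (rho + kap + 1) => z x y xy h m hm.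
have [P [_ h2 _ _ h5]] := fibre_path xy; have [p Pp mp] := h5 m hm.
have [m' hm' pm'] := h2 p Pp; have := h _ hm'; have := HT z p m'.
rewrite leqNgt => h3 h4; apply/negP => lt.
have := hrho z p; have := GT (f z) m (f p); lia.
Qed.

Lemma fibre_far21 r : exists N, forall z x y, dcH x y <= 1 ->
  far dG (f z) (f x) (f y) N -> far dH z x y r.
Proof.
have [rho hrho] := le12 (r + kap); exists (rho + kap + 1) => z x y xy h m hm.
have [P [_ _ h3 h4 _]] := fibre_path xy; have [p Pp mp] := h3 m hm.
have [m' hm' pm'] := h4 p Pp; have := h _ hm'; have := GT (f z) (f p) m'.
rewrite leqNgt => h5 h6; apply/negP => lt.
have := hrho z p; have := HT z m p; lia.
Qed.

Let share x y := dcH x y <= 1.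

Let share_refl x : share x x. Proof. by rewrite /share; case: cPH => ->. Qed.

Let share_sym x y : share x y -> share y x. Proof. by rewrite /share cHC. Qed.

Lemma share_reach_le n x y : dcH x y <= n -> reach share n x y.
Proof.
have [c0 cg] := cGH; elim: n x => [|n IH] x h /=; first by apply: c0; lia.
have [e|ne] := posnP (dcH x y).
  by exists x; split; [left|apply: IH; rewrite e].
have [z [xz zy]] := cg x y 1 ne; exists z; split; first by right; rewrite /share xz.
by apply: IH; lia.
Qed.

Lemma coned_transfer12 n r : exists N, forall z x y, dcH x y <= n ->
  far dH z x y N -> far dG (f z) (f x) (f y) r.
Proof.
have [|N hN] := @transfer_far H H G id f dH dG delta kap PH GH thH PG thG share
  share_refl share_sym _ fibre_far12 le12 le21 n r.
- move=> x y m xy hm; have [P [h1 _ h3 _ _]] := fibre_path xy.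
  by have [p Pp mp] := h3 m hm; have [k1 k2] := h1 p Pp; exists p.
by exists N => z x y /share_reach_le; apply: hN.
Qed.

Lemma coned_transfer21 n r : exists N, forall z x y, dcH x y <= n ->
  far dG (f z) (f x) (f y) N -> far dH z x y r.
Proof.
have [|N hN] := @transfer_far H G H f id dG dH delta kap PG GG thG PH thH share
  share_refl share_sym _ fibre_far21 le21 le12 n r.
- move=> x y m xy hm; have [P [h1 _ _ _ h5]] := fibre_path xy.
  by have [p Pp mp] := h5 m hm; have [k1 k2] := h1 p Pp; exists p.
by exists N => z x y /share_reach_le; apply: hN.
Qed.

Let netH := net_near hypB1 cPH cGH oH_le oH_ge oH_onto.
Let netG := net_near hypB cPG cGG oG_le oG_ge oG_onto.

Lemma geodesicG_B : exists C : nat, forall x y n g c, dpath dG n g -> g 0 = x -> g n = y ->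
  geodesic dB (oG x) (oG y) c ->
  (forall i, i <= n -> exists2 t, (0 <= t <= dB (oG x) (oG y))%R & (dB (oG (g i)) (c t) <= C%:R)%R) /\
  (forall t, (0 <= t <= dB (oG x) (oG y))%R -> exists2 i, i <= n & (dB (oG (g i)) (c t) <= C%:R)%R).
Proof.
have [K hK] := netG; exists (kappa * kap + K) => x y n g c hg g0 gn hc.
have [a [a0 an ha]] := dpath_ex cPG cGG x y.
have [h1 h2] := hK _ _ _ _ _ hc ha a0 an.
have [k1 k2] := coneG hg ha ltac:(congruence) ltac:(congruence).
have kk u v : dcG u v <= kap -> (dB (oG u) (oG v) <= (kappa * kap)%:R)%R.
  by move=> h; apply: le_trans (oG_le _ _) _; rewrite ler_nat leq_mul2l h orbT.
split=> [i hi|t ht].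
  have [j hj dj] := k1 i hi; have [t ht dt] := h2 j hj; exists t => //.
  by rewrite natrD; have := BT (oG (g i)) (oG (a j)) (c t); have := kk _ _ dj; lra.
have [j hj dj] := h1 t ht; have [i hi di] := k2 j hj; exists i => //.
rewrite cGC in di.
by rewrite natrD; have := BT (oG (g i)) (oG (a j)) (c t); have := kk _ _ di; lra.
Qed.

Lemma geodesicH_B1 : exists C : nat, forall x y n g c, dpath dH n g -> g 0 = x -> g n = y ->
  geodesic dB1 (oH x) (oH y) c ->
  (forall i, i <= n -> exists2 t, (0 <= t <= dB1 (oH x) (oH y))%R & (dB1 (oH (g i)) (c t) <= C%:R)%R) /\
  (forall t, (0 <= t <= dB1 (oH x) (oH y))%R -> exists2 i, i <= n & (dB1 (oH (g i)) (c t) <= C%:R)%R).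
Proof.
have [K hK] := netH; exists (kappa * kap + K) => x y n g c hg g0 gn hc.
have [a [a0 an ha]] := dpath_ex cPH cGH x y.
have [h1 h2] := hK _ _ _ _ _ hc ha a0 an.
have [k1 k2] := coneH hg ha ltac:(congruence) ltac:(congruence).
have kk u v : dcH u v <= kap -> (dB1 (oH u) (oH v) <= (kappa * kap)%:R)%R.
  by move=> h; apply: le_trans (oH_le _ _) _; rewrite ler_nat leq_mul2l h orbT.
split=> [i hi|t ht].
  have [j hj dj] := k1 i hi; have [t ht dt] := h2 j hj; exists t => //.
  by rewrite natrD; have := B1T (oH (g i)) (oH (a j)) (c t); have := kk _ _ dj; lra.
have [j hj dj] := h1 t ht; have [i hi di] := k2 j hj; exists i => //.
rewrite cHC in di.
by rewrite natrD; have := B1T (oH (g i)) (oH (a j)) (c t); have := kk _ _ di; lra.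
Qed.

Lemma productH (r : R) : exists k, forall n a, dpath dH n a -> (forall i, i <= n -> k <= dcH 1%g (a i)) ->
  (r <= gromov_product dB1 (oH 1%g) (oH (a 0%N)) (oH (a n)))%R.
Proof.
have [C hC] := geodesicH_B1; have [k' hk'] := geodesic_le_gromov_product hypB1.
have [n0 hn0] := nat_ge (r + k' + C%:R)%R.
exists (kappa * n0 + kappa).+1 => n a ha hk.
have [_ ge] : geodesic_space dB1 by case: hypB1.
have [c hc] := ge (oH (a 0)) (oH (a n)).
have [t ht hm] := hk' (oH 1%g) _ _ _ hc.
have [_ /(_ t ht) [i hi di]] := hC _ _ _ _ _ ha erefl erefl hc.
rewrite leNgt; apply/negP => lt.
have : (dB1 (oH 1%g) (oH (a i)) <= n0%:R)%R.
  apply: le_trans hn0; have := B1T (oH 1%g) (c t) (oH (a i)); rewrite (B1C (c t)).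
  by move: lt hm di; lra.
by move/oH_ge; have := hk i hi; lia.
Qed.

Lemma productG_far r : exists N : nat, forall x y,
  (N%:R <= gromov_product dB (oG 1%g) (oG x) (oG y))%R ->
  forall m, between dG x y m -> r <= dcG 1%g m.
Proof.
have [C hC] := geodesicG_B; exists (kappa * r + C).+1 => x y h m hm.
have [_ ge] : geodesic_space dB by case: hypB.
have [c hc] := ge (oG x) (oG y); have [g [g0 gm gn hg]] := dpath_through PG GG hm.
have [/(_ (dG x m)) h1 _] := hC _ _ _ _ _ hg g0 gn hc.
have [|t ht dt] := h1; first by move: hm; rewrite /between; lia.
rewrite gm in dt; have := gromov_product_le_geodesic hypB (oG 1%g) hc ht.
have := BT (oG 1%g) (oG m) (c t); have := oG_le 1%g m => h2 h3 h4.
have : ((kappa * r + C).+1%:R <= (kappa * dcG 1%g m + C)%:R :> R)%R by rewrite natrD; lra.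
rewrite ler_nat => h5; rewrite leqNgt; apply/negP => lt.
have : kappa * dcG 1%g m <= kappa * r by rewrite leq_mul2l (ltnW lt) orbT.
by lia.
Qed.

Lemma mitra_far r : exists k, forall n a, dpath dH n a -> (forall i, i <= n -> k <= dcH 1%g (a i)) ->
  far dG 1%g (f (a 0)) (f (a n)) r.
Proof.
have [N1 h1] := productG_far r; have [N2 h2] := phi_gp (oH 1%g) N1%:R%R.
have [k hk] := productH N2%:R%R; exists k => n a ha ka m hm.
have := h2 _ _ (hk n a ha ka); rewrite !phi_o hom1 => /h1 /(_ m hm).
by have := cleG 1%g m; lia.
Qed.

Theorem group_far r : exists N, forall z x y, far dH z x y N -> far dG (f z) (f x) (f y) r.
Proof.
suff [N hN] : exists N, forall x y, far dH 1%g x y N -> far dG 1%g (f x) (f y) r.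
  exists N => z x y /(far_mul hSH z^-1%g); rewrite mulVg => /hN.
  rewrite -(far_mul hSG (f z)) mulg1 !gmulfM homV !mulgA mulgV !mul1g; exact.
have [k hk] := mitra_far (r + 2 * delta).
have [N hN] := coned_transfer12 (2 * k.+1) (r + 2 * delta).
have [rho hrho] := le21 (r + 2 * delta); exists (N + rho).+1 => x y hxy.
have [a [a0 an ha]] := dpath_ex PH GH x y; set n := dH x y in an ha.
have end_far i : i <= n -> far dG 1%g (f (a i)) (f (a i)) (r + 2 * delta).
  move=> hi; apply: (far_close PG (c := 0)); first by case: PG => ->.
  rewrite addn0 leqNgt; apply/negP => lt.
  have := hrho 1%g (a i); rewrite hom1 => /(_ (ltnW lt)).
  have hb := dpath_between ha (i := 0) (j := i) (k := n); rewrite a0 an in hb.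
  by have := hxy _ (hb ltac:(lia) (leqnn _)); lia.
(* [i0] and [i1] will be the first and the last times in the coned-off ball of radius [k]; the
   corresponding points are joined by at most [2 * k] fibres. *)
pose Q i := (i <= n) && (dcH 1%g (a i) <= k).
have [exQ|noQ] := pselect (exists i, Q i); last first.
  rewrite -a0 -an; apply: far_mono (hk n a ha _); first by lia.
  by move=> i hi; rewrite leqNgt; apply/negP => lt; apply: noQ; exists i; rewrite /Q hi ltnW.
have [i0 /andP[i0n d0] min0] : exists2 i, Q i & forall j, Q j -> i <= j.
  by case: (ex_minnP exQ) => i Qi h; exists i.
have [i1 /andP[i1n d1] max1] : exists2 i, Q i & forall j, Q j -> j <= i.
  have ub j : Q j -> j <= n by case/andP.
  by case: (ex_maxnP exQ ub) => i Qi h; exists i.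
have i01 : i0 <= i1 by apply: min0; rewrite /Q i1n.
have step i : i < n -> dcH (a i) (a i.+1) <= 1.
  by move=> hi; apply: leq_trans (cleH _ _) _; rewrite ha //; lia.
have f0 : far dG 1%g (f x) (f (a i0)) (r + 2 * delta).
  have [e|i0p] := posnP i0; first by rewrite e a0; have := end_far 0 isT; rewrite a0.
  have hp : dpath dH i0 a by move=> i j h1 h2; apply: ha; lia.
  rewrite -a0; apply: hk hp _ => i hi.
  have big j : j < i0 -> k < dcH 1%g (a j).
    by move=> hj; rewrite ltnNge; apply/negP => le; have := min0 j; rewrite /Q le andbT; lia.
  have [lt|ge] := ltnP i i0; first exact/ltnW/big.
  (* The end [a i0] itself is still at coned-off distance at least [k], being one step away from a
     point beyond [k]. *)
  have ei : i = i0.-1.+1 by lia.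
  have := big i0.-1 ltac:(lia); have := step i0.-1 ltac:(lia).
  by rewrite -ei; have := cHT 1%g (a i) (a i0.-1); have := cHC (a i) (a i0.-1); lia.
have f2 : far dG 1%g (f (a i1)) (f y) (r + 2 * delta).
  have [e|i1p] := eqVneq i1 n; first by rewrite e -an; apply: end_far.
  pose b i := a (i1 + i); have hp : dpath dH (n - i1) b.
    by move=> i j h1 h2; rewrite /b ha; lia.
  have -> : a i1 = b 0 by rewrite /b addn0.
  have -> : y = b (n - i1) by rewrite /b -an; congr a; lia.
  apply: hk hp _ => i hi; have big j : i1 < j <= n -> k < dcH 1%g (a j).
    by move=> hj; rewrite ltnNge; apply/negP => le; have := max1 j; rewrite /Q le andbT; lia.
  rewrite /b; have [e|ip] := posnP i; last by apply/ltnW/big; lia.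
  rewrite e addn0; have := big i1.+1 ltac:(lia); have := step i1 ltac:(lia).
  by have := cHT 1%g (a i1) (a i1.+1); lia.
have f1 : far dG 1%g (f (a i0)) (f (a i1)) (r + 2 * delta).
  rewrite -(hom1 f); apply: hN.
    by have := cHT (a i0) 1%g (a i1); have := cHC (a i0) 1%g; lia.
  apply: (far_mono (N := (N + rho).+1)); first lia.
  move=> m hm; apply: hxy; move: hm; rewrite /between ha ?(leq_trans i01) // => hm.
  have := ha 0 i0; have := ha i1 n; rewrite a0 an /n.
  have := HT x (a i0) m; have := HT m (a i1) y; have := HT x m y.
  by rewrite /n in i0n i1n; lia.
have u := far_ultra PG thG f0 f1.
have u' : far dG 1%g (f x) (f (a i1)) (r + delta) by apply: far_mono u; lia.
have u'' : far dG 1%g (f (a i1)) (f y) (r + delta) by apply: far_mono f2; lia.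
by apply: far_mono (far_ultra PG thG u' u''); lia.
Qed.

(** With [z] on a geodesic of [H] the hypothesis says that its image stays near the geodesics of [G]
    with the image ends. By [crossing] the latter stay near the image, and [near_image_qi]
    applies. *)
Lemma far_reflect_qi N : (forall z x y, far dG (f z) (f x) (f y) N -> far dH z x y 1) ->
  exists q, forall x y, dH x y <= q * dG (f x) (f y) + q.
Proof.
move=> hN; have [c1 hc1] := le12 1; pose C := N + 2 * delta.
apply: (@near_image_qi H G SH SG hSH hSG f (3 * C + c1) f_inj) => x y.
have [g [g0 gn hg]] := dpath_ex PG GG (f x) (f y); exists g => // j hj.
set n := wd hSG (f x) (f y) in gn hg hj.
have [a [a0 an ha]] := dpath_ex PH GH x y.
have near i : i <= dH x y -> exists2 l, l <= n & dG (f (a i)) (g l) <= C.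
  move=> hi; have hm : between dH x y (a i).
    by have := dpath_between ha (i := 0) (j := i) (k := dH x y); rewrite a0 an => /(_ ltac:(lia) (leqnn _)).
  have [m m1 m2] : exists2 m, between dG (f x) (f y) m & dG (f (a i)) m < N.
    apply: contrapT => no; have : far dH (a i) x y 1.
      by apply: hN => m hm'; rewrite leqNgt; apply/negP => lt; apply: no; exists m.
    by move=> /(_ _ hm); rewrite Hxx.
  have [l hl dl] := between_dpath_near PG thG hg ltac:(by rewrite g0 gn; exact: m1).
  by exists l => //; have := GT (f (a i)) m (g l); rewrite /C; lia.
pose P i := exists2 l, l <= j & dG (f (a i)) (g l) <= C.
pose Q i := exists2 l, j <= l <= n & dG (f (a i)) (g l) <= C.
have P0 : P 0 by exists 0; rewrite // a0 g0; case: PG => ->.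
have Qn : Q (dH x y) by exists n; rewrite ?hj ?leqnn // an gn; case: PG => ->.
have PQ i : i <= dH x y -> P i \/ Q i.
  move=> /near[l ln dl]; have [lj|jl] := leqP l j; first by left; exists l.
  by right; exists l; rewrite // (ltnW jl).
have [i hi [[l hl dl] hQ]] := crossing P0 Qn PQ; exists (a i).
have [l' /andP[jl' l'n] dl'] : exists2 l', j <= l' <= n & dG (f (a i)) (g l') <= C + c1.
  case: hQ => [[l' h1 h2]|[lt [l' h1 h2]]]; exists l' => //; first by lia.
  have := GT (f (a i)) (f (a i.+1)) (g l'); have := hc1 (a i) (a i.+1).
  by rewrite (ha _ _ (ltnW lt) lt); lia.
have := GT (g l) (f (a i)) (g l'); rewrite (hg _ _ (leq_trans hl hj) l'n).
have := GT (g j) (g l) (f (a i)); rewrite (hg _ _ hj (leq_trans hl hj)).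
have := GC (g l) (f (a i)); rewrite -/dG; lia.
Qed.

Section Rays.
Variable alpha : nat -> H.
Hypothesis ray : forall n, dpath dH n alpha.
Hypothesis ray0 : alpha 0 = 1%g.
Hypothesis unbounded : ~ exists k, forall i, dcH 1%g (alpha i) <= k.

Lemma ray_far k : exists i0, forall i, i0 <= i -> k <= dcH 1%g (alpha i).
Proof.
apply: contrapT => no; apply: unbounded; exists (k + kap) => i.
have [l il lk] : exists2 l, i <= l & dcH 1%g (alpha l) < k.
  apply: contrapT => no'; apply: no; exists i => l il; rewrite leqNgt; apply/negP => lt.
  by apply: no'; exists l.
have [c [c0 cn hc]] := dpath_ex cPH cGH 1%g (alpha l).
have [/(_ i il) [j hj dj] _] := coneH (@ray l) hc ltac:(congruence) ltac:(congruence).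
have := cHT 1%g (c j) (alpha i); have := cHC (alpha i) (c j).
have := hc 0 j isT hj; rewrite c0; lia.
Qed.

Lemma ray_product (r : R) : exists i0, forall i j, i0 <= i -> i0 <= j ->
  (r <= gromov_product dB1 (oH 1%g) (oH (alpha i)) (oH (alpha j)))%R.
Proof.
have [k hk] := productH r; have [i0 hi0] := ray_far k; exists i0.
have main i j : i0 <= i <= j ->
    (r <= gromov_product dB1 (oH 1%g) (oH (alpha i)) (oH (alpha j)))%R.
  move=> /andP[h1 h2]; have := hk (j - i) (fun l => alpha (i + l)).
  rewrite addn0 subnKC //; apply; last by move=> l _; apply: hi0; lia.
  by move=> u w h3 h4; rewrite (@ray (i + u + w)); lia.
move=> i j hi hj; have [ij|ji] := leqP i j; first by apply: main; rewrite hi.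
have := main j i; rewrite hj (ltnW ji) => /(_ isT).
by rewrite /gromov_product (B1C (oH (alpha j))); lra.
Qed.

Lemma ray_converges : gromov_close dB1 (oH \o alpha) (oH \o alpha).
Proof.
move=> p r; have [i0 h] := ray_product (r + dB1 (oH 1%g) p)%R; exists i0 => i j hi hj /=.
have := gromov_product_basepoint hypB1 (oH 1%g) p (oH (alpha i)) (oH (alpha j)).
by have := h i j hi hj; lra.
Qed.

Lemma ray_cone L : exists i0, forall i j m, i0 <= i -> i0 <= j ->
  between dG (f (alpha i)) (f (alpha j)) m -> L <= dcG 1%g m.
Proof.
have [N1 h1] := productG_far L; have [N2 h2] := phi_gp (oH 1%g) N1%:R%R.
have [i0 hi0] := ray_product N2%:R%R; exists i0 => i j m hi hj.
by have := h2 _ _ (hi0 i j hi hj); rewrite !phi_o hom1 => /h1; apply.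
Qed.

(** Let [c u] be the first point outside the coned-off ball of radius [C + delta] on a geodesic from
    [1] to [f (alpha i0)]. By [ray_cone] it is not near a geodesic from [f (alpha i0)] to
    [f (alpha j)], so by thinness every geodesic from [1] to [f (alpha j)] has a point near [c u],
    at a bounded time. *)
Lemma ray_escapes C : ~ forall t N, exists2 j, N <= j &
  forall p, between dG 1%g (f (alpha j)) p -> dG 1%g p <= t -> dcG 1%g p <= C.
Proof.
move=> hC; pose L := C + 2 * delta + 2; have [i0 hi0] := ray_cone L.
have [c [c0 cn hc]] := dpath_ex PG GG 1%g (f (alpha i0)); set n := dG 1%g _ in cn hc.
have exu : exists u, (u <= n) && (C + delta < dcG 1%g (c u)).
  exists n; rewrite leqnn cn; apply: leq_trans (hi0 i0 i0 _ _ _ _) => //.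
    by rewrite /L; lia.
  by rewrite /between; case: PG => ->.
have [u /andP[un hu] minu] := ex_minnP exu.
have small : dcG 1%g (c u) <= C + delta + 1.
  have [e|up] := posnP u; first by move: hu; rewrite e c0; case: cPG => ->.
  have : ~~ (C + delta < dcG 1%g (c u.-1)).
    by apply/negP => h; have := minu u.-1; rewrite h andbT; lia.
  have := cGT 1%g (c u.-1) (c u); have := cleG (c u.-1) (c u).
  by rewrite hc; lia.
have [j hj hp] := hC (dG 1%g (c u) + delta) i0.
have hm : between dG 1%g (f (alpha i0)) (c u).
  by have := dpath_between hc (i := 0) (j := u) (k := n); rewrite c0 cn => /(_ ltac:(lia) (leqnn _)).
have [m [hm'|hm'] dm] := thG (f (alpha j)) hm.
  have := hp m hm'; have := GT 1%g (c u) m; have := cGT 1%g m (c u); have := cleG m (c u).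
  by have := GC m (c u); lia.
have := hi0 j i0 m hj (leqnn _) hm'; have := cGT 1%g (c u) m; have := cleG (c u) m.
by rewrite /L; lia.
Qed.
End Rays.

Section RayPair.
Variables alpha beta : nat -> H.
Hypothesis (rayA : forall n, dpath dH n alpha) (rayB : forall n, dpath dH n beta).
Hypothesis (rayA0 : alpha 0 = 1%g) (rayB0 : beta 0 = 1%g).
Hypothesis rayAB : forall i j, dH (alpha i) (beta j) = i + j.
Hypothesis ray_merge : forall r, exists i0, forall i j, i0 <= i -> i0 <= j ->
  far dG 1%g (f (alpha i)) (f (beta j)) r.

Lemma ray_through i j : between dH (alpha i) (beta j) 1%g.
Proof.
rewrite /between rayAB -{1}rayA0 -{1}rayB0 (rayA (leqnn i) (leq0n _)) (rayB (leq0n j) (leqnn _)); lia.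
Qed.

(** The points of the two rays are joined by boundedly many fibres, so [far] passes back from [G] to
    [H], where the geodesics run through [1]. *)
Lemma rays_not_bounded k : (forall i, dcH 1%g (alpha i) <= k) ->
  (forall i, dcH 1%g (beta i) <= k) -> False.
Proof.
move=> ha hb; have [N hN] := coned_transfer21 (2 * k) 1; have [i0 hi0] := ray_merge N.
have : far dH 1%g (alpha i0) (beta i0) 1.
  apply: hN; last by rewrite hom1; apply: hi0.
  have := cHT (alpha i0) 1%g (beta i0); have := ha i0; have := hb i0.
  by have := cHC 1%g (alpha i0); lia.
by move=> /(_ _ (ray_through _ _)); rewrite Hxx.
Qed.

Lemma dcG_f x y : dcG (f x) (f y) <= kappa * (kappa * dcH x y) + kappa.
Proof. by apply: oG_ge; rewrite -!phi_o; apply: le_trans (phi_le _ _) (oH_le _ _). Qed.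

(** Geodesics from [1] to points [f (beta i0)] stay in a coned-off ball, and by [ray_merge] those to
    [f (alpha i)] follow them up to any prescribed time; this contradicts [ray_escapes] if [alpha]
    is unbounded. *)
Lemma ray_half_bounded k : (forall i, dcH 1%g (beta i) <= k) ->
  exists k', forall i, dcH 1%g (alpha i) <= k'.
Proof.
move=> hb; apply: contrapT => unb.
pose C := kappa * (kappa * k) + kappa + kap + delta.
apply: (ray_escapes rayA rayA0 unb (C := C)) => t N.
have [i0 hi0] := ray_merge (t + delta + 1); exists (maxn N i0); first exact: leq_maxl.
move=> p hp pt; set i := maxn N i0 in hp.
have [m [hm|hm] dm] := thG (f (beta i0)) hp; last first.
  have hf : far dG 1%g (f (alpha i)) (f (beta i0)) (t + delta + 1) by apply: hi0; rewrite ?leq_maxr.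
  by have := far_sym PG hf hm; have := GT 1%g p m; lia.
have [c [c0 cm cn hc]] := dpath_through PG GG hm.
have [a [a0 an ha]] := dpath_ex cPG cGG 1%g (f (beta i0)).
have [/(_ (dG 1%g m)) h1 _] := coneG hc ha ltac:(congruence) ltac:(congruence).
have [|j hj dj] := h1; first by move: hm; rewrite /between; lia.
have kb : dcG 1%g (f (beta i0)) <= kappa * (kappa * k) + kappa.
  rewrite -(hom1 f); apply: leq_trans (dcG_f _ _) _.
  by rewrite leq_add2r leq_mul2l leq_mul2l hb !orbT.
rewrite cm in dj; have := ha 0 j isT hj; rewrite a0.
have := cGT 1%g (a j) p; have := cGT (a j) m p; have := cleG m p.
have := GC m p; have := cGC (a j) m; rewrite /C; lia.
Qed.

(** Long initial parts of the geodesics to [f (alpha i)] and to [f (beta j)] run close together. If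
    the Gromov products in [B] did not tend to infinity, these parts would stay in a bounded part of
    [B], against [ray_escapes]. *)
Lemma rays_converge_apart : (~ exists k, forall i, dcH 1%g (alpha i) <= k) ->
  gromov_close dB (phi \o (oH \o alpha)) (phi \o (oH \o beta)).
Proof.
move=> unb; apply: contrapT => nc.
have [p [r0 hr0]] : exists p (r0 : R), forall N, exists i j, [/\ N <= i, N <= j &
    (gromov_product dB p (oG (f (alpha i))) (oG (f (beta j))) < r0)%R].
  apply: contrapT => no; apply: nc => p r; apply: contrapT => no'; apply: no.
  exists p, r => N; apply: contrapT => no''; apply: no'; exists N => i j Ni Nj.
  by rewrite /= !phi_o leNgt; apply/negP => lt; apply: no''; exists i, j.
have [C0 hC0] := geodesicG_B.
have [n0 hn0] := nat_ge (r0 + dB (oG 1%g) p + 2 * C0%:R + (kappa * delta)%:R)%R.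
apply: (ray_escapes rayA rayA0 unb (C := kappa * n0 + kappa)) => t N.
have [i0 hi0] := ray_merge (t + delta + 1).
have [i [j [Ni Nj lt]]] := hr0 (maxn N i0); exists i; first by lia.
move=> u hu ut.
have [m [hm|hm] dm] := thG (f (beta j)) hu; last first.
  have hf : far dG 1%g (f (alpha i)) (f (beta j)) (t + delta + 1) by apply: hi0; lia.
  by have := far_sym PG hf hm; have := GT 1%g u m; lia.
apply: oG_ge; apply: le_trans hn0; have [_ ge] : geodesic_space dB by case: hypB.
have on_geod x q : between dG 1%g x q ->
    (dB (oG 1%g) (oG q) + dB (oG q) (oG x) <= dB (oG 1%g) (oG x) + 2 * C0%:R)%R.
  move=> hq; have [g [g0 gq gn hg]] := dpath_through PG GG hq; have [c hc] := ge (oG 1%g) (oG x).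
  have [/(_ (dG 1%g q)) h1 _] := hC0 _ _ _ _ _ hg g0 gn hc.
  have [|s hs ds] := h1; first by move: hq; rewrite /between; lia.
  rewrite gq in ds; have gB : geodesic_space dB by case: hypB.
  have := geodesic_left gB hc hs; have := geodesic_right gB hc hs.
  have := BT (oG 1%g) (c s) (oG q); have := BT (oG q) (c s) (oG x).
  by rewrite (BC (c s) (oG q)); lra.
have := on_geod _ _ hu; have := on_geod _ _ hm.
have um : (dB (oG u) (oG m) <= (kappa * delta)%:R)%R.
  apply: le_trans (oG_le _ _) _; rewrite ler_nat leq_mul2l; apply/orP; right.
  by have := cleG u m; lia.
have := gromov_product_basepoint hypB (oG 1%g) p (oG (f (alpha i))) (oG (f (beta j))).
have := BT (oG (f (alpha i))) (oG u) (oG (f (beta j))); have := BT (oG u) (oG m) (oG (f (beta j))).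
have := BT (oG 1%g) (oG m) (oG u); rewrite (BC (oG m) (oG u)) (BC (oG (f (alpha i))) (oG u)).
by move: lt; rewrite /gromov_product; lra.
Qed.

Lemma rays_not_close : ~ gromov_close dB1 (oH \o alpha) (oH \o beta).
Proof.
move=> h; have [C hC] := geodesicH_B1; have [N hN] := h (oH 1%g) (C%:R + 1)%R.
have := hN N N (leqnn _) (leqnn _) => /=; have hm := ray_through N N.
have [_ ge] : geodesic_space dB1 by case: hypB1.
have [c hc] := ge (oH (alpha N)) (oH (beta N)).
have [g [g0 gm gn hg]] := dpath_through PH GH hm.
have [/(_ (dH (alpha N) 1%g)) h1 _] := hC _ _ _ _ _ hg g0 gn hc.
have [|t ht dt] := h1; first by move: hm; rewrite /between; lia.
by rewrite gm in dt; have := gromov_product_le_geodesic hypB1 (oH 1%g) hc ht; lra.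
Qed.
End RayPair.

Lemma rays_ex : (forall n, exists x y, between dH x y 1%g /\ far dG 1%g (f x) (f y) n) ->
  exists alpha beta, [/\ (forall n, dpath dH n alpha) /\ alpha 0 = 1%g,
    (forall n, dpath dH n beta) /\ beta 0 = 1%g,
    forall i j, dH (alpha i) (beta j) = i + j &
    forall r, exists i0, forall i j, i0 <= i -> i0 <= j ->
      far dG 1%g (f (alpha i)) (f (beta j)) r].
Proof.
move=> /choice[xs /choice[ys hxy]].
have long (zs : nat -> H) : (forall n, n <= dG 1%g (f (zs n))) ->
    forall L, exists N, forall n, N <= n -> L <= dH 1%g (zs n).
  move=> hz L; have [rho hrho] := le12 L; exists rho.+1 => n hn; rewrite leqNgt; apply/negP => lt.
  by have := hrho 1%g (zs n) (ltnW lt); have := hz n; rewrite hom1; lia.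
have lx := long xs (fun n => far_l PG (hxy n).2).
have ly := long ys (fun n => far_r PG (hxy n).2).
have [a ha] := choice (fun n => dpath_ex PH GH 1%g (xs n)).
have [b hb] := choice (fun n => dpath_ex PH GH 1%g (ys n)).
(* The rays are the limits along [U] of geodesics from [1] to [xs n] and [ys n]. *)
have [U [UU sub]] := ultraFilterLemma (@eventually_filter).
have big N : U [set n | N <= n]%classic by apply/sub/nbhs_infty_ge.
have limit (zs : nat -> H) (c : nat -> nat -> H) :
    (forall L, exists N, forall n, N <= n -> L <= dH 1%g (zs n)) ->
    (forall n, [/\ c n 0 = 1%g, c n (dH 1%g (zs n)) = zs n & dpath dH (dH 1%g (zs n)) (c n)]) ->
    exists g, forall i, U [set n | i <= dH 1%g (zs n) /\ c n i = g i]%classic.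
  move=> lz hc; have [|g hg] := choice (_ : forall i, exists v, U [set n | c n i = v]%classic).
    move=> i; have [l hl] := wd_ball hSH i; apply: (ultra_pigeonhole (l := l)).
    have [N hN] := lz i; apply: filterS (big N) => n /= /hN hn; apply: hl.
    by have [c0 _ h] := hc n; rewrite -c0 -/dH h //; lia.
  exists g => i; have [N hN] := lz i; apply: filterS (filterI (hg i) (big N)) => n /= [h1 /hN h2].
  by split.
have [alpha hA] := limit xs a lx ha; have [beta hB] := limit ys b ly hb.
have dpathE (zs : nat -> H) (c : nat -> nat -> H) g :
    (forall n, [/\ c n 0 = 1%g, c n (dH 1%g (zs n)) = zs n & dpath dH (dH 1%g (zs n)) (c n)]) ->
    (forall i, U [set n | i <= dH 1%g (zs n) /\ c n i = g i]%classic) ->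
    (forall n, dpath dH n g) /\ g 0 = 1%g.
  move=> hc hg; split=> [n i j _ _|].
    have [m /= [[h1 h2] [h3 h4]]] := filter_ex (filterI (hg i) (hg j)).
    by have [_ _ h] := hc m; rewrite -h2 -h4 h.
  by have [m /= [_ <-]] := filter_ex (hg 0); have [-> _ _] := hc m.
exists alpha, beta; split; [exact: dpathE ha hA|exact: dpathE hb hB| |].
  move=> i j; have [n /= [[h1 <-] [h2 <-]]] := filter_ex (filterI (hA i) (hB j)).
  have [a0 a1 an] := ha n; have [b0 b1 bn] := hb n; have [hm _] := hxy n.
  have := an 0 i isT h1; have := an i _ h1 (leqnn _); have := bn 0 j isT h2.
  have := bn j _ h2 (leqnn _); rewrite a0 a1 b0 b1; move: hm; rewrite /between.
  have := HT (xs n) (a n i) (ys n); have := HT (a n i) (b n j) (ys n).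
  have := HT (a n i) 1%g (b n j); have := HC (a n i) 1%g; have := HC (xs n) 1%g.
  by have := HC (xs n) (a n i); lia.
(* The part of a geodesic of [H] beyond its point at time [i] is far from [1], and [group_far] keeps
   this true in [G]; between [xs n] and [ys n] it holds by their choice. *)
move=> r; have [N hN] := group_far (r + 2 * delta); exists N => i j hi hj.
have [n /= [[[h1 e1] [h2 e2]] hn]] := filter_ex (filterI (filterI (hA i) (hB j)) (big (r + 2 * delta))).
have side (zs : nat -> H) (c : nat -> nat -> H) l x : N <= l -> l <= dH 1%g (zs n) -> c n l = x ->
    (forall n, [/\ c n 0 = 1%g, c n (dH 1%g (zs n)) = zs n & dpath dH (dH 1%g (zs n)) (c n)]) ->
    far dG 1%g (f x) (f (zs n)) (r + 2 * delta).
  move=> Nl ll <- hc; rewrite -(hom1 f); apply: hN; have [c0 cn h] := hc n.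
  have hm : between dH 1%g (zs n) (c n l).
    by have := dpath_between h (i := 0) (j := l) (k := dH 1%g (zs n)); rewrite c0 cn; apply; lia.
  apply: far_mono (far_beyond PH hm); have := h 0 l isT ll; rewrite c0; lia.
have sA := side xs a i _ hi h1 e1 ha; have sB := side ys b j _ hj h2 e2 hb.
have [_ hf] := hxy n; have hf' := far_mono hn hf.
have u := far_ultra PG thG sA hf'.
have u1 : far dG 1%g (f (alpha i)) (f (ys n)) (r + delta) by apply: far_mono u; lia.
have u2 : far dG 1%g (f (ys n)) (f (beta j)) (r + delta) by apply: far_mono (far_sym PG sB); lia.
by apply: far_mono (far_ultra PG thG u1 u2); lia.
Qed.

Variable F : boundary dB1 -> boundary dB.
Hypothesis F_conv : forall xi y, converges_to y xi -> converges_to (phi \o y) (F xi).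

Lemma converges_boundary (y : nat -> B1) : gromov_close dB1 y y ->
  exists xi : boundary dB1, converges_to y xi.
Proof.
move=> h; have cls : exists2 x, gromov_close dB1 x x &
    [set z | gromov_close dB1 z z /\ gromov_close dB1 y z]%classic =
    [set z | gromov_close dB1 z z /\ gromov_close dB1 x z]%classic by exists y.
by exists (Boundary cls).
Qed.

Theorem boundary_injective_qi : injective F ->
  exists q, forall x y, dH x y <= q * dG (f x) (f y) + q.
Proof.
move=> F_inj; suff [N hN] : exists N, forall z x y, far dG (f z) (f x) (f y) N -> far dH z x y 1.
  exact: far_reflect_qi hN.
apply: contrapT => no.
have [n|alpha [beta [[rA a0] [rB b0] hAB merge]]] := rays_ex.
  apply: contrapT => no'; apply: no; exists n => z x y h m hm.
  rewrite leqNgt ltnS leqn0; apply/negP => /eqP e; apply: no'.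
  have [h0 _] := GH; have {e} e := h0 _ _ e; subst m.
  exists (z^-1 * x)%g, (z^-1 * y)%g; split.
    by move: hm; rewrite /between -{1 2}(mulVg z) /dH !wd_mul.
  by rewrite !gmulfM homV -(mulVg (f z)); apply/(far_mul hSG).
have hBA i j : dH (beta i) (alpha j) = i + j by rewrite HC hAB addnC.
have merge' r : exists i0, forall i j, i0 <= i -> i0 <= j -> far dG 1%g (f (beta i)) (f (alpha j)) r.
  by have [i0 h] := merge r; exists i0 => i j hi hj; apply/(far_sym PG)/h.
(* If one ray is bounded in the coned-off metric, then so is the other, which [rays_not_bounded]
   excludes; so both define points of the boundary of [B1]. *)
have [[kb hb]|ub] := pselect (exists k, forall i, dcH 1%g (beta i) <= k).
  have [ka hka] := ray_half_bounded rA a0 merge hb.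
  apply: (rays_not_bounded rA rB a0 b0 hAB merge (k := ka + kb)) => i.
    by have := hka i; lia.
  by have := hb i; lia.
have [[ka hka]|ua] := pselect (exists k, forall i, dcH 1%g (alpha i) <= k).
  by have [kb hb] := ray_half_bounded rB b0 merge' hka; apply: ub; exists kb.
have cA := ray_converges rA a0 ua; have cB := ray_converges rB b0 ub.
have [xi hxi] := converges_boundary cA; have [eta heta] := converges_boundary cB.
have e : xi = eta.
  apply: F_inj; apply: (boundary_eq hypB (F_conv hxi) (F_conv heta)).
  exact: rays_converge_apart rA a0 merge ua.
subst eta; apply: (rays_not_close rA rB a0 b0 hAB).
move: hxi heta; rewrite /converges_to; case: (bseq_class xi) => u _ -> [_ h1] [_ h2].
exact: (gromov_close_trans hypB1 (gromov_close_sym hypB1 h1) h2).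
Qed.

(** A geodesic of [H] has a point close to [1] in [B1]. By the Morse lemma its image is near the
    geodesic of [G] with the image ends, so the geodesic of [B] also comes close to the base
    point. *)
Lemma qi_product (q : nat) (r : R) : (forall x y, dH x y <= q * dG (f x) (f y) + q) ->
  exists r', forall u w, (gromov_product dB1 (oH 1%g) u w < r)%R ->
    (gromov_product dB (oG 1%g) (phi u) (phi w) < r')%R.
Proof.
move=> qi; have [c1 hc1] := word_lipschitz hSH hSG f.
have [k1 hk1] := morse delta (maxn c1 q); have [C1 hC1] := geodesicH_B1; have [C hC] := geodesicG_B.
have [k hk] := geodesic_le_gromov_product hypB1.
exists (r + 4 * kappa%:R + k + C1%:R + (kappa * k1)%:R + C%:R + 1)%R => u w huw.
have [x hx] := oH_onto u; have [y hy] := oH_onto w.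
have [_ ge] : geodesic_space dB by case: hypB. have [_ ge1] : geodesic_space dB1 by case: hypB1.
have [c hc] := ge1 (oH x) (oH y); have [c' hc'] := ge (oG (f x)) (oG (f y)).
have [a [a0 an ha]] := dpath_ex PH GH x y; have [g [g0 gn hg]] := dpath_ex PG GG (f x) (f y).
have [t ht dt] := hk (oH 1%g) _ _ _ hc.
have [_ /(_ t ht) [i hi di]] := hC1 _ _ _ _ _ ha a0 an hc.
have qi' v z : dG (f v) (f z) <= maxn c1 q * dH v z /\ dH v z <= maxn c1 q * dG (f v) (f z) + maxn c1 q.
  split; first by apply: leq_trans (hc1 v z) _; rewrite leq_mul2r leq_maxl orbT.
  by apply: leq_trans (qi v z) _; rewrite leq_add ?leq_maxr // leq_mul2r leq_maxr orbT.
have [_ /(_ i hi) [j hj dj]] := hk1 H G dH dG f PG GG thG qi' _ _ _ _ ha hg ltac:(congruence) ltac:(congruence).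
have [/(_ j hj) [s hs ds] _] := hC _ _ _ _ _ hg g0 gn hc'.
have := gromov_product_le_geodesic hypB (oG 1%g) hc' hs.
have := BT (oG 1%g) (oG (f (a i))) (c' s); have := BT (oG (f (a i))) (oG (g j)) (c' s).
have : (dB (oG (f (a i))) (oG (g j)) <= (kappa * k1)%:R)%R.
  apply: le_trans (oG_le _ _) _; rewrite ler_nat leq_mul2l; apply/orP; right.
  by apply: leq_trans (cleG _ _) dj.
have := phi_le (oH 1%g) (oH (a i)); rewrite !phi_o hom1.
have := B1T (oH 1%g) (c t) (oH (a i)); rewrite (B1C (c t)).
have := B1T (oH 1%g) (oH x) u; have := B1T (oH 1%g) u (oH x); have := B1T (oH 1%g) w (oH y).
have := B1T u (oH x) w; have := B1T (oH x) (oH y) w; have := B1T (oH x) u (oH y); have := B1T u w (oH y).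
have := phi_le (oH x) u; have := phi_le (oH y) w; rewrite !phi_o.
have := BT (oG 1%g) (oG (f x)) (phi u); have := BT (oG 1%g) (oG (f y)) (phi w).
have := BT (oG (f x)) (phi u) (oG (f y)); have := BT (phi u) (phi w) (oG (f y)).
rewrite (B1C u (oH x)) (B1C w (oH y)) (BC (phi w) (oG (f y))).
by move: huw dt di hx hy ds; rewrite /gromov_product; lra.
Qed.

Theorem qi_boundary_injective q : (forall x y, dH x y <= q * dG (f x) (f y) + q) -> injective F.
Proof.
move=> qi xi eta e.
have [x hx] : exists x, converges_to x xi.
  by rewrite /converges_to; case: (bseq_class xi) => u uu ->; exists u.
have [y hy] : exists y, converges_to y eta.
  by rewrite /converges_to; case: (bseq_class eta) => u uu ->; exists u.
apply: (boundary_eq hypB1 hx hy) => p r; apply: contrapT => no.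
have [r' hr'] := qi_product (r + dB1 (oH 1%g) p)%R qi.
have : gromov_close dB (phi \o x) (phi \o y).
  have := F_conv hx; have := F_conv hy; rewrite -e /converges_to.
  case: (bseq_class (F xi)) => u _ -> [_ h1] [_ h2].
  exact: (gromov_close_trans hypB (gromov_close_sym hypB h2) h1).
move=> /(_ (oG 1%g) r') [N hN]; apply: no; exists N => i j hi hj.
rewrite leNgt; apply/negP => lt; have := hN i j hi hj; rewrite leNgt => /negP; apply.
apply: hr'; have := gromov_product_basepoint hypB1 (oH 1%g) p (x i) (y j).
by have := gromov_product_basepoint hypB1 p (oH 1%g) (x i) (y j); rewrite (B1C p); lra.
Qed.
End CannonThurston.

(** * Restriction to a subcomplex *)

Lemma qi_fibre_near delta q e : exists kap,
  forall (V X : Type) (dV : V -> V -> nat) (dX : X -> X -> nat) (f : V -> X),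
  pmetric dX -> dgeodesic dX -> thin_triangles dX delta ->
  (forall x y, dX (f x) (f y) <= q * dV x y /\ dV x y <= q * dX (f x) (f y) + q) ->
  forall n z x y, dpath dV n z -> dX x (f (z 0)) <= e -> dX y (f (z n)) <= e ->
  (forall i, i <= n -> exists2 m, between dX x y m & dX (f (z i)) m <= kap) /\
  (forall m, between dX x y m -> exists2 i, i <= n & dX m (f (z i)) <= kap).
Proof.
have [k hk] := morse delta q; exists (k + 2 * delta + e) => V X dV dX f dP dG th qi n z x y hz hx hy.
have [_ dC dT] := dP; have hC u v : dX u v <= e -> dX v u <= e by rewrite dC.
split=> [i hi|m hm].
  have [h [h0 hn hh]] := dpath_ex dP dG (f (z 0)) (f (z n)).
  have [_ /(_ i hi) [j hj dj]] := hk V X dV dX f dP dG th qi _ _ _ _ hz hh h0 hn.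
  have hm : between dX (f (z 0)) (f (z n)) (h j).
    by have := dpath_between hh (i := 0) (j := j) (k := dX (f (z 0)) (f (z n))); rewrite h0 hn; apply; lia.
  have [m h1 h2] := quad_near dP th (hC _ _ hx) (hC _ _ hy) hm.
  by exists m => //; have := dT (f (z i)) (h j) m; lia.
have [m' h1 h2] := quad_near dP th hx hy hm.
have [h [h0 hm' hn hh]] := dpath_through dP dG h1.
have [/(_ (dX (f (z 0)) m')) h3 _] := hk V X dV dX f dP dG th qi _ _ _ _ hz hh h0 hn.
have [|j hj dj] := h3; first by move: h1; rewrite /between; lia.
by exists j => //; rewrite hm' in dj; have := dT m m' (f (z j)); lia.
Qed.

Section Labels.
Variables (V : finType) (K : simplicial_complex V) (G : complex_of_groups K).
Variable T : {set edge K}.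
Local Notation pi1 := (pi1 G T).
Local Notation locv := (locv G T).
Variables (SL : forall s : simplex K, seq (lgroup G s)) (hSL : forall s, generates (SL s)).
Local Notation d := (wd (@pi1_generates V K G T SL hSL)).
Local Notation near := (near d (@iota _ _ _ locv)).
Variable c : nat.
Hypothesis vertex_qi : forall (j : vtx K) (a b : lgroup G (sv j)),
  wd (@hSL (sv j)) a b <= c * d (locv j a) (locv j b) + c.

Lemma locv_lip (j : vtx K) (a b : lgroup G (sv j)) :
  d (locv j a) (locv j b) <= wd (@hSL (sv j)) a b.
Proof.
have lg (i : vtx K) s : s \in SL (sv i) -> locv i s \in pi1_gens T SL by apply: locm_gens.
have := @iota_lip pi1 _ (@pi1_generates V K G T SL hSL) (vtx K) _ locv
  (fun j => SL (sv j)) (fun j => @hSL (sv j)) lg (mk_coset locv j 1%g) a b.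
by rewrite /iota wd_mul mul1n.
Qed.

Lemma iota_qi (w : cosets locv) (a b : lgroup G (sv (ty w))) :
  d (@iota _ _ _ locv w a) (@iota _ _ _ locv w b) <= maxn 1 c * wd (@hSL (sv (ty w))) a b /\
  wd (@hSL (sv (ty w))) a b <= maxn 1 c * d (@iota _ _ _ locv w a) (@iota _ _ _ locv w b) + maxn 1 c.
Proof.
rewrite /iota wd_mul; split.
  by apply: leq_trans (locv_lip _ _) _; rewrite leq_pmull // leq_max.
by apply: leq_trans (vertex_qi _ _) _; rewrite leq_add ?leq_maxr // leq_mul2r leq_maxr orbT.
Qed.

Lemma near_labels delta : thin_triangles d delta ->
  exists q, quasiconvex_labels d (fun v x => near 1 x v) q.
Proof.
move=> th; have [k hk] := qi_fibre_near delta (maxn 1 c) 1; exists k.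
move=> w x y m [a ha] [b hb] hm.
have LP := wd_pmetric (@hSL (sv (ty w))); have LG := wd_geodesic (@hSL (sv (ty w))).
have [g [g0 gn hg]] := dpath_ex LP LG a b.
have [_ /(_ m hm) [i hi di]] := hk _ _ _ _ (@iota _ _ _ locv w) (wd_pmetric _) (wd_geodesic _) th
  (@iota_qi w) _ _ x y hg ltac:(by rewrite g0) ltac:(by rewrite gn).
by exists (@iota _ _ _ locv w (g i)) => //; exists (g i); have [-> _ _] := wd_pmetric (@pi1_generates V K G T SL hSL).
Qed.
End Labels.

Section Subcomplex.
Local Open Scope quotient_scope.
Variables (R : realType) (V : finType) (K K1 : simplicial_complex V).
Variables (G : complex_of_groups K) (K1K : subcomplex K1 K).
Variables (T : {set edge K}) (T1 : {set edge K1}).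
Hypothesis T1T : {in T1, forall e, inc_edge K1K e \in T}.
Local Notation G1 := (restriction K1K G).
Local Notation f := (pi1_hom G T1T).
Local Notation phi := (dev_map G T1T R).
Local Notation dist1 := (dev_dist R G1 T1).
Local Notation dist := (dev_dist R G T).

Definition incv (j : vtx K1) : vtx K :=
  exist _ (sval j) (fintype.subsetP K1K _ (svalP (sv j))).

Lemma pi1_hom_locm s (g : lgroup G1 s) : f (locm G1 T1 s g) = locm G T (inc K1K s) g.
Proof. by rewrite -[LHS]/(@pi1_map V K1 K K1K G T1 T (pi1_class T1 [:: @Lgroup V K1 G1 s g])) (pi1_mapE T1T). Qed.

Lemma dev_map_dpt g s x (hx : std_simplex (sval s) x) :
  phi (@dpt R V K1 G1 T1 g s x hx) = @dpt R V K G T (f g) (inc K1K s) x hx.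
Proof. by rewrite dev_mapE; congr (\pi_(dev R G T) (DevPre _ _)); apply: Prop_irrelevance. Qed.

Lemma dev_map_basept j x : phi (basept R j x) = basept R (incv j) (f x).
Proof.
rewrite /basept !vpt_mk dev_map_dpt.
have irr s y (h h' : std_simplex (sval s) y) : @dpt R V K G T (f x) s y h = dpt (f x) h'.
  by rewrite (Prop_irrelevance h h').
exact: irr.
Qed.

Hypotheses (metric1 : is_metric dist1) (metric : is_metric dist).

Lemma dev_map_chain a b l : @chain R _ _ (@dev_piece R V K1 G1 T1) a b l ->
  @chain R _ _ (@dev_piece R V K G T) (phi a) (phi b) l.
Proof.
elim=> [{}a|_ _ _ {}b m [g s x y hx hy] _ h]; first exact: chain_nil.
rewrite -/(dpt g hx) -/(dpt g hy) !dev_map_dpt in h *.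
by apply: chain_cons h; apply: Dev_piece.
Qed.

Lemma dev_map_dist a b : (dist (phi a) (phi b) <= dist1 a b)%R.
Proof.
rewrite leNgt; apply/negP => lt; have [e|[l lt' /dev_map_chain/dist_le_chain h]] := dist_chain metric1 lt.
  subst b; have [_ h0 _ _] := metric; have [h1 _ _ _] := metric1.
  by move: lt; rewrite (h0 _ _).2 // ltNge h1.
by have := lt_le_trans lt' h; rewrite ltxx.
Qed.

Variable D : nat.
Variable j0 : vtx K1.
Hypothesis onto : forall p, exists x, (dist1 (basept R j0 x) p <= D%:R)%R.
Hypothesis phi_gp : forall y0 (r : R), exists N : nat, forall x y,
  (N%:R <= gromov_product dist1 y0 x y -> r <= gromov_product dist (phi y0) (phi x) (phi y))%R.

(** For [x = y] the Gromov product is the distance to the base point, so [phi_gp] gives properness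
    there; cocompactness and equivariance make it uniform. *)
Lemma dev_map_proper (r : R) : exists N : nat, forall x y,
  (N%:R <= dist1 x y -> r <= dist (phi x) (phi y))%R.
Proof.
have [_ h10 C1 T1'] := metric1; have [_ h0 C T'] := metric.
pose b := basept R j0 (1%g : pi1 G1 T1); have [N hN] := phi_gp b (r + D%:R)%R.
exists (N + D) => x y; have [h hx] := onto x.
rewrite -(dist_act h^-1%g x) -(dist_act h^-1%g (basept R j0 h)) basept_act mulVg in hx *.
rewrite -/b in hx; set x' := dev_act _ x in hx *; set y' := dev_act _ y => hxy.
have {hN} : (r + D%:R <= dist (phi b) (phi y'))%R.
  have := hN y' y'; rewrite /gromov_product (h10 y' y').2 // (h0 (phi y') (phi y')).2 // !subr0.
  have e (z : R) : ((z + z) / 2 = z)%R by field.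
  rewrite !e; apply; have := T1' x' b y'; rewrite (C1 x' b); move: hxy; rewrite natrD; lra.
have := T' (phi b) (phi x') (phi y'); have := dev_map_dist b x'.
rewrite /x' /y' !dev_map_act dist_act; lra.
Qed.

Hypothesis f_inj : injective f.

(** The image of a large set is large by [dev_map_proper], and [f_inj] embeds the stabilizer of the
    set into that of its image. *)
Lemma restriction_acylindrical : acylindrical R G T -> acylindrical R G1 T1.
Proof.
move=> [A A0 hA]; have [N hN] := dev_map_proper A.
exists (N%:R + 1)%R => [|D' diam]; first by rewrite ltr_wpDl.
have [x [y [Dx Dy xy]]] : exists x y, [/\ D' x, D' y & (N%:R <= dist1 x y)%R].
  apply: contrapT => no; move: diam; apply/negP; rewrite -ltNge.
  apply: (@le_lt_trans _ _ N%:R%:E); last by rewrite lte_fin ltrDl.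
  apply: ge_ereal_sup => _ [[x y] /= [Dx Dy] <-]; rewrite lee_fin leNgt; apply/negP => lt.
  by apply: no; exists x, y; split=> //; apply: ltW.
have fin : finite_set [set g : pi1 G T | forall z, (phi @` D')%classic z -> dev_act g z = z]%classic.
  apply: hA; apply: (@le_trans _ _ (dist (phi x) (phi y))%:E); first by rewrite lee_fin; apply: hN.
  by apply: ereal_sup_ubound; exists (phi x, phi y) => //=; split; [exists x|exists y].
apply: sub_finite_set (finite_preimage (f := f) _ fin) => [g hg z [u Du <-]|u v _ _ /f_inj//].
by rewrite -dev_map_act hg.
Qed.
End Subcomplex.

(** * Change of generators and quasiconvexity *)

Lemma wd_change (G : groupType) (S S' : seq G) (hS : generates S) (hS' : generates S') :
  exists c, forall x y, wd hS' x y <= c * wd hS x y.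
Proof. exact: (word_lipschitz hS hS' (idfun : {multiplicative G -> G})). Qed.

Lemma qi_thin (V X : Type) (dV : V -> V -> nat) (dX : X -> X -> nat) (f : V -> X) delta q :
  pmetric dV -> dgeodesic dV -> pmetric dX -> dgeodesic dX -> thin_triangles dX delta ->
  (forall x y, dX (f x) (f y) <= q * dV x y /\ dV x y <= q * dX (f x) (f y) + q) ->
  exists delta', thin_triangles dV delta'.
Proof.
move=> vP vG xP xG th qi; have [k hk] := qi_fibre_near delta q 0.
have [xx _ xT] := xP; exists (q * (k + delta + k) + q) => x y z m hm.
have near u w n h : dpath dV n h -> h 0 = u -> h n = w ->
    (forall i, i <= n -> exists2 m, between dX (f u) (f w) m & dX (f (h i)) m <= k) /\
    (forall m, between dX (f u) (f w) m -> exists2 i, i <= n & dX m (f (h i)) <= k).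
  by move=> hh h0 hn; apply: (hk V X dV dX f xP xG th qi) => //; rewrite ?h0 ?hn xx.
have [g [g0 gm gn hg]] := dpath_through vP vG hm.
have [/(_ (dV x m)) h1 _] := near _ _ _ _ hg g0 gn.
have [|m1 bm1 dm1] := h1; first by move: hm; rewrite /between; lia.
rewrite gm in dm1.
have fin u w m2 : between dX (f u) (f w) m2 -> dX m1 m2 <= delta ->
    exists2 m', between dV u w m' & dV m m' <= q * (k + delta + k) + q.
  move=> bm2 dm2; have [h [h0 hn hh]] := dpath_ex vP vG u w.
  have [_ /(_ m2 bm2) [i hi di]] := near _ _ _ _ hh h0 hn; exists (h i).
    by have := dpath_between hh (i := 0) (j := i) (k := dV u w); rewrite h0 hn; apply; lia.
  have [_ h2] := qi m (h i); apply: leq_trans h2 _; rewrite leq_add2r leq_mul2l; apply/orP; right.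
  have := xT (f m) m1 (f (h i)); have := xT m1 m2 (f (h i)); lia.
have [m2 [bm2|bm2] dm2] := th _ _ (f z) _ bm1.
  by have [m' h2 h3] := fin _ _ _ bm2 dm2; exists m' => //; left.
by have [m' h2 h3] := fin _ _ _ bm2 dm2; exists m' => //; right.
Qed.

Lemma wd_qi (G : groupType) (S S' : seq G) (hS : generates S) (hS' : generates S') :
  exists q, forall x y, wd hS' x y <= q * wd hS x y /\ wd hS x y <= q * wd hS' x y + q.
Proof.
have [c hc] := wd_change hS hS'; have [c' hc'] := wd_change hS' hS; exists (maxn c c') => x y; split.
  by apply: leq_trans (hc x y) _; rewrite leq_mul2r leq_maxl orbT.
apply: leq_trans (hc' x y) _; apply: leq_trans (leq_addr _ _).
by rewrite leq_mul2r leq_maxr orbT.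
Qed.

Lemma thin_change (G : groupType) (S S' : seq G) (hS : generates S) (hS' : generates S') delta :
  thin_triangles (wd hS) delta -> exists delta', thin_triangles (wd hS') delta'.
Proof.
move=> th; have [q hq] := wd_qi hS' hS.
exact: (qi_thin (f := id) (wd_pmetric hS') (wd_geodesic hS') (wd_pmetric hS) (wd_geodesic hS) th hq).
Qed.

Lemma qi_far (V X : Type) (dV : V -> V -> nat) (dX : X -> X -> nat) (f : V -> X) delta q :
  pmetric dV -> dgeodesic dV -> pmetric dX -> dgeodesic dX -> thin_triangles dX delta ->
  (forall x y, dX (f x) (f y) <= q * dV x y /\ dV x y <= q * dX (f x) (f y) + q) ->
  forall r, exists N, forall z x y, far dV z x y N -> far dX (f z) (f x) (f y) r.
Proof.
move=> vP vG xP xG th qi r; have [k hk] := qi_fibre_near delta q 0.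
have [xx xC xT] := xP; exists (q * (r + k) + q).+1 => z x y h m hm.
have [g [g0 gn hg]] := dpath_ex vP vG x y.
have [_ /(_ m hm) [i hi di]] := hk V X dV dX f xP xG th qi _ _ (f x) (f y) hg
  ltac:(by rewrite g0 xx) ltac:(by rewrite gn xx).
have bi : between dV x y (g i).
  by have := dpath_between hg (i := 0) (j := i) (k := dV x y); rewrite g0 gn; apply; lia.
have h1 := h _ bi; have [_ h2] := qi z (g i).
rewrite leqNgt; apply/negP => lt; have := xT (f z) m (f (g i)) => h3.
have : q * dX (f z) (f (g i)) <= q * (r + k) by rewrite leq_mul2l; apply/orP; right; lia.
by lia.
Qed.

Section CayleyCT.
Local Open Scope ring_scope.
Local Open Scope quotient_scope.
Variables (R : realType) (H G : groupType) (f : {multiplicative H -> G}).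
Variables (SH : seq H) (SG : seq G) (fS : {in SH, forall s, f s \in SG}).
Variables (hSH : generates SH) (hSG : generates SG).
Local Notation distH := (@cayley_dist R H SH).
Local Notation distG := (@cayley_dist R G SG).
Local Notation F := (@cayley_map R H G f SH SG fS).

Lemma cayley_map_cvert h : F (cvert R SH h) = cvert R SG (f h).
Proof. exact: cayley_mapE. Qed.

Lemma cayley_map_chain a b l : @chain R _ _ (@cayley_piece R H SH) a b l ->
  @chain R _ _ (@cayley_piece R G SG) (F a) (F b) l.
Proof.
elim=> [{}a|p q m {}b n hpq _ h]; first exact: chain_nil.
rewrite !cayley_mapE in h *; apply: chain_cons h.
by case: hpq => *; apply: Cayley_piece.
Qed.

Lemma cayley_map_dist a b : distG (F a) (F b) <= distH a b.
Proof.
apply: lb_le_inf; first by have [l hl] := cayley_chain hSH a b; exists l.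
by move=> l /= /cayley_map_chain/dist_le_chainc.
Qed.

Variables (deltaH deltaG : nat).
Hypotheses (thH : thin_triangles (wd hSH) deltaH) (thG : thin_triangles (wd hSG) deltaG).
Hypothesis f_far : forall r, exists N, forall z x y,
  far (wd hSH) z x y N -> far (wd hSG) (f z) (f x) (f y) r.

Theorem cayley_admits_CT : admits_CT distH distG F.
Proof.
apply: product_admits_CT; [exact: thin_hyperbolic_cayley thH|exact: thin_hyperbolic_cayley thG|].
move=> y0 r; pose k := (6 * deltaG + 4)%N; have [r' hr'] := nat_ge (r + k%:R + 3).
have [N hN] := f_far r'; exists (N + 3)%N => x y.
have HC := @cayley_distC R H SH; have HT := @cayley_distT R H SH hSH.
have GC := @cayley_distC R G SG; have GT := @cayley_distT R G SG hSG.
have [z0 hz] := cayley_near_vertex hSH y0; have [x0 hx] := cayley_near_vertex hSH x.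
have [w0 hw] := cayley_near_vertex hSH y.
have Hv := cvert_dist R hSH; have Gv := cvert_dist R hSG.
rewrite /gromov_product => h.
have /hN/(product_far (wd_pmetric hSG) thG (wd_geodesic hSG)) : far (wd hSH) z0 x0 w0 N.
  apply: (far_product (wd_pmetric hSH)); rewrite -(ler_nat R) (natrD _ (wd hSH x0 w0)) (natrD _ (wd hSH z0 x0)) natrM -!Hv.
  have := HT y0 x (cvert R SH x0); have := HT y0 (cvert R SH z0) (cvert R SH x0).
  have := HT y0 (cvert R SH z0) x; have := HT (cvert R SH z0) (cvert R SH x0) x.
  have := HT y0 (cvert R SH z0) y; have := HT (cvert R SH z0) (cvert R SH w0) y.
  have := HT (cvert R SH x0) x (cvert R SH w0); have := HT x y (cvert R SH w0).
  rewrite (HC (cvert R SH x0) x) (HC (cvert R SH w0) y).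
  by move: h; rewrite natrD; lra.
rewrite -/k -(ler_nat R) (natrD _ (wd hSG _ _)) (natrD _ (_ + _)) (natrD _ (wd hSG _ _)) natrM -!Gv -!cayley_map_cvert.
have := cayley_map_dist y0 (cvert R SH z0); have := cayley_map_dist x (cvert R SH x0).
have := cayley_map_dist y (cvert R SH w0).
set a := F (cvert R SH z0); set b := F (cvert R SH x0); set c := F (cvert R SH w0).
have := GT a (F y0) b; have := GT (F y0) (F x) b; have := GT a (F y0) c; have := GT (F y0) (F y) c.
have := GT (F x) b (F y); have := GT b c (F y).
by have := ler0n R k; rewrite (GC a (F y0)) (GC c (F y)); lra.
Qed.
End CayleyCT.

Section QuasiconvexImage.
Variables (R : realType) (H G : groupType) (f : {multiplicative H -> G}).
Variables (SH : seq H) (hSH : generates SH) (SG : seq G) (hSG : generates SG) (delta : nat).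
Hypothesis thG : thin_triangles (wd hSG) delta.
Variables (S : seq G) (hS : generates S).

Lemma cayley_net : exists K : nat, forall x y c n a,
  geodesic (@cayley_dist R G S) (cvert R S x) (cvert R S y) c ->
  dpath (wd hS) n a -> a 0 = x -> a n = y ->
  (forall t, (0 <= t <= cayley_dist (cvert R S x) (cvert R S y))%R ->
     exists2 i, i <= n & (cayley_dist (cvert R S (a i)) (c t) <= K%:R)%R) /\
  (forall i, i <= n -> exists2 t, (0 <= t <= cayley_dist (cvert R S x) (cvert R S y))%R &
     (cayley_dist (cvert R S (a i)) (c t) <= K%:R)%R).
Proof.
have [delta' th'] := thin_change hS thG; have hyp := thin_hyperbolic_cayley R th'.
apply: (@net_near R _ _ hyp G (wd hS) (wd_pmetric hS) (wd_geodesic hS) (cvert R S) 1).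
- by move=> x y; rewrite cvert_dist mul1n.
- by move=> x y n; rewrite (cvert_dist R hS) ler_nat mul1n; lia.
- by move=> a; have [g hg] := cayley_near_vertex hS a; exists g; rewrite cayley_distC.
Qed.

Lemma qi_quasiconvex_image q :
  (forall x y, wd hSH x y <= q * wd hSG (f x) (f y) + q) -> quasiconvex_image R f S.
Proof.
move=> qi; have [delta' th'] := thin_change hS thG; have [K hK] := cayley_net.
have [c1 hc1] := word_lipschitz hSH hS f; have [c2 hc2] := wd_change hS hSG.
pose q' := maxn c1 (maxn (q * c2) q).
have [k hk] := morse delta' q'; exists (K + k)%:R%R => _ _ c [x _ <-] [y _ <-] hc t ht.
have [a [a0 an ha]] := dpath_ex (wd_pmetric hSH) (wd_geodesic hSH) x y.
have [g [g0 gn hg]] := dpath_ex (wd_pmetric hS) (wd_geodesic hS) (f x) (f y).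
have [/(_ t ht) [i hi di] _] := hK _ _ _ _ _ hc hg g0 gn.
have qi' v z : wd hS (f v) (f z) <= q' * wd hSH v z /\ wd hSH v z <= q' * wd hS (f v) (f z) + q'.
  split; first by apply: leq_trans (hc1 v z) _; rewrite leq_mul2r leq_maxl orbT.
  apply: leq_trans (qi v z) _; have := hc2 (f v) (f z) => h.
  apply: (@leq_trans (q * c2 * wd hS (f v) (f z) + q)).
    by rewrite leq_add2r -mulnA leq_mul2l h orbT.
  by rewrite leq_add // ?leq_mul2r /q' ?leq_max ?leqnn ?orbT.
have [/(_ i hi) [j hj dj] _] := hk H G (wd hSH) (wd hS) f (wd_pmetric hS) (wd_geodesic hS) th' qi'
  _ _ _ _ ha hg ltac:(congruence) ltac:(congruence).
exists (cvert R S (f (a j))); first by exists (a j).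
have := cayley_distT hS (c t) (cvert R S (g i)) (cvert R S (f (a j))).
have : (cayley_dist (cvert R S (g i)) (cvert R S (f (a j))) <= k%:R)%R.
  by rewrite (cvert_dist R hS) ler_nat.
by rewrite (cayley_distC (c t) (cvert R S (g i))) natrD; lra.
Qed.

Lemma quasiconvex_image_qi : injective f -> quasiconvex_image R f S ->
  exists q, forall x y, wd hSH x y <= q * wd hSG (f x) (f y) + q.
Proof.
move=> f_inj [k qc]; have [K hK] := cayley_net; have [n hn] := nat_ge (K%:R + k)%R.
have [|q hq] := @near_image_qi H G SH S hSH hS f n f_inj.
  move=> x y; have [g [g0 gn hg]] := dpath_ex (wd_pmetric hS) (wd_geodesic hS) (f x) (f y).
  exists g => // j hj.
  have [_ ge] := cayley_geodesic_space R hS; have [c hc] := ge (cvert R S (f x)) (cvert R S (f y)).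
  have [_ /(_ j hj) [t ht dt]] := hK _ _ _ _ _ hc hg g0 gn.
  have [_ [h _ <-] dh] := qc _ _ _ (ex_intro2 _ _ x I erefl) (ex_intro2 _ _ y I erefl) hc t ht.
  exists h; rewrite -(ler_nat R) -(cvert_dist R hS); apply: le_trans hn.
  by have := cayley_distT hS (cvert R S (g j)) (c t) (cvert R S (f h)); lra.
have [c hc] := wd_change hSG hS; exists (maxn (q * c) q) => x y.
apply: leq_trans (hq x y) _; rewrite leq_add ?leq_maxr //.
apply: (@leq_trans (q * c * wd hSG (f x) (f y))); last by rewrite leq_mul2r leq_maxl orbT.
by rewrite -mulnA leq_mul2l hc orbT.
Qed.
End QuasiconvexImage.

Lemma group_qi_wd (R : realType) (H G : groupType) (f : {multiplicative H -> G})
    (SH : seq H) (SG : seq G) (hSH : generates SH) (hSG : generates SG) :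
  group_qi_embedding R f -> exists q, forall x y,
    wd hSG (f x) (f y) <= q * wd hSH x y /\ wd hSH x y <= q * wd hSG (f x) (f y) + q.
Proof.
move=> [S [S' [hS hS' [k [c [k1 c0 qi]]]]]].
have [cf hf] := word_lipschitz hSH hSG f; have [c1 h1] := wd_change hS hSH.
have [c2 h2] := wd_change hSG hS'; have [n hn] := nat_ge k; have [m hm] := nat_ge c.
have low x y : wd hS x y <= n * wd hS' (f x) (f y) + n * m.
  have /andP[h _] := qi x y; rewrite /word_dist (cvert_dist R hS) (cvert_dist R hS') in h.
  have k0 : (0 < k)%R by lra.
  have d0 : (0 <= (wd hS' (f x) (f y))%:R :> R)%R by rewrite ler0n.
  rewrite -(ler_nat R) natrD !natrM -mulrDr.
  apply: (@le_trans _ _ (k * ((wd hS' (f x) (f y))%:R + c))%R).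
    by rewrite mulrC -ler_pdivrMr //; lra.
  by apply: ler_pM => //; [exact: ltW|rewrite addr_ge0|rewrite lerD2l].
pose q := maxn cf (maxn (c1 * (n * c2)) (c1 * (n * m))); exists q => x y; split.
  by apply: leq_trans (hf x y) _; rewrite leq_mul2r leq_maxl orbT.
apply: leq_trans (h1 x y) _; apply: (@leq_trans (c1 * (n * c2) * wd hSG (f x) (f y) + c1 * (n * m))).
  rewrite -mulnA -mulnDr leq_mul2l; apply/orP; right; apply: leq_trans (low x y) _.
  by rewrite leq_add2r -mulnA leq_mul2l h2 orbT.
by apply: leq_add; rewrite ?leq_mul2r /q !leq_max !leqnn ?orbT.
Qed.

Section ComplexData.
Variables (R : realType) (V : finType) (K : simplicial_complex V) (G : complex_of_groups K).
Variable T : {set edge K}.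
Local Notation dist := (dev_dist R G T).
Variables (SL : forall s : simplex K, seq (lgroup G s)) (hSL : forall s, generates (SL s)).
Local Notation d := (wd (@pi1_generates V K G T SL hSL)).
Hypothesis dev_inj : developable G T.
Hypothesis SL_thin : forall s, exists delta, thin_triangles (wd (@hSL s)) delta.
Hypothesis lmap_qi : forall s t (e : face t s), exists q, forall x y,
  wd (@hSL t) (lmap G e x) (lmap G e y) <= q * wd (@hSL s) x y /\
  wd (@hSL s) x y <= q * wd (@hSL t) (lmap G e x) (lmap G e y) + q.
Hypothesis dist_hyp : hyperbolic dist.
Hypothesis dist_cat0 : cat0 dist.
Hypothesis acyl : acylindrical R G T.
Variable j0 : vtx K.
Local Notation dc := (@coned_pi1 V K G T SL hSL j0).
Local Notation o := (@basept R V K G T j0).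

(** The estimates hold for every [D] beyond a threshold, so that one constant can serve both
    complexes. *)
Lemma complex_data : exists C, forall D, C <= D ->
  [/\ thin_triangles d D,
   forall n g N a, dpath d n g -> dpath dc N a -> g 0 = a 0 -> g n = a N ->
     (forall i, i <= n -> exists2 j, j <= N & dc (g i) (a j) <= D) /\
     (forall j, j <= N -> exists2 i, i <= n & dc (a j) (g i) <= D),
   forall x y, (dist (o x) (o y) <= (D * dc x y)%:R)%R /\
     forall n, (dist (o x) (o y) <= n%:R)%R -> dc x y <= D * n + D,
   forall p, exists x, (dist (o x) p <= D%:R)%R &
   forall (j : vtx K) (a b : lgroup G (sv j)),
     wd (@hSL (sv j)) a b <= D * d (locv G T j a) (locv G T j b) + D].
Proof.
have [delta th] := complex_thin dev_inj SL_thin lmap_qi dist_hyp dist_cat0 acyl j0.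
have [c vqi] := complex_vertex_qi dev_inj SL_thin lmap_qi dist_hyp dist_cat0 acyl j0.
have [q lq] := near_labels vqi th; have [kap hk] := coned_near delta q.
have [D1 h1] := @basept_le R V K G T SL hSL dist_cat0 j0.
have [D2 h2] := @basept_ge R V K G T SL hSL dist_cat0 j0.
have [D3 h3] := @basept_onto R V K G T SL hSL dist_cat0 j0.
exists (delta + c + kap + D1 + D2 + D3) => D hD.
have le C x y : C <= D -> C * x + y <= D * x + y by move=> h; rewrite leq_add2r leq_mul2r h orbT.
split.
- by move=> x y z m hm; have [m' b dm] := th x y z m hm; exists m' => //; lia.
- move=> n g N a hg ha e0 e1.
  have [k1 k2] := hk _ _ _ _ _ (wd_pmetric _) (wd_geodesic _) th lq _ _ _ _ hg ha e0 e1.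
  split=> [i /k1[j hj dj]|j /k2[i hi di]]; [exists j|exists i] => //.
    by apply: leq_trans dj _; lia.
  by apply: leq_trans di _; lia.
- move=> x y; split.
    apply: le_trans (h1 x y) _; rewrite ler_nat leq_mul2r; apply/orP; right; lia.
  move=> n /h2 h; apply: leq_trans h _; apply: leq_add; last by lia.
  by rewrite leq_mul2r; apply/orP; right; lia.
- by move=> p; have [x hx] := h3 p; exists x; apply: le_trans hx _; rewrite ler_nat; lia.
- move=> j a b; apply: leq_trans (vqi j a b) _; apply: leq_add; last by lia.
  by rewrite leq_mul2r; apply/orP; right; lia.
Qed.
End ComplexData.

Section FibrePath.
Variables (V : finType) (K K1 : simplicial_complex V).
Variables (G : complex_of_groups K) (K1K : subcomplex K1 K).
Variables (T : {set edge K}) (T1 : {set edge K1}).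
Variable T1T : {in T1, forall e, inc_edge K1K e \in T}.
Local Notation G1 := (restriction K1K G).
Local Notation f := (pi1_hom G T1T).
Variables (SL : forall s : simplex K, seq (lgroup G s)) (hSL : forall s, generates (SL s)).
Let SL1 (s : simplex K1) : seq (lgroup G1 s) := SL (inc K1K s).
Let hSL1 (s : simplex K1) : generates (SL1 s) := @hSL (inc K1K s).
Local Notation dG := (wd (@pi1_generates V K G T SL hSL)).
Local Notation dH := (wd (@pi1_generates V K1 G1 T1 SL1 hSL1)).
Variables (j0 : vtx K1) (D : nat).
Local Notation dcH := (@coned_pi1 V K1 G1 T1 SL1 hSL1 j0).
Hypotheses (thG : thin_triangles dG D) (thH : thin_triangles dH D).
Hypothesis vqG : forall (j : vtx K) (a b : lgroup G (sv j)),
  wd (@hSL (sv j)) a b <= D * dG (locv G T j a) (locv G T j b) + D.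
Hypothesis vqH : forall (j : vtx K1) (a b : lgroup G1 (sv j)),
  wd (@hSL1 (sv j)) a b <= D * dH (locv G1 T1 j a) (locv G1 T1 j b) + D.

(** The local group of a vertex of [K1] is quasi-isometrically embedded in both fundamental groups;
    [P] is a geodesic of it, moved into the fibre shared by neighbours of [x] and [y]. *)
Lemma restriction_fibre_path : exists k, forall k', k <= k' -> forall x y, dcH x y <= 1 ->
  exists P : pi1 G1 T1 -> Prop,
  [/\ forall p, P p -> dcH x p <= 1 /\ dcH p y <= 1,
      forall p, P p -> exists2 m, between dH x y m & dH p m <= k',
      forall m, between dH x y m -> exists2 p, P p & dH m p <= k',
      forall p, P p -> exists2 m, between dG (f x) (f y) m & dG (f p) m <= k' &
      forall m, between dG (f x) (f y) m -> exists2 p, P p & dG m (f p) <= k'].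
Proof.
have [c hc] := word_lipschitz (@pi1_generates V K1 G1 T1 SL1 hSL1) (@pi1_generates V K G T SL hSL) f.
have [k hk] := qi_fibre_near D (maxn 1 D) (c + 1); exists k => k' kk' x y xy.
have dP := wd_pmetric (@pi1_generates V K1 G1 T1 SL1 hSL1).
have dG' := wd_geodesic (@pi1_generates V K1 G1 T1 SL1 hSL1).
have le1 u w : dcH u w <= 1 <-> exists v, near dH (@iota _ _ _ (locv G1 T1)) 1 u v /\
    near dH (@iota _ _ _ (locv G1 T1)) 1 w v.
  exact: coned_le1.
have [v [xv yv]] := (le1 x y).1 xy; have [a ha] := xv; have [b hb] := yv.
have LP := wd_pmetric (@hSL1 (sv (ty v))); have LG := wd_geodesic (@hSL1 (sv (ty v))).
have [g [g0 gn hg]] := dpath_ex LP LG a b.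
pose n := wd (@hSL1 (sv (ty v))) a b.
pose i1 := @iota _ _ _ (locv G1 T1) v.
exists (fun p => exists2 i, i <= n & p = i1 (g i)).
have qi1 := @iota_qi V K1 G1 T1 SL1 hSL1 D vqH v.
have near1 := hk _ _ _ _ i1 dP dG' thH qi1 n g x y hg
  ltac:(by rewrite g0; apply: leq_trans ha _; rewrite addn1)
  ltac:(by rewrite gn; apply: leq_trans hb _; rewrite addn1).
have fi u : f (i1 u) = (f (rp v) * locv G T (incv K1K (ty v)) u)%g.
  rewrite /i1 /iota gmulfM; congr (_ * _)%g; exact: (pi1_hom_locm T1T).
have lip u w : dG (locv G T (incv K1K (ty v)) u) (locv G T (incv K1K (ty v)) w) <=
    wd (@hSL1 (sv (ty v))) u w.
  exact: (@locv_lip V K G T SL hSL (incv K1K (ty v))).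
have low u w : wd (@hSL1 (sv (ty v))) u w <=
    D * dG (locv G T (incv K1K (ty v)) u) (locv G T (incv K1K (ty v)) w) + D.
  exact: (@vqG (incv K1K (ty v))).
have qi2 u w : dG (f (i1 u)) (f (i1 w)) <= maxn 1 D * wd (@hSL1 (sv (ty v))) u w /\
    wd (@hSL1 (sv (ty v))) u w <= maxn 1 D * dG (f (i1 u)) (f (i1 w)) + maxn 1 D.
  rewrite !fi wd_mul; split.
    apply: leq_trans (lip u w) _.
    by rewrite leq_pmull // leq_max.
  apply: leq_trans (low u w) _.
  by rewrite leq_add ?leq_maxr // leq_mul2r leq_maxr orbT.
have near2 := hk _ _ _ _ (f \o i1) (wd_pmetric _) (wd_geodesic _) thG qi2 n g (f x) (f y) hg
  ltac:(rewrite /= g0; apply: leq_trans (hc _ _) _; apply: leq_trans (_ : c * 1 <= _); [by rewrite leq_mul2l ha orbT|lia])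
  ltac:(rewrite /= gn; apply: leq_trans (hc _ _) _; apply: leq_trans (_ : c * 1 <= _); [by rewrite leq_mul2l hb orbT|lia]).
have lek m : m <= k -> m <= k' by move=> h; apply: leq_trans h kk'.
split.
- move=> _ [i hi ->]; have pv : near dH (@iota _ _ _ (locv G1 T1)) 1 (i1 (g i)) v.
    by exists (g i); have [-> _ _] := dP.
  by split; apply/le1; exists v.
- by move=> _ [i hi ->]; have [/(_ i hi) [m h1 h2] _] := near1; exists m => //; apply: lek.
- move=> m hm; have [_ /(_ m hm) [i hi di]] := near1; exists (i1 (g i)); last exact: lek.
  by exists i.
- by move=> _ [i hi ->]; have [/(_ i hi) [m h1 h2] _] := near2; exists m => //; apply: lek.
- move=> m hm; have [_ /(_ m hm) [i hi di]] := near2; exists (i1 (g i)); last exact: lek.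
  by exists i.
Qed.
End FibrePath.

Lemma hyperbolic_generators (R : realType) (I : Type) (L : I -> groupType) :
  (forall i, hyperbolic_group R (L i)) ->
  exists (SL : forall i, seq (L i)) (hSL : forall i, generates (SL i)),
  forall i, exists delta, thin_triangles (wd (hSL i)) delta.
Proof.
move=> h; pose sig i := cid2 (h i); exists (fun i => s2val (sig i)), (fun i => s2valP (sig i)) => i.
exact: (hyperbolic_cayley_thin (R := R) (s2valP (sig i)) (s2valP' (sig i))).
Qed.

(** A change of generators is a quasi-isometry and preserves [far] up to the constants, so one pair
    of generating sets is enough. *)
Lemma group_admits_CT_far (R : realType) (H G : groupType) (f : {multiplicative H -> G})
    (SH : seq H) (SG : seq G) (hSH : generates SH) (hSG : generates SG) deltaH deltaG :
  thin_triangles (wd hSH) deltaH -> thin_triangles (wd hSG) deltaG ->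
  (forall r, exists N, forall z x y, far (wd hSH) z x y N -> far (wd hSG) (f z) (f x) (f y) r) ->
  group_admits_CT R f.
Proof.
move=> thH thG f_far; split.
- by exists SH => //; apply: thin_hyperbolic_cayley thH.
- by exists SG => //; apply: thin_hyperbolic_cayley thG.
move=> SH' SG' fS hSH' hSG'.
have [dH' thH'] := thin_change hSH' thH; have [dG' thG'] := thin_change hSG' thG.
apply: (cayley_admits_CT R fS thH' thG') => r.
have [q qi] := wd_qi hSG hSG'; have [q' qi'] := wd_qi hSH' hSH.
have [r1 h1] := @qi_far _ _ _ _ idfun _ q (wd_pmetric _) (wd_geodesic _) (wd_pmetric _) (wd_geodesic _) thG' qi r.
have [r2 h2] := f_far r1.
have [r3 h3] := @qi_far _ _ _ _ idfun _ q' (wd_pmetric _) (wd_geodesic _) (wd_pmetric _) (wd_geodesic _) thH qi' r2.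
by exists r3 => z x y /h3/h2/h1.
Qed.

Theorem theorem4 (R : realType) (V : finType) (K K1 : simplicial_complex V)
    (G : complex_of_groups K) (K1K : subcomplex K1 K)
    (K_connected : connected_complex K) (K1_connected : connected_complex K1)
    (T : {set edge K}) (T1 : {set edge K1})
    (T_max : maximal_tree T) (T1_max : maximal_tree T1)
    (T1T : {in T1, forall e, inc_edge K1K e \in T})
    (GK_hyp : complex_of_hyperbolic_groups R G T)
    (GK1_hyp : complex_of_hyperbolic_groups R (restriction K1K G) T1)
    (B_cat0 : cat0 (dev_dist R G T))
    (B1_cat0 : cat0 (dev_dist R (restriction K1K G) T1))
    (B_acyl : acylindrical R G T)
    (pi1_inj : injective (pi1_hom G T1T))
    (mitra : mitra_criterion (dev_dist R (restriction K1K G) T1)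
               (dev_dist R G T) (dev_map G T1T R)) :
  group_admits_CT R (pi1_hom G T1T) /\
  exists2 F : boundary (dev_dist R (restriction K1K G) T1) ->
              boundary (dev_dist R G T),
    is_CT (dev_map G T1T R) F &
    forall S : seq (pi1 G T), generates S ->
      quasiconvex_image R (pi1_hom G T1T) S <-> injective F.
Proof.
(* The base vertex is taken in [K1], so that base points of [B1] are sent to base points of [B]. *)
have [s0 _] := K1_connected.1; have [v0 v0s] := set0Pn _ (simplex_neq0 (proj2_sig s0)).
have v0K1 : (v0 |: finset.set0)%SET \in simplices K1.
  apply: (simplex_sub (proj2_sig s0)); first by apply/set0Pn; exists v0; rewrite !inE eqxx.
  by apply/fintype.subsetP => v; rewrite !inE orbF => /eqP ->.
rewrite finset.setU0 in v0K1; pose j0 : vtx K1 := exist _ v0 v0K1.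
have [dev_inj loc_hyp loc_qi hypB] := GK_hyp; have [dev_inj1 _ loc_qi1 hypB1] := GK1_hyp.
have [SL [hSL SL_thin]] := hyperbolic_generators loc_hyp.
pose G1 := restriction K1K G.
(* The local groups over [K1] keep the generators chosen over [K], so that each has the same word
   metric in both complexes. *)
pose SL1 (s : simplex K1) : seq (lgroup G1 s) := SL (inc K1K s).
pose hSL1 (s : simplex K1) : generates (SL1 s) := @hSL (inc K1K s).
have SL1_thin s : exists delta, thin_triangles (wd (@hSL1 s)) delta := SL_thin (inc K1K s).
have lqi s t (e : face t s) := group_qi_wd (@hSL s) (@hSL t) (loc_qi s t e).
have lqi1 s t (e : face t s) := @group_qi_wd R _ _ _ _ _ (@hSL1 s) (@hSL1 t) (loc_qi1 s t e).
have phi_gp := mitra_gromov_product hypB1 hypB mitra.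
have metric : is_metric (dev_dist R G T) by case: B_cat0 => -[].
have metric1 : is_metric (dev_dist R G1 T1) by case: B1_cat0 => -[].
have [D0 onto0] := @basept_onto R V K1 G1 T1 SL1 hSL1 B1_cat0 j0.
have acyl1 : acylindrical R G1 T1 := restriction_acylindrical metric1 metric onto0 phi_gp pi1_inj B_acyl.
have [C hC] := complex_data dev_inj SL_thin lqi hypB B_cat0 B_acyl (incv K1K j0).
have [C1 hC1] := complex_data dev_inj1 SL1_thin lqi1 hypB1 B1_cat0 acyl1 j0.
pose D := maxn C C1.
have [thG _ _ _ vqG] := hC D (leq_maxl _ _); have [thH _ _ _ vqH] := hC1 D (leq_maxr _ _).
have [k hk] := restriction_fibre_path T1T j0 thG thH vqG vqH.
(* [k] was obtained from the estimates at [D], so the estimates are taken again at a constant beyond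
   both. *)
pose kap := maxn D k.
have [{}thG coneG oG onG _] := hC kap ltac:(rewrite /kap /D; lia).
have [{}thH coneH oH onH _] := hC1 kap ltac:(rewrite /kap /D; lia).
have fibre := hk kap (leq_maxr _ _).
have phi_o := @dev_map_basept R V K K1 G K1K T T1 T1T j0.
have phi_le := dev_map_dist T1T metric1 metric.
have f_far := @group_far R _ _ _ _ _ _ _ pi1_inj _ _ kap kap kap thH thG
  (coned_pmetric _ _) (coned_geodesic _ _) (coned_pmetric _ _) (coned_geodesic _ _)
  (coned_le _ _) (coned_le _ _) coneH coneG _ _ _ _ _ _ hypB1 hypB
  (fun x y => (oH x y).1) (fun x y => (oH x y).2) onH (fun x y => (oG x y).1) (fun x y => (oG x y).2) onG
  _ phi_o phi_gp fibre.
split; first exact: group_admits_CT_far thH thG f_far.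
have [F hF] := product_admits_CT hypB1 hypB phi_gp; exists F => // S hS.
have [_ _ F_conv _] := hF; split=> [qc|F_inj].
- have [q qi] := quasiconvex_image_qi (pi1_generates hSL1) thG hS pi1_inj qc.
  exact: (@qi_boundary_injective R _ _ _ _ _ _ _ _ _ kap kap kap thG
    (coned_pmetric _ _) (coned_geodesic _ _) (coned_pmetric _ _) (coned_geodesic _ _)
    (coned_le _ _) coneH coneG _ _ _ _ _ _ hypB1 hypB
    (fun x y => (oH x y).1) (fun x y => (oH x y).2) onH (fun x y => (oG x y).1) (fun x y => (oG x y).2) onG
    _ phi_o phi_le _ F_conv q qi).
- have [q qi] := @boundary_injective_qi R _ _ _ _ _ _ _ pi1_inj _ _ kap kap kap thH thG
    (coned_pmetric _ _) (coned_geodesic _ _) (coned_pmetric _ _) (coned_geodesic _ _)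
    (coned_le _ _) (coned_le _ _) coneH coneG _ _ _ _ _ _ hypB1 hypB
    (fun x y => (oH x y).1) (fun x y => (oH x y).2) onH (fun x y => (oG x y).1) (fun x y => (oG x y).2) onG
    _ phi_o phi_le phi_gp fibre _ F_conv F_inj.
  exact: (qi_quasiconvex_image R thG hS qi).
Qed.
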